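(* Let $D \subseteq \mathbb{C}$ be a domain, let $k$ be a positive integer, and let $\mathcal{F}$ be a family of holomorphic functions on $D$ such that, for every $f \in \mathcal{F}$, all zeros of $f$ are of multiplicity at least $k$. Let $a(z), b(z), \alpha_0(z), \alpha_1(z)$ be holomorphic functions in $D$ with $\alpha_0(z) \neq 0$ for all $z \in D$. Suppose that (1) $b(z) \neq 0$ for all $z \in D$; (2) $a(z) \neq b(z)$ and $b(z) - \alpha_1(z) a(z) - \alpha_0(z) a^{(k)}(z) \neq 0$ for all $z \in D$; and that for each $f \in \mathcal{F}$ and all $z \in D$: (3) $f(z) = a(z)$ if and only if $\alpha_0(z) f^{(k)}(z) + \alpha_1(z) f(z) = a(z)$; (4) $f(z) = b(z)$ whenever $\alpha_0(z) f^{(k)}(z) + \alpha_1(z) f(z) = b(z)$. Then $\mathcal{F}$ is normal in $D$.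
   Context: $f^{(k)}$ and $a^{(k)}$ denote $k$-th derivatives. A family $\mathcal{F}$ of holomorphic functions on a domain $D \subseteq \mathbb{C}$ is normal in $D$ if every sequence $(f_n) \subseteq \mathcal{F}$ has either a subsequence converging uniformly on each compact subset of $D$ to a limit function $f \not\equiv \infty$, or a subsequence converging uniformly to $\infty$ on each compact subset of $D$. *)

(* Defs.v *)
From HB Require Import structures.
From mathcomp Require Import all_boot all_order all_algebra.
From mathcomp Require Import complex.
From mathcomp Require Import boolp classical_sets reals topology normedtype
  sequences derive.

Set Implicit Arguments.
Unset Strict Implicit.
Unset Printing Implicit Defensive.

Import Order.TTheory GRing.Theory Num.Theory.
Import numFieldNormedType.Exports.

Local Open Scope classical_set_scope.
Local Open Scope ring_scope.
Local Open Scope complex_scope.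

(* The topology and the normed-module structure over itself are attached to the
   sort of an abstract [numClosedFieldType], not to the head constant [complex];
   packing R[i] once makes them inferable. *)
Definition Cplx (R : realType) : numClosedFieldType := R[i].

Section NormalFamilies.
Variable R : realType.
Local Notation C := (Cplx R).

Definition domain (D : set C) : Prop := [/\ open D, connected D & D !=set0].

(* Functions on D are total functions whose values off D are irrelevant: as D
   is open, [derivable] and the iterated derivatives at a point of D only depend
   on the restriction to D.  The increment in [derivable f z 1] ranges over C,
   so this is complex differentiability. *)
Definition holomorphic_on (D : set C) (f : C -> C) : Prop :=
  forall z, D z -> derivable f z 1.

(* A point near which f vanishes identically has infinite multiplicity, hence
   satisfies this for every k. *)
Definition multiplicity_ge (k : nat) (f : C -> C) (z : C) : Prop :=
  forall j, (j < k)%N -> derive1n j f z = 0.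

Definition cvg_loc_unif (D : set C) (f : nat -> C -> C) (g : C -> C) : Prop :=
  forall K, compact K -> K `<=` D -> {uniform K, f @ \oo --> g}.

Definition cvg_loc_unif_infty (D : set C) (f : nat -> C -> C) : Prop :=
  forall K, compact K -> K `<=` D ->
  forall M : R, \forall n \near \oo, forall z, K z -> M%:C < `|f n z|.

Definition normal_family (D : set C) (F : set (C -> C)) : Prop :=
  forall f : nat -> C -> C, (forall n, F (f n)) ->
  exists2 phi : nat -> nat, increasing_seq phi &
    (exists g : C -> C, cvg_loc_unif D (f \o phi) g) \/
    cvg_loc_unif_infty D (f \o phi).

End NormalFamilies.

(* Main.v *)
Require Import Defs.
From HB Require Import structures.
From mathcomp Require Import all_boot all_order all_algebra.
From mathcomp Require Import complex.
From mathcomp Require Import boolp classical_sets reals topology normedtype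
  sequences derive.
From mathcomp Require Import constructive_ereal exp trigo measure
  lebesgue_measure lebesgue_integral ftc.
From mathcomp Require Import ring lra zify.
Set Implicit Arguments.
Unset Strict Implicit.
Unset Printing Implicit Defensive.
Import Order.TTheory GRing.Theory Num.Theory.
Import numFieldNormedType.Exports.
Local Open Scope classical_set_scope.
Local Open Scope ring_scope.

(* Normality is a local property, and by Marty's criterion it can only fail near
   a point p if suitable spherical derivatives are unbounded.  Near p write
   a = (z - p)^m a1 with a1(p) <> 0, put h = f - a if k = 1 and h = f otherwise,
   and rescale a la Zalcman about points z_n at scales s_n -> 0, dividing by
   M_n = (|z_n - p| + s_n)^m + s_n^k (just s_n^k if k = 1 or a = 0 near p).
   With this amplitude both the rescaled a and s_n^k / M_n have limits, so that
   h(z_n + s_n w) / M_n tends along a subsequence to a nonconstant entire G for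
   which, by Hurwitz, G = A implies G^(k) = B1, conversely G^(k) = B1 implies
   G = A, and G^(k) omits B; here A = c (d + e w)^m, and B1 = 0 if k > 1.  The
   growth bound inherited by G makes G / w^m of bounded derivative where its
   modulus is 1, hence G of exponential type (Clunie-Hayman).  An omitted value
   then means G^(k) = B + C exp(c w), and comparing with the polynomial A at the
   infinitely many periodic points where G^(k) = B1 excludes every case; the case
   m = k is the one that needs b <> alpha0 a^(k) at p. *)

(** * Complex numbers and differentiability *)

Section ComplexNumbers.
Variable R : realType.
Local Notation C := (Cplx R).

(** The obstacle for k > 1 is that neither natural amplitude works alone. Dividing by s_n^k keeps
    the k-th derivatives under control, but the rescaled a may explode; dividing by the size of a
    may send the multiple of b that G^(k) should omit to 0. For the sum, both quotients stay
    bounded, and their limits c and t obey a normalisation that forbids both to vanish, so either A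
    or B survives. The conditions on b serve to show that B is omitted: at a point where G^(k) = B,
    (4) yields b = (lim M_n) G in the limit. This contradicts b <> 0 if M_n tends to 0; otherwise t
    = 0, the targets of (3) and (4) merge, and the same point gives a = b. For k = 1 multiplicities
    say nothing, but subtracting a makes (3) a bound for h' at the zeros of h. The threshold K for
    the spherical derivative is part of the argument: |G'(0)| >= K, with K beyond the derivatives
    that (3) allows or that A itself has, discards the limits which satisfy all the sharing
    conditions. *)

Definition re (z : C) : R := complex.Re z.
Definition im (z : C) : R := complex.Im z.
Definition mkc (x y : R) : C := Complex x y.
Definition toC (x : R) : C := mkc x 0.
Definition iC : C := mkc 0 1.
Definition cj (z : C) : C := mkc (re z) (- im z).
Definition nrm (z : C) : R := Num.sqrt (re z ^+ 2 + im z ^+ 2).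

Lemma mkcE z : mkc (re z) (im z) = z. Proof. by case: z. Qed.
Lemma ceqP (z w : C) : re z = re w -> im z = im w -> z = w.
Proof. by move=> h1 h2; rewrite -(mkcE z) -(mkcE w) h1 h2. Qed.
Lemma re_mkc x y : re (mkc x y) = x. Proof. by []. Qed.
Lemma im_mkc x y : im (mkc x y) = y. Proof. by []. Qed.
Lemma reD z w : re (z + w) = re z + re w. Proof. by case: z; case: w. Qed.
Lemma imD z w : im (z + w) = im z + im w. Proof. by case: z; case: w. Qed.
Lemma reN z : re (- z) = - re z. Proof. by case: z. Qed.
Lemma imN z : im (- z) = - im z. Proof. by case: z. Qed.
Lemma reM z w : re (z * w) = re z * re w - im z * im w.
Proof. by case: z; case: w. Qed.
Lemma imM z w : im (z * w) = re z * im w + im z * re w.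
Proof. by case: z; case: w. Qed.
Lemma re_toC x : re (toC x) = x. Proof. by []. Qed.
Lemma im_toC x : im (toC x) = 0. Proof. by []. Qed.
Lemma re_iC : re iC = 0. Proof. by []. Qed.
Lemma im_iC : im iC = 1. Proof. by []. Qed.
Lemma re_cj z : re (cj z) = re z. Proof. by []. Qed.
Lemma im_cj z : im (cj z) = - im z. Proof. by []. Qed.
Lemma re0 : re 0 = 0. Proof. by []. Qed.
Lemma im0 : im 0 = 0. Proof. by []. Qed.
Lemma re1 : re 1 = 1. Proof. by []. Qed.
Lemma im1 : im 1 = 0. Proof. by []. Qed.

Definition cpxE := (reD, imD, reN, imN, reM, imM, re_mkc, im_mkc, re_toC,
  im_toC, re_iC, im_iC, re_cj, im_cj, re0, im0, re1, im1).

Lemma toC_additive : additive toC.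
Proof. by move=> x y; apply: ceqP; rewrite !cpxE // subrr. Qed.
Lemma toC_monoid : monoid_morphism toC.
Proof. by split=> // x y; apply: ceqP; rewrite !cpxE; ring. Qed.
HB.instance Definition _ := GRing.isZmodMorphism.Build R C toC toC_additive.
HB.instance Definition _ := GRing.isMonoidMorphism.Build R C toC toC_monoid.

Lemma toCD x y : toC (x + y) = toC x + toC y. Proof. exact: rmorphD. Qed.
Lemma toCB x y : toC (x - y) = toC x - toC y. Proof. exact: rmorphB. Qed.
Lemma toCM x y : toC (x * y) = toC x * toC y. Proof. exact: rmorphM. Qed.
Lemma toC0 : toC 0 = 0. Proof. by []. Qed.
Lemma toC1 : toC 1 = 1. Proof. by []. Qed.
Lemma toC_nat n : toC n%:R = n%:R. Proof. exact: rmorph_nat. Qed.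
Lemma toC_eq0 x : (toC x == 0) = (x == 0). Proof. exact: fmorph_eq0. Qed.

Lemma cpx_decomp z : z = toC (re z) + iC * toC (im z).
Proof. by apply: ceqP; rewrite !cpxE; ring. Qed.
Lemma iC2 : iC * iC = -1. Proof. by apply: ceqP; rewrite !cpxE; ring. Qed.

Lemma nrm_ge0 z : 0 <= nrm z. Proof. exact: sqrtr_ge0. Qed.
Lemma nrm_sqr z : nrm z ^+ 2 = re z ^+ 2 + im z ^+ 2.
Proof. by rewrite sqr_sqrtr // addr_ge0 ?sqr_ge0. Qed.
Lemma nrmM z w : nrm (z * w) = nrm z * nrm w.
Proof.
rewrite /nrm -sqrtrM ?addr_ge0 ?sqr_ge0 // !cpxE; congr Num.sqrt; ring.
Qed.
Lemma normE (z : C) : `|z| = toC (nrm z). Proof. exact: normc_def. Qed.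
Lemma toC_le x y : (toC x <= toC y) = (x <= y). Proof. exact: lecR. Qed.
Lemma toC_lt x y : (toC x < toC y) = (x < y). Proof. exact: ltcR. Qed.
Lemma nrmD z w : nrm (z + w) <= nrm z + nrm w.
Proof. by rewrite -toC_le toCD -!normE ler_normD. Qed.
Lemma nrmN z : nrm (- z) = nrm z.
Proof. by rewrite /nrm !cpxE !sqrrN. Qed.
Lemma nrmB z w : nrm (z - w) <= nrm z + nrm w.
Proof. by rewrite -(nrmN w) nrmD. Qed.
Lemma nrmC z w : nrm (z - w) = nrm (w - z).
Proof. by rewrite -nrmN opprB. Qed.
Lemma nrm0 : nrm 0 = 0. Proof. by rewrite /nrm !cpxE expr0n addr0 sqrtr0. Qed.
Lemma nrm1 : nrm 1 = 1. Proof. by rewrite /nrm !cpxE expr0n addr0 expr1n sqrtr1. Qed.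
Lemma nrm_toC x : nrm (toC x) = `|x|.
Proof. by rewrite /nrm !cpxE expr0n addr0 sqrtr_sqr. Qed.
Lemma nrm_iC : nrm iC = 1. Proof. by rewrite /nrm !cpxE expr0n add0r expr1n sqrtr1. Qed.
Lemma nrm_eq0 z : (nrm z == 0) = (z == 0).
Proof. by rewrite -toC_eq0 -normE normr_eq0. Qed.
Lemma nrm_gt0 z : (0 < nrm z) = (z != 0).
Proof. by rewrite lt0r nrm_eq0 nrm_ge0 andbT. Qed.
Lemma nrmV z : nrm z^-1 = (nrm z)^-1.
Proof.
have [->|z0] := eqVneq z 0; first by rewrite invr0 nrm0 invr0.
have h : nrm z != 0 by rewrite nrm_eq0.
by apply: (mulfI h); rewrite -nrmM !divff // nrm1.
Qed.
Lemma nrmX z n : nrm (z ^+ n) = nrm z ^+ n.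
Proof. by elim: n => [|n IH]; rewrite ?nrm1 // !exprS nrmM IH. Qed.
Lemma nrm_distD w z t : nrm (z - t) <= nrm (z - w) + nrm (w - t).
Proof. have -> : z - t = (z - w) + (w - t) by ring. exact: nrmD. Qed.
Lemma nrm_lerB z w : nrm z - nrm w <= nrm (z - w).
Proof. by have := nrmD (z - w) w; rewrite subrK; lra. Qed.
Lemma nrm_cj z : nrm (cj z) = nrm z.
Proof. by rewrite /nrm !cpxE sqrrN. Qed.
Lemma re_le_nrm z : `|re z| <= nrm z.
Proof. by rewrite -sqrtr_sqr ler_wsqrtr // lerDl sqr_ge0. Qed.
Lemma im_le_nrm z : `|im z| <= nrm z.
Proof. by rewrite -sqrtr_sqr ler_wsqrtr // lerDr sqr_ge0. Qed.
Lemma nrm_le_reim z : nrm z <= `|re z| + `|im z|.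
Proof.
rewrite {1}(cpx_decomp z); apply: le_trans (nrmD _ _) _.
by rewrite nrmM nrm_iC mul1r !nrm_toC.
Qed.
Lemma cjM_nrm z : z * cj z = toC (nrm z ^+ 2).
Proof. by rewrite nrm_sqr; apply: ceqP; rewrite !cpxE; ring. Qed.

(* Continuity of maps into C from a normed group given by its real-valued norm;
   it is used for the domains C (with [nrm]) and R (with the absolute value). *)
Section Continuity.
Variables (X : zmodType) (N : X -> R).
Definition cont_at (f : X -> C) (x : X) :=
  forall e, 0 < e -> exists2 d, 0 < d &
    forall y, N (y - x) < d -> nrm (f y - f x) < e.

Lemma cont_cst c x : cont_at (fun=> c) x.
Proof. by move=> e e0; exists 1 => // y _; rewrite subrr nrm0. Qed.

Lemma cont_add f g x : cont_at f x -> cont_at g x -> cont_at (fun y => f y + g y) x.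
Proof.
move=> hf hg e e0.
have [d1 d10 h1] := hf (e / 2) ltac:(lra).
have [d2 d20 h2] := hg (e / 2) ltac:(lra).
exists (Num.min d1 d2); first by rewrite lt_min d10.
move=> y; rewrite lt_min => /andP[/h1 a1 /h2 a2].
rewrite opprD addrACA; apply: le_lt_trans (nrmD _ _) _; lra.
Qed.

Lemma cont_mul f g x : cont_at f x -> cont_at g x -> cont_at (fun y => f y * g y) x.
Proof.
move=> hf hg e e0.
set a := nrm (f x); set b := nrm (g x).
have a0 : 0 <= a := nrm_ge0 _. have b0 : 0 <= b := nrm_ge0 _.
set e' := Num.min 1 (e / (a + b + 2)).
have e'0 : 0 < e' by rewrite lt_min ltr01 divr_gt0 //; lra.
have [d1 d10 h1] := hf e' e'0.
have [d2 d20 h2] := hg e' e'0.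
exists (Num.min d1 d2); first by rewrite lt_min d10.
move=> y; rewrite lt_min => /andP[/h1 a1 /h2 a2].
have -> : f y * g y - f x * g x =
  (f y - f x) * (g y - g x) + ((f y - f x) * g x + f x * (g y - g x)) by ring.
apply: le_lt_trans (nrmD _ _) _; rewrite nrmM.
apply: le_lt_trans (lerD (lexx _) (nrmD _ _)) _; rewrite !nrmM -/a -/b.
have e1 : e' <= 1 by rewrite ge_min lexx.
have e2 : e' * (a + b + 2) <= e.
  by rewrite -ler_pdivlMr ?ge_min ?lexx ?orbT //; lra.
have := nrm_ge0 (f y - f x); have := nrm_ge0 (g y - g x).
move: a1 a2; set u := nrm (f y - _); set v := nrm (g y - _) => hu hv v0 u0.
have : u * v <= e' * 1 by apply: ler_pM => //; lra.
have : u * b <= e' * b by apply: ler_wpM2r => //; lra.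
have : a * v <= a * e' by apply: ler_wpM2l => //; lra.
nra.
Qed.

Lemma cont_inv f x : f x != 0 -> cont_at f x -> cont_at (fun y => (f y)^-1) x.
Proof.
move=> fx0 hf e e0.
set a := nrm (f x); have a0 : 0 < a by rewrite nrm_gt0.
have [d d0 h] := hf (Num.min (a / 2) (e * (a * a / 2)))
  ltac:(rewrite lt_min divr_gt0 //= !mulr_gt0 //; lra).
exists d => // y /h; rewrite lt_min => /andP[h1 h2].
have a2 : a / 2 < nrm (f y).
  by have := nrm_lerB (f x) (f y); rewrite nrmC -/a; lra.
have fy0 : f y != 0 by rewrite -nrm_gt0; lra.
have -> : (f y)^-1 - (f x)^-1 = - ((f y - f x) / (f y * f x)) by field; rewrite fx0.
rewrite nrmN nrmM nrmV nrmM ltr_pdivrMr; last by rewrite mulr_gt0 //; lra.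
apply: lt_le_trans h2 _; rewrite ler_pM2l // -/a; nra.
Qed.

Lemma cont_opp f x : cont_at f x -> cont_at (fun y => - f y) x.
Proof.
move=> hf e /hf [d d0 h]; exists d => // y /h.
by rewrite -opprD nrmN.
Qed.
Lemma cont_sub f g x : cont_at f x -> cont_at g x -> cont_at (fun y => f y - g y) x.
Proof. by move=> hf hg; apply: cont_add => //; apply: cont_opp. Qed.
Lemma cont_ext f g x : (forall y, f y = g y) -> cont_at f x -> cont_at g x.
Proof. by move=> /funext ->. Qed.
Lemma cont_local f g x r : 0 < r -> N 0 = 0 -> (forall y, N (y - x) < r -> f y = g y) ->
  cont_at f x -> cont_at g x.
Proof.
move=> r0 N0 fg hf e /hf[d d0 h]; exists (Num.min d r); first by rewrite lt_min d0.
move=> y; rewrite lt_min => /andP[yd yr]; rewrite -fg // -fg ?subrr ?N0 //.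
exact: h.
Qed.
Lemma cont_exp f x n : cont_at f x -> cont_at (fun y => f y ^+ n) x.
Proof.
move=> hf; elim: n => [|n IH]; first by apply: cont_ext (cont_cst 1 x).
by apply: cont_ext (cont_mul hf IH) => y; rewrite exprS.
Qed.
Lemma cont_bounded f x : cont_at f x -> exists2 d, 0 < d &
  forall y, N (y - x) < d -> nrm (f y) < nrm (f x) + 1.
Proof.
move=> /(_ 1 ltr01)[d d0 h]; exists d => // y /h.
by have := nrm_lerB (f y) (f x); lra.
Qed.
End Continuity.

Notation ccont := (cont_at nrm).

Lemma ccont_id z : ccont (fun w => w) z.
Proof. by move=> e e0; exists e. Qed.

Lemma cont_comp (X : zmodType) (N : X -> R) (f : C -> C) (g : X -> C) x :
  ccont f (g x) -> cont_at N g x -> cont_at N (fun y => f (g y)) x.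
Proof.
by move=> hf hg e /hf[d d0 h]; have [d' d'0 h'] := hg d d0;
  exists d' => // y /h'; apply: h.
Qed.

(* Caratheodory's formulation of differentiability: the difference quotient
   extends continuously. *)
Definition cder (f : C -> C) (z d : C) :=
  exists2 phi : C -> C, phi z = d /\ ccont phi z &
    forall w, f w = f z + phi w * (w - z).

Lemma cder_cont f z d : cder f z d -> ccont f z.
Proof.
case=> phi [_ hp] h; apply: (@cont_ext _ _ (fun w => f z + phi w * (w - z))).
  by move=> w; rewrite -h.
apply: cont_add; first exact: cont_cst.
by apply: cont_mul => //; apply: cont_sub (ccont_id _) (cont_cst _ _ _).
Qed.

Lemma cder_cst c z : cder (fun=> c) z 0.
Proof. by exists (fun=> 0) => [|w]; [split=> //; exact: cont_cst|rewrite mul0r addr0]. Qed.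
Lemma cder_id z : cder (fun w => w) z 1.
Proof. by exists (fun=> 1) => [|w]; [split=> //; exact: cont_cst|rewrite mul1r subrKC]. Qed.
Lemma cder_add f g z a b : cder f z a -> cder g z b -> cder (fun w => f w + g w) z (a + b).
Proof.
move=> [p [pz cp] hp] [q [qz cq] hq]; exists (fun w => p w + q w).
  by split; [rewrite pz qz|exact: cont_add].
by move=> w; rewrite (hp w) (hq w); ring.
Qed.
Lemma cder_mul f g z a b : cder f z a -> cder g z b ->
  cder (fun w => f w * g w) z (a * g z + f z * b).
Proof.
move=> hf [q [qz cq] hq]; have cg : ccont g z by apply: (@cder_cont _ _ b); exists q.
case: hf => p [pz cp] hp; exists (fun w => p w * g w + f z * q w).
  split; first by rewrite pz qz.
  by apply: cont_add; apply: cont_mul => //; exact: cont_cst.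
by move=> w; rewrite (hp w) (hq w); ring.
Qed.
Lemma cder_opp f z a : cder f z a -> cder (fun w => - f w) z (- a).
Proof.
move=> [p [pz cp] hp]; exists (fun w => - p w).
  by split; [rewrite pz|exact: cont_opp].
by move=> w; rewrite (hp w); ring.
Qed.
Lemma cder_sub f g z a b : cder f z a -> cder g z b -> cder (fun w => f w - g w) z (a - b).
Proof. by move=> hf hg; apply: cder_add => //; exact: cder_opp. Qed.
Lemma cder_comp f g z a b : cder f (g z) a -> cder g z b ->
  cder (fun w => f (g w)) z (a * b).
Proof.
move=> [p [pz cp] hp] hg; have cg := cder_cont hg.
case: hg => q [qz cq] hq; exists (fun w => p (g w) * q w).
  by split; [rewrite pz qz|apply: cont_mul => //; exact: cont_comp].
by move=> w; rewrite (hp (g w)) {2}(hq w); ring.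
Qed.
Lemma cder_inv f z a : f z != 0 -> cder f z a -> cder (fun w => (f w)^-1) z (- a / f z ^+ 2).
Proof.
move=> fz0 hf; have cf := cder_cont hf.
have [d d0 hd] := cf (nrm (f z)) ltac:(by rewrite nrm_gt0).
case: hf => p [pz cp] hp.
(* Where f vanishes the inverse is 0 by convention, and the slope must account for that value; near
   z this branch never occurs. *)
pose q w := if f w == 0 then - (f z)^-1 / (w - z) else - p w / (f w * f z).
exists q.
  split; first by rewrite /q (negbTE fz0) pz expr2.
  apply: (@cont_local _ _ (fun w => - p w / (f w * f z)) _ _ d) => //; first exact: nrm0.
    move=> y yd; rewrite /q; case: eqP => // fy.
    by have := hd _ yd; rewrite fy sub0r nrmN ltxx.
  apply: cont_mul; first exact: cont_opp.
  apply: cont_inv; first by rewrite mulf_neq0.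
  by apply: cont_mul => //; exact: cont_cst.
move=> w; rewrite /q; case: eqP => [fw|/eqP fw].
  have wz : w - z != 0.
    by rewrite subr_eq0; apply: contra fz0 => /eqP <-; rewrite fw.
  by rewrite fw invr0 divfK // subrr.
have e : p w * (w - z) = f w - f z by rewrite (hp w) addrAC subrr add0r.
have -> : - p w / (f w * f z) * (w - z) = - (p w * (w - z)) / (f w * f z) by field; rewrite fz0.
by rewrite e; field; rewrite fz0.
Qed.
Lemma cder_div f g z a b : g z != 0 -> cder f z a -> cder g z b ->
  cder (fun w => f w / g w) z ((a * g z - f z * b) / g z ^+ 2).
Proof.
move=> gz hf hg; have := cder_mul hf (cder_inv gz hg).
by congr cder; field; rewrite gz.
Qed.
Lemma cder_exp f z a n : cder f z a -> cder (fun w => f w ^+ n.+1) z (n.+1%:R * f z ^+ n * a).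
Proof.
move=> hf; elim: n => [|n IH].
  have -> : (fun w => f w ^+ 1) = f by apply/funext => w; rewrite expr1.
  by rewrite expr0 !mul1r.
have -> : (fun w => f w ^+ n.+2) = (fun w => f w * f w ^+ n.+1).
  by apply/funext => w; rewrite exprS.
have := cder_mul hf IH; congr cder.
by rewrite -[in RHS]addn1 natrD !exprS; ring.
Qed.
Lemma cder_local f g z d r : 0 < r -> (forall w, nrm (w - z) < r -> f w = g w) ->
  cder f z d -> cder g z d.
Proof.
move=> r0 fg [p [pz cp] hp].
exists (fun w => if w == z then d else (g w - g z) / (w - z)).
  rewrite eqxx; split=> //.
  apply: (@cont_local _ _ p _ _ r) => //; first exact: nrm0.
  move=> w wr; case: eqP => [->//|/eqP wz].
  rewrite -!fg ?subrr ?nrm0 // (hp w).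
  have h : w - z != 0 by rewrite subr_eq0.
  by field.
move=> w; case: eqP => [->|/eqP wz]; first by rewrite subrr mulr0 addr0.
by rewrite divfK ?subrKC // subr_eq0.
Qed.
Lemma cder_ext f g z d : (forall w, f w = g w) -> cder f z d -> cder g z d.
Proof. by move=> /funext ->. Qed.

Lemma cderP f z d : cder f z d <->
  (forall e, 0 < e -> exists2 r, 0 < r & forall h, h != 0 -> nrm h < r ->
     nrm ((f (h + z) - f z) / h - d) < e).
Proof.
split=> [[p [pz cp] hp] e /cp[r r0 hr]|H].
  exists r => // h h0 hh; have := hr (h + z); rewrite addrK => /(_ hh).
  by rewrite pz (hp (h + z)) addrK addrAC subrr add0r mulfK.
exists (fun w => if w == z then d else (f w - f z) / (w - z)).
  rewrite eqxx; split=> // e e0; have [r r0 hr] := H e e0; exists r => // y yr.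
  rewrite eqxx; case: eqP => [_|/eqP yz]; first by rewrite subrr nrm0.
  by have := hr (y - z); rewrite subrK; apply=> //; rewrite subr_eq0.
move=> w; case: eqP => [->|/eqP wz]; first by rewrite subrr mulr0 addr0.
by rewrite divfK ?subrKC // subr_eq0.
Qed.

(** This is the only bridge to the derivative of the theorem; everything else is done with
    real-valued moduli. *)
Lemma cder_derivable f z d : cder f z d <-> derivable f z 1 /\ derive1 f z = d.
Proof.
have E : (fun h : C => h^-1 *: (f (h + z) - f z)) =
         (fun h : C => (f (h + z) - f z) / h).
  by apply/funext => h; rewrite /GRing.scale /= mulrC.
have E2 : (fun h : C => h^-1 *: ((f \o shift z) (h *: 1) - f z)) =
         (fun h : C => (f (h + z) - f z) / h).
  by apply/funext => h; rewrite /= [h *: 1]mulr1 /GRing.scale /= mulrC.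
split.
  move=> /cderP H.
  have cv : (fun h : C => (f (h + z) - f z) / h) @ 0^' --> d.
    apply/cvgrPdist_lt => /= e e0.
    (* Only real numbers are comparable with 0 in C, so a positive e is real. *)
    have eE : e = toC (re e).
      by apply: ceqP => //; rewrite im_toC; have := gtr0_real e0; move/Creal_ImP;
        case: (e) {e0} => u v /=; rewrite -complexIm => -[] .
    move: e0; rewrite eE -toC0 toC_lt => e0.
    have [r r0 hr] := H _ e0.
    exists (toC r); first by rewrite /= -toC0 toC_lt.
    move=> h /=; rewrite sub0r normrN normE toC_lt => hh h0.
    by rewrite distrC normE toC_lt; apply: hr.
  split; last by rewrite /derive1 E; exact: cvg_lim.
  by rewrite /derivable E2; apply/cvg_ex; exists d.
case=> dv <-; apply/cderP => e e0.
have cv : (fun h : C => (f (h + z) - f z) / h) @ 0^' --> derive1 f z.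
  by rewrite /derive1 E; move: dv; rewrite /derivable E2.
have := @cvgr_dist_lt _ _ _ _ _ _ _ cv (toC e) => /(_ _).
rewrite -toC0 toC_lt => /(_ e0).
move=> -[r /= r0 hr].
exists (re r).
  by move: r0; rewrite ltcE => /andP[].
have rE : r = toC (re r).
  by move: r0; rewrite ltcE => /andP[/eqP r1 _]; apply: ceqP.
move=> h h0 hh; have := hr h; rewrite /ball_ /= sub0r normrN normE {1}rE toC_lt.
by rewrite distrC normE toC_lt; apply.
Qed.

End ComplexNumbers.
Notation ccont := (cont_at (@nrm _)).

(** * Curves, integrals and the exponential *)

Section RealParameter.
Variable R : realType.
Local Notation C := (Cplx R).
Local Notation rcont := (cont_at (@Num.norm R R)).

Definition rder (F : R -> C) (t : R) (d : C) :=
  exists2 phi : R -> C, phi t = d /\ rcont phi t &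
    forall s, F s = F t + phi s * toC (s - t).

Lemma rcont_toC t : rcont (@toC R) t.
Proof. by move=> e e0; exists e => // s; rewrite -toCB nrm_toC. Qed.

Lemma rder_cont F t d : rder F t d -> rcont F t.
Proof.
case=> phi [_ hp] h; apply: (@cont_ext _ _ _ (fun w => F t + phi w * toC (w - t))).
  by move=> w; rewrite -h.
apply: cont_add; first exact: cont_cst.
apply: cont_mul => //; apply: cont_ext (cont_sub (@rcont_toC t) (@cont_cst _ _ _ (toC t) t)).
by move=> s; rewrite toCB.
Qed.
Lemma rder_add F G t a b : rder F t a -> rder G t b -> rder (fun s => F s + G s) t (a + b).
Proof.
move=> [p [pz cp] hp] [q [qz cq] hq]; exists (fun w => p w + q w).
  by split; [rewrite pz qz|exact: cont_add].
by move=> w; rewrite (hp w) (hq w); ring.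
Qed.
Lemma rder_cmul F t a c : rder F t a -> rder (fun s => c * F s) t (c * a).
Proof.
move=> [p [pz cp] hp]; exists (fun w => c * p w).
  by split; [rewrite pz|apply: cont_mul => //; exact: cont_cst].
by move=> w; rewrite (hp w); ring.
Qed.
Lemma rder_mul F G t a b : rder F t a -> rder G t b ->
  rder (fun s => F s * G s) t (a * G t + F t * b).
Proof.
move=> hf hg; have cg := rder_cont hg; case: hg => q [qz cq] hq.
case: hf => p [pz cp] hp; exists (fun w => p w * G w + F t * q w).
  split; first by rewrite pz qz.
  by apply: cont_add; apply: cont_mul => //; exact: cont_cst.
by move=> w; rewrite (hp w) (hq w); ring.
Qed.
Lemma rder_cst c t : rder (fun=> c) t 0.
Proof. by exists (fun=> 0) => [|w]; [split=> //; exact: cont_cst|rewrite mul0r addr0]. Qed.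
Lemma rder_toC t : rder (@toC R) t 1.
Proof.
exists (fun=> 1) => [|w]; first by split=> //; exact: cont_cst.
by rewrite mul1r -toCD subrKC.
Qed.
Lemma rder_comp (f : C -> C) F t a b : cder f (F t) a -> rder F t b ->
  rder (fun s => f (F s)) t (a * b).
Proof.
move=> [p [pz cp] hp] hg; have cg := rder_cont hg.
case: hg => q [qz cq] hq; exists (fun w => p (F w) * q w).
  by split; [rewrite pz qz|apply: cont_mul => //; exact: cont_comp].
by move=> w; rewrite (hp (F w)) {2}(hq w); ring.
Qed.
Lemma rder_ext F G t d : (forall s, F s = G s) -> rder F t d -> rder G t d.
Proof. by move=> /funext ->. Qed.

Lemma is_derive_eps (f : R -> R) (t d : R) : is_derive t 1 f d <->
  (forall e, 0 < e -> exists2 r, 0 < r & forall h, h != 0 -> `|h| < r ->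
     `|(f (h + t) - f t) / h - d| < e).
Proof.
have E2 : (fun h : R => h^-1 *: ((f \o shift t) (h *: 1) - f t)) =
         (fun h : R => (f (h + t) - f t) / h).
  by apply/funext => h; rewrite /= [h *: 1]mulr1 /GRing.scale /= mulrC.
have E : (fun h : R => (f (h + t) - f t) / h) @ 0^' --> d <-> is_derive t 1 f d.
  split=> [cv|[dv <-]].
    by apply: DeriveDef; [rewrite /derivable E2; apply/cvg_ex; exists d|
      rewrite /derive E2; exact: cvg_lim].
  by move: dv; rewrite /derivable /derive E2.
rewrite -E; split=> [cv e e0|H].
  have := @cvgr_dist_lt _ _ _ _ _ _ _ cv e e0 => -[r /= r0 hr].
  exists r => // h h0 hh; rewrite distrC; apply: hr => //.
  by rewrite /ball_ /= sub0r normrN.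
apply/cvgrPdist_lt => /= e e0; have [r r0 hr] := H e e0.
exists r => // h /=; rewrite sub0r normrN => hh h0.
by rewrite distrC; apply: hr.
Qed.

Lemma rder_real (f : R -> R) (t d : R) : is_derive t 1 f d -> rder (fun s => toC (f s)) t (toC d).
Proof.
move=> /is_derive_eps H.
exists (fun s => if s == t then toC d else toC ((f s - f t) / (s - t))).
  rewrite eqxx; split=> // e e0; have [r r0 hr] := H e e0; exists r => // s sr.
  rewrite eqxx; case: eqP => [_|/eqP st]; first by rewrite subrr nrm0.
  by rewrite -toCB nrm_toC; have := hr (s - t); rewrite subrK; apply=> //; rewrite subr_eq0.
move=> s; case: eqP => [->|/eqP st]; first by rewrite subrr mulr0 addr0.
by rewrite -toCM divfK ?subr_eq0 // -toCD subrKC.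
Qed.

Lemma rder_re u F t d : rder F t d -> is_derive t 1 (fun s => re (u * F s)) (re (u * d)).
Proof.
case=> phi [pt cp] hp; apply/is_derive_eps => e e0.
have [r r0 hr] := cp (e / (nrm u + 1)) ltac:(by rewrite divr_gt0 // ltr_wpDl // nrm_ge0).
exists r => // h h0 hh; rewrite (hp (h + t)) addrK.
have -> : (re (u * (F t + phi (h + t) * toC h)) - re (u * F t)) / h = re (u * phi (h + t)).
  by rewrite !cpxE; field.
have -> : re (u * phi (h + t)) - re (u * d) = re (u * (phi (h + t) - phi t)).
  by rewrite pt !cpxE; ring.
apply: le_lt_trans (re_le_nrm _) _; rewrite nrmM.
have := hr (h + t); rewrite addrK => /(_ hh); set v := nrm (_ - _) => hv.
have u0 := nrm_ge0 u; have v0 : 0 <= v := nrm_ge0 _.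
move: hv; rewrite ltr_pdivlMr; last lra.
nra.
Qed.

(** The real mean value theorem is applied to [re (u * F)], where u is the conjugate of the
    increment w of F, because [re (u * w)] is the square of the modulus of w. *)
Lemma mean_value_ineq F dF a b m : a <= b -> (forall t, a <= t <= b -> rder F t (dF t)) ->
  (forall t, a <= t <= b -> nrm (dF t) <= m) -> nrm (F b - F a) <= m * (b - a).
Proof.
move=> ab hF hm; set w := F b - F a; set u := cj w.
have D t : t \in `]a, b[%R -> is_derive t 1 (fun s => re (u * F s)) (re (u * dF t)).
  by rewrite in_itv /= => /andP[/ltW ta /ltW tb]; apply: rder_re; apply: hF; rewrite ta.
have CT : {within `[a, b], continuous (fun s => re (u * F s))}.
  apply: derivable_within_continuous => t; rewrite in_itv /= => h.
  by have [] := rder_re u (hF t h).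
have [c] := MVT_segment ab D CT.
rewrite in_itv /= => cab.
have -> : re (u * F b) - re (u * F a) = nrm w ^+ 2.
  have : re (w * u) = nrm w ^+ 2 by rewrite cjM_nrm.
  by move=> <-; rewrite /w !cpxE; ring.
move=> E; have [w0|w0] := eqVneq (nrm w) 0.
  have := hm a; rewrite lexx ab => /(_ isT) h.
  by rewrite w0 mulr_ge0 ?subr_ge0 // (le_trans (nrm_ge0 _) h).
have wp : 0 < nrm w by rewrite lt_def w0 nrm_ge0.
rewrite -(ler_pM2l wp) -expr2 E mulrA ler_wpM2r ?subr_ge0 //.
apply: le_trans (ler_norm _) _; apply: le_trans (re_le_nrm _) _.
by rewrite nrmM /u nrm_cj ler_wpM2l // ?nrm_ge0 //; exact: hm.
Qed.

Lemma antiderivative_real (f : R -> R) (L : R) : 0 < L ->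
  (forall t, {for t, continuous f}) ->
  exists F : R -> R, forall t, - L < t < L -> is_derive t 1 F (f t).
Proof.
move=> L0 cf.
exists (fun x => \int[lebesgue_measure]_(t in `[(- L), x]) f t)%R => t /andP[t1 t2].
have intf : lebesgue_measure.-integrable `[(- L), L] (EFin \o f).
  apply: continuous_compact_integrable; first exact: segment_compact.
  by apply: continuous_subspaceT => x; exact: cf.
have [d1 d2] := continuous_FTC1_closed t2 intf t1 (cf t).
by rewrite -d2 derive1E; apply: derivableP.
Qed.

Lemma antiderivative (phi : R -> C) (L : R) : 0 < L -> (forall t, rcont phi t) ->
  exists F : R -> C, forall t, - L < t < L -> rder F t (phi t).
Proof.
move=> L0 cp.
have cr u : forall t, {for t, continuous (fun s => re (u * phi s))}.
  move=> t; apply/cvgrPdist_lt => /= e e0.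
  have [r r0 hr] := cont_mul (cont_cst _ u t) (cp t) e0.
  exists r => //= s hs; rewrite distrC.
  have h : nrm (u * phi s - u * phi t) < e by apply: hr; rewrite distrC.
  by apply: le_lt_trans h; apply: le_trans (re_le_nrm _); rewrite reD reN.
have [F hF] := antiderivative_real L0 (cr 1).
(* The real part of - i z is the imaginary part of z. *)
have [G hG] := antiderivative_real L0 (cr (- iC R)).
exists (fun s => toC (F s) + iC R * toC (G s)) => t ht.
have := rder_add (rder_real (hF t ht)) (rder_cmul (iC R) (rder_real (hG t ht))).
by congr rder; apply: ceqP; rewrite !cpxE; ring.
Qed.

(* Oriented integral, as the increment of any antiderivative. *)
Definition rint (phi : R -> C) (a b : R) : C :=
  get [set v | exists2 F : R -> C, (forall t, Num.min a b <= t <= Num.max a b -> rder F t (phi t)) &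
     v = F b - F a].

Lemma rint_bound_aux F phi a b m :
  (forall t, Num.min a b <= t <= Num.max a b -> rder F t (phi t)) ->
  (forall t, Num.min a b <= t <= Num.max a b -> nrm (phi t) <= m) ->
  nrm (F b - F a) <= m * `|b - a|.
Proof.
have [ab|ba] := leP a b => hF hm.
  by rewrite ger0_norm ?subr_ge0 //; exact: (mean_value_ineq ab hF hm).
rewrite nrmC distrC ger0_norm; last by rewrite subr_ge0 ltW.
exact: (mean_value_ineq (ltW ba) hF hm).
Qed.

(** The choice inside [rint] is harmless: the difference of two antiderivatives has derivative 0, so
    its increment is bounded by 0. *)
Lemma rintE F phi a b : (forall t, Num.min a b <= t <= Num.max a b -> rder F t (phi t)) ->
  rint phi a b = F b - F a.
Proof.
move=> hF; rewrite /rint; set S := [set _ | _].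
have : S (get S) by apply: (@getI _ S (F b - F a)); exists F.
case=> G hG ->; apply/eqP; rewrite -subr_eq0 -nrm_eq0 eq_le nrm_ge0 andbT.
have := @rint_bound_aux (fun s => G s + - 1 * F s) (fun=> 0) a b 0.
rewrite mul0r; have -> : G b + -1 * F b - (G a + -1 * F a) = G b - G a - (F b - F a) by ring.
apply=> t ht; last by rewrite nrm0.
by have := rder_add (hG t ht) (rder_cmul (- 1) (hF t ht)); congr rder; ring.
Qed.

Lemma antiderivative_on phi a b : (forall t, rcont phi t) ->
  exists F, forall t, a <= t <= b -> rder F t (phi t).
Proof.
move=> cp; have L0 : 0 < `|a| + `|b| + 1.
  by rewrite ltr_wpDl // addr_ge0 // normr_ge0.
have [F hF] := antiderivative L0 cp; exists F => t /andP[t1 t2]; apply: hF.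
have := ler_norm b; have := ler_norm (- a); rewrite normrN.
have := normr_ge0 a; have := normr_ge0 b.
lra.
Qed.

Lemma rint_bound phi a b m : (forall t, rcont phi t) ->
  (forall t, Num.min a b <= t <= Num.max a b -> nrm (phi t) <= m) ->
  nrm (rint phi a b) <= m * `|b - a|.
Proof.
move=> cp hm; have [F hF] := antiderivative_on (Num.min a b) (Num.max a b) cp.
by rewrite (rintE hF); apply: rint_bound_aux hF hm.
Qed.

Lemma rint_chasles phi a b c : (forall t, rcont phi t) ->
  rint phi a c = rint phi a b + rint phi b c.
Proof.
move=> cp.
have [F hF] := antiderivative_on (Num.min a (Num.min b c)) (Num.max a (Num.max b c)) cp.
move: F hF; set lo := Num.min a _; set hi := Num.max a _ => F hF.
have H u v : lo <= u <= hi -> lo <= v <= hi -> rint phi u v = F v - F u.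
  move=> /andP[u1 u2] /andP[v1 v2]; apply: rintE => t /andP[t1 t2]; apply: hF.
  apply/andP; split; first by apply: le_trans t1; rewrite le_min u1.
  by apply: le_trans t2 _; rewrite ge_max u2.
have aI : lo <= a <= hi by rewrite ge_min le_max lexx.
have bI : lo <= b <= hi by rewrite !ge_min !le_max lexx !orbT.
have cI : lo <= c <= hi by rewrite !ge_min !le_max lexx !orbT.
by rewrite !H //; ring.
Qed.

Lemma rint_swap phi a b : (forall t, rcont phi t) -> rint phi b a = - rint phi a b.
Proof.
move=> cp; have := rint_chasles a b a cp.
have -> : rint phi a a = 0.
  apply/eqP; rewrite -nrm_eq0 eq_le nrm_ge0 andbT.
  have := @rint_bound phi a a (nrm (phi a)) cp; rewrite subrr normr0 mulr0; apply=> t.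
  by rewrite minxx maxxx => /le_anti ->.
by move=> h; apply/eqP; rewrite -addr_eq0 addrC -h.
Qed.

Lemma rint_lin phi psi c a b : (forall t, rcont phi t) -> (forall t, rcont psi t) ->
  rint (fun t => phi t + c * psi t) a b = rint phi a b + c * rint psi a b.
Proof.
move=> cp cs; have [F hF] := antiderivative_on (Num.min a b) (Num.max a b) cp.
have [G hG] := antiderivative_on (Num.min a b) (Num.max a b) cs.
rewrite (rintE hF) (rintE hG) (@rintE (fun s => F s + c * G s)); first ring.
by move=> t ht; apply: rder_add; [exact: hF|apply: rder_cmul; exact: hG].
Qed.

End RealParameter.

Section Exponential.
Variable R : realType.
Local Notation C := (Cplx R).

Definition cis (t : R) : C := mkc (cos t) (sin t).
Definition cexp (z : C) : C := toC (expR (re z)) * cis (im z).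

Lemma cisD s t : cis (s + t) = cis s * cis t.
Proof. by apply: ceqP; rewrite /cis !cpxE ?cosD ?sinD; ring. Qed.
Lemma nrm_cis t : nrm (cis t) = 1.
Proof. by rewrite /nrm !cpxE cos2Dsin2 sqrtr1. Qed.
Lemma rder_cis t : rder cis t (iC R * cis t).
Proof.
apply: (@rder_ext _ (fun s => toC (cos s) + iC R * toC (sin s))).
  by move=> s; rewrite [RHS]cpx_decomp.
have := rder_add (rder_real (is_derive_cos t)) (rder_cmul (iC R) (rder_real (is_derive_sin t))).
by congr rder; apply: ceqP; rewrite /cis !cpxE; ring.
Qed.

Lemma cexpD z w : cexp (z + w) = cexp z * cexp w.
Proof. by rewrite /cexp !cpxE expRD cisD toCM; ring. Qed.
Lemma nrm_cexp z : nrm (cexp z) = expR (re z).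
Proof. by rewrite /cexp nrmM nrm_cis mulr1 nrm_toC ger0_norm // expR_ge0. Qed.
Lemma cexp0 : cexp 0 = 1.
Proof. by apply: ceqP; rewrite /cexp /cis !cpxE expR0 cos0 sin0; ring. Qed.
Lemma cexp_neq0 z : cexp z != 0.
Proof. by rewrite -nrm_gt0 nrm_cexp expR_gt0. Qed.
Lemma cexpN z : cexp (- z) = (cexp z)^-1.
Proof. by apply: (mulfI (cexp_neq0 z)); rewrite -cexpD subrr cexp0 divff // cexp_neq0. Qed.
Definition twopi_i : C := mkc 0 (pi *+ 2).
Lemma cexp_2pi : cexp twopi_i = 1.
Proof. by apply: ceqP; rewrite /cexp /cis !cpxE cos2pi sin2pi expR0; ring. Qed.
Lemma twopi_i_neq0 : twopi_i != 0.
Proof.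
rewrite -nrm_eq0 /nrm !cpxE expr0n add0r sqrtr_sqr normr_eq0 mulrn_eq0 /=.
by rewrite gt_eqF // pi_gt0.
Qed.

Lemma cis_surj (w : C) : nrm w = 1 -> exists t, cis t = w.
Proof.
move=> w1; have := nrm_sqr w; rewrite w1 expr1n => h.
have x1 : -1 <= re w <= 1 by have := sqr_ge0 (im w); have := re_le_nrm w; rewrite w1 ler_norml.
have E : sin (acos (re w)) = `|im w|.
  by rewrite sin_acos // -[1]/(1%R) h addrAC subrr add0r sqrtr_sqr.
have [i0|i0] := leP 0 (im w).
  exists (acos (re w)); apply: ceqP; rewrite /cis !cpxE; first by rewrite acosK.
  by rewrite E ger0_norm.
exists (- acos (re w)); apply: ceqP; rewrite /cis !cpxE; first by rewrite cosN acosK.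
by rewrite sinN E ltr0_norm // opprK.
Qed.

Lemma cexp_surj (w : C) : w != 0 -> exists z, cexp z = w.
Proof.
move=> w0; have n0 : 0 < nrm w by rewrite nrm_gt0.
have nz : toC (nrm w) != 0 by rewrite toC_eq0 gt_eqF.
have [t ht] : exists t, cis t = w / toC (nrm w).
  apply: cis_surj; rewrite nrmM nrmV nrm_toC (ger0_norm (nrm_ge0 _)) divff //.
  by rewrite gt_eqF.
exists (mkc (ln (nrm w)) t); rewrite /cexp re_mkc im_mkc ht lnK ?posrE //.
by rewrite mulrC divfK.
Qed.

Lemma cder_cexp z : cder cexp z (cexp z).
Proof.
suff H : cder cexp 0 1.
  have H1 : cder (fun w => cexp (w - z)) z 1.
    have Hs : cder (fun w => w - z) z (1 - 0).
      by apply: cder_sub; [exact: cder_id|exact: cder_cst].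
    have H0 : cder cexp (z - z) 1 by rewrite subrr.
    by have := @cder_comp _ cexp (fun w => w - z) z _ _ H0 Hs; rewrite subr0 mulr1.
  have := cder_mul (cder_cst (cexp z) z) H1; rewrite mul0r add0r mulr1.
  by apply: cder_ext => w; rewrite -cexpD subrKC.
have [p [p0 cp] hp] := @rder_real R expR 0 (expR 0) (is_derive_expR _).
have [q [q0 cq] hq] := rder_cis 0.
have c0 : cis 0 = 1 by apply: ceqP; rewrite /cis !cpxE ?cos0 ?sin0.
have ccis : cont_at Num.norm cis 0 := rder_cont (rder_cis 0).
have cr (f : R -> C) : cont_at Num.norm f 0 -> ccont (fun w : C => f (re w)) 0.
  move=> cf e /cf [d d0 h]; exists d => // w; rewrite !subr0 => wd; rewrite re0.
  by apply: h; rewrite subr0; apply: le_lt_trans (re_le_nrm _) wd.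
have ci (f : R -> C) : cont_at Num.norm f 0 -> ccont (fun w : C => f (im w)) 0.
  move=> cf e /cf [d d0 h]; exists d => // w; rewrite !subr0 => wd; rewrite im0.
  by apply: h; rewrite subr0; apply: le_lt_trans (im_le_nrm _) wd.
(* For h = x + i y one has exp h - 1 - h = x A(h) + y B(h), and both factors are continuous and
   vanish at 0; this is differentiability at 0. The addition formula has moved the general point
   there. *)
pose A (w : C) := p (re w) * cis (im w) - 1.
pose B (w : C) := q (im w) - iC R.
have A0 : A 0 = 0 by rewrite /A re0 im0 p0 c0 expR0 mulr1 subrr.
have B0 : B 0 = 0 by rewrite /B im0 q0 c0 mulr1 subrr.
have cA : ccont A 0.
  by apply: cont_sub; [apply: cont_mul; [exact: cr|exact: ci]|exact: cont_cst].
have cB : ccont B 0 by apply: cont_sub; [exact: ci|exact: cont_cst].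
apply/cderP => e e0.
have [r1 r10 h1] := cA (e / 2) ltac:(lra); have [r2 r20 h2] := cB (e / 2) ltac:(lra).
exists (Num.min r1 r2); first by rewrite lt_min r10.
move=> h hn0; rewrite lt_min => /andP[/[dup] H1 hr1 hr2].
have := h1 h; have := h2 h; rewrite A0 B0 !subr0 => /(_ hr2) b /(_ hr1) a.
rewrite addr0 cexp0.
have E : cexp h - 1 = toC (re h) * A h + toC (im h) * B h + h.
  transitivity (toC (re h) * A h + toC (im h) * B h + (toC (re h) + iC R * toC (im h))); last by rewrite -cpx_decomp.
  rewrite /A /B.
  have := hp (re h); rewrite expR0 subr0 /cexp => ->.
  have e2 := hq (im h); rewrite c0 subr0 in e2.
  have e3 : q (im h) * toC (im h) = cis (im h) - 1 by rewrite e2; ring.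
  rewrite toC1.
  transitivity (p (re h) * toC (re h) * cis (im h) + (cis (im h) - 1)); first by ring.
  by rewrite -e3; ring.
have -> : (cexp h - 1) / h - 1 = (toC (re h) * A h + toC (im h) * B h) / h.
  by rewrite E; field.
have n0 : 0 < nrm h by rewrite nrm_gt0.
rewrite nrmM nrmV ltr_pdivrMr //; apply: le_lt_trans (nrmD _ _) _; rewrite !nrmM !nrm_toC.
have ra := re_le_nrm h; have ib := im_le_nrm h.
have : `|re h| * nrm (A h) <= nrm h * nrm (A h) by rewrite ler_wpM2r ?nrm_ge0.
have : `|im h| * nrm (B h) <= nrm h * nrm (B h) by rewrite ler_wpM2r ?nrm_ge0.
nra.
Qed.

End Exponential.

(** * Cauchy theory on discs *)

Section Goursat.
Variable R : realType.
Local Notation C := (Cplx R).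
Local Notation rcont := (cont_at (@Num.norm R R)).
Local Notation i := (iC R).

Definition hint (g : C -> C) y a b := rint (fun s => g (mkc s y)) a b.
Definition vint (g : C -> C) x a b := rint (fun t => g (mkc x t)) a b.
Definition rect_int g x0 x1 y0 y1 :=
  hint g y0 x0 x1 + i * vint g x1 y0 y1 - hint g y1 x0 x1 - i * vint g x0 y0 y1.

Definition between (a b t : R) := Num.min a b <= t <= Num.max a b.

Lemma between_l a b : between a b a.
Proof. by rewrite /between ge_min le_max lexx. Qed.
Lemma between_r a b : between a b b.
Proof. by rewrite /between ge_min le_max lexx !orbT. Qed.
Lemma between_dist a b t : between a b t -> `|t - a| <= `|b - a|.
Proof.
rewrite /between; have [ab|ba] := leP a b => /andP[h1 h2].
  by rewrite !ger0_norm; lra.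
by rewrite !ler0_norm; lra.
Qed.
Lemma between_split a b c t : between b c t -> between a b t \/ between a c t.
Proof.
rewrite /between !ge_min !le_max => /andP[/orP h1 /orP h2].
case: (leP a t) => at_; case: (leP b t) => bt; case: (leP c t) => ct /=;
  rewrite ?(ltW at_) ?(ltW bt) ?(ltW ct) /= ?orbT ?andbT /=; try (by left); try (by right);
  move: at_ bt ct h1 h2; lra.
Qed.

Lemma rder_horiz y t : rder (fun s => mkc s y : C) t 1.
Proof.
apply: (@rder_ext _ (fun s => toC s + i * toC y)); first by move=> s; rewrite [RHS]cpx_decomp.
by rewrite -[1]addr0; apply: rder_add; [exact: rder_toC|exact: rder_cst].
Qed.
Lemma rder_vert x t : rder (fun s => mkc x s : C) t i.
Proof.
apply: (@rder_ext _ (fun s => toC x + i * toC s)); first by move=> s; rewrite [RHS]cpx_decomp.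
by rewrite -[X in rder _ _ X]add0r -[X in _ + X]mulr1; apply: rder_add; [exact: rder_cst|apply: rder_cmul; exact: rder_toC].
Qed.

Lemma cont_horiz (g : C -> C) y : (forall z, ccont g z) -> forall t, rcont (fun s => g (mkc s y)) t.
Proof. by move=> cg t; apply: cont_comp => //; apply: rder_cont (rder_horiz y t). Qed.
Lemma cont_vert (g : C -> C) x : (forall z, ccont g z) -> forall t, rcont (fun s => g (mkc x s)) t.
Proof. by move=> cg t; apply: cont_comp => //; apply: rder_cont (rder_vert x t). Qed.

Lemma hint_prim Q q y a b : (forall z, cder Q z (q z)) ->
  hint q y a b = Q (mkc b y) - Q (mkc a y).
Proof.
move=> hQ; rewrite /hint (@rintE _ (fun s => Q (mkc s y))) // => t _.
by have := @rder_comp _ Q (fun s => mkc s y) t _ _ (hQ (mkc t y)) (rder_horiz y t); rewrite mulr1.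
Qed.
Lemma vint_prim Q q x a b : (forall z, cder Q z (q z)) ->
  i * vint q x a b = Q (mkc x b) - Q (mkc x a).
Proof.
move=> hQ; rewrite /vint (@rintE _ (fun s => - i * Q (mkc x s))).
  by transitivity (- (i * i) * (Q (mkc x b) - Q (mkc x a))); [ring|rewrite iC2; ring].
move=> t _; have := rder_cmul (- i) (@rder_comp _ Q (fun s => mkc x s) t _ _ (hQ (mkc x t)) (rder_vert x t)).
by congr rder; transitivity (- (i * i) * q (mkc x t)); [ring|rewrite iC2; ring].
Qed.
Lemma rect_int_prim Q q x0 x1 y0 y1 : (forall z, cder Q z (q z)) ->
  rect_int q x0 x1 y0 y1 = 0.
Proof. by move=> hQ; rewrite /rect_int !(hint_prim _ _ _ hQ) !(vint_prim _ _ _ hQ); ring. Qed.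

Lemma rect_int_sub g q x0 x1 y0 y1 : (forall z, ccont g z) -> (forall z, ccont q z) ->
  rect_int (fun z => g z + -1 * q z) x0 x1 y0 y1 =
  rect_int g x0 x1 y0 y1 - rect_int q x0 x1 y0 y1.
Proof.
move=> cg cq; rewrite /rect_int /hint /vint !rint_lin; first by ring.
all: by [exact: cont_horiz|exact: cont_vert].
Qed.

Lemma rect_int_bound g x0 x1 y0 y1 m : (forall z, ccont g z) ->
  (forall x y, between x0 x1 x -> between y0 y1 y -> nrm (g (mkc x y)) <= m) ->
  nrm (rect_int g x0 x1 y0 y1) <= 2 * m * (`|x1 - x0| + `|y1 - y0|).
Proof.
move=> cg hm; rewrite /rect_int.
apply: le_trans (nrmB _ _) _; apply: le_trans (lerD (nrmB _ _) (lexx _)) _.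
apply: le_trans (lerD (lerD (nrmD _ _) (lexx _)) (lexx _)) _.
rewrite !nrmM nrm_iC !mul1r.
have h1 y : between y0 y1 y -> nrm (hint g y x0 x1) <= m * `|x1 - x0|.
  by move=> hy; apply: rint_bound; [exact: cont_horiz|move=> t ht; exact: hm].
have h2 x : between x0 x1 x -> nrm (vint g x y0 y1) <= m * `|y1 - y0|.
  by move=> hx; apply: rint_bound; [exact: cont_vert|move=> t ht; exact: hm].
have := h1 _ (between_l y0 y1); have := h1 _ (between_r y0 y1).
have := h2 _ (between_l x0 x1); have := h2 _ (between_r x0 x1).
lra.
Qed.

Lemma rect_int_split g x0 x1 x2 y0 y1 y2 : (forall z, ccont g z) ->
  rect_int g x0 x2 y0 y2 = rect_int g x0 x1 y0 y1 + rect_int g x1 x2 y0 y1 +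
   rect_int g x0 x1 y1 y2 + rect_int g x1 x2 y1 y2.
Proof.
move=> cg; rewrite /rect_int.
have h y : hint g y x0 x2 = hint g y x0 x1 + hint g y x1 x2.
  by apply: rint_chasles; exact: cont_horiz.
have v x : vint g x y0 y2 = vint g x y0 y1 + vint g x y1 y2.
  by apply: rint_chasles; exact: cont_vert.
by rewrite !h !v; ring.
Qed.

Lemma nested_point (u : nat -> R) (w : R) : 0 <= w ->
  (forall n, u n <= u n.+1 /\ u n.+1 + w / 2 ^+ n.+1 <= u n + w / 2 ^+ n) ->
  exists X, forall n, u n <= X <= u n + w / 2 ^+ n.
Proof.
move=> w0 H.
have wn n : 0 <= w / 2 ^+ n by rewrite divr_ge0 // exprn_ge0.
have up n k : u n <= u (n + k)%N.
  by elim: k => [|k IH]; rewrite ?addn0 // addnS; apply: le_trans IH (H _).1.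
have dn n k : u (n + k)%N + w / 2 ^+ (n + k) <= u n + w / 2 ^+ n.
  by elim: k => [|k IH]; rewrite ?addn0 // addnS; apply: le_trans (H _).2 IH.
have ub n m : u m <= u n + w / 2 ^+ n.
  apply: le_trans (up m n) _; rewrite addnC; apply: le_trans (dn n m).
  by rewrite lerDl.
pose S := [set x | exists n, x = u n].
have hS : has_sup S.
  split; first by exists (u 0%N); exists 0%N.
  by exists (u 0%N + w / 2 ^+ 0) => _ [n ->]; exact: ub.
exists (sup S) => n; apply/andP; split.
  by apply: ub_le_sup; [exact: hS.2|exists n].
by apply: ge_sup; [exact: hS.1|move=> _ [m ->]; exact: ub].
Qed.

(** Under repeated quartering some quarter keeps at least a quarter of the integral. At the common
    point of the chosen rectangles g differs from its tangent map by o(diameter), and the tangent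
    map has a primitive, so the n-th integral is o(4^-n). *)
Lemma goursat_ordered g x0 y0 w h : 0 <= w -> 0 <= h -> (forall z, ccont g z) ->
  (forall x y, x0 <= x <= x0 + w -> y0 <= y <= y0 + h -> exists d, cder g (mkc x y) d) ->
  rect_int g x0 (x0 + w) y0 (y0 + h) = 0.
Proof.
move=> w0 h0 cg dg.
pose J n (p : R * R) := rect_int g p.1 (p.1 + w / 2 ^+ n) p.2 (p.2 + h / 2 ^+ n).
pose step n (p q : R * R) :=
  [/\ p.1 <= q.1, q.1 + w / 2 ^+ n.+1 <= p.1 + w / 2 ^+ n,
      p.2 <= q.2, q.2 + h / 2 ^+ n.+1 <= p.2 + h / 2 ^+ n &
      nrm (J n p) <= 4 * nrm (J n.+1 q)].
have half n (c : R) : c / 2 ^+ n = c / 2 ^+ n.+1 + c / 2 ^+ n.+1.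
  by rewrite exprS invfM mulrA -mulrDl -splitr.
have stepP n p : exists q, step n p q.
  have wn : 0 <= w / 2 ^+ n.+1 by rewrite divr_ge0 // exprn_ge0.
  have hn : 0 <= h / 2 ^+ n.+1 by rewrite divr_ge0 // exprn_ge0.
  case: p => x y; rewrite /step /J /=.
  rewrite (half n w) (half n h) !addrA.
  set wx := w / _ in wn *; set hy := h / _ in hn *.
  rewrite (rect_int_split _ (x + wx) _ _ (y + hy) _ cg).
  set a := rect_int g x (x + wx) y (y + hy).
  set b := rect_int g (x + wx) (x + wx + wx) y _.
  set c := rect_int g x (x + wx) (y + hy) _.
  set d := rect_int g (x + wx) (x + wx + wx) (y + hy) _.
  have tri : nrm (a + b + c + d) <= nrm a + nrm b + nrm c + nrm d.
    by have := nrmD (a + b + c) d; have := nrmD (a + b) c; have := nrmD a b; lra.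
  have [ha|ha] := leP (nrm (a + b + c + d)) (4 * nrm a); first by exists (x, y); split=> //=; lra.
  have [hb|hb] := leP (nrm (a + b + c + d)) (4 * nrm b); first by exists (x + wx, y); split=> //=; lra.
  have [hc|hc] := leP (nrm (a + b + c + d)) (4 * nrm c); first by exists (x, y + hy); split=> //=; lra.
  exists (x + wx, y + hy); split=> //=; lra.
(* The state carries the depth because the admissible steps depend on it. *)
pose fs (s : nat * (R * R)) := (s.1.+1, get [set q | step s.1 s.2 q]).
pose P n := (iter n fs (0%N, (x0, y0))).2.
have P1 n : (iter n fs (0%N, (x0, y0))).1 = n by elim: n => //= n ->.
have PS n : step n (P n) (P n.+1).
  rewrite {2}/P iterS /fs P1 /=; have [q hq] := stepP n (P n).
  exact: (@getI _ [set q | step n (P n) q] q).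
have [X hX] := @nested_point (fun n => (P n).1) w w0 (fun n => let: And5 a b _ _ _ := PS n in conj a b).
have [Y hY] := @nested_point (fun n => (P n).2) h h0 (fun n => let: And5 _ _ a b _ := PS n in conj a b).
have big n : nrm (J 0%N (x0, y0)) <= 4 ^+ n * nrm (J n (P n)).
  elim: n => [|n IH]; first by rewrite mul1r.
  apply: le_trans IH _; rewrite exprSr -mulrA ler_wpM2l ?exprn_ge0 //.
  by case: (PS n).
have [d hd] : exists d, cder g (mkc X Y) d.
  by apply: dg; [have := hX 0%N|have := hY 0%N]; rewrite expr0 divr1.
have EJ : J 0%N (x0, y0) = rect_int g x0 (x0 + w) y0 (y0 + h) by rewrite /J /= expr0 !divr1.
rewrite -EJ; apply/eqP; rewrite -nrm_eq0 eq_le nrm_ge0 andbT.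
apply/ler_addgt0Pr => e e0; rewrite add0r.
(* Twice the half-perimeter times the bound w + h for the diameter, enlarged to be positive even for
   a degenerate rectangle. *)
pose K := 2 * (w + h + 1) * (w + h + 1).
have K0 : 0 < K by rewrite !mulr_gt0 //; lra.
case: hd => phi [phi0 cphi] hphi.
have [r r0 hr] := cphi (e / K) ltac:(by rewrite divr_gt0).
have [n hn] : exists n, (w + h) / 2 ^+ n < r.
  exists (Num.bound ((w + h) / r)); rewrite ltr_pdivrMr ?exprn_gt0 // mulrC -ltr_pdivrMr //.
  apply: lt_trans (archi_boundP _) _; first by rewrite divr_ge0 ?addr_ge0 // ltW.
  by rewrite -natrX ltr_nat ltn_expl.
apply: le_trans (big n) _.
(* Subtracting the tangent map q changes no rectangle integral, since Q is a primitive of it. *)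
pose z0 : C := mkc X Y; pose q z := g z0 + d * (z - z0).
pose Q (z : C) := g z0 * z + (d / 2) * (z - z0) ^+ 2.
have hQ z : cder Q z (q z).
  have s1 := cder_sub (cder_id z) (cder_cst z0 z).
  have := cder_add (cder_mul (cder_cst (g z0) z) (cder_id z))
            (cder_mul (cder_cst (d / 2) z) (cder_exp 1 s1)).
  by congr cder; rewrite /q; field.
have cq z : ccont q z.
  apply: cont_add; first exact: cont_cst.
  apply: cont_mul; first exact: cont_cst.
  by apply: cont_sub; [exact: ccont_id|exact: cont_cst].
have -> : J n (P n) = rect_int (fun z => g z + -1 * q z) (P n).1 ((P n).1 + w / 2 ^+ n) (P n).2 ((P n).2 + h / 2 ^+ n).
  by rewrite rect_int_sub // (rect_int_prim _ _ _ _ hQ) subr0.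
have wn : 0 <= w / 2 ^+ n by rewrite divr_ge0 // exprn_ge0.
have hn0 : 0 <= h / 2 ^+ n by rewrite divr_ge0 // exprn_ge0.
have B := @rect_int_bound (fun z => g z + -1 * q z) (P n).1 ((P n).1 + w / 2 ^+ n) (P n).2 ((P n).2 + h / 2 ^+ n)
  (e / K * ((w + h) / 2 ^+ n)).
apply: le_trans (ler_wpM2l (exprn_ge0 _ _) (B _ _)) _ => //.
- move=> z; apply: cont_add => //; apply: cont_mul => //; exact: cont_cst.
- move=> x y; rewrite /between !min_l ?max_r ?lerDl // => hx hy.
  have HX := hX n; have HY := hY n.
  have dist : nrm (mkc x y - z0) <= (w + h) / 2 ^+ n.
    apply: le_trans (nrm_le_reim _) _; rewrite !cpxE mulrDl.
    by apply: lerD; rewrite ler_norml; lra.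
  have -> : g (mkc x y) + -1 * q (mkc x y) = (phi (mkc x y) - phi z0) * (mkc x y - z0).
    by rewrite (hphi (mkc x y)) /q -phi0 /z0; ring.
  rewrite nrmM; apply: ler_pM; rewrite ?nrm_ge0 //.
  by apply: ltW; apply: hr; apply: le_lt_trans hn.
rewrite ![_ + _ - _]addrAC !subrr !add0r !ger0_norm //.
have E2 : (2 : R) ^+ n * 2 ^+ n = 4 ^+ n by rewrite -exprMn -natrM.
have t0 : (2 : R) ^+ n != 0 by rewrite expf_neq0 // pnatr_eq0.
rewrite -E2; move: t0; set t := 2 ^+ n => t0.
have -> : t * t * (2 * (e / K * ((w + h) / t)) * (w / t + h / t)) =
   e / K * (2 * (w + h) * (w + h)).
  by field; rewrite t0 gt_eqF.
rewrite mulrAC ler_pdivrMr // ler_pM2l // /K; nra.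
Qed.

Lemma rect_int_swapx g x0 x1 y0 y1 : (forall z, ccont g z) ->
  rect_int g x1 x0 y0 y1 = - rect_int g x0 x1 y0 y1.
Proof.
move=> cg; have h y : hint g y x1 x0 = - hint g y x0 x1 by apply: rint_swap; exact: cont_horiz.
by rewrite /rect_int !h; ring.
Qed.
Lemma rect_int_swapy g x0 x1 y0 y1 : (forall z, ccont g z) ->
  rect_int g x0 x1 y1 y0 = - rect_int g x0 x1 y0 y1.
Proof.
move=> cg; have h y : vint g y y1 y0 = - vint g y y0 y1 by apply: rint_swap; exact: cont_vert.
by rewrite /rect_int !h; ring.
Qed.

Lemma goursat g x0 x1 y0 y1 : (forall z, ccont g z) ->
  (forall x y, between x0 x1 x -> between y0 y1 y -> exists d, cder g (mkc x y) d) ->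
  rect_int g x0 x1 y0 y1 = 0.
Proof.
move=> cg dg.
wlog xx : x0 x1 dg / x0 <= x1.
  move=> H; have [/H|/ltW x10] := leP x0 x1; first exact.
  apply: oppr_inj; rewrite oppr0 -rect_int_swapx //; apply: H => // x y hx; apply: dg.
  by move: hx; rewrite /between minC maxC.
wlog yy : y0 y1 dg / y0 <= y1.
  move=> H; have [/H|/ltW y10] := leP y0 y1; first exact.
  apply: oppr_inj; rewrite oppr0 -rect_int_swapy //; apply: H => // x y hx hy; apply: dg => //.
  by move: hy; rewrite /between minC maxC.
have := @goursat_ordered g x0 y0 (x1 - x0) (y1 - y0).
rewrite !subrKC !subr_ge0; apply=> // x y hx hy; apply: dg.
  by rewrite /between min_l ?max_r.
by rewrite /between min_l ?max_r.
Qed.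

(** Integrate from p first horizontally, then vertically; U contains the rectangle spanned by p and
    any of its points. Continuity on the whole plane makes every edge integral meaningful, so local
    functions enter through an extension. *)
Lemma primitive (U : set C) (g : C -> C) (p : C) : (forall z, ccont g z) ->
  (forall z, U z -> exists2 r, 0 < r & forall w, nrm (w - z) < r -> U w) ->
  (forall z x y, U z -> between (re p) (re z) x -> between (im p) (im z) y -> U (mkc x y)) ->
  (forall z, U z -> exists d, cder g z d) ->
  exists F, forall z, U z -> cder F z (g z).
Proof.
move=> cg oU rU dg.
exists (fun z => hint g (im p) (re p) (re z) + i * vint g (re z) (im p) (im z)) => z Uz.
apply/cderP => e e0.
have [r1 r10 hU] := oU z Uz; have [r2 r20 hg] := cg z (e / 4) ltac:(lra).
exists (Num.min r1 (r2 / 2)); first by rewrite lt_min r10; lra.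
move=> h h0; rewrite lt_min => /andP[hr1 hr2].
have Uzh : U (z + toC (re h)).
  apply: hU; rewrite addrAC subrr add0r nrm_toC.
  by apply: le_lt_trans hr1; exact: re_le_nrm.
(* This thin rectangle lets the horizontal increment move from height im p to height im z, where it
   is close to z. *)
have G0 : rect_int g (re z) (re z + re h) (im p) (im z) = 0.
  apply: goursat => // x y hx hy; apply: dg.
  have [h1|h1] := between_split (re p) hx; first exact: (rU z).
  apply: (rU _ _ _ Uzh); first by rewrite !cpxE.
  by rewrite !cpxE addr0.
rewrite !(reD h) !(imD h) (addrC (re h)) (addrC (im h)).
have c1 : hint g (im p) (re p) (re z + re h) = hint g (im p) (re p) (re z) + hint g (im p) (re z) (re z + re h).
  by apply: rint_chasles; exact: cont_horiz.
have c2 : vint g (re z + re h) (im p) (im z + im h) = vint g (re z + re h) (im p) (im z) + vint g (re z + re h) (im z) (im z + im h).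
  by apply: rint_chasles; exact: cont_vert.
have csth a b : rint (fun=> 1 : C) a b = toC (b - a).
  by rewrite (@rintE _ (@toC R)) ?toCB // => t _; exact: rder_toC.
set N := (X in X / h).
have EN : N = rint (fun s => g (mkc s (im z)) + - g z * 1) (re z) (re z + re h) +
     i * rint (fun s => g (mkc (re z + re h) s) + - g z * 1) (im z) (im z + im h) + g z * h.
  rewrite !rint_lin ?csth; try by [exact: cont_horiz|exact: cont_vert|move=> t; exact: cont_cst].
  rewrite -/(hint _ _ _ _) -/(vint _ _ _ _).
  have -> : g z * h = g z * (toC (re h) + i * toC (im h)) by rewrite -cpx_decomp.
  have ex (a b : R) : a + b - a = b by ring.
  rewrite !ex.
  rewrite /N c1 c2; apply/eqP; rewrite -subr_eq0 -[X in _ == X]G0 /rect_int; apply/eqP; ring.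
have -> : N / h - g z = (N - g z * h) / h by field.
rewrite nrmM nrmV ltr_pdivrMr ?nrm_gt0 // EN addrK.
have near x y : `|x - re z| <= `|re h| -> `|y - im z| <= `|im h| ->
  nrm (g (mkc x y) + - g z * 1) <= e / 4.
  move=> hx hy; rewrite mulr1; apply: ltW; apply: hg.
  apply: le_lt_trans (nrm_le_reim _) _; rewrite !cpxE.
  have := re_le_nrm h; have := im_le_nrm h; lra.
have ca (f : R -> C) : (forall t, rcont f t) -> forall t, rcont (fun s => f s + - g z * 1) t.
  by move=> cf t; apply: cont_add => //; exact: cont_cst.
apply: le_lt_trans (nrmD _ _) _; rewrite nrmM nrm_iC mul1r.
have B1 : nrm (rint (fun s => g (mkc s (im z)) + - g z * 1) (re z) (re z + re h)) <= e / 4 * `|re h|.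
  have -> : `|re h| = `|re z + re h - re z| by rewrite addrAC subrr add0r.
  apply: rint_bound; first by apply: ca; exact: cont_horiz.
  move=> t /between_dist; rewrite [_ + _ - _]addrAC subrr add0r => ht.
  by apply: near => //; rewrite subrr normr0.
have B2 : nrm (rint (fun s => g (mkc (re z + re h) s) + - g z * 1) (im z) (im z + im h)) <= e / 4 * `|im h|.
  have -> : `|im h| = `|im z + im h - im z| by rewrite addrAC subrr add0r.
  apply: rint_bound; first by apply: ca; exact: cont_vert.
  move=> t /between_dist; rewrite [_ + _ - _]addrAC subrr add0r => ht.
  by apply: near => //; rewrite addrAC subrr add0r.
have := re_le_nrm h; have := im_le_nrm h.
have : 0 < nrm h by rewrite nrm_gt0.
nra.
Qed.

End Goursat.

Section MaximumPrinciple.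
Variable R : realType.
Local Notation C := (Cplx R).
Local Notation rcont := (cont_at (@Num.norm R R)).
Local Notation i := (iC R).

Definition disc (p : C) (r : R) (z : C) : Prop := nrm (z - p) < r.
Definition hol (U : C -> Prop) (f : C -> C) := forall z, U z -> exists d, cder f z d.

Lemma disc_center p r : 0 < r -> disc p r p.
Proof. by rewrite /disc subrr nrm0. Qed.
Lemma disc_le p r s z : r <= s -> disc p r z -> disc p s z.
Proof. by rewrite /disc => rs zr; apply: lt_le_trans rs. Qed.
Lemma disc_sub p q r s z : nrm (q - p) + s <= r -> disc q s z -> disc p r z.
Proof. by rewrite /disc; have := nrm_distD q z p; lra. Qed.
Lemma disc_open p r z : disc p r z -> exists2 s, 0 < s & forall w, disc z s w -> disc p r w.
Proof.
rewrite {1}/disc => zr; exists (r - nrm (z - p)); first lra.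
by move=> w; apply: disc_sub; lra.
Qed.
Lemma hol_sub (U V : C -> Prop) f : (forall z, V z -> U z) -> hol U f -> hol V f.
Proof. by move=> VU hf z /VU /hf. Qed.
Lemma hol_cont U f z : hol U f -> U z -> ccont f z.
Proof. by move=> hf /hf[d]; exact: cder_cont. Qed.

(** Radial retraction onto the closed disc: composing with it turns a function holomorphic on a
    larger disc into one continuous on the whole plane and unchanged on the open disc. *)
Definition ret (p : C) (r : R) (z : C) : C :=
  p + (z - p) * (toC (Num.max 1 (nrm (z - p) / r)))^-1.

Lemma ret_id p r z : 0 < r -> disc p r z -> ret p r z = z.
Proof.
move=> r0; rewrite /disc => zr; rewrite /ret max_l ?ler_pdivrMr ?mul1r 1?ltW //.
by rewrite toC1 invr1 mulr1 subrKC.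
Qed.
Lemma ret_le p r z : 0 < r -> nrm (ret p r z - p) <= r.
Proof.
move=> r0; rewrite /ret addrAC subrr add0r nrmM nrmV nrm_toC.
set n := nrm _; set M := Num.max _ _.
have M1 : 1 <= M by rewrite le_max lexx.
have nM : n <= r * M by rewrite mulrC -ler_pdivrMr // le_max lexx orbT.
by rewrite ger0_norm ?ler_pdivrMr; lra.
Qed.
Lemma ret_cont p r z : 0 < r -> ccont (ret p r) z.
Proof.
move=> r0; apply: cont_add; first exact: cont_cst.
have cz : ccont (fun w => w - p) z by apply: cont_sub; [exact: ccont_id|exact: cont_cst].
apply: cont_mul => //; apply: cont_inv.
  by rewrite toC_eq0 gt_eqF // lt_max ltr01.
move=> e e0; have [d d0 h] := cz (e * r) ltac:(by rewrite mulr_gt0).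
exists d => // y /h; rewrite -toCB nrm_toC => hy.
have : `|nrm (y - p) - nrm (z - p)| < e * r.
  have h1 := nrm_lerB (y - p) (z - p); have h2 := nrm_lerB (z - p) (y - p).
  have h3 := nrmC (z - p) (y - p); rewrite ltr_norml; lra.
move=> h1; have : `|nrm (y - p) / r - nrm (z - p) / r| < e.
  by rewrite -mulrBl normrM normfV (gtr0_norm r0) ltr_pdivrMr.
set a := nrm (y - p) / r; set b := nrm _ / r; rewrite !ltr_norml !maxEle => /andP[u v].
by case: (leP 1 a) => ha; case: (leP 1 b) => hb; apply/andP; split; lra.
Qed.

Lemma cont_ret f p r s : 0 < r -> r < s -> hol (disc p s) f -> forall z, ccont (fun w => f (ret p r w)) z.
Proof.
move=> r0 rs hf z; apply: cont_comp; last exact: ret_cont.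
by apply: (hol_cont hf); apply: le_lt_trans rs; exact: ret_le.
Qed.

Lemma hol_ret f p r s : 0 < r -> r < s -> hol (disc p s) f -> hol (disc p r) (fun w => f (ret p r w)).
Proof.
move=> r0 rs hf z zr; have [d hd] := hf z (disc_le (ltW rs) zr); exists d.
have [t t0 ht] := disc_open zr; apply: (@cder_local _ f _ z d t t0 _ hd) => w wz; have wr := ht w wz.
by rewrite ret_id.
Qed.

Lemma primitive_disc f p r s : 0 < r -> r < s -> hol (disc p s) f ->
  exists F, forall z, disc p r z -> cder F z (f z).
Proof.
move=> r0 rs hf.
have [F hF] : exists F, forall z, disc p r z -> cder F z (f (ret p r z)).
  apply: (@primitive _ (disc p r) (fun w => f (ret p r w)) p).
  - exact: cont_ret hf.
  - by move=> z /disc_open.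
  - move=> z x y zr hx hy; apply: le_lt_trans zr.
    have sq (a b : R) : `|a| <= `|b| -> a ^+ 2 <= b ^+ 2.
      by move=> h; rewrite -(real_normK (num_real a)) -(real_normK (num_real b)) lerXn2r ?nnegrE.
    by rewrite /nrm !cpxE ler_wsqrtr // lerD // sq // between_dist.
  - exact: hol_ret hf.
by exists F => z zr; have := hF z zr; rewrite ret_id.
Qed.

Lemma primitive_plane f : hol (fun=> True) f -> exists F, forall z, cder F z (f z).
Proof.
move=> hf; have [F hF] := @primitive _ (fun=> True) f 0 (fun z => hol_cont hf I)
  (fun z _ => ex_intro2 _ _ 1 ltr01 (fun _ _ => I)) (fun _ _ _ _ _ _ => I) hf.
by exists F => z; exact: hF.
Qed.

(** The mean value property in logarithmic coordinates: u goes to p + exp u, a half-plane covers the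
    punctured disc, and circles become vertical segments of length 2 pi. *)
Lemma max_center f p r s m : 0 < r -> r < s -> hol (disc p s) f ->
  (forall z, nrm (z - p) = r -> nrm (f z) <= m) -> nrm (f p) <= m.
Proof.
move=> r0 rs hf hm.
pose r1 := (r + s) / 2; have rr1 : r < r1 by rewrite /r1; lra.
have r1s : r1 < s by rewrite /r1; lra.
have r10 : 0 < r1 by lra.
pose ft w := f (ret p r1 w); have cft := cont_ret r10 r1s hf.
have hft := hol_ret r10 r1s hf.
pose e1 (u : C) := p + cexp u.
have De1 u : cder e1 u (cexp u).
  by rewrite -[X in cder _ _ X]add0r; apply: cder_add; [exact: cder_cst|exact: cder_cexp].
have nE u : nrm (e1 u - p) = expR (re u) by rewrite /e1 addrAC subrr add0r nrm_cexp.
pose L := ln r1; have eL : expR L = r1 by rewrite lnK ?posrE.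
have [G hG] : exists G, forall u : C, re u < L -> cder G u (ft (e1 u)).
  apply: (@primitive _ (fun u => re u < L) (fun u => ft (e1 u)) (toC (L - 1))).
  - by move=> z; apply: cont_comp; [exact: cft|exact: cder_cont (De1 z)].
  - move=> z zL; exists (L - re z); first lra.
    move=> w hw; have := le_lt_trans (re_le_nrm (w - z)) hw.
    by rewrite !cpxE ltr_norml; lra.
  - move=> z x y zL; rewrite /between re_toC re_mkc le_max => /andP[_ /orP[]]; lra.
  - move=> z zL; have [d hd] := hft (e1 z) ltac:(by rewrite /disc nE -eL ltr_expR).
    by exists (d * cexp z); exact: cder_comp.
have ft_in u : re u < L -> ft (e1 u) = f (e1 u).
  by move=> uL; rewrite /ft ret_id // /disc nE -eL ltr_expR.
pose T := pi *+ 2 : R; have T0 : 0 < T by rewrite mulrn_wgt0 // pi_gt0.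
have per u : ft (e1 (u + twopi_i R)) = ft (e1 u) by rewrite /e1 cexpD cexp_2pi mulr1.
(* By periodicity of the integrand k has derivative 0 in x. It is the integral over a circle of
   radius exp x: at x = ln r it is at most 2 pi m, and as x tends to - oo it tends to 2 pi i
   f(p). *)
pose k x := G (toC x + twopi_i R) - G (toC x).
have kc x y : x <= y -> y < L -> k x = k y.
  move=> xy yL; apply/eqP; rewrite eq_sym -subr_eq0 -nrm_eq0 eq_le nrm_ge0 andbT.
  have := @mean_value_ineq _ k (fun=> 0) x y 0 xy; rewrite mul0r; apply=> t /andP[_ ty]; last by rewrite nrm0.
  have D1 : rder (fun s => toC s + twopi_i R) t 1.
    by rewrite -[X in rder _ _ X]addr0; apply: rder_add; [exact: rder_toC|exact: rder_cst].
  have h1 : re (toC t + twopi_i R) < L by rewrite !cpxE addr0; lra.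
  have h2 : re (toC t) < L by rewrite re_toC; lra.
  have := rder_add (@rder_comp _ G (fun s => toC s + twopi_i R) t _ _ (hG _ h1) D1)
     (rder_cmul (- 1) (@rder_comp _ G (@toC R) t _ _ (hG _ h2) (rder_toC t))).
  rewrite per; have -> : ft (e1 (toC t)) * 1 + -1 * (ft (e1 (toC t)) * 1) = 0 by ring.
  by apply: rder_ext => v; rewrite /k; ring.
have DG x t : x < L -> rder (fun s => G (mkc x s)) t (f (e1 (mkc x t)) * i).
  move=> xL; have := @rder_comp _ G (fun s => mkc x s) t _ _ (hG (mkc x t) xL) (rder_vert x t).
  by rewrite ft_in.
have kE x : k x = G (mkc x T) - G (mkc x 0).
  rewrite /k; congr (G _ - G _); apply: ceqP; rewrite /T !cpxE; ring.
have nE' x t : nrm (e1 (mkc x t) - p) = expR x by rewrite nE.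
have kB : nrm (k (ln r)) <= m * T.
  rewrite kE; have := @mean_value_ineq _ (fun s => G (mkc (ln r) s)) _ 0 T m (ltW T0)
    (fun t _ => DG (ln r) t _); rewrite subr0; apply; first by rewrite /L ltr_ln ?posrE.
  by move=> t _; rewrite nrmM nrm_iC mulr1; apply: hm; rewrite nE' lnK ?posrE.
apply/ler_addgt0Pr => e e0; rewrite -(ler_pM2r T0).
have [d d0 hd] := hol_cont hf (disc_center p (lt_trans r0 rs)) e0.
(* So far left that the circle of radius exp x lies where f is within e of f(p). *)
pose x := Num.min (ln r) (ln (Num.min d r / 2)).
have mr : 0 < Num.min d r / 2 by rewrite divr_gt0 // lt_min d0.
have xr : x <= ln r by rewrite ge_min lexx.
have lrL : ln r < L by rewrite /L ltr_ln ?posrE.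
have xd : expR x < d.
  apply: (@le_lt_trans _ _ (Num.min d r / 2)).
    by rewrite -[leRHS]lnK ?posrE // ler_expR ge_min lexx orbT.
  by have : Num.min d r <= d by [rewrite ge_min lexx]; lra.
rewrite -(kc x (ln r) xr lrL) kE in kB.
have := @mean_value_ineq _ (fun s => G (mkc x s) + - (f p * i) * toC s)
  (fun t => f (e1 (mkc x t)) * i + - (f p * i) * 1) 0 T e (ltW T0).
rewrite subr0 => B.
have {B} := B (fun t _ => rder_add (DG x t (le_lt_trans xr lrL)) (rder_cmul _ (rder_toC t))).
have hb t : 0 <= t <= T -> nrm (f (e1 (mkc x t)) * i + - (f p * i) * 1) <= e.
  move=> _; have -> : f (e1 (mkc x t)) * i + - (f p * i) * 1 = (f (e1 (mkc x t)) - f p) * i by ring.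
  by rewrite nrmM nrm_iC mulr1; apply: ltW; apply: hd; rewrite nE'.
move=> /(_ hb) B.
have E : f p * i * toC T = G (mkc x T) - G (mkc x 0) -
    (G (mkc x T) + - (f p * i) * toC T - (G (mkc x 0) + - (f p * i) * toC 0)).
  by rewrite toC0; ring.
have <- : nrm (f p * i * toC T) = nrm (f p) * T.
  by rewrite !nrmM nrm_iC mulr1 nrm_toC gtr0_norm.
rewrite E; apply: le_trans (nrmB _ _) _; lra.
Qed.

(** A Moebius automorphism moves the given point to the centre, and [max_center] is applied on a
    circle so close to the boundary that its image stays in the annulus. The bound is assumed on an
    annulus since f has no values on the boundary circle. *)
Lemma max_disc f p r r' m : r' < r -> hol (disc p r) f ->
  (forall z, r' < nrm (z - p) < r -> nrm (f z) <= m) ->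
  forall z, disc p r z -> nrm (f z) <= m.
Proof.
move=> r'r hf hm w wr; have r0 : 0 < r := le_lt_trans (nrm_ge0 _) wr.
pose a := (w - p) / toC r.
have a1 : nrm a < 1 by rewrite nrmM nrmV nrm_toC gtr0_norm // ltr_pdivrMr // mul1r.
have a0 := nrm_ge0 a.
pose T z := (z + a) / (1 + cj a * z).
have den z : nrm z < 1 -> 1 - nrm a <= nrm (1 + cj a * z).
  move=> z1; have := nrm_lerB 1 (- (cj a * z)); rewrite opprK nrmN nrmM nrm_cj nrm1.
  by have := nrm_ge0 z; nra.
have den0 z : nrm z < 1 -> 1 + cj a * z != 0.
  by move=> /den h; rewrite -nrm_gt0; lra.
have TE z : nrm z < 1 -> (1 - nrm (T z) ^+ 2) * nrm (1 + cj a * z) ^+ 2 = (1 - nrm z ^+ 2) * (1 - nrm a ^+ 2).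
  move=> z1; rewrite mulrBl mul1r -exprMn -nrmM /T divfK ?den0 // !nrm_sqr !cpxE; ring.
(* From the identity [TE] and the lower bound 1 - |a| for the denominator of T: K compares the
   distances of T z and of z to the unit circle. *)
pose K := (1 - nrm a ^+ 2) / (1 - nrm a) ^+ 2.
have K0 : 0 < K by rewrite divr_gt0 ?exprn_gt0 //; nra.
have Tlt z : nrm z < 1 -> nrm (T z) < 1 /\ 1 - nrm (T z) ^+ 2 <= K * (1 - nrm z ^+ 2).
  move=> z1; have := TE z z1; have D := den z z1; have z0 := nrm_ge0 z.
  have T0 := nrm_ge0 (T z).
  have D0 : 0 < (1 - nrm a) ^+ 2 by rewrite exprn_gt0 //; lra.
  have D2 : (1 - nrm a) ^+ 2 <= nrm (1 + cj a * z) ^+ 2 by rewrite lerXn2r ?nnegrE //; lra.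
  have P : 0 < (1 - nrm z ^+ 2) * (1 - nrm a ^+ 2) by rewrite mulr_gt0 // subr_gt0 expr_lt1.
  move: D0 D2; rewrite /K; set X := (1 - nrm a) ^+ 2; set Y := _ ^+ 2 => X0 XY EE.
  have Y0 : 0 < Y by lra.
  have S0 : 0 < 1 - nrm (T z) ^+ 2 by rewrite -(pmulr_lgt0 _ Y0) EE.
  split; first by nra.
  by rewrite mulrAC ler_pdivlMr // [leRHS]mulrC -EE ler_pM2l.
have hT z : nrm z < 1 -> exists d, cder T z d.
  move=> z1; eexists; apply: (@cder_div _ (fun z => z + a) (fun z => 1 + cj a * z)).
  - exact: den0.
  - by apply: cder_add; [exact: cder_id|exact: cder_cst].
  - apply: cder_add; first exact: cder_cst.
    by apply: cder_mul; [exact: cder_cst|exact: cder_id].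
pose S z := p + toC r * T z.
have Sn z : nrm (S z - p) = r * nrm (T z).
  by rewrite /S addrAC subrr add0r nrmM nrm_toC gtr0_norm.
have S0 : S 0 = w.
  rewrite /S /T mulr0 addr0 add0r divr1 /a mulrC divfK ?subrKC //.
  by rewrite toC_eq0 gt_eqF.
have hS : hol (disc 0 1) (fun z => f (S z)).
  move=> z; rewrite /disc subr0 => z1.
  have [d1 h1] := hT z z1; have [d2 h2] := hf (S z) ltac:(by rewrite /disc Sn -ltr_pdivlMl // mulVf ?gt_eqF //; exact: (Tlt _ _).1).
  eexists; apply: cder_comp h2 _; apply: cder_add; first exact: cder_cst.
  by apply: cder_mul; [exact: cder_cst|exact: h1].
(* Truncated at 0 because r' may be negative. *)
pose q := Num.max 0 (r' / r).
have q0 : 0 <= q by rewrite le_max lexx.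
have q1 : q < 1 by rewrite gt_max ltr01 ltr_pdivrMr // mul1r.
(* On the circle of radius rho = 1 - t2 / 2 one has 1 - |z|^2 <= t2, and K t2 <= (1 - q^2) / 2 then
   forces |T z| > q. *)
pose t2 := Num.min (1 / 2) ((1 - q ^+ 2) / (2 * K)).
have q2 : 0 < 1 - q ^+ 2 by rewrite subr_gt0 expr_lt1.
have t20 : 0 < t2 by rewrite lt_min !divr_gt0 // mulr_gt0.
pose rho := 1 - t2 / 2.
have t21 : t2 <= 1 / 2 by rewrite ge_min lexx.
have t2K : t2 * K <= (1 - q ^+ 2) / 2.
  rewrite -ler_pdivlMr //; have -> : (1 - q ^+ 2) / 2 / K = (1 - q ^+ 2) / (2 * K) by field; rewrite gt_eqF.
  by rewrite ge_min lexx orbT.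
rewrite -S0; apply: (@max_center (fun z => f (S z)) 0 rho 1) => //; rewrite /rho; try lra.
move=> z; rewrite subr0 => zrho; have z1 : nrm z < 1 by lra.
have [T1 T2] := Tlt z z1.
apply: hm; rewrite Sn; apply/andP; split; last by nra.
have h1 : 1 - nrm z ^+ 2 <= t2 by rewrite zrho; nra.
have h2 : q < nrm (T z).
  have T0 := nrm_ge0 (T z); have : 1 - nrm (T z) ^+ 2 < 1 - q ^+ 2 by nra.
  by nra.
have h3 : r' / r <= q by rewrite le_max lexx orbT.
by rewrite mulrC -ltr_pdivrMr //; lra.
Qed.

Lemma bernoulli_ineq (d : R) n : 0 <= d -> 1 + n%:R * d <= (1 + d) ^+ n.
Proof.
move=> d0; elim: n => [|n IH]; first by rewrite mul0r addr0.
rewrite exprS -natr1; have n0 : 0 <= n%:R :> R by [].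
have : 1 <= (1 + d) ^+ n by apply: exprn_ege1; lra.
nra.
Qed.

Lemma pow_le_root (x m K : R) : 0 <= x -> 0 <= m -> 0 < K ->
  (forall n, x ^+ n <= K * m ^+ n) -> x <= m.
Proof.
move=> x0 m0 K0 H; rewrite leNgt; apply/negP => mx.
have [m00|mn0] := eqVneq m 0; first by have := H 1%N; rewrite !expr1 m00 mulr0; lra.
have mp : 0 < m by rewrite lt_def mn0.
pose d := x / m - 1.
have d0 : 0 < d by rewrite subr_gt0 ltr_pdivlMr // mul1r.
have := H (Num.bound (K / d)); rewrite -ler_pdivrMr ?exprn_gt0 // -expr_div_n.
have -> : x / m = 1 + d by rewrite /d subrKC.
apply/negP; rewrite -ltNge; apply: lt_le_trans (bernoulli_ineq _ (ltW d0)).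
have := archi_boundP (divr_ge0 (ltW K0) (ltW d0)); rewrite ltr_pdivrMr //; lra.
Qed.

(* Multiplying the N-th power of Q by z - e removes the singularity at e without
   changing the N-th root asymptotics of the bound. *)
Lemma max_exceptional (E : seq C) Q p r r' m : r' < r -> 0 <= m ->
  (forall z, disc p r z -> ccont Q z) ->
  (forall z, disc p r z -> z \notin E -> exists d, cder Q z d) ->
  (forall z, r' < nrm (z - p) < r -> nrm (Q z) <= m) ->
  forall z, disc p r z -> nrm (Q z) <= m.
Proof.
move=> r'r; elim: E Q m => [|e E IH] Q m m0 cQ hQ hm.
  by apply: max_disc r'r _ hm => z zr; exact: hQ.
have main z : disc p r z -> z != e -> nrm (Q z) <= m.
  (* The auxiliary function is (w - e) Q(w)^n; K bounds |w - e| / |z - e| on the disc independently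
     of n, and [pow_le_root] removes it as n grows. *)
  move=> zr ze; pose K := (r + nrm (p - e) + 1) / nrm (z - e).
  have ne : 0 < nrm (z - e) by rewrite nrm_gt0 subr_eq0.
  have r0 : 0 < r := le_lt_trans (nrm_ge0 _) zr.
  have K0 : 0 < K by rewrite divr_gt0 //; have := nrm_ge0 (p - e); lra.
  apply: (@pow_le_root _ _ K (nrm_ge0 _) m0 K0) => n.
  rewrite /K mulrAC ler_pdivlMr // mulrC -nrmX -nrmM.
  have cs w : ccont (fun w => w - e) w by apply: cont_sub; [exact: ccont_id|exact: cont_cst].
  apply: (IH (fun w => (w - e) * Q w ^+ n)) => //.
  - by apply: mulr_ge0; [have := nrm_ge0 (p - e); lra|exact: exprn_ge0].
  - by move=> w wr; apply: cont_mul => //; apply: cont_exp; exact: cQ.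
  - move=> w wr wE; have [E0|we] := eqVneq w e.
      rewrite E0; exists (Q e ^+ n); exists (fun w => Q w ^+ n).
        by split=> //; apply: cont_exp; apply: cQ; move: wr; rewrite E0.

      by move=> v; rewrite subrr mul0r add0r mulrC.
    have [d hd] := hQ w wr ltac:(by rewrite inE negb_or we).
    have [d' hd'] : exists d', cder (fun v => Q v ^+ n) w d'.
      case: (n) => [|k]; [by exists 0; exact: (cder_cst 1)|eexists; exact: cder_exp hd].
    by eexists; apply: (cder_mul (cder_sub (cder_id w) (cder_cst e w)) hd').
  - move=> w /[dup] /andP[_ wr] /hm h; rewrite nrmM nrmX.
    apply: ler_pM; rewrite ?nrm_ge0 ?exprn_ge0 ?nrm_ge0 //.
      by have := nrm_distD p w e; lra.
    by rewrite lerXn2r ?nnegrE ?nrm_ge0.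
move=> z zr; have [ze|] := eqVneq z e; last exact: main.
apply/ler_addgt0Pr => eps eps0.
have [d d0 hd] := cQ z zr eps eps0; have [s s0 hs] := disc_open zr.
pose t := Num.min d s / 2.
have t0 : 0 < t by rewrite divr_gt0 // lt_min d0.
have td : t < d /\ t < s.
  have : Num.min d s <= d by rewrite ge_min lexx.
  by have : Num.min d s <= s by [rewrite ge_min lexx orbT]; rewrite /t; lra.
have wz : nrm (z + toC t - z) = t by rewrite addrAC subrr add0r nrm_toC gtr0_norm.
have := main (z + toC t) (hs _ _); rewrite /disc wz => /(_ td.2).
rewrite -ze -subr_eq0 addrAC subrr add0r toC_eq0 gt_eqF // => /(_ isT) B.
have := hd (z + toC t); rewrite wz => /(_ td.1) B2.
by have := nrm_lerB (Q z) (Q (z + toC t)); rewrite nrmC; lra.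
Qed.

End MaximumPrinciple.

(** * Limits of sequences and diagonal subsequences *)

Section Sequences.
Variable R : realType.
Local Notation C := (Cplx R).

Definition tends (u : nat -> C) (l : C) := forall e, 0 < e ->
  exists N, forall n, (N <= n)%N -> nrm (u n - l) < e.
Definition rtends (u : nat -> R) (l : R) := forall e, 0 < e ->
  exists N, forall n, (N <= n)%N -> `|u n - l| < e.

Definition sinc (phi : nat -> nat) := forall n, (phi n < phi n.+1)%N.
Lemma sinc_ge phi n : sinc phi -> (n <= phi n)%N.
Proof. by move=> h; elim: n => // n IH; apply: leq_ltn_trans IH (h n). Qed.
Lemma sinc_lt phi m n : sinc phi -> (m < n)%N -> (phi m < phi n)%N.
Proof.
move=> h; elim: n => // n IH; rewrite ltnS leq_eqVlt => /orP[/eqP->|/IH] //.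
by move=> a; apply: ltn_trans a (h n).
Qed.
Lemma sinc_comp phi psi : sinc phi -> sinc psi -> sinc (phi \o psi).
Proof. by move=> h1 h2 n /=; apply: sinc_lt. Qed.
Lemma sinc_shift N : sinc (fun n => n + N)%N. Proof. by move=> n; rewrite addSn. Qed.
Lemma sincP phi : sinc phi -> increasing_seq phi.
Proof. by move=> h; apply/increasing_seqP => n; rewrite ltEnat; exact: h. Qed.

(** A diagonal sequence refines each of its stages only from some index on; this weak form of
    refinement is all that limits need in order to be inherited. *)
Definition esub (chi phi : nat -> nat) :=
  exists N, forall n, (N <= n)%N -> exists2 m, (n <= m)%N & chi n = phi m.
Lemma esub_comp phi psi : sinc psi -> esub (phi \o psi) phi.
Proof. by move=> h; exists 0%N => n _; exists (psi n) => //; exact: sinc_ge. Qed.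

Lemma diag_subseq (P : nat -> (nat -> nat) -> Prop) :
  (forall i phi, sinc phi -> exists2 psi, sinc psi & P i (phi \o psi)) ->
  (forall i phi chi, P i phi -> sinc chi -> esub chi phi -> P i chi) ->
  exists2 chi, sinc chi & forall i, P i chi.
Proof.
move=> ex her.
pose step i phi := get [set psi | sinc psi /\ P i (phi \o psi)].
have stepP i phi : sinc phi -> sinc (step i phi) /\ P i (phi \o step i phi).
  move=> hp; have [psi h1 h2] := ex i phi hp.
  exact: (@getI _ [set psi | sinc psi /\ P i (phi \o psi)] psi).
pose F := fix F i := if i is j.+1 then F j \o step j (F j) else id.
have sF i : sinc (F i).
  by elim: i => [//|i IH] /=; apply: sinc_comp => //; exact: (stepP i _ IH).1.
have FE i j n : exists2 m, (n <= m)%N & F (i + j)%N n = F i m.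
  elim: j n => [|j IH] n; first by exists n; rewrite ?addn0.
  rewrite addnS /=; have [m nm ->] := IH (step (i + j)%N (F (i + j)%N) n).
  exists m => //; apply: leq_trans nm; apply: sinc_ge.
  exact: (stepP _ _ (sF _)).1.
(* The stage is n + 1, not n, because property i is achieved by [F i.+1]; then it holds for the
   diagonal from index i on. *)
have hchi : sinc (fun n => F n.+1 n).
  move=> n; rewrite [F n.+2]/=; apply: sinc_lt => //.
  exact: (sinc_ge n.+1 (stepP n.+1 _ (sF n.+1)).1).
exists (fun n => F n.+1 n) => // i.
apply: (her i (F i.+1)) => //; first exact: (stepP i _ (sF i)).2.
exists i => n ni; have [m nm e] := FE i.+1 (n - i)%N n; exists m => //.
by rewrite -e addSn subnKC.
Qed.

Lemma tends_esub u l phi chi : tends (u \o phi) l -> esub chi phi -> tends (u \o chi) l.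
Proof.
move=> h [N0 hs] e /h[N hN]; exists (maxn N0 N) => n; rewrite geq_max => /andP[n0 n1] /=.
by have [m nm ->] := hs n n0; apply: hN; apply: leq_trans nm.
Qed.
Lemma tends_sub u l phi : tends u l -> sinc phi -> tends (u \o phi) l.
Proof. by move=> h s; apply: (@tends_esub u l id) => //; exact: (@esub_comp id). Qed.
Lemma rtends_sub u l phi : rtends u l -> sinc phi -> rtends (u \o phi) l.
Proof.
move=> h s e /h[N hN]; exists N => n Nn; apply: hN; apply: leq_trans Nn _; exact: sinc_ge.
Qed.

Lemma rbounded_sub (u : nat -> R) M : (forall n, `|u n| <= M) ->
  exists2 phi, sinc phi & exists l, rtends (u \o phi) l.
Proof.
move=> hM.
have [|phi incr /cvg_ex[l hl]] := @bolzano_weierstrass R u.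
  exists M; split; first exact: num_real.
  by move=> x Mx n _; apply: le_trans (hM n) (ltW Mx).
exists phi; first by move=> n; have /increasing_seqP/(_ n) := incr; rewrite ltEnat.
exists l => e e0; move/cvgrPdist_lt: hl => /(_ e e0)[N _ hN]; exists N => n Nn.
by rewrite distrC; exact: hN.
Qed.

Lemma bounded_sub (u : nat -> C) M : (forall n, nrm (u n) <= M) ->
  exists2 phi, sinc phi & exists l, tends (u \o phi) l.
Proof.
move=> hM.
have [phi s1 [x hx]] := @rbounded_sub (fun n => re (u n)) M (fun n => le_trans (re_le_nrm _) (hM n)).
have [psi s2 [y hy]] := @rbounded_sub (fun n => im (u (phi n))) M (fun n => le_trans (im_le_nrm _) (hM _)).
exists (phi \o psi); first exact: sinc_comp.
exists (mkc x y) => e e0.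
have [N1 h1] := rtends_sub hx s2 (ltac:(lra) : 0 < e / 2); have [N2 h2] := hy (e / 2) ltac:(lra).
exists (maxn N1 N2) => n; rewrite geq_max => /andP[n1 n2].
apply: le_lt_trans (nrm_le_reim _) _; rewrite !cpxE.
by have := h1 _ n1; have := h2 _ n2; rewrite /=; lra.
Qed.

Lemma tends_uniq u a b : tends u a -> tends u b -> a = b.
Proof.
move=> ha hb; apply/eqP; rewrite -subr_eq0 -nrm_eq0 eq_le nrm_ge0 andbT.
apply/ler_addgt0Pr => e e0; rewrite add0r.
have [N h] := ha (e / 2) ltac:(lra); have [M k] := hb (e / 2) ltac:(lra).
have := h (maxn N M) (leq_maxl _ _); have := k (maxn N M) (leq_maxr _ _).
by have := nrm_distD (u (maxn N M)) a b; have := nrmC a (u (maxn N M)); lra.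
Qed.

Lemma tends_bounded u l : tends u l -> exists M, forall n, nrm (u n) <= M.
Proof.
move=> /(_ 1 ltr01)[N hN].
have [M hM] : exists M, forall n, (n < N)%N -> nrm (u n) <= M.
  elim: N {hN} => [|N [M IH]]; first by exists 0.
  exists (Num.max M (nrm (u N))) => n; rewrite ltnS leq_eqVlt => /orP[/eqP->|/IH h].
    by rewrite le_max lexx orbT.
  by rewrite le_max h.
exists (Num.max M (nrm l + 1)) => n; rewrite le_max.
have [/hM->//|/hN h] := ltnP n N.
by apply/orP; right; have := nrm_lerB (u n) l; lra.
Qed.

Lemma cauchy_tends u : (forall e, 0 < e -> exists N, forall m n, (N <= m)%N -> (N <= n)%N ->
  nrm (u m - u n) < e) -> exists l, tends u l.
Proof.
move=> hu; have [N hN] := hu 1 ltr01.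
have [phi sp [l hl]] := @bounded_sub (fun n => u (n + N)%N) (nrm (u N) + 1)
  (fun n => ltac:(have := hN (n + N)%N N (leq_addl _ _) (leqnn _); have := nrm_lerB (u (n + N)%N) (u N); lra)).
exists l => e e0; have [N1 h1] := hu (e / 2) ltac:(lra); have [N2 h2] := hl (e / 2) ltac:(lra).
exists N1 => n n1; pose k := maxn N1 N2.
have := h2 k (leq_maxr _ _); have := h1 n (phi k + N)%N n1; rewrite /=.
have k1 : (N1 <= phi k + N)%N.
  by apply: leq_trans (leq_addr _ _); apply: leq_trans (leq_maxl _ _) (sinc_ge _ sp).
by move=> /(_ k1); have := nrm_distD (u (phi k + N)%N) (u n) l; lra.
Qed.

Lemma tends_le u l a m : tends u l -> (exists N, forall n, (N <= n)%N -> nrm (u n - a) <= m) ->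
  nrm (l - a) <= m.
Proof.
move=> hl [N hN]; apply/ler_addgt0Pr => e /hl[M hM].
have := hN (maxn N M) (leq_maxl _ _); have := hM (maxn N M) (leq_maxr _ _).
by have := nrm_distD (u (maxn N M)) l a; have := nrmC l (u (maxn N M)); lra.
Qed.
Lemma tends_le0 u l m : tends u l -> (exists N, forall n, (N <= n)%N -> nrm (u n) <= m) ->
  nrm l <= m.
Proof.
move=> hl [N hN]; rewrite -[l]subr0; apply: tends_le hl _; exists N => n /hN.
by rewrite subr0.
Qed.

Lemma tends_cont f u z : ccont f z -> tends u z -> tends (fun n => f (u n)) (f z).
Proof. by move=> cf hu e /cf[d d0 h]; have [N hN] := hu d d0; exists N => n /hN /h. Qed.

Lemma tends_cst c : tends (fun=> c) c.
Proof. by move=> e e0; exists 0%N => n _; rewrite subrr nrm0. Qed.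
Lemma tends_add u v a b : tends u a -> tends v b -> tends (fun n => u n + v n) (a + b).
Proof.
move=> hu hv e e0; have [N h] := hu (e / 2) ltac:(lra); have [M k] := hv (e / 2) ltac:(lra).
exists (maxn N M) => n; rewrite geq_max => /andP[/h n1 /k n2].
by rewrite opprD addrACA; have := nrmD (u n - a) (v n - b); lra.
Qed.
Lemma tends_mul u v a b : tends u a -> tends v b -> tends (fun n => u n * v n) (a * b).
Proof.
move=> hu hv e e0; have [B hB] := tends_bounded hv.
have B0 : 0 <= B := le_trans (nrm_ge0 _) (hB 0%N).
have a0 := nrm_ge0 a.
pose e' := e / (2 * (B + nrm a + 1)).
have e'0 : 0 < e' by rewrite divr_gt0 // mulr_gt0 //; lra.
have ee : e' * (B + nrm a + 1) = e / 2 by rewrite /e'; field; lra.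
have [N h] := hu e' e'0; have [M k] := hv e' e'0.
exists (maxn N M) => n; rewrite geq_max => /andP[/h n1 /k n2].
have -> : u n * v n - a * b = (u n - a) * v n + a * (v n - b) by ring.
apply: le_lt_trans (nrmD _ _) _; rewrite !nrmM.
have : nrm (u n - a) * nrm (v n) <= e' * B by rewrite ler_pM ?nrm_ge0 // ltW.
have : nrm a * nrm (v n - b) <= nrm a * e' by rewrite ler_wpM2l // ltW.
nra.
Qed.
Lemma tends_ext u v l : (forall n, u n = v n) -> tends u l -> tends v l.
Proof. by move=> /funext ->. Qed.
Lemma tends_eventually u v l : (exists N, forall n, (N <= n)%N -> u n = v n) -> tends u l -> tends v l.
Proof.
move=> [N h] hu e /hu[M k]; exists (maxn N M) => n; rewrite geq_max => /andP[/h <- /k].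
by [].
Qed.
Lemma tends_opp u l : tends u l -> tends (fun n => - u n) (- l).
Proof. by move=> hu e /hu[N h]; exists N => n /h; rewrite -opprD nrmN. Qed.
Lemma tends_subr u v a b : tends u a -> tends v b -> tends (fun n => u n - v n) (a - b).
Proof. by move=> hu hv; apply: tends_add => //; exact: tends_opp. Qed.

Lemma inv_nat_small (e : R) : 0 < e -> exists N, forall n, (N <= n)%N -> n.+1%:R^-1 < e.
Proof.
move=> e0; exists (Num.bound e^-1) => n Nn.
rewrite invf_plt ?posrE //; apply: lt_le_trans (archi_boundP _) _; first by rewrite invr_ge0 ltW.
by rewrite ler_nat; apply: leq_trans Nn _.
Qed.

End Sequences.

(** * Difference quotients and differentiability of all orders *)

Section Derivatives.
Variable R : realType.
Local Notation C := (Cplx R).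
Local Notation disc := (@disc R).
Local Notation hol := (@hol R).

Definition der (f : C -> C) : C -> C := derive1 f.
Definition dern (k : nat) (f : C -> C) : C -> C := derive1n k f.

Lemma derE f z d : cder f z d -> der f z = d.
Proof. by case/cder_derivable. Qed.
Lemma cder_der f z d : cder f z d -> cder f z (der f z).
Proof. by move=> h; rewrite (derE h). Qed.
Lemma hol_der (U : C -> Prop) f z : hol U f -> U z -> cder f z (der f z).
Proof. by move=> hf /hf[d]; exact: cder_der. Qed.
Lemma dernS k f : dern k.+1 f = der (dern k f). Proof. by []. Qed.
Lemma der_loc f g z d r : 0 < r -> (forall w, disc z r w -> f w = g w) -> cder f z d -> der g z = d.
Proof. by move=> r0 fg hf; apply: derE; apply: (@cder_local _ f g z d r). Qed.

(** Cauchy estimates, Taylor expansions and higher differentiability all come from bounding and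
    iterating this completed difference quotient. *)
Definition quot (f : C -> C) (p z : C) : C := if z == p then der f p else (f z - f p) / (z - p).

Lemma quotE f p z : f z = f p + (z - p) * quot f p z.
Proof.
rewrite /quot; case: eqP => [->|/eqP zp]; first by rewrite subrr mul0r addr0.
by rewrite mulrC divfK ?subr_eq0 // subrKC.
Qed.
Lemma quotpp f p : quot f p p = der f p. Proof. by rewrite /quot eqxx. Qed.
Lemma quot_neq f p z : z != p -> quot f p z = (f z - f p) / (z - p).
Proof. by rewrite /quot => /negbTE->. Qed.

Lemma quot_cont f p d : cder f p d -> ccont (quot f p) p.
Proof.
move=> hf; have := cder_der hf => /cderP H e e0; have [r r0 hr] := H e e0.
exists r => // z zr; rewrite quotpp /quot; case: eqP => [_|/eqP zp]; first by rewrite subrr nrm0.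
by have := hr (z - p); rewrite subrK; apply=> //; rewrite subr_eq0.
Qed.

Lemma quot_hol_off f p z d : z != p -> cder f z d -> exists d', cder (quot f p) z d'.
Proof.
move=> zp hf; have zp0 : z - p != 0 by rewrite subr_eq0.
eexists; apply: (@cder_local _ (fun w => (f w - f p) / (w - p)) _ _ _ (nrm (z - p))).
- by rewrite nrm_gt0.
- move=> w hw; rewrite quot_neq //; apply/negP => /eqP E.
  by move: hw; rewrite E nrmC ltxx.
- apply: cder_div => //; first by apply: cder_sub; [exact: hf|exact: cder_cst].
  by apply: cder_sub; [exact: cder_id|exact: cder_cst].
Qed.

Lemma quot_cont_on f p r w z : hol (disc p r) f -> disc p r w -> disc p r z -> ccont (quot f w) z.
Proof.
move=> hf wr zr; have [d hd] := hf z zr; have [E|zw] := eqVneq z w.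
  by rewrite E in hd *; exact: quot_cont hd.
by have [d' hd'] := quot_hol_off zw hd; exact: cder_cont hd'.
Qed.

Lemma quot_bound f p r r' w m : r' < r -> 0 <= m -> hol (disc p r) f -> nrm (w - p) <= r' ->
  (forall z, r' < nrm (z - p) < r -> nrm (f z - f w) <= m * nrm (z - w)) ->
  forall z, disc p r z -> nrm (quot f w z) <= m.
Proof.
move=> r'r m0 hf wr hm; apply: (@max_exceptional _ [:: w] _ _ _ r') => //.
- by move=> z; apply: quot_cont_on hf _; apply: le_lt_trans r'r.
- move=> z zr; rewrite inE => zw; have [d hd] := hf z zr; exact: quot_hol_off hd.
move=> z /[dup] /andP[z1 _] /hm; have zw : z != w by apply/negP => /eqP E; move: z1; rewrite E; lra.
by rewrite quot_neq // nrmM nrmV ler_pdivrMr // nrm_gt0 subr_eq0.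
Qed.

(** On the annulus 3r/4 < |v - p| < r the numerator is at most 2m and the denominator at least r/4,
    whence 8m/r. At z = w this is a Cauchy estimate. *)
Lemma quot_bound_half f p r m w z : 0 < r -> hol (disc p r) f -> (forall v, disc p r v -> nrm (f v) <= m) ->
  disc p (r / 2) w -> disc p r z -> nrm (quot f w z) <= 8 * m / r.
Proof.
move=> r0 hf hm wr zr; have m0 : 0 <= m := le_trans (nrm_ge0 _) (hm z zr).
apply: (@quot_bound f p r (3 / 4 * r) w) => //; first lra.
- by rewrite divr_ge0 //; lra.
- by move: wr; rewrite /disc; lra.
move=> v /andP[v1 v2]; apply: le_trans (nrmB _ _) _.
have h1 := hm v v2; have h2 : nrm (f w) <= m by apply: hm; move: wr; rewrite /disc; lra.
have h3 : r / 4 <= nrm (v - w) by have := nrm_distD w v p; move: wr; rewrite /disc; lra.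
rewrite mulrAC ler_pdivlMr //; nra.
Qed.

Lemma der_bound f p r m w : 0 < r -> hol (disc p r) f -> (forall v, disc p r v -> nrm (f v) <= m) ->
  disc p (r / 2) w -> nrm (der f w) <= 8 * m / r.
Proof.
move=> r0 hf hm wr; rewrite -quotpp; apply: (quot_bound_half r0 hf hm wr).
by move: wr; rewrite /disc; lra.
Qed.

Lemma quot_diff (x y t z w v : C) : z - w != 0 -> z - v != 0 ->
  (x - y) / (z - w) - (x - t) / (z - v) =
  ((x - t) * (w - v) - (y - t) * (z - v)) / ((z - w) * (z - v)).
Proof. by move=> zw zv; field; rewrite zw zv. Qed.

(* The difference quotients of [q := quot f p] based at points w near p, and
   evaluated at p, form a Cauchy net as w tends to p by the maximum principle. *)
Lemma quot_hol f p r : hol (disc p r) f -> hol (disc p r) (quot f p).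
Proof.
move=> hf z zr; have r0 : 0 < r := le_lt_trans (nrm_ge0 _) zr.
have [zp|zp] := eqVneq z p; last by have [d hd] := hf z zr; exact: quot_hol_off hd.
subst z; clear zr; have [q Eq] : exists q, q = quot f p by exists (quot f p).
have dp := disc_center p r0; have cq : ccont q p by rewrite Eq; exact: (quot_cont_on hf dp dp).
have [s0 s00 hs0] := cont_bounded cq.
pose s := Num.min s0 r / 2.
have s1 : 0 < s by rewrite divr_gt0 // lt_min s00.
have sr : s < r by have : Num.min s0 r <= r by [rewrite ge_min lexx orbT]; rewrite /s; lra.
have ss : s < s0 by have : Num.min s0 r <= s0 by [rewrite ge_min lexx]; rewrite /s; lra.
pose m := nrm (q p) + 1; have m0 : 0 < m by rewrite ltr_wpDl // nrm_ge0.
have qm z : disc p s z -> nrm (q z) <= m by move=> zs; apply: ltW; apply: hs0; apply: lt_trans ss.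
clearbody s m.
have hq z : disc p r z -> z != p -> exists d, cder q z d.
  by move=> zr zp; have [d hd] := hf z zr; rewrite Eq; exact: quot_hol_off hd.
have cqz z : disc p r z -> ccont q z by move=> zr; rewrite Eq; exact: (quot_cont_on hf dp zr).
(* Obtained from [quot_diff] on the annulus s/2 < |z - p| < s: there |q| <= m, |z - v| <= 2s, and
   both denominators are at least s/4. It tends to 0 as w and v approach p, by continuity of q. *)
pose B w v := (2 * m * nrm (w - v) + 2 * s * nrm (q w - q v)) * (16 / s ^+ 2).
have B0 w v : 0 <= B w v.
  have m1 := ltW m0; have s2 := ltW s1.
  apply: mulr_ge0; last by rewrite divr_ge0 // sqr_ge0.
  by apply: addr_ge0; apply: mulr_ge0; rewrite ?nrm_ge0 //; apply: mulr_ge0.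
have S w v : disc p (s / 4) w -> disc p (s / 4) v -> w != p -> v != p ->
    nrm (quot q w p - quot q v p) <= B w v.
  rewrite /disc => ws vs wp vp.
  have wr : disc p r w by rewrite /disc; lra.
  have vr : disc p r v by rewrite /disc; lra.
  have cQ u : disc p r u -> u != p -> forall z, disc p r z -> ccont (quot q u) z.
    move=> ur up z zr; have [E|zu] := eqVneq z u.
      by rewrite E; have [d hd] := hq u ur up; exact: quot_cont hd.
    apply: (@cont_local _ _ _ (fun t => (q t - q u) / (t - u)) _ _ (nrm (z - u))).
    - by rewrite nrm_gt0 subr_eq0.
    - exact: nrm0.
    - move=> t ht; rewrite quot_neq //; apply/negP => /eqP E.
      by move: ht; rewrite E nrmC ltxx.
    apply: cont_mul; first by apply: cont_sub; [exact: cqz|exact: cont_cst].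
    apply: cont_inv; first by rewrite subr_eq0.
    by apply: cont_sub; [exact: ccont_id|exact: cont_cst].
  (* At p differentiability of q is what is being proved, and at w and v a quotient has its base
     point. *)
  apply: (@max_exceptional _ [:: p; w; v] (fun z => quot q w z - quot q v z) p s (s / 2)) => //.
  - lra.
  - by move=> z zs; apply: cont_sub; apply: cQ => //; apply: disc_le zs; exact: ltW.
  - move=> z zs; rewrite !inE !negb_or => /and3P[zp zw zv].
    have zr : disc p r z by apply: disc_le zs; exact: ltW.
    have [d hd] := hq z zr zp.
    have [d1 h1] := quot_hol_off zw hd; have [d2 h2] := quot_hol_off zv hd.
    by eexists; exact: cder_sub h1 h2.
  - move=> z /andP[z1 z2].
    have a1 : s / 4 <= nrm (z - w) by have := nrm_distD w z p; lra.
    have a2 : s / 4 <= nrm (z - v) by have := nrm_distD v z p; lra.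
    have zw : z - w != 0 by rewrite -nrm_gt0; lra.
    have zv : z - v != 0 by rewrite -nrm_gt0; lra.
    have [zw' zv'] : z != w /\ z != v by rewrite -(subr_eq0 z w) -(subr_eq0 z v).
    rewrite /=.
    rewrite (quot_neq q zw').
    rewrite (quot_neq q zv').
    rewrite (quot_diff (q z) (q w) (q v) zw zv).
    rewrite nrmM nrmV nrmM; apply: ler_pM; rewrite ?nrm_ge0 ?invr_ge0 ?mulr_ge0 ?nrm_ge0 //.
      apply: le_trans (nrmB _ _) _; rewrite !nrmM.
      have b1 : nrm (q z - q v) <= 2 * m.
        have := nrmB (q z) (q v); have := qm z z2; have := qm v; rewrite /disc; lra.
      have b2 : nrm (z - v) <= 2 * s by have := nrm_distD p z v; rewrite (nrmC p v); lra.
      by apply: lerD; [rewrite ler_wpM2r ?nrm_ge0|rewrite mulrC ler_wpM2r ?nrm_ge0].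
    have -> : 16 / s ^+ 2 = (s / 4 * (s / 4))^-1 by field; rewrite gt_eqF.
    have s4 : 0 < s / 4 by rewrite divr_gt0.
    rewrite lef_pV2 ?posrE; [|by rewrite mulr_gt0 ?nrm_gt0|exact: mulr_gt0].
    by apply: ler_pM => //; exact: ltW.
  exact: (disc_center p s1).
pose w n : C := p + toC (s / 4 / n.+2%:R).
have wn n : nrm (w n - p) = s / 4 / n.+2%:R.
  by rewrite /w addrAC subrr add0r nrm_toC ger0_norm // !divr_ge0 // (ltW s1).
have ws n : disc p (s / 4) (w n).
  by rewrite /disc wn ltr_pdivrMr // -[ltLHS]mulr1 ltr_pM2l ?ltr1n // divr_gt0.
have wp n : w n != p by rewrite -subr_eq0 -nrm_gt0 wn !divr_gt0.
have small e : 0 < e -> exists2 d, 0 < d & forall u v, nrm (u - p) < d -> nrm (v - p) < d -> B u v < e.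
  move=> e0.
  pose e' := e / (16 / s ^+ 2) / (8 * (m + s)).
  have K0 : 0 < 16 / s ^+ 2 by rewrite divr_gt0 // exprn_gt0.
  have M0 : 0 < 8 * (m + s) by rewrite mulr_gt0 //; lra.
  have e'0 : 0 < e' by apply: divr_gt0 => //; exact: divr_gt0.
  have [d d0 hd] := cq e' e'0.
  exists (Num.min d e'); first by rewrite lt_min d0.
  move=> u v; rewrite !lt_min => /andP[/hd u1 u2] /andP[/hd v1 v2].
  rewrite /B -ltr_pdivlMr //.
  have -> : e / (16 / s ^+ 2) = 8 * (m + s) * e' by rewrite /e'; field; rewrite !gt_eqF //; lra.
  have h1 : nrm (u - v) < 2 * e' by have := nrm_distD p u v; rewrite (nrmC p v); lra.
  have h2 : nrm (q u - q v) < 2 * e' by have := nrm_distD (q p) (q u) (q v); rewrite (nrmC (q p)); lra.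
  have : m * nrm (u - v) < m * (2 * e') by rewrite ltr_pM2l.
  have : s * nrm (q u - q v) < s * (2 * e') by rewrite ltr_pM2l.
  nra.
have wlim d : 0 < d -> exists N, forall n, (N <= n)%N -> nrm (w n - p) < d.
  move=> d0; have [N hN] := inv_nat_small (divr_gt0 d0 s1); exists N => n /hN h; rewrite wn.
  apply: le_lt_trans (_ : s * n.+1%:R^-1 < _); last by rewrite mulrC -ltr_pdivlMr.
  rewrite -mulrA ler_wpM2l ?(ltW s1) // -invfM lef_pV2 ?posrE ?mulr_gt0 //.
  by rewrite -natrM ler_nat; lia.
have [l hl] : exists l, tends (fun n => quot q (w n) p) l.
  apply: cauchy_tends => e /small[d d0 hd]; have [N hN] := wlim d d0; exists N => a b /hN ha /hN hb.
  by apply: le_lt_trans (S _ _ (ws a) (ws b) (wp a) (wp b)) _; exact: hd.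
exists l; apply/cderP => e e0.
have [d d0 hd] := small (e / 2) ltac:(lra).
exists (Num.min d (s / 4)); first by rewrite lt_min d0 divr_gt0.
move=> h h0; rewrite lt_min => /andP[hd1 hs4].
have hw : h + p - p = h by ring.
have hp : h + p != p by rewrite -subr_eq0 hw.
have -> : (quot f p (h + p) - quot f p p) / h = quot q (h + p) p.
  rewrite -Eq (@quot_neq q) 1?eq_sym //; have -> : p - (h + p) = - h by ring.
  by rewrite invrN mulrN -mulNr opprB.
rewrite nrmC; apply: (@le_lt_trans _ _ (e / 2)); last lra.
apply: tends_le hl _; have [N hN] := wlim d d0; exists N => n /hN hn.
apply: le_trans (S _ _ (ws n) _ (wp n) hp) _; first by rewrite /disc hw.
by apply: ltW; apply: hd => //; rewrite hw.
Qed.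

Lemma der_quot f p r z : hol (disc p r) f -> disc p r z ->
  der f z = quot f p z + (z - p) * der (quot f p) z.
Proof.
move=> hf zr; have hq := hol_der (quot_hol hf) zr.
apply: derE; apply: (@cder_ext _ (fun w => f p + (w - p) * quot f p w)).
  by move=> w; rewrite -quotE.
have := cder_add (cder_cst (f p) z) (cder_mul (cder_sub (cder_id z) (cder_cst p z)) hq).
by congr cder; ring.
Qed.

(** In f' = q + (z - p) q', with q the quotient at p, the first term is continuous and q' is bounded
    near p by the Cauchy estimate for q. *)
Lemma der_cont f p r : 0 < r -> hol (disc p r) f -> ccont (der f) p.
Proof.
move=> r0 hf; have hq := quot_hol hf; have dp := disc_center p r0.
have cq := hol_cont hq dp; have [s s0 hs] := cont_bounded cq.
pose t := Num.min s r.
have t0 : 0 < t by rewrite lt_min s0.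
have ts : t <= s by rewrite ge_min lexx. have tr : t <= r by rewrite ge_min lexx orbT.
set m := nrm (quot f p p) + 1 in hs; have m0 : 0 < m by rewrite ltr_wpDl // nrm_ge0.
have hqt : hol (disc p t) (quot f p) by apply: hol_sub hq => z; exact: disc_le.
have B w : disc p (t / 2) w -> nrm (der (quot f p) w) <= 8 * m / t.
  by apply: der_bound => // v vt; apply: ltW; apply: hs; apply: disc_le vt.
move=> e e0; have [d d0 hd] := cq (e / 2) ltac:(lra).
pose d2 := e / 2 / (8 * m / t + 1).
have K0 : 0 < 8 * m / t + 1 by have : 0 < 8 * m / t by [rewrite divr_gt0 // mulr_gt0]; lra.
have d20 : 0 < d2 by rewrite divr_gt0 //; lra.
exists (Num.min d (Num.min d2 (t / 2))); first by rewrite !lt_min d0 d20 divr_gt0.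
move=> w; rewrite !lt_min => /and3P[/hd w1 w2 w3].
have wr : disc p r w by rewrite /disc; lra.
rewrite (der_quot hf wr) -(quotpp f p) addrAC.
apply: le_lt_trans (nrmD _ _) _; rewrite nrmM.
have : nrm (w - p) * nrm (der (quot f p) w) <= d2 * (8 * m / t).
  by apply: ler_pM; rewrite ?nrm_ge0 ?(ltW w2) //; exact: B.
have : d2 * (8 * m / t + 1) = e / 2 by rewrite /d2 divfK // gt_eqF.
nra.
Qed.

(** Around each z again f' = q + (w - z) q'; the second term is differentiable at z because q' is
    continuous there, by [der_cont] for q. *)
Lemma der_hol_disc f p r : hol (disc p r) f -> hol (disc p r) (der f).
Proof.
move=> hf z zr; have [s s0 hs] := disc_open zr.
have hfz : hol (disc z s) f := hol_sub hs hf.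
have hq := quot_hol hfz; have [d1 h1] := hq z (disc_center z s0).
exists (d1 + der (quot f z) z).
apply: (@cder_local _ (fun w => quot f z w + (w - z) * der (quot f z) w) _ _ _ s) => //.
  by move=> w ws; rewrite -(der_quot hfz).
apply: cder_add => //; exists (der (quot f z)); first by split=> //; exact: der_cont hq.
by move=> w; rewrite subrr mul0r add0r mulrC.
Qed.

Lemma der_hol (U : C -> Prop) f : (forall z, U z -> exists2 r, 0 < r & forall w, disc z r w -> U w) ->
  hol U f -> hol U (der f).
Proof.
move=> oU hf z /oU[r r0 hr]; apply: (@der_hol_disc f z r); last exact: disc_center.
exact: hol_sub hf.
Qed.
Lemma dern_hol (U : C -> Prop) f k : (forall z, U z -> exists2 r, 0 < r & forall w, disc z r w -> U w) ->
  hol U f -> hol U (dern k f).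
Proof. by move=> oU hf; elim: k => // k IH; rewrite dernS; exact: der_hol. Qed.
Lemma dern_hol_disc p r f k : hol (disc p r) f -> hol (disc p r) (dern k f).
Proof. by apply: dern_hol => z; exact: disc_open. Qed.
Lemma dern_hol_plane f k : hol (fun=> True) f -> hol (fun=> True) (dern k f).
Proof. by apply: dern_hol => z _; exists 1. Qed.

Lemma dern_loc f g p r k : 0 < r -> hol (disc p r) f -> (forall w, disc p r w -> f w = g w) ->
  forall w, disc p r w -> dern k f w = dern k g w.
Proof.
move=> r0 hf fg; elim: k => [|k IH] w wr; first exact: fg.
have [s s0 hs] := disc_open wr; rewrite !dernS; apply/esym.
apply: (@der_loc (dern k f) _ _ _ s) => //; first by move=> v /hs; exact: IH.
exact: hol_der (dern_hol_disc k hf) wr.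
Qed.

End Derivatives.

(** * Power series and locally uniform convergence *)

Section Convergence.
Variable R : realType.
Local Notation C := (Cplx R).
Local Notation disc := (@disc R).
Local Notation hol := (@hol R).
Local Notation der := (@der R).
Local Notation dern := (@dern R).

Lemma hol_cst U c : hol U (fun=> c). Proof. by move=> z _; exists 0; exact: cder_cst. Qed.
Lemma hol_add U f g : hol U f -> hol U g -> hol U (fun z => f z + g z).
Proof. by move=> hf hg z Uz; have [a ha] := hf z Uz; have [b hb] := hg z Uz; exists (a + b); exact: cder_add. Qed.
Lemma hol_subr U f g : hol U f -> hol U g -> hol U (fun z => f z - g z).
Proof. by move=> hf hg z Uz; have [a ha] := hf z Uz; have [b hb] := hg z Uz; exists (a - b); exact: cder_sub. Qed.
Lemma hol_mul U f g : hol U f -> hol U g -> hol U (fun z => f z * g z).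
Proof. by move=> hf hg z Uz; have [a ha] := hf z Uz; have [b hb] := hg z Uz; eexists; exact: cder_mul ha hb. Qed.
Lemma hol_inv U f : hol U f -> (forall z, U z -> f z != 0) -> hol U (fun z => (f z)^-1).
Proof. by move=> hf f0 z Uz; have [a ha] := hf z Uz; eexists; exact: cder_inv (f0 z Uz) ha. Qed.

(** At p it is the n-th Taylor coefficient of f, and at z the factor in the n-th remainder. *)
Definition iterq (f : C -> C) (p : C) (n : nat) : C -> C := iter n (fun g => quot g p) f.

Lemma iterq_hol f p r n : hol (disc p r) f -> hol (disc p r) (iterq f p n).
Proof. by move=> hf; elim: n => //= n IH; exact: quot_hol. Qed.
Lemma iterqS f p n : iterq f p n.+1 = iterq (quot f p) p n.
Proof. by rewrite /iterq iterSr. Qed.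
Lemma iterq_bound f p r m n z : 0 < r -> hol (disc p r) f -> (forall v, disc p r v -> nrm (f v) <= m) ->
  disc p r z -> nrm (iterq f p n z) <= m * (8 / r) ^+ n.
Proof.
move=> r0 hf hm; elim: n z => [|n IH] z zr; first by rewrite expr0 mulr1; exact: hm.
have pr : disc p (r / 2) p by apply: disc_center; rewrite divr_gt0.
have := quot_bound_half r0 (iterq_hol n hf) IH pr zr.
by congr (_ <= _); rewrite exprS; ring.
Qed.
Lemma taylor f p n z :
  f z = \sum_(j < n) iterq f p j p * (z - p) ^+ j + (z - p) ^+ n * iterq f p n z.
Proof.
elim: n => [|n IH]; first by rewrite big_ord0 add0r expr0 mul1r.
by rewrite {1}IH big_ord_recr /= -addrA; congr (_ + _); rewrite {1}(quotE (iterq f p n) p z) exprS; ring.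
Qed.
Lemma iterq_factor f p n z : (forall j, (j < n)%N -> iterq f p j p = 0) ->
  f z = (z - p) ^+ n * iterq f p n z.
Proof.
by move=> h; rewrite (taylor f p n) big1 ?add0r // => j _; rewrite h ?mul0r.
Qed.

Lemma pow2_small (e : R) : 0 < e -> exists n, forall m, (n <= m)%N -> (1 / 2) ^+ m < e.
Proof.
move=> e0; exists (Num.bound e^-1) => m nm.
rewrite div1r exprVn invf_plt ?posrE ?exprn_gt0 //.
apply: lt_trans (archi_boundP _) _; first by rewrite invr_ge0 ltW.
by rewrite -natrX ltr_nat; apply: leq_ltn_trans nm _; exact: ltn_expl.
Qed.

(** Each iteration costs a factor 8/r, so on the radius r/16 the n-th remainder is at most m /
    2^n. *)
Lemma iterq_eq0 f p r m : 0 < r -> hol (disc p r) f -> (forall v, disc p r v -> nrm (f v) <= m) ->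
  (forall j, iterq f p j p = 0) -> forall z, disc p (r / 16) z -> f z = 0.
Proof.
move=> r0 hf hm h0 z zr; apply/eqP; rewrite -nrm_eq0 eq_le nrm_ge0 andbT.
apply/ler_addgt0Pr => e e0; rewrite add0r.
have m0 : 0 <= m := le_trans (nrm_ge0 _) (hm p (disc_center p r0)).
have [n hn] := pow2_small (e := e / (m + 1)) ltac:(by rewrite divr_gt0 //; lra).
rewrite (@iterq_factor f p n) // nrmM nrmX.
have zr' : disc p r z by apply: disc_le zr; lra.
have B := iterq_bound n r0 hf hm zr'.
have : nrm (z - p) ^+ n <= (r / 16) ^+ n by rewrite lerXn2r ?nnegrE ?nrm_ge0 ?divr_ge0 // ltW.
move=> A; apply: le_trans (ler_pM (exprn_ge0 _ (nrm_ge0 _)) (nrm_ge0 _) A B) _.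
rewrite mulrCA -exprMn; have -> : r / 16 * (8 / r) = 1 / 2 by field; rewrite gt_eqF.
have := hn n (leqnn _); rewrite ltr_pdivlMr; last lra.
have : 0 <= (1 / 2 : R) ^+ n by apply: exprn_ge0; rewrite divr_ge0.
nra.
Qed.

Lemma dern_quot f p r k z : hol (disc p r) f -> disc p r z ->
  dern k.+1 f z = k.+1%:R * dern k (quot f p) z + (z - p) * dern k.+1 (quot f p) z.
Proof.
move=> hf; have hq := quot_hol hf.
elim: k z => [|k IH] z zr; first by rewrite !dernS mul1r; exact: (der_quot hf zr).
have [s s0 hs] := disc_open zr.
rewrite dernS; apply: (@der_loc _ (fun z => k.+1%:R * dern k (quot f p) z + (z - p) * dern k.+1 (quot f p) z) _ _ _ s) => //.
  by move=> w ws; rewrite IH //; exact: hs.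
have := cder_add (cder_mul (cder_cst k.+1%:R z) (hol_der (dern_hol_disc k hq) zr))
  (cder_mul (cder_sub (cder_id z) (cder_cst p z)) (hol_der (dern_hol_disc k.+1 hq) zr)).
rewrite -!dernS.
have -> : k.+2%:R = k.+1%:R + 1 :> C by rewrite natr1.
move: (dern k _ z) (dern k.+1 _ z) (dern k.+2 _ z) => x y t.
by congr cder; ring.
Qed.

Lemma dern_iterq f p r j : 0 < r -> hol (disc p r) f -> dern j f p = j`!%:R * iterq f p j p.
Proof.
move=> r0; elim: j f => [|j IH] f hf; first by rewrite mul1r.
rewrite (dern_quot j hf (disc_center p r0)) subrr mul0r addr0 IH; last exact: quot_hol.
by rewrite iterqS factS natrM mulrA.
Qed.

Lemma nat_neq0 n : (0 < n)%N -> n%:R != 0 :> C.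
Proof. by move=> n0; rewrite -toC_nat toC_eq0 pnatr_eq0 -lt0n. Qed.

Lemma dern_eq0_iterq f p r j : 0 < r -> hol (disc p r) f -> (dern j f p = 0 <-> iterq f p j p = 0).
Proof.
move=> r0 hf; rewrite (dern_iterq j r0 hf); split=> [|->]; last by rewrite mulr0.
by move/eqP; rewrite mulf_eq0 (negbTE (nat_neq0 (fact_gt0 _))) => /eqP.
Qed.

Lemma hol_bounded f p r s : r < s -> hol (disc p s) f ->
  exists m, forall z, nrm (z - p) <= r -> nrm (f z) <= m.
Proof.
move=> rs hf; apply: contrapT => H.
have [|u hu] := @choice nat C (fun n z => nrm (z - p) <= r /\ n%:R < nrm (f z)).
  move=> n; apply: contrapT => H2; apply: H; exists n%:R => z zr.
  by rewrite leNgt; apply/negP => hz; apply: H2; exists z.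
have [phi sp [l hl]] := @bounded_sub _ u (r + nrm p)
  (fun n => ltac:(have := (hu n).1; have := nrm_lerB (u n) p; lra)).
have lr : nrm (l - p) <= r by apply: tends_le hl _; exists 0%N => n _; exact: (hu _).1.
have cf := hol_cont hf (le_lt_trans lr rs).
have [M hM] := tends_bounded (tends_cont cf hl).
pose n := Num.bound M.
have := (hu (phi n)).2; have := hM n; rewrite /=.
have M0 : 0 <= M := le_trans (nrm_ge0 _) (hM 0%N).
have h1 := archi_boundP M0; have h2 : n%:R <= (phi n)%:R :> R by rewrite ler_nat; exact: sinc_ge.
by rewrite -/n in h1; lra.
Qed.

Lemma hol_factor f p r : 0 < r -> hol (disc p r) f ->
  (exists2 s, 0 < s & forall z, disc p s z -> f z = 0) \/
  (exists n, [/\ forall j, (j < n)%N -> iterq f p j p = 0, iterq f p n p != 0 &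
     forall z, f z = (z - p) ^+ n * iterq f p n z]).
Proof.
move=> r0 hf; have [h|h] := pselect (forall j, iterq f p j p = 0).
  left; have hr : r / 2 < r by lra.
  have [m hm] := hol_bounded hr hf.
  exists (r / 2 / 16); first by rewrite !divr_gt0.
  apply: (@iterq_eq0 f p (r / 2) m) => //; first by rewrite divr_gt0.
    by apply: hol_sub hf => z; apply: disc_le; lra.
  by move=> v vr; apply: hm; exact: ltW.
right; have ex : exists j, iterq f p j p != 0.
  by apply: contrapT => H; apply: h => j; apply: contrapT => /eqP hj; apply: H; exists j.
case: (ex_minnP ex) => n nn nmin; have hn j : (j < n)%N -> iterq f p j p = 0.
  by move=> jn; apply/eqP; apply: contraLR jn => /nmin; rewrite -leqNgt.
by exists n; split=> // z; exact: iterq_factor.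
Qed.

(** All Taylor coefficients at p vanish, and for an entire function the remainder estimate is
    available on discs as large as desired. *)
Lemma entire_eq0 f p s : hol (fun=> True) f -> 0 < s -> (forall z, disc p s z -> f z = 0) ->
  forall z, f z = 0.
Proof.
move=> hf s0 h z.
have hol_d r : hol (disc p r) f by apply: hol_sub hf.
have d0 j w : disc p s w -> dern j f w = 0.
  move=> ws; have H0 : hol (disc p s) (fun=> 0) by move=> v _; exists 0; exact: cder_cst.
  rewrite -(@dern_loc _ (fun=> 0) f p s j s0 H0 _ w ws); last by move=> v /h.
  elim: j w {ws} => // j IH w; rewrite dernS; apply: derE.
  have -> : dern j (fun=> 0) = (fun=> 0) by apply/funext.
  exact: cder_cst.
(* Large enough for z to lie in the disc of radius r/16. *)
pose r := 16 * (nrm (z - p) + 1).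
have r0 : 0 < r by rewrite mulr_gt0 // ltr_wpDl // nrm_ge0.
have rr : r < r + 1 by lra.
have [m hm] := hol_bounded rr (hol_d _).
apply: (@iterq_eq0 f p r m) => //.
- by move=> v vr; apply: hm; exact: ltW.
- move=> j; apply/(dern_eq0_iterq j r0 (hol_d r)); apply: d0; exact: disc_center.
- by rewrite /disc /r mulrAC divff ?mul1r ?ltrDl // pnatr_eq0.
Qed.

Lemma entire_eq0_dern f p : hol (fun=> True) f -> (forall j, dern j f p = 0) -> forall z, f z = 0.
Proof.
move=> hf h; have hd : hol (disc p 1) f by apply: hol_sub hf.
have [[s s0 hs]|[n [_ nn _]]] := hol_factor ltr01 hd; first exact: (entire_eq0 hf s0 hs).
have /(dern_eq0_iterq n ltr01 hd) nz := h n.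
by rewrite nz eqxx in nn.
Qed.

Definition ucvg (U : C -> Prop) (f : nat -> C -> C) (g : C -> C) := forall e, 0 < e ->
  exists N, forall n, (N <= n)%N -> forall z, U z -> nrm (f n z - g z) < e.
Definition lucvg (U : C -> Prop) f g := forall z, U z -> exists2 r, 0 < r & ucvg (disc z r) f g.
(** A rescaled function is defined near a given point only from an index on that depends on the
    point, hence this eventual form of holomorphy. *)
Definition lhol (U : C -> Prop) (f : nat -> C -> C) := forall z, U z -> exists2 r, 0 < r &
  exists N, forall n, (N <= n)%N -> hol (disc z r) (f n).

Lemma ucvg_sub (U V : C -> Prop) f g : (forall z, V z -> U z) -> ucvg U f g -> ucvg V f g.
Proof. by move=> VU h e /h[N hN]; exists N => n /hN H z /VU /H. Qed.
Lemma ucvg_esub U f g phi chi : ucvg U (fun n => f (phi n)) g -> esub chi phi -> ucvg U (fun n => f (chi n)) g.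
Proof.
move=> h [N0 hs] e /h[N hN]; exists (maxn N0 N) => n; rewrite geq_max => /andP[n0 n1].
by have [m nm ->] := hs n n0; apply: hN; apply: leq_trans nm.
Qed.
Lemma ucvg_tends U f g z : ucvg U f g -> U z -> tends (fun n => f n z) (g z).
Proof. by move=> h Uz e /h[N hN]; exists N => n /hN; apply. Qed.

(** By [quot_bound_half] the quotients of the f n at p are uniformly Cauchy; away from p their limit
    is the difference quotient of g, which therefore extends continuously to p. *)
Lemma ucvg_hol_center f g p r N : 0 < r -> (forall n, (N <= n)%N -> hol (disc p r) (f n)) ->
  ucvg (disc p r) f g -> exists d, cder g p d.
Proof.
move=> r0 hf cv; have pr := disc_center p r0.
have pr2 : disc p (r / 2) p by apply: disc_center; rewrite divr_gt0.
have qsub a b z : (N <= a)%N -> (N <= b)%N -> disc p r z ->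
    quot (fun v => f a v - f b v) p z = quot (f a) p z - quot (f b) p z.
  move=> Na Nb zr; have [->|zp] := eqVneq z p.
    by rewrite !quotpp; apply: derE; apply: cder_sub; apply: hol_der pr; exact: hf.
  by rewrite !quot_neq // -mulrBl; congr (_ / _); ring.
have K : 0 < 8 / r by rewrite divr_gt0.
have C1 e : 0 < e -> exists M, forall a b z, (M <= a)%N -> (M <= b)%N -> disc p r z ->
    nrm (quot (f a) p z - quot (f b) p z) <= e.
  move=> e0; pose e' := e / (8 / r) / 2.
  have e'0 : 0 < e' by rewrite !divr_gt0.
  have [M hM] := cv e' e'0; exists (maxn N M) => a b z; rewrite !geq_max => /andP[a1 a2] /andP[b1 b2] zr.
  rewrite -qsub //; have := @quot_bound_half _ (fun v => f a v - f b v) p r (2 * e') p z r0.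
  have -> : 8 * (2 * e') / r = e by rewrite /e'; field; rewrite gt_eqF.
  apply=> //; first by apply: hol_subr; exact: hf.
  move=> v vr; have := hM a a2 v vr; have := hM b b2 v vr.
  by have := nrm_distD (g v) (f a v) (f b v); rewrite (nrmC (g v)); lra.
have [l hl] : exists l, tends (fun n => quot (f n) p p) l.
  apply: cauchy_tends => e e0; have [M hM] := C1 (e / 2) ltac:(lra); exists M => a b Ma Mb.
  by apply: le_lt_trans (hM a b p Ma Mb pr) _; lra.
exists l; exists (fun v => if v == p then l else (g v - g p) / (v - p)); last first.
  move=> v; case: eqP => [->|/eqP vp]; first by rewrite subrr mulr0 addr0.
  by rewrite divfK ?subrKC // subr_eq0.
rewrite eqxx; split=> // e e0; rewrite eqxx.
have [M hM] := C1 (e / 4) ltac:(lra); pose a := maxn N M.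
have Na : (N <= a)%N by rewrite leq_maxl. have Ma : (M <= a)%N by rewrite leq_maxr.
have cq := quot_cont_on (hf a Na) pr pr.
have [d d0 hd] := cq (e / 4) ltac:(lra).
exists (Num.min d r); first by rewrite lt_min d0.
move=> v; rewrite lt_min => /andP[/hd v1 v2]; case: eqP => [_|/eqP vp]; first by rewrite subrr nrm0.
have h1 : nrm ((g v - g p) / (v - p) - quot (f a) p v) <= e / 4.
  have tv : tends (fun n => quot (f n) p v) ((g v - g p) / (v - p)).
    apply: (@tends_ext _ (fun n => (f n v - f n p) * (v - p)^-1)); first by move=> n; rewrite quot_neq.
    apply: tends_mul; last exact: tends_cst.
    by apply: tends_subr; apply: ucvg_tends cv _.
  by apply: tends_le tv _; exists M => n Mn; apply: hM.
have h2 : nrm (l - quot (f a) p p) <= e / 4.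
  by apply: tends_le hl _; exists M => n Mn; apply: hM.
set x := _ / _ in h1 *; have := nrm_distD (quot (f a) p v) x l.
have := nrm_distD (quot (f a) p p) (quot (f a) p v) l; have := nrmC l (quot (f a) p p); lra.
Qed.

Lemma lucvg_hol U f g : lhol U f -> lucvg U f g -> hol U g.
Proof.
move=> lf cv z Uz; have [r r0 [N hN]] := lf z Uz; have [s s0 hs] := cv z Uz.
apply: (@ucvg_hol_center f g z (Num.min r s) N); first by rewrite lt_min r0.
  by move=> n /hN; apply: hol_sub => w; apply: disc_le; rewrite ge_min lexx.
by apply: ucvg_sub hs => w; apply: disc_le; rewrite ge_min lexx orbT.
Qed.
Lemma ucvg_hol p r f g N : (forall n, (N <= n)%N -> hol (disc p r) (f n)) -> ucvg (disc p r) f g ->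
  hol (disc p r) g.
Proof.
move=> hf cv; apply: (@lucvg_hol _ f) => z /disc_open[s s0 hs]; exists s => //.
  by exists N => n /hf; exact: hol_sub.
exact: ucvg_sub cv.
Qed.

Lemma ucvg_der p r f g N : 0 < r -> (forall n, (N <= n)%N -> hol (disc p r) (f n)) ->
  ucvg (disc p r) f g -> ucvg (disc p (r / 2)) (fun n => der (f n)) (der g).
Proof.
move=> r0 hf cv e e0; have hg := ucvg_hol hf cv.
pose e' := e / (8 / r) / 2; have e'0 : 0 < e' by rewrite !divr_gt0.
have [M hM] := cv e' e'0; exists (maxn N M) => n; rewrite geq_max => /andP[Nn Mn] z zr.
have zr' : disc p r z by apply: disc_le zr; lra.
have -> : der (f n) z - der g z = der (fun v => f n v - g v) z.
  by apply/esym; apply: derE; apply: cder_sub; apply: hol_der zr' => //; exact: hf.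
apply: (@le_lt_trans _ _ (8 * e' / r)); last first.
  by have -> : 8 * e' / r = e / 2 by [rewrite /e'; field; rewrite gt_eqF]; lra.
apply: der_bound zr => //; first by apply: hol_subr => //; exact: hf.
by move=> v vr; apply: ltW; exact: hM.
Qed.

Lemma lhol_der U f : lhol U f -> lhol U (fun n => der (f n)).
Proof.
move=> h z /h[r r0 [N hN]]; exists r => //; exists N => n /hN; exact: der_hol_disc.
Qed.
Lemma lucvg_der U f g : lhol U f -> lucvg U f g -> lucvg U (fun n => der (f n)) (der g).
Proof.
move=> lf cv z Uz; have [r r0 [N hN]] := lf z Uz; have [s s0 hs] := cv z Uz.
pose t := Num.min r s; have t0 : 0 < t by rewrite lt_min r0.
exists (t / 2); first by rewrite divr_gt0.
apply: (@ucvg_der _ _ _ _ N) => //.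
  by move=> n /hN; apply: hol_sub => w; apply: disc_le; rewrite ge_min lexx.
by apply: ucvg_sub hs => w; apply: disc_le; rewrite ge_min lexx orbT.
Qed.
Lemma lhol_dern U f k : lhol U f -> lhol U (fun n => dern k (f n)).
Proof. by move=> h; elim: k => // k IH; exact: lhol_der IH. Qed.
Lemma lucvg_dern U f g k : lhol U f -> lucvg U f g -> lucvg U (fun n => dern k (f n)) (dern k g).
Proof. by move=> lf h; elim: k => // k IH; apply: lucvg_der => //; exact: lhol_dern. Qed.

Lemma lucvg_point U f g u z : U z -> lhol U f -> lucvg U f g -> tends u z -> tends (fun n => f n (u n)) (g z).
Proof.
move=> Uz lf cv hu e e0; have [d hd] := lucvg_hol lf cv Uz; have cg := cder_cont hd.
have [r r0 hr] := cv z Uz.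
have [s s0 hs] := cg (e / 2) ltac:(lra); have [N hN] := hr (e / 2) ltac:(lra).
have [M hM] := hu (Num.min r s) ltac:(by rewrite lt_min r0).
exists (maxn N M) => n; rewrite geq_max => /andP[/hN n1 /hM].
rewrite lt_min => /andP[/n1 a /hs b].
by have := nrm_distD (g (u n)) (f n (u n)) (g z); lra.
Qed.

(** On an annulus around p one has |g| >= c > 0. If f n had no zero inside, 1 / f n would be bounded
    by 2/c on the annulus and so at p, although f n p tends to 0. *)
Lemma hurwitz_aux f g p r d N0 : 0 < r -> (forall n, (N0 <= n)%N -> hol (disc p r) (f n)) ->
  ucvg (disc p r) f g -> g p = 0 -> ~ (exists2 s, 0 < s & forall z, disc p s z -> g z = 0) ->
  0 < d -> exists N, forall n, (N <= n)%N -> exists2 z, disc p d z & f n z = 0.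
Proof.
move=> r0 hf cv gp nz d0; have hg := ucvg_hol hf cv.
have [//|[k [_ qk gk]]] := hol_factor r0 hg; set q := iterq g p k in qk gk.
have cq : ccont q p := hol_cont (iterq_hol k hg) (disc_center p r0).
have q0 : 0 < nrm (q p) by rewrite nrm_gt0.
have [s1 s10 hs1] := cq (nrm (q p) / 2) ltac:(lra).
pose s := Num.min s1 (Num.min d r).
have s0 : 0 < s by rewrite !lt_min s10 d0.
have [ss1 sd sr] : [/\ s <= s1, s <= d & s <= r] by rewrite !ge_min !lexx !orbT.
pose c := (s / 2) ^+ k * (nrm (q p) / 2).
have c0 : 0 < c by rewrite mulr_gt0 ?exprn_gt0 // divr_gt0.
have low z : s / 2 < nrm (z - p) < s -> c <= nrm (g z).
  move=> /andP[z1 z2]; rewrite gk nrmM nrmX; apply: ler_pM.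
  - by rewrite exprn_ge0 // divr_ge0 // ltW.
  - by rewrite divr_ge0 // ltW.
  - by rewrite lerXn2r ?nnegrE ?nrm_ge0 ?divr_ge0 // ltW.
  - by have := hs1 z ltac:(lra); have := nrm_lerB (q p) (q z); rewrite nrmC; lra.
have [N hN] := cv (c / 2) ltac:(lra).
exists (maxn N0 N) => n; rewrite geq_max => /andP[n0 n1].
apply: contrapT => H.
have fz z : disc p s z -> f n z != 0.
  by move=> zs; apply/eqP => E; apply: H; exists z => //; apply: disc_le zs.
have hfn : hol (disc p s) (fun z => (f n z)^-1).
  by apply: hol_inv fz; apply: hol_sub (hf n n0) => z; exact: disc_le.
have ps : disc p s p by exact: disc_center.
have := @max_disc _ (fun z => (f n z)^-1) p s (s / 2) (2 / c) ltac:(lra) hfn _ p ps.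
have fp : nrm (f n p) < c / 2 by have := hN n n1 p (disc_center p r0); rewrite gp subr0.
have fp0 : 0 < nrm (f n p) by rewrite nrm_gt0 fz.
have H2 : forall z : C, s / 2 < nrm (z - p) < s -> nrm (f n z)^-1 <= 2 / c.
  move=> z zz; have := low z zz; move/andP: zz => [_ zs] lz.
  have := hN n n1 z ltac:(by rewrite /disc; lra) => hz.
  have : c / 2 <= nrm (f n z) by have := nrm_lerB (g z) (f n z); rewrite nrmC; lra.
  move=> h; rewrite nrmV -[2 / c]invrK lef_pV2 ?posrE ?invr_gt0 ?divr_gt0 //; last lra.
  by rewrite invf_div.
move=> /(_ H2); rewrite nrmV -[2 / c]invrK lef_pV2 ?posrE ?invr_gt0 ?divr_gt0 // invf_div; lra.
Qed.

Lemma hurwitz U f g p : U p -> lhol U f -> lucvg U f g -> g p = 0 ->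
  ~ (exists2 s, 0 < s & forall z, disc p s z -> g z = 0) ->
  exists2 u, tends u p & exists N, forall n, (N <= n)%N -> f n (u n) = 0.
Proof.
move=> Up lf cv gp nz; have [r r0 [N0 hN0]] := lf p Up; have [s s0 hs] := cv p Up.
pose t := Num.min r s; have t0 : 0 < t by rewrite lt_min r0.
have H d : 0 < d -> exists N, forall n, (N <= n)%N -> exists2 z, disc p d z & f n z = 0.
  apply: (@hurwitz_aux f g p t d N0) => //.
    by move=> n /hN0; apply: hol_sub => w; apply: disc_le; rewrite ge_min lexx.
  by apply: ucvg_sub hs => w; apply: disc_le; rewrite ge_min lexx orbT.
(* One choice must serve all radii: u n is a zero of f n whose distance to p is minimal up to
   1/(n+1). *)
have [|u hu] := @choice nat C (fun n w => (exists z, f n z = 0) ->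
    f n w = 0 /\ forall z, f n z = 0 -> nrm (w - p) <= nrm (z - p) + n.+1%:R^-1).
  move=> n; have [[z0 hz0]|h] := pselect (exists z, f n z = 0); last by exists 0.
  pose S := [set x : R | exists2 z, f n z = 0 & x = nrm (z - p)].
  have Slb : has_lbound S by exists 0 => _ [z _ ->]; exact: nrm_ge0.
  have Sn : S !=set0 by exists (nrm (z0 - p)); exists z0.
  have n0 : 0 < n.+1%:R^-1 :> R by rewrite invr_gt0.
  have [|x [z hz ->] hx] := @inf_adherent _ S _ n0; first by split.
  exists z => _; split=> // w hw.
  have : inf S <= nrm (w - p) by apply: ge_inf => //; exists w.
  by move: hx; set a := inf S; set b := _^-1; lra.
exists u; last first.
  by have [N hN] := H 1 ltr01; exists N => n /hN[z _ hz]; apply: (hu n _).1; exists z.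
move=> e e0; have [N hN] := H (e / 2) ltac:(lra).
have [M hM] := inv_nat_small (e := e / 2) ltac:(lra).
exists (maxn N M) => n; rewrite geq_max => /andP[/hN[z zd hz] /hM hn].
have := (hu n (ex_intro _ z hz)).2 z hz; move: zd; rewrite /disc.
by move: hn; set b := _^-1; lra.
Qed.

(** Along a diagonal subsequence every Taylor coefficient at p converges; on radius r/16 the
    remainders are uniformly geometric, so the subsequence is uniformly Cauchy. *)
Lemma montel f p r m : 0 < r -> (forall n, hol (disc p r) (f n)) ->
  (forall n z, disc p r z -> nrm (f n z) <= m) ->
  exists2 phi, sinc phi & exists g, ucvg (disc p (r / 16)) (fun n => f (phi n)) g.
Proof.
move=> r0 hf hm; have m0 : 0 <= m := le_trans (nrm_ge0 _) (hm 0%N p (disc_center p r0)).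
have [||phi sp hphi] := @diag_subseq (fun j phi => exists l, tends (fun n => iterq (f (phi n)) p j p) l).
- move=> j phi sp.
  have [psi s2 [l hl]] := @bounded_sub _ (fun n => iterq (f (phi n)) p j p) (m * (8 / r) ^+ j)
    (fun n => iterq_bound j r0 (hf _) (hm _) (disc_center p r0)).
  by exists psi => //; exists l.
- move=> j phi chi [l hl] _ hc; exists l.
  exact: (@tends_esub _ (fun n => iterq (f n) p j p) l phi).
exists phi => //; pose F n := f (phi n).
have small z : disc p (r / 16) z -> nrm (z - p) <= r / 16 by move=> h; exact: ltW.
have UC e : 0 < e -> exists N, forall a b z, (N <= a)%N -> (N <= b)%N -> disc p (r / 16) z ->
    nrm (F a z - F b z) <= e.
  move=> e0.
  have [J hJ] := pow2_small (e := e / (4 * (m + 1))) ltac:(by rewrite divr_gt0 // mulr_gt0 //; lra).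
  have [N hN] : exists N, forall a b z, (N <= a)%N -> (N <= b)%N -> disc p (r / 16) z ->
      nrm (\sum_(j < J) (iterq (F a) p j p - iterq (F b) p j p) * (z - p) ^+ j) <= e / 2.
    have e2 : 0 < e / 2 by lra.
    elim: J {hJ} (e / 2) e2 => [|J IH] t t0; last first.
    - have [N1 h1] := IH (t / 2) ltac:(lra).
      have [l hl] := hphi J; pose K := (r / 16) ^+ J; have K0 : 0 < K by rewrite exprn_gt0 // divr_gt0.
      have [N2 h2] := hl (t / 4 / K) ltac:(by rewrite !divr_gt0).
      exists (maxn N1 N2) => a b z; rewrite !geq_max => /andP[a1 a2] /andP[b1 b2] zr.
      rewrite big_ord_recr /=; apply: le_trans (nrmD _ _) _.
      have := h1 a b z a1 b1 zr; rewrite nrmM nrmX.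
      have hz : nrm (z - p) ^+ J <= K by rewrite lerXn2r ?nnegrE ?nrm_ge0 ?divr_ge0 ?small // ltW.
      have hd : nrm (iterq (F a) p J p - iterq (F b) p J p) <= t / 2 / K.
        have := h2 a a2; have := h2 b b2.
        have := nrm_distD l (iterq (F a) p J p) (iterq (F b) p J p); have := nrmC l (iterq (F b) p J p).
        have -> : t / 2 / K = t / 4 / K + t / 4 / K by field; rewrite gt_eqF.
        rewrite /F; lra.
      have := ler_pM (nrm_ge0 _) (exprn_ge0 _ (nrm_ge0 _)) hd hz; rewrite divfK ?gt_eqF //; lra.
    - by exists 0%N => a b z _ _ _; rewrite big_ord0 nrm0 ltW.
  exists N => a b z Na Nb zr.
  rewrite (taylor (F a) p J) (taylor (F b) p J).
  have -> : \sum_(j < J) iterq (F a) p j p * (z - p) ^+ j + (z - p) ^+ J * iterq (F a) p J z -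
    (\sum_(j < J) iterq (F b) p j p * (z - p) ^+ j + (z - p) ^+ J * iterq (F b) p J z) =
    \sum_(j < J) (iterq (F a) p j p - iterq (F b) p j p) * (z - p) ^+ j +
     ((z - p) ^+ J * iterq (F a) p J z - (z - p) ^+ J * iterq (F b) p J z).
    rewrite opprD addrACA; congr (_ + _); rewrite -sumrB; apply: eq_bigr => j _; ring.
  apply: le_trans (nrmD _ _) _; have := hN a b z Na Nb zr.
  have zr' : disc p r z by apply: disc_le zr; lra.
  have tail n : nrm ((z - p) ^+ J * iterq (F n) p J z) <= e / 4.
    rewrite nrmM nrmX; have B := iterq_bound J r0 (hf (phi n)) (hm (phi n)) zr'.
    have hz : nrm (z - p) ^+ J <= (r / 16) ^+ J by rewrite lerXn2r ?nnegrE ?nrm_ge0 ?divr_ge0 ?small // ltW.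
    apply: le_trans (ler_pM (exprn_ge0 _ (nrm_ge0 _)) (nrm_ge0 _) hz B) _.
    rewrite mulrCA -exprMn; have -> : r / 16 * (8 / r) = 1 / 2 by field; rewrite gt_eqF.
    have := hJ J (leqnn _); rewrite ltr_pdivlMr; last by rewrite mulr_gt0 //; lra.
    have : 0 <= (1 / 2 : R) ^+ J by apply: exprn_ge0; rewrite divr_ge0.
    nra.
  by have := tail a; have := tail b; have := nrmB ((z - p) ^+ J * iterq (F a) p J z) ((z - p) ^+ J * iterq (F b) p J z); lra.
have [|g hg] := @choice C C (fun z l => disc p (r / 16) z -> tends (fun n => F n z) l).
  move=> z; have [zr|zr] := pselect (disc p (r / 16) z); last by exists 0.
  have [l hl] : exists l, tends (fun n => F n z) l; last by exists l.
  apply: cauchy_tends => e e0; have [N hN] := UC (e / 2) ltac:(lra); exists N => a b Na Nb.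
  by apply: le_lt_trans (hN a b z Na Nb zr) _; lra.
exists g => e e0; have [N hN] := UC (e / 2) ltac:(lra); exists N => n Nn z zr.
rewrite nrmC; apply: (@le_lt_trans _ _ (e / 2)); last lra.
by apply: tends_le (hg z zr) _; exists N => k Nk; exact: hN.
Qed.

End Convergence.

(** * Entire functions of exponential type *)

Section Growth.
Variable R : realType.
Local Notation C := (Cplx R).
Local Notation disc := (@disc R).
Local Notation hol := (@hol R).
Local Notation der := (@der R).
Local Notation dern := (@dern R).

Lemma hol_plane f p r : hol (fun=> True) f -> hol (disc p r) f.
Proof. exact: hol_sub. Qed.

Lemma segment_const (f : C -> C) p z : (forall t : R, 0 <= t <= 1 -> cder f (p + toC t * (z - p)) 0) -> f z = f p.
Proof.
move=> h; apply/eqP; rewrite -subr_eq0 -nrm_eq0 eq_le nrm_ge0 andbT.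
have D t : rder (fun s => p + toC s * (z - p)) t (z - p).
  have := rder_add (rder_cst p t) (rder_mul (rder_toC t) (rder_cst (z - p) t)).
  by congr rder; ring.
have M := @mean_value_ineq _ (fun s => f (p + toC s * (z - p))) (fun=> 0 * (z - p)) 0 1 0 ler01
  (fun t ht => @rder_comp _ f (fun s => p + toC s * (z - p)) t _ _ (h t ht) (D t)) _.
have {}M : nrm (f (p + toC 1 * (z - p)) - f (p + toC 0 * (z - p))) <= 0 * (1 - 0).
  by apply: M => t _; rewrite mul0r nrm0.
by move: M; rewrite toC0 toC1 mul1r !mul0r addr0 subrKC.
Qed.

Lemma disc_const (f : C -> C) p r z : (forall w, disc p r w -> cder f w 0) -> disc p r z -> f z = f p.
Proof.
move=> h zr; apply: segment_const => t /andP[t0 t1]; apply: h; apply: le_lt_trans zr.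
rewrite addrAC subrr add0r nrmM nrm_toC ger0_norm //.
by have := nrm_ge0 (z - p); nra.
Qed.

Lemma plane_const (f : C -> C) : (forall w, cder f w 0) -> forall z, f z = f 0.
Proof. by move=> h z; apply: segment_const. Qed.

(** The product f exp(-F) has derivative 0. That it is then constant depends on the shape of U and
    is left as a premise, discharged by segments in a disc or in the plane. *)
Lemma log_of_primitive (U : C -> Prop) f F p : U p -> (forall z, U z -> f z != 0) ->
  hol U f -> (forall z, U z -> cder F z (der f z / f z)) ->
  ((forall z, U z -> cder (fun w => f w * cexp (- F w)) z 0) ->
     forall z, U z -> f z * cexp (- F z) = f p * cexp (- F p)) ->
  exists2 L, (forall z, U z -> cder L z (der f z / f z)) & forall z, U z -> f z = cexp (L z).
Proof.
move=> Up f0 hf hF hc.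
have c0 : f p * cexp (- F p) != 0 by rewrite mulf_neq0 ?f0 ?cexp_neq0.
have [w hw] := cexp_surj c0.
exists (fun z => F z + w).
  by move=> z Uz; rewrite -[X in cder _ _ X]addr0; apply: cder_add; [exact: hF|exact: cder_cst].
move=> z Uz; rewrite cexpD hw -(hc _ z Uz) ?cexpN.
  by rewrite mulrCA divff ?mulr1 // cexp_neq0.
move=> v Uv; have hE := @cder_comp _ (@cexp R) (fun w => - F w) v _ _ (cder_cexp _) (cder_opp (hF v Uv)).
have := cder_mul (hol_der hf Uv) hE; congr cder.
move: (f0 v Uv); move: (der f v) (f v) (cexp (- F v)) => x y t y0.
by field.
Qed.

Lemma log_disc f p r s : 0 < r -> r < s -> hol (disc p s) f -> (forall z, disc p s z -> f z != 0) ->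
  exists2 L, hol (disc p r) L & forall z, disc p r z -> f z = cexp (L z).
Proof.
move=> r0 rs hf f0.
have sub z : disc p r z -> disc p s z by apply: disc_le; exact: ltW.
have hq : hol (disc p s) (fun z => der f z / f z).
  by apply: hol_mul; [exact: der_hol_disc|exact: hol_inv].
have [F hF] := primitive_disc r0 rs hq.
have [||L h1 h2] := @log_of_primitive (disc p r) f F p (disc_center p r0) _ (hol_sub sub hf) hF.
- by move=> z /sub; exact: f0.
- by move=> h z zr; exact: (disc_const h zr).
by exists L => // z zr; exists (der f z / f z); exact: h1.
Qed.

Lemma log_plane f : hol (fun=> True) f -> (forall z, f z != 0) ->
  exists2 L, hol (fun=> True) L & forall z, f z = cexp (L z).
Proof.
move=> hf f0.
have hq : hol (fun=> True) (fun z => der f z / f z).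
  by apply: hol_mul; [exact: (dern_hol_plane 1)|apply: hol_inv].
have [F hF] := primitive_plane hq.
have [|||L h1 h2] := @log_of_primitive (fun=> True) f F 0 I _ hf.
- by move=> z _; exact: f0.
- by move=> z _; exact: hF.
- by move=> h z _; exact: (plane_const (fun w => h w I)).
by exists L => [z _|z]; [exists (der f z / f z); exact: h1|exact: h2].
Qed.

Lemma schwarz f p r z : 0 < r -> hol (disc p r) f -> f p = 0 -> (forall w, disc p r w -> nrm (f w) <= 1) ->
  disc p r z -> nrm (f z) <= nrm (z - p) / r.
Proof.
move=> r0 hf fp hm zr; rewrite ler_pdivlMr //.
apply/ler_addgt0Pr => e e0; have n0 := nrm_ge0 (f z).
(* [quot_bound] works on radii r' < r only; with this t, replacing r by r - t costs at most e. *)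
pose t := Num.min (r / 2) (e / (nrm (f z) + 1)).
have t0 : 0 < t by rewrite lt_min !divr_gt0 //; lra.
have t1 : t <= r / 2 by rewrite ge_min lexx.
have t2 : t * (nrm (f z) + 1) <= e by rewrite -ler_pdivlMr ?ge_min ?lexx ?orbT //; lra.
pose r' := r - t; have r'0 : 0 < r' by rewrite /r'; lra.
have r'r : r' < r by rewrite /r'; lra.
have := @quot_bound _ f p r r' p r'^-1 r'r (ltW _) hf.
rewrite invr_gt0 subrr nrm0 => /(_ r'0 (ltW r'0)) Q.
have {}Q : nrm (quot f p z) <= r'^-1.
  apply: Q => // w /andP[w1 w2]; rewrite fp subr0; apply: le_trans (hm w w2) _.
  by rewrite mulrC ler_pdivlMr // mul1r ltW.
have : nrm (f z) * r' <= nrm (z - p).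
  rewrite (quotE f p z) fp add0r nrmM -mulrA -[leRHS]mulr1 ler_wpM2l ?nrm_ge0 //.
  by rewrite -ler_pdivlMr // div1r.
rewrite /r'; nra.
Qed.

(** The map L / (2A - L) sends the half-plane re <= A into the unit disc, so by Schwarz |L| <= |2A -
    L| / 2 at half the radius, and hence |L| <= 2A. *)
Lemma borel_caratheodory L p r A z : 0 < r -> 0 < A -> hol (disc p r) L -> L p = 0 ->
  (forall w, disc p r w -> re (L w) <= A) -> nrm (z - p) <= r / 2 -> nrm (L z) <= 2 * A.
Proof.
move=> r0 A0 hL Lp hA zr.
have zr' : disc p r z by rewrite /disc; lra.
have den w : disc p r w -> toC (2 * A) - L w != 0.
  move=> /hA h; apply/eqP => /(congr1 (@re R)); rewrite !cpxE; lra.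
have le w : disc p r w -> nrm (L w) <= nrm (toC (2 * A) - L w).
  move=> /hA h; rewrite -(@ler_pXn2r _ 2) ?nnegrE ?nrm_ge0 // !nrm_sqr !cpxE; nra.
have := @schwarz (fun w => L w / (toC (2 * A) - L w)) p r z r0.
rewrite Lp mul0r => S.
have {}S : nrm (L z / (toC (2 * A) - L z)) <= nrm (z - p) / r.
  apply: S => //.
    by apply: hol_mul => //; apply: hol_inv => //; apply: hol_subr => //; exact: hol_cst.
  move=> w wr; rewrite nrmM nrmV ler_pdivrMr ?mul1r; first exact: le.
  by rewrite nrm_gt0 den.
have t12 : nrm (z - p) / r <= 1 / 2 by rewrite ler_pdivrMr //; lra.
have D0 : 0 < nrm (toC (2 * A) - L z) by rewrite nrm_gt0 den.
move: S; rewrite nrmM nrmV ler_pdivrMr // => S.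
have := nrmB (toC (2 * A)) (L z); rewrite nrm_toC ger0_norm; last lra.
by have := nrm_ge0 (L z); nra.
Qed.

(** The Cayley transform (L - L(p)) / (L + conj L(p)) maps the right half-plane to the unit disc and
    p to 0; Schwarz's inequality, squared, is then solved for the real parts. *)
Lemma harnack_re L p d w : 0 < d -> hol (disc p d) L -> (forall z, disc p d z -> 0 < re (L z)) ->
  disc p d w -> (d - nrm (w - p)) * re (L p) <= (d + nrm (w - p)) * re (L w).
Proof.
move=> d0 hL hp wd; have pd := disc_center p d0.
have x0 := hp p pd.
have den z : disc p d z -> L z + cj (L p) != 0.
  move=> /hp h; apply/eqP => /(congr1 (@re R)); rewrite !cpxE; lra.
have S : nrm ((L w - L p) / (L w + cj (L p))) <= nrm (w - p) / d.
  apply: (@schwarz (fun z => (L z - L p) / (L z + cj (L p)))) => //.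
  - apply: hol_mul; first by apply: hol_subr => //; exact: hol_cst.
    by apply: hol_inv => //; apply: hol_add => //; exact: hol_cst.
  - by rewrite subrr mul0r.
  move=> z zd; rewrite nrmM nrmV ler_pdivrMr ?mul1r ?nrm_gt0 ?den //.
  rewrite -(@ler_pXn2r _ 2) ?nnegrE ?nrm_ge0 // !nrm_sqr !cpxE; have := hp z zd; nra.
have xw := hp w wd; set t := nrm (w - p) in S *.
have t0 : 0 <= t := nrm_ge0 _. have td : t < d := wd.
clearbody t.
move: S; rewrite nrmM nrmV ler_pdivrMr ?nrm_gt0 ?den // mulrAC ler_pdivlMr // => S.
have {}S : (nrm (L w - L p) * d) ^+ 2 <= (t * nrm (L w + cj (L p))) ^+ 2.
  by rewrite lerXn2r ?nnegrE ?mulr_ge0 ?nrm_ge0 // ltW.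
move: S; rewrite !exprMn !nrm_sqr !cpxE.
move: (re (L w)) (re (L p)) (im (L w)) (im (L p)) xw x0 => x y a b x0 y0 S.
rewrite leNgt; apply/negP => H.
have H1 : 0 < (y - x) * d - t * (x + y) by lra.
have H2 : 0 < (y - x) * d + t * (x + y) by have : 0 <= t * (x + y) by [rewrite mulr_ge0 //; lra]; lra.
have H3 : 0 < ((y - x) * d - t * (x + y)) * ((y - x) * d + t * (x + y)) by rewrite mulr_gt0.
have H4 : 0 <= (a - b) ^+ 2 * ((d - t) * (d + t)) by rewrite mulr_ge0 ?sqr_ge0 // mulr_ge0 //; lra.
have E : (x - y) ^+ 2 * d ^+ 2 + (a - b) ^+ 2 * d ^+ 2 - t ^+ 2 * ((x + y) ^+ 2 + (a - b) ^+ 2) =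
  ((y - x) * d - t * (x + y)) * ((y - x) * d + t * (x + y)) + (a - b) ^+ 2 * ((d - t) * (d + t)) by ring.
move: S; rewrite mulrDl; move: E H3 H4; lra.
Qed.

Lemma harnack f p d w : hol (disc p d) f -> (forall z, disc p d z -> 1 < nrm (f z)) ->
  disc p d w -> (d - nrm (w - p)) * ln (nrm (f p)) <= (d + nrm (w - p)) * ln (nrm (f w)).
Proof.
move=> hf f1 wd; have d0 : 0 < d := le_lt_trans (nrm_ge0 _) wd.
have f0 z : disc p d z -> f z != 0 by move=> /f1 h; rewrite -nrm_gt0; lra.
have H r : nrm (w - p) < r -> r < d ->
    (r - nrm (w - p)) * ln (nrm (f p)) <= (r + nrm (w - p)) * ln (nrm (f w)).
  move=> wr rd; have r0 : 0 < r := le_lt_trans (nrm_ge0 _) wr.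
  have [L hL Lf] := log_disc r0 rd hf f0.
  have E z : disc p r z -> re (L z) = ln (nrm (f z)) by move=> zr; rewrite Lf // nrm_cexp expRK.
  rewrite -!E //; last exact: disc_center.
  apply: harnack_re => // z zr; rewrite E //; apply: ln_gt0; apply: f1.
  by apply: disc_le zr; exact: ltW.
move: H (wd); rewrite /disc; set t := nrm (w - p); set u := ln _; set v := ln _ => H td.
rewrite leNgt; apply/negP => h.
pose g := (d - t) * u - (d + t) * v; have g0 : 0 < g by rewrite /g; lra.
(* The logarithm exists on radii r < d only; a failure by g at radius d would persist at radius d -
   e. *)
pose e := Num.min ((d - t) / 2) (g / (2 * (`|u - v| + 1))).
have e0 : 0 < e by rewrite lt_min !divr_gt0 ?mulr_gt0 //; have := normr_ge0 (u - v); lra.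
have e1 : e <= (d - t) / 2 by rewrite ge_min lexx.
have e2 : e * (2 * (`|u - v| + 1)) <= g.
  by rewrite -ler_pdivlMr ?ge_min ?lexx ?orbT // mulr_gt0 //; have := normr_ge0 (u - v); lra.
have := H (d - e) ltac:(lra) ltac:(lra).
have := ler_norm (u - v); rewrite /g in e2 g0; have : 0 <= `|u - v| by [].
by clearbody e u v t; clear H; nra.
Qed.

Lemma nearest_point (A : C -> Prop) z a0 : A a0 ->
  (forall u l, tends u l -> (forall n, A (u n)) -> A l) ->
  exists2 w, A w & forall v, A v -> nrm (w - z) <= nrm (v - z).
Proof.
move=> A0 cl; pose S := [set x : R | exists2 v, A v & x = nrm (v - z)].
have Slb : has_lbound S by exists 0 => _ [v _ ->]; exact: nrm_ge0.
have Sn : S !=set0 by exists (nrm (a0 - z)); exists a0.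
have Hn n : exists w, A w /\ nrm (w - z) < inf S + n.+1%:R^-1.
  have n0 : 0 < n.+1%:R^-1 :> R by rewrite invr_gt0.
  by have [|x [w Aw ->] hw] := @inf_adherent _ S _ n0; [split|exists w].
have [u hu] := @choice nat C _ Hn.
have bu n : nrm (u n) <= inf S + 1 + nrm z.
  have : n.+1%:R^-1 <= 1 :> R by rewrite invf_le1 ?ler1n.
  have := (hu n).2; have := nrm_lerB (u n) z; move: (n.+1%:R^-1) => b; lra.
have [phi sp [l hl]] := bounded_sub bu.
exists l; first by apply: cl hl _ => n; exact: (hu _).1.
move=> v Av; apply/ler_addgt0Pr => e e0.
have hv : inf S <= nrm (v - z) by apply: ge_inf => //; exists v.
have [N hN] := inv_nat_small e0.
apply: tends_le hl _; exists N => n Nn.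
have := (hu (phi n)).2; have := hN (phi n) (leq_trans Nn (sinc_ge n sp)); rewrite /=.
by set b := _^-1; lra.
Qed.

(* Clunie-Hayman, by the argument of Pommerenke: at a boundary point of
   {|Gam| > 1} nearest to z the gradient of log|Gam| is bounded, while by
   Harnack it is at least log|Gam z| / 2d. *)
Lemma clunie_hayman Gam S K : 0 <= S -> 0 <= K -> hol (fun z => 1 < nrm z) Gam ->
  (forall z, nrm z = 2 -> nrm (Gam z) <= expR S) ->
  (forall z, 1 < nrm z -> nrm (Gam z) = 1 -> nrm (der Gam z) <= K) ->
  forall z, 2 <= nrm z -> nrm (Gam z) <= expR ((2 * (K + 1) + 2 * S) * nrm z).
Proof.
move=> S0 K0 hG h2 hK z z2.
have z0 : z != 0 by rewrite -nrm_gt0; lra.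
have pos : 0 <= (2 * (K + 1) + 2 * S) * nrm z by rewrite mulr_ge0 //; lra.
have [g1|g1] := leP (nrm (Gam z)) 1.
  by apply: le_trans g1 _; rewrite -[leLHS]expR0 ler_expR.
(* Gam is controlled only outside the unit disc, so that disc is treated as part of the set to be
   avoided; the nearest point may lie in either piece. *)
pose A w := nrm w <= 1 \/ nrm (Gam w) <= 1.
have clA u l : tends u l -> (forall n, A (u n)) -> A l.
  move=> hu hA; have [l1|l1] := leP (nrm l) 1; [by left|right].
  have [N hN] := hu (nrm l - 1) ltac:(lra).
  apply: tends_le0 (tends_cont (hol_cont hG l1) hu) _; exists N => n /hN hn.
  case: (hA n) => // un; have := nrm_lerB l (u n); rewrite nrmC; lra.
have [w Aw wmin] := @nearest_point A z 0 ltac:(by left; rewrite nrm0) clA.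
pose d := nrm (w - z).
have dz : d <= nrm z by apply: le_trans (wmin 0 _) _; [left; rewrite nrm0|rewrite sub0r nrmN].
have d0 : 0 < d.
  rewrite nrm_gt0 subr_eq0; apply/eqP => E; move: Aw; rewrite E => -[]; lra.
have nA v : disc z d v -> 1 < nrm v /\ 1 < nrm (Gam v).
  rewrite /disc => vd; split; rewrite ltNge; apply/negP => h.
    have : d <= nrm (v - z) by apply: wmin; left.
    lra.
  have : d <= nrm (v - z) by apply: wmin; right.
  lra.
have hGd : hol (disc z d) Gam by apply: hol_sub hG => v /nA[].
have H v : disc z d v -> (d - nrm (v - z)) * ln (nrm (Gam z)) <= (d + nrm (v - z)) * ln (nrm (Gam v)).
  by move=> vd; apply: harnack => // t /nA[].
have g0 : 0 < nrm (Gam z) by lra.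
rewrite -[leLHS]lnK ?posrE // ler_expR; set u := ln _ in H *.
have u0 : 0 < u by exact: ln_gt0.
have [w1|w1] := leP (nrm w) 1.
  (* If the nearest point lies in the unit disc then d = |z| - 1, and Harnack compares z with the
     point of modulus 2 on its ray, where the bound exp S is known. *)
  pose v := z * toC (2 / nrm z).
  have nz : 0 < nrm z by lra.
  have nv : nrm v = 2 by rewrite nrmM nrm_toC ger0_norm ?divr_ge0 ?nrm_ge0 // mulrC divfK // gt_eqF.
  have dv : nrm (v - z) = nrm z - 2.
    have -> : v - z = - (z * toC (1 - 2 / nrm z)) by rewrite /v toCB toC1; ring.
    rewrite nrmN nrmM nrm_toC ger0_norm; last by rewrite subr_ge0 ler_pdivrMr // mul1r.
    by rewrite mulrBr mulr1 mulrCA divff ?mulr1 // gt_eqF.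
  have dz1 : d = nrm z - 1.
    apply/eqP; rewrite eq_le; apply/andP; split; last by have := nrm_lerB z w; rewrite nrmC -/d; lra.
    pose q := z * toC (nrm z)^-1.
    have nq : nrm q = 1 by rewrite nrmM nrm_toC ger0_norm ?invr_ge0 ?nrm_ge0 // divff // gt_eqF.
    apply: le_trans (wmin q _) _; first by left; rewrite nq.
    have -> : q - z = - (z * toC (1 - (nrm z)^-1)) by rewrite /q toCB toC1; ring.
    rewrite nrmN nrmM nrm_toC ger0_norm; last by rewrite subr_ge0 invf_le1 //; lra.
    by rewrite mulrBr mulr1 divff // gt_eqF.
  have := H v ltac:(by rewrite /disc dv dz1; lra).
  have vS : ln (nrm (Gam v)) <= S.
    rewrite -(expRK S) ler_ln ?posrE ?expR_gt0 ?h2 //.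
    by have [] := nA v ltac:(by rewrite /disc dv dz1; lra); lra.
  rewrite dv dz1; move: vS; set x := ln _ => vS.
  have P : (nrm z - 1 + (nrm z - 2)) * x <= (nrm z - 1 + (nrm z - 2)) * S by rewrite ler_wpM2l //; lra.
  have : 0 <= (K + 1) * nrm z by rewrite mulr_ge0 //; lra.
  nra.
have Gw : nrm (Gam w) <= 1 by case: Aw => //; lra.
have cG := hol_cont hG w1.
pose v h := w + toC (h / d) * (z - w).
have nvw h : 0 <= h -> nrm (v h - w) = h.
  move=> h0; rewrite /v addrAC subrr add0r nrmM nrm_toC ger0_norm; last by rewrite divr_ge0 // ltW.
  by rewrite nrmC -/d divfK // gt_eqF.
have nvz x : 0 < x -> x < d -> nrm (v x - z) = d - x.
  move=> h0 hd; have -> : v x - z = toC (1 - x / d) * (w - z) by rewrite /v toCB toC1; ring.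
  rewrite nrmM nrm_toC ger0_norm -/d; last by rewrite subr_ge0 ler_pdivrMr // mul1r ltW.
  by rewrite mulrBl mul1r divfK // gt_eqF.
have Gw1 : nrm (Gam w) = 1.
  apply/eqP; rewrite eq_le Gw /=; apply/ler_addgt0Pr => e e0.
  have [t t0 ht] := cG e e0; pose h := Num.min t d / 2.
  have m0 : 0 < Num.min t d by rewrite lt_min t0.
  have h0 : 0 < h by rewrite divr_gt0.
  have [mt md] : Num.min t d <= t /\ Num.min t d <= d by rewrite !ge_min !lexx !orbT.
  have hv := ht (v h) ltac:(by rewrite nvw ?ltW // /h; lra).
  have [_] := nA (v h) ltac:(by rewrite /disc nvz //; rewrite /h; lra).
  by have := nrm_lerB (Gam (v h)) (Gam w); lra.
have := hol_der hG w1 => -[phi [p0 cp] hphi].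
have pK : nrm (phi w) <= K by rewrite p0; exact: hK.
have [t t0 ht] := cp 1 ltr01.
(* At distance h from w the slope of Gam is within 1 of its derivative at w, which is the origin of
   K + 1; Harnack at that point gives h u <= 2d (K + 1) h. *)
pose h := Num.min t d / 2.
have m0 : 0 < Num.min t d by rewrite lt_min t0.
have h0 : 0 < h by rewrite divr_gt0.
have [mt md] : Num.min t d <= t /\ Num.min t d <= d by rewrite !ge_min !lexx !orbT.
have hh : h < t /\ h < d by rewrite /h; split; lra.
have vd : disc z d (v h) by rewrite /disc nvz //; lra.
have vt : nrm (phi (v h) - phi w) < 1 by apply: ht; rewrite nvw; lra.
have Hv := H (v h) vd; rewrite nvz ?hh.2 // in Hv.
have B : ln (nrm (Gam (v h))) <= (K + 1) * h.
  have gv := (nA (v h) vd).2.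
  have L1 : ln (nrm (Gam (v h))) <= nrm (Gam (v h)) - 1.
    have := expR_ge1Dx (ln (nrm (Gam (v h)))); rewrite lnK ?posrE; lra.
  apply: le_trans L1 _; apply: (@le_trans _ _ (nrm (Gam (v h) - Gam w))).
    by have := nrm_lerB (Gam (v h)) (Gam w); rewrite Gw1; lra.
  rewrite (hphi (v h)) addrAC subrr add0r nrmM (nvw _ (ltW h0)) ler_wpM2r ?(ltW h0) //.
  by have := nrm_lerB (phi (v h)) (phi w); lra.
have P : u <= (2 * d) * (K + 1).
  rewrite -(ler_pM2l h0); have -> : h * (2 * d * (K + 1)) = 2 * d * ((K + 1) * h) by ring.
  apply: (@le_trans _ _ ((d + (d - h)) * ln (nrm (Gam (v h))))).
    by move: Hv; congr (_ <= _); ring.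
  have lp : 0 <= ln (nrm (Gam (v h))) by apply: ln_ge0; apply: ltW; exact: (nA (v h) vd).2.
  apply: ler_pM => //; lra.
apply: le_trans P _; have : 0 <= S * nrm z by rewrite mulr_ge0 ?nrm_ge0.
by have : d * (K + 1) <= nrm z * (K + 1) by [rewrite ler_wpM2r //; lra]; nra.
Qed.

(** The summand 1 lets the exponent absorb multiplicative constants. *)
Definition exptype (f : C -> C) := exists2 K, 0 <= K & forall z, nrm (f z) <= expR (K * (1 + nrm z)).

Lemma exptype_scale f c : exptype f -> exptype (fun z => c * f z).
Proof.
move=> [K K0 hf]; exists (nrm c + K); first by have := nrm_ge0 c; lra.
move=> z; rewrite nrmM mulrDl expRD; apply: ler_pM; rewrite ?nrm_ge0 ?hf //.
apply: (@le_trans _ _ (expR (nrm c))); first by have := expR_ge1Dx (nrm c); lra.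
by rewrite ler_expR; have := nrm_ge0 c; have := nrm_ge0 z; nra.
Qed.
Lemma exptype_add f g : exptype f -> exptype g -> exptype (fun z => f z + g z).
Proof.
move=> [K K0 hf] [L L0 hg]; exists (1 + K + L); first lra.
move=> z; apply: le_trans (nrmD _ _) _; have z0 := nrm_ge0 z.
have := expR_ge1Dx (1 + nrm z) => h1.
have fK := hf z; have gL := hg z.
have e1 : 1 <= expR (K * (1 + nrm z)) by rewrite -[leLHS]expR0 ler_expR mulr_ge0 //; lra.
have e2 : 1 <= expR (L * (1 + nrm z)) by rewrite -[leLHS]expR0 ler_expR mulr_ge0 //; lra.
have -> : (1 + K + L) * (1 + nrm z) = (1 + nrm z) + (K * (1 + nrm z) + L * (1 + nrm z)) by ring.
rewrite (expRD (1 + nrm z)) (expRD (K * _)).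
move: (expR (1 + _)) (expR (K * _)) (expR (L * _)) h1 fK gL e1 e2 => a b c.
move=> h1 fK gL e1 e2; have b2 : 2 <= a by lra.
have : 2 * (b * c) <= a * (b * c) by rewrite ler_wpM2r // mulr_ge0 //; lra.
have : b <= b * c by rewrite ler_peMr //; lra.
have : c <= b * c by rewrite ler_peMl //; lra.
lra.
Qed.
Lemma exptype_sub f g : exptype f -> exptype g -> exptype (fun z => f z - g z).
Proof.
move=> hf hg; have := exptype_add hf (exptype_scale (- 1) hg).
by move=> [K K0 h]; exists K => // z; have := h z; rewrite mulN1r.
Qed.
Lemma exptype_monomial c m : exptype (fun z => c * z ^+ m).
Proof.
apply: exptype_scale; exists m%:R => // z; rewrite nrmX.
apply: (@le_trans _ _ (expR (nrm z) ^+ m)).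
  by rewrite lerXn2r ?nnegrE ?nrm_ge0 ?expR_ge0 //; have := expR_ge1Dx (nrm z); lra.
by rewrite -expRM_natl ler_expR ler_wpM2l //; lra.
Qed.
Lemma exptype_der f : hol (fun=> True) f -> exptype f -> exptype (der f).
Proof.
move=> hf [K K0 hK]; exists (8 + 2 * K); first lra.
move=> z; have z0 := nrm_ge0 z.
have : nrm (der f z) <= 8 * expR (K * (2 + nrm z)) / 1.
  apply: (@der_bound _ f z 1); rewrite ?ltr01 //; first by exact: hol_plane.
    move=> v; rewrite /disc => v1; apply: le_trans (hK v) _; rewrite ler_expR ler_wpM2l //.
    by have := nrm_lerB v z; lra.
  by apply: disc_center; lra.
rewrite divr1 => /le_trans; apply.
have -> : (8 + 2 * K) * (1 + nrm z) = 8 * (1 + nrm z) + 2 * K * (1 + nrm z) by ring.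
rewrite expRD; apply: ler_pM => //; first exact: expR_ge0.
  by have := expR_ge1Dx (8 * (1 + nrm z)); lra.
by rewrite ler_expR; nra.
Qed.
Lemma exptype_dern f k : hol (fun=> True) f -> exptype f -> exptype (dern k f).
Proof. by move=> hf he; elim: k => // k IH; rewrite dernS; apply: exptype_der => //; exact: dern_hol_plane. Qed.
Lemma exptype_quot f p : hol (fun=> True) f -> exptype f -> exptype (quot f p).
Proof.
move=> hf [K K0 hK]; exists (8 + 2 * K * (1 + nrm p)); first by have := nrm_ge0 p; nra.
move=> z; have z0 := nrm_ge0 z; have p0 := nrm_ge0 p.
pose r := nrm (z - p) + 1; have r1 : 1 <= r by have := nrm_ge0 (z - p); rewrite /r; lra.
have Hd : hol (disc p r) f by exact: hol_plane.
have : nrm (quot f p z) <= 8 * expR (K * (1 + nrm p + r)) / r.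
  apply: (@quot_bound_half _ f p r) => //; rewrite ?(lt_le_trans ltr01) //.
  - move=> v; rewrite /disc => v1; apply: le_trans (hK v) _; rewrite ler_expR ler_wpM2l //.
    by have := nrm_lerB v p; lra.
  - by apply: disc_center; lra.
  - by rewrite /disc /r ltrDl.
have e0 := expR_gt0 (K * (1 + nrm p + r)).
move=> h; have : nrm (quot f p z) <= 8 * expR (K * (1 + nrm p + r)).
  by apply: le_trans h _; rewrite ler_pdivrMr; nra.
move=> /le_trans; apply.
have -> : (8 + 2 * K * (1 + nrm p)) * (1 + nrm z) = 8 * (1 + nrm z) + K * (2 * (1 + nrm p) * (1 + nrm z)) by ring.
rewrite expRD; apply: ler_pM => //; first exact: ltW.
  by have := expR_ge1Dx (8 * (1 + nrm z)); lra.
rewrite ler_expR ler_wpM2l // /r.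
by have := nrmB z p; nra.
Qed.

Lemma growth_exptype G m K : 0 <= K -> hol (fun=> True) G ->
  (forall z, 1 <= nrm z -> nrm (der G z) * nrm z ^+ m <= K * (nrm z ^+ m ^+ 2 + nrm (G z) ^+ 2)) ->
  exptype G.
Proof.
move=> K0 hG hK.
have [B hB] := @hol_bounded _ G 0 2 3 ltac:(lra) (hol_plane hG).
have B0 : 0 <= B by apply: le_trans (hB 0 _); rewrite ?nrm_ge0 // subrr nrm0.
pose Gam z := G z / z ^+ m.
have nz (z : C) : 1 < nrm z -> z != 0 by move=> h; rewrite -nrm_gt0; lra.
have dz z n : cder (fun w : C => w ^+ n) z (n%:R * z ^+ n.-1).
  case: n => [|n]; first by rewrite mul0r; exact: (cder_cst 1).
  by have := cder_exp n (cder_id z); rewrite mulr1.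
have dG z : 1 < nrm z -> cder Gam z (der G z / z ^+ m - Gam z * (m%:R / z)).
  move=> z1; have z0 := nz z z1.
  have := @cder_div _ G (fun w => w ^+ m) z _ _ (expf_neq0 m z0) (hol_der hG (I : (fun=> True) z)) (dz z m).
  congr cder; rewrite /Gam; move: (der G z) (G z) (expf_neq0 m z0) => x y h.
  case: (m) h => [|n] h /=; first by rewrite expr0 !mul0r; field.
  by move: h; rewrite exprS mulf_eq0 negb_or => /andP[_ h]; field; rewrite z0 h.
have hGam : hol (fun z => 1 < nrm z) Gam by move=> z z1; eexists; exact: dG.
have H2 z : nrm z = 2 -> nrm (Gam z) <= expR B.
  move=> z2; rewrite nrmM nrmV nrmX z2; apply: (@le_trans _ _ B); last by have := expR_ge1Dx B; lra.
  have p1 : 1 <= (2 : R) ^+ m by apply: exprn_ege1; lra.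
  rewrite ler_pdivrMr; last lra.
  have := hB z; rewrite subr0 z2 lexx => /(_ isT) h; nra.
(* Where |G| = |z|^m the hypothesis gives |G'| <= 2K |z|^m, and differentiating z^-m adds at most m
   / |z|. *)
have H1 z : 1 < nrm z -> nrm (Gam z) = 1 -> nrm (der Gam z) <= 2 * K + m%:R.
  move=> z1 g1; rewrite (derE (dG z z1)); apply: le_trans (nrmB _ _) _.
  rewrite (nrmM (Gam z)) g1 mul1r (nrmM (der G z)) (nrmM m%:R) !nrmV.
  have zm : 0 < nrm z ^+ m by rewrite exprn_gt0 //; lra.
  apply: lerD.
    rewrite nrmX ler_pdivrMr //.
    have E : nrm (G z) = nrm z ^+ m.
      by move: g1; rewrite nrmM nrmV nrmX => /divr1_eq.
    have := hK z (ltW z1); rewrite E => h.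
    rewrite -(ler_pM2r zm); move: h; rewrite expr2; move: (nrm z ^+ m) => a; nra.
  rewrite -toC_nat nrm_toC ger0_norm // ler_pdivrMr; last lra.
  have : 0 <= m%:R :> R by []; nra.
have := @clunie_hayman Gam B (2 * K + m%:R) B0 _ hGam H2 H1.
have m0 : 0 <= m%:R :> R by [].
move=> /(_ ltac:(lra)) CH.
pose K1 := 2 * (2 * K + m%:R + 1) + 2 * B.
exists (B + K1 + m%:R); first by rewrite /K1; lra.
move=> z; have z0 := nrm_ge0 z.
have [z2|z2] := leP (nrm z) 2.
  apply: le_trans (hB z _) _; first by rewrite subr0.
  apply: (@le_trans _ _ (expR B)); first by have := expR_ge1Dx B; lra.
  by rewrite ler_expR /K1; nra.
have := CH z (ltW z2); rewrite -/K1 nrmM nrmV nrmX ler_pdivrMr; last by rewrite exprn_gt0 //; lra.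
move=> /le_trans; apply.
apply: (@le_trans _ _ (expR (K1 * nrm z) * expR (m%:R * nrm z))).
  rewrite ler_wpM2l ?expR_ge0 // expRM_natl lerXn2r ?nnegrE ?expR_ge0 //.
  by have := expR_ge1Dx (nrm z); lra.
by rewrite -expRD ler_expR -mulrDl /K1; nra.
Qed.

Lemma liouville_der f B : hol (fun=> True) f -> (forall z, nrm (f z) <= B) -> forall z, der f z = 0.
Proof.
move=> hf hB z; have B0 : 0 <= B := le_trans (nrm_ge0 _) (hB 0).
apply/eqP; rewrite -nrm_eq0 eq_le nrm_ge0 andbT.
apply/ler_addgt0Pr => e e0; rewrite add0r.
pose r := 8 * B / e + 1.
have r0 : 0 < r by have : 0 <= 8 * B / e by [rewrite divr_ge0 ?mulr_ge0 // ltW]; rewrite /r; lra.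
have zr : disc z (r / 2) z by apply: disc_center; rewrite divr_gt0.
have := der_bound r0 (hol_plane hf) (fun v _ => hB v) zr.
move=> /le_trans; apply; rewrite ler_pdivrMr // /r mulrDr mulr1 mulrCA divff ?mulr1; last by rewrite gt_eqF.
lra.
Qed.

(** The logarithm L has real part at most K (1 + |z|); Borel-Caratheodory then bounds L linearly, so
    L' is bounded and constant by Liouville. *)
Lemma nonvanishing_exptype f : hol (fun=> True) f -> exptype f -> (forall z, f z != 0) ->
  exists A c, A != 0 /\ forall z, f z = A * cexp (c * z).
Proof.
move=> hf [K K0 hK] f0; have [L hL fL] := log_plane hf f0.
pose M z := L z - L 0.
have hM : hol (fun=> True) M by apply: hol_subr => //; exact: hol_cst.
have M0 : M 0 = 0 by rewrite /M subrr.
(* With r = 4 (|z| + 1), z lies in the disc of radius r/4, and the Cauchy estimate on radius r/2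
   with bound 2A gives 32 A / r. *)
pose B := 32 * (2 * K + nrm (L 0) + 1).
have dM z : nrm (der M z) <= B.
  pose r := 4 * (nrm z + 1); have z0 := nrm_ge0 z.
  have r4 : 4 <= r by rewrite /r; lra.
  pose A := K * (1 + r) + nrm (L 0) + 1.
  have Kr : 0 <= K * (1 + r) by rewrite mulr_ge0 //; lra.
  have L0 := nrm_ge0 (L 0); have A0 : 0 < A by rewrite /A; lra.
  have reM w : disc 0 r w -> re (M w) <= A.
    rewrite /disc subr0 => wr; rewrite /M reD reN.
    have : re (L w) <= K * (1 + r).
      have := hK w; rewrite fL nrm_cexp ler_expR => /le_trans; apply.
      by rewrite ler_wpM2l //; lra.
    have := re_le_nrm (L 0); rewrite /A ler_norml; lra.
  have bM w : disc 0 (r / 2) w -> nrm (M w) <= 2 * A.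
    move=> wr; apply: (@borel_caratheodory M 0 r A) => //; try lra.
      by exact: hol_plane.
    by apply: ltW; exact: wr.
  have := @der_bound _ M 0 (r / 2) (2 * A) z ltac:(lra) (hol_plane hM) bM
     ltac:(rewrite /disc subr0 /r; lra).
  move=> /le_trans; apply; rewrite ler_pdivrMr; last lra.
  by rewrite /B /A; nra.
have d2 := liouville_der (dern_hol_plane 1 hM) dM.
pose c := der M 0.
have dc z : der M z = c.
  apply: (plane_const (f := der M)) => w; rewrite -[X in cder _ _ X](d2 w).
  exact: (hol_der (dern_hol_plane 1 hM) I).
have Mz z : M z = c * z.
  have := @plane_const (fun z => M z - c * z); rewrite M0 mulr0 subr0 => H.
  apply/eqP; rewrite -subr_eq0 H // => w.
  have := cder_sub (hol_der hM (I : (fun=> True) w)) (cder_mul (cder_cst c w) (cder_id w)).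
  by rewrite dc mul0r add0r mulr1 subrr.
exists (cexp (L 0)), c; split; first exact: cexp_neq0.
by move=> z; rewrite fL -cexpD -Mz /M subrKC.
Qed.

End Growth.

(** * The exceptional entire functions *)

Section Classification.
Variable R : realType.
Local Notation C := (Cplx R).
Local Notation disc := (@disc R).
Local Notation hol := (@hol R).
Local Notation der := (@der R).
Local Notation dern := (@dern R).
Local Notation entire := (hol (fun=> True)).

Lemma der_fun f g : (forall z, cder f z (g z)) -> der f = g.
Proof. by move=> h; apply/funext => z; exact: derE. Qed.
Lemma entire_dern f k z : entire f -> cder (dern k f) z (dern k.+1 f z).
Proof. by move=> hf; apply: hol_der (dern_hol_plane k hf) I. Qed.
Lemma entire_der f z : entire f -> cder f z (der f z).
Proof. exact: (entire_dern 0). Qed.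

Lemma dern_add f g k : entire f -> entire g ->
  dern k (fun z => f z + g z) = (fun z => dern k f z + dern k g z).
Proof.
move=> hf hg; elim: k => [//|k IH]; rewrite dernS IH; apply: der_fun => z.
by apply: cder_add; exact: entire_dern.
Qed.
Lemma dern_sub f g k : entire f -> entire g ->
  dern k (fun z => f z - g z) = (fun z => dern k f z - dern k g z).
Proof.
move=> hf hg; elim: k => [//|k IH]; rewrite dernS IH; apply: der_fun => z.
by apply: cder_sub; exact: entire_dern.
Qed.
Lemma dern_cst c k : dern k.+1 (fun=> c) = (fun=> 0).
Proof.
elim: k => [|k IH]; first by apply: der_fun => z; exact: cder_cst.
by rewrite dernS IH; apply: der_fun => z; exact: cder_cst.
Qed.
Lemma dern_shift f w k : entire f -> dern k (fun z => f (z + w)) = (fun z => dern k f (z + w)).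
Proof.
move=> hf; elim: k => [//|k IH].
rewrite dernS.
rewrite IH.
apply: der_fun => z.
have D : cder (fun v => v + w) z 1.
  by rewrite -[1]addr0; apply: cder_add; [exact: cder_id|exact: cder_cst].
have := @cder_comp _ (dern k f) (fun v => v + w) z _ _ (entire_dern k (z + w) hf) D.
by rewrite mulr1.
Qed.
Lemma cder_aexp a c (z : C) : cder (fun z => a * cexp (c * z)) z (a * c * cexp (c * z)).
Proof.
have D : cder (fun v => c * v) z c.
  by have := cder_mul (cder_cst c z) (cder_id z); rewrite mul0r add0r mulr1.
have := cder_mul (cder_cst a z) (@cder_comp _ (@cexp R) (fun v => c * v) z _ _ (cder_cexp (c * z)) D).
by congr cder; ring.
Qed.
Lemma entire_aexp a c : entire (fun z => a * cexp (c * z)).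
Proof. by move=> z _; eexists; exact: cder_aexp. Qed.
Lemma dern_aexp a c k : dern k (fun z => a * cexp (c * z)) = (fun z => a * c ^+ k * cexp (c * z)).
Proof.
elim: k => [|k IH]; first by apply/funext => z; rewrite expr0 mulr1.
rewrite dernS IH; apply: der_fun => z; have := cder_aexp (a * c ^+ k) c z.
by congr cder; rewrite exprS; ring.
Qed.
Lemma cder_mono c m (z : C) : cder (fun z => c * z ^+ m) z (c * m%:R * z ^+ m.-1).
Proof.
case: m => [|m]; first by rewrite mulr0 mul0r; apply: (@cder_ext _ (fun=> c)); [move=> w; rewrite mulr1|exact: cder_cst].
have := cder_mul (cder_cst c z) (cder_exp m (cder_id z)).
by congr cder; rewrite /=; ring.
Qed.
Lemma entire_mono c m : entire (fun z => c * z ^+ m).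
Proof. by move=> z _; eexists; exact: cder_mono. Qed.
Lemma dernSr f k : entire f -> dern k.+1 f = dern k (der f).
Proof. by move=> hf; elim: k => [//|k IH]; rewrite dernS IH [in RHS]dernS. Qed.
Lemma dern_mono_lt c m k : (m < k)%N -> dern k (fun z => c * z ^+ m) = (fun=> 0).
Proof.
elim: m c k => [|m IH] c [|k] // mk.
  have -> : (fun z : C => c * z ^+ 0) = (fun=> c) by apply/funext => z; rewrite mulr1.
  exact: dern_cst.
by rewrite dernSr; [rewrite (der_fun (cder_mono c m.+1)) IH|exact: entire_mono].
Qed.
Lemma dern_mono_eq c m : dern m (fun z => c * z ^+ m) = (fun=> c * m`!%:R).
Proof.
elim: m c => [|m IH] c; first by apply/funext.
rewrite dernSr; last exact: entire_mono.
rewrite (der_fun (cder_mono c m.+1)) IH; apply/funext => _.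
by rewrite factS natrM; ring.
Qed.

Lemma aexp_const (a c b : C) : a != 0 -> (forall z, a * cexp (c * z) = b) -> c = 0.
Proof.
move=> a0 h; apply/eqP; apply/negPn/negP => c0.
have n2 : (2 : C) != 0 by rewrite (nat_neq0 R).
have [w hw] := cexp_surj n2.
have := h 0; rewrite -(h (w / c)) mulr0 cexp0 [c * _]mulrC divfK // hw mulr1.
move=> /eqP; rewrite -subr_eq0.
have -> : a - a * 2 = - a by ring.
by rewrite oppr_eq0 (negbTE a0).
Qed.

(** A polynomial of degree k cannot vanish on an infinite arithmetic progression: its difference
    with step w vanishes there too and has the nonzero constant beta w as derivative of order one
    less. *)
Lemma finite_difference k P (beta z0 w : C) : entire P -> beta != 0 -> w != 0 ->
  (forall z, dern k P z = beta) -> ~ (forall j : nat, P (z0 + j%:R * w) = 0).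
Proof.
elim: k P beta => [|k IH] P beta hP b0 w0 hk h.
  have e : P (z0 + 0%:R * w) = beta := hk _.
  by move: b0; rewrite -e h eqxx.
have hS : entire (fun z => P (z + w)).
  move=> z _; have D : cder (fun v => v + w) z 1.
    by rewrite -[1]addr0; apply: cder_add; [exact: cder_id|exact: cder_cst].
  by eexists; exact: (@cder_comp _ P (fun v => v + w) z _ _ (entire_der (z + w) hP) D).
apply: (IH (fun z => P (z + w) - P z) (beta * w)) => //.
- exact: hol_subr.
- by rewrite mulf_neq0.
- move=> z; rewrite dern_sub // dern_shift //.
  have := @plane_const _ (fun z => dern k P z - beta * z) _.
  rewrite mulr0 subr0 => H.
  have {}H v : dern k P v - beta * v = dern k P 0.
    apply: H => u; have := cder_sub (entire_dern k u hP) (cder_mul (cder_cst beta u) (cder_id u)).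
    by rewrite hk mul0r add0r mulr1 subrr.
  have := H (z + w); rewrite -(H z); move: (dern k P (z + w)) (dern k P z) => x y e.
  by have -> : x = y - beta * z + beta * (z + w) by [rewrite -e; ring]; ring.
- move=> j; have -> : z0 + j%:R * w + w = z0 + j.+1%:R * w by rewrite -natr1; ring.
  by rewrite !h subrr.
Qed.

Lemma dern_all_zero G k z0 : entire G -> (forall j, (j < k)%N -> dern j G z0 = 0) ->
  (forall z, dern k G z = 0) -> forall z, G z = 0.
Proof.
move=> hG h hk; apply: (@entire_eq0_dern _ G z0) => // j.
have [/h//|kj] := ltnP j k.
have -> : dern j G = (fun=> 0); last by [].
rewrite -(subnKC kj); elim: (j - k)%N => [|i IH]; first by rewrite addn0; apply/funext.
by rewrite addnS dernS IH; apply: der_fun => z; exact: cder_cst.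
Qed.

Lemma dern_neq0 G k : (0 < k)%N -> entire G -> exptype G ->
  (forall z, G z = 0 -> forall j, (j < k)%N -> dern j G z = 0) ->
  ~ (exists c, forall z, G z = c) -> ~ (forall z, dern k G z = 0).
Proof.
move=> k0 hG eG F1 nc hk; have [[z0 Gz0]|nz] := pselect (exists z, G z = 0).
  by apply: nc; exists 0; exact: dern_all_zero (F1 z0 Gz0) hk.
have [|a [c [a0 hE]]] := nonvanishing_exptype hG eG.
  by move=> z; apply/eqP => h; apply: nz; exists z.
have GE : G = fun z => a * cexp (c * z) by apply/funext.
have := hk 0; rewrite GE dern_aexp mulr0 cexp0 mulr1 => /eqP.
rewrite mulf_eq0 (negbTE a0) /= expf_eq0 => /andP[_ /eqP c0].
by apply: nc; exists a => z; rewrite hE c0 mul0r cexp0 mulr1.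
Qed.

(** If G^(k) is not constant it is B plus an exponential, takes the value B1 along a progression of
    period 2 pi i / c, and G must agree with A at all those points. *)
Lemma classify_linear k G A B B1 bA : (0 < k)%N -> entire G -> exptype G -> entire A ->
  (forall z, dern k A z = bA) -> B != B1 -> B != bA ->
  ((exists z, dern k G z != B1) -> forall z, dern k G z = B1 -> G z = A z) ->
  ((exists z, dern k G z != B) -> forall z, dern k G z != B) ->
  exists B2, forall z, dern k G z = B2.
Proof.
move=> k0 hG eG hA dA BB1 BbA F3 F4; apply: contrapT => nc.
have ex b : exists z, dern k G z != b.
  apply: contrapT => H; apply: nc; exists b => z; apply/eqP/negPn/negP => h.
  by apply: H; exists z.
have hE : entire (fun z => dern k G z - B).
  by apply: hol_subr; [exact: dern_hol_plane|exact: hol_cst].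
have eE : exptype (fun z => dern k G z - B).
  apply: exptype_sub; first exact: exptype_dern.
  have [K K0 hK] := exptype_monomial B 0; exists K => // z.
  by have := hK z; rewrite expr0 mulr1.
have [|a [c [a0 aE]]] := nonvanishing_exptype hE eE.
  by move=> z; rewrite subr_eq0 F4.
have GE z : dern k G z = B + a * cexp (c * z) by rewrite -aE subrKC.
have c0 : c != 0.
  by apply/eqP => c0; apply: nc; exists (B + a) => z; rewrite GE c0 mul0r cexp0 mulr1.
have [w hw] : exists w, cexp w = (B1 - B) / a.
  by apply: cexp_surj; rewrite mulf_neq0 ?invr_eq0 // subr_eq0 eq_sym.
have ck : c ^+ k != 0 by rewrite expf_neq0.
pose a' := a / c ^+ k.
(* Removing the k-fold antiderivative of the exponential leaves a polynomial with k-th derivative B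
   - bA. The added constant makes it vanish on the progression, where exp(c z) = (B1 - B) / a. *)
pose P z := G z - A z - (a' * cexp (c * z) - (B1 - B) / c ^+ k).
have hP2 : entire (fun z => a' * cexp (c * z) - (B1 - B) / c ^+ k).
  by apply: hol_subr; [exact: entire_aexp|exact: hol_cst].
have hP1 : entire (fun z => G z - A z) by exact: hol_subr.
have hP : entire P by exact: hol_subr.
apply: (@finite_difference k P (B - bA) (w / c) (twopi_i R / c)) => //.
- by rewrite subr_eq0.
- by rewrite mulf_neq0 ?invr_eq0 ?twopi_i_neq0.
- move=> z; rewrite /P dern_sub // dern_sub // dern_sub; [|exact: entire_aexp|exact: hol_cst].
  rewrite dern_aexp GE dA -(prednK k0) dern_cst (prednK k0) /a' divfK //; ring.
- move=> j; have per : cexp (c * (w / c + j%:R * (twopi_i R / c))) = (B1 - B) / a.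
    have -> : c * (w / c + j%:R * (twopi_i R / c)) = w + j%:R * twopi_i R by field.
    rewrite cexpD hw; suff -> : cexp (j%:R * twopi_i R) = 1 by rewrite mulr1.
    elim: j => [|j IH]; first by rewrite mul0r cexp0.
    by rewrite -natr1 mulrDl mul1r cexpD IH cexp_2pi mulr1.
  have hB1 : dern k G (w / c + j%:R * (twopi_i R / c)) = B1 by rewrite GE per mulrC divfK // subrKC.
  rewrite /P per (F3 (ex B1) _ hB1) subrr sub0r /a'; field.
  by rewrite ck a0.
Qed.

(** With A = 0 the derivative is a constant B2, nonzero because it exceeds B1 in modulus; the affine
    G has a zero, where its derivative is B1, a contradiction. *)
Lemma classify_first G B B1 : entire G -> exptype G -> B != B1 -> B != 0 ->
  (forall z, G z = 0 -> der G z = B1) ->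
  ((exists z, der G z != B1) -> forall z, der G z = B1 -> G z = 0) ->
  ((exists z, der G z != B) -> forall z, der G z != B) ->
  ~ (exists z, nrm B1 < nrm (der G z)).
Proof.
move=> hG eG BB1 B0 F2 F3 F4 [z0 hz0].
have [|B2 hB2] := @classify_linear 1 G (fun=> 0) B B1 0 isT hG eG (@hol_cst _ _ 0) _ BB1 B0 F3 F4.
  by move=> z; rewrite dern_cst.
have {}hB2 z : der G z = B2 := hB2 z.
have B21 : B2 != B1 by apply/eqP => h; move: hz0; rewrite hB2 h ltxx.
have B20 : B2 != 0.
  by apply/eqP => h; move: hz0; rewrite hB2 h nrm0; have := nrm_ge0 B1; lra.
have GE z : G z - B2 * z = G 0.
  have := @plane_const _ (fun z => G z - B2 * z) _ z; rewrite mulr0 subr0; apply=> u.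
  have := cder_sub (entire_der u hG) (cder_mul (cder_cst B2 u) (cder_id u)).
  by rewrite hB2 mul0r add0r mulr1 subrr.
have := F2 (- G 0 / B2); rewrite hB2 => H.
have E : G (- G 0 / B2) = 0.
  have := GE (- G 0 / B2); rewrite [B2 * _]mulrC divfK // opprK => e.
  by apply: (addIr (G 0)); rewrite e add0r.
by move/eqP: (H E); rewrite (negbTE B21).
Qed.

(** Here G^(k) is a constant B2 <> 0, so G never meets T z^e and differs from it by an exponential.
    Constancy of G^(k) makes that exponential a constant a, and T z^e + a has no zero of
    multiplicity k > 1 unless G is constant; yet G has a zero, since otherwise it would itself be an
    exponential. *)
Lemma classify_case2 k G T e B : (1 < k)%N -> (e = 0%N \/ e = k) -> entire G -> exptype G ->
  ~ (exists c, forall z, G z = c) -> ~ (forall z, G z = T * z ^+ e) ->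
  B != 0 -> B != dern k (fun z => T * z ^+ e) 0 ->
  (forall z, G z = 0 -> forall j, (j < k)%N -> dern j G z = 0) ->
  (forall z, G z = T * z ^+ e -> dern k G z = 0) ->
  ((exists z, dern k G z != 0) -> forall z, dern k G z = 0 -> G z = T * z ^+ e) ->
  ((exists z, dern k G z != B) -> forall z, dern k G z != B) -> False.
Proof.
move=> k1 ek hG eG nc nA B0 BbA F1 F2 F3 F4; have k0 := ltnW k1.
have hA := entire_mono T e.
have dA z : dern k (fun z => T * z ^+ e) z = dern k (fun z => T * z ^+ e) 0.
  by case: ek => ->; [rewrite dern_mono_lt|rewrite dern_mono_eq].
have [B2 hB2] := classify_linear k0 hG eG hA dA B0 BbA F3 F4.
have B20 : B2 != 0.
  by apply/eqP => h; apply: (dern_neq0 k0 hG eG F1 nc) => z; rewrite hB2.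
have [z1 Gz1] : exists z, G z = 0.
  apply: contrapT => nz; have [|a [c [a0 hE]]] := nonvanishing_exptype hG eG.
    by move=> z; apply/eqP => h; apply: nz; exists z.
  have GE : G = fun z => a * cexp (c * z) by apply/funext.
  have h z : a * c ^+ k * cexp (c * z) = B2 by rewrite -(hB2 z) GE dern_aexp.
  have ac : a * c ^+ k != 0.
    by apply/eqP => ac; move: B20; rewrite -(h 0) ac mul0r eqxx.
  have c0 := aexp_const ac h; move: ac.
  by rewrite c0 expr0n eqn0Ngt k0 mulr0 eqxx.
have nz z : G z - T * z ^+ e != 0.
  rewrite subr_eq0; apply/eqP => h; have := F2 z h; rewrite hB2 => /eqP.
  by rewrite (negbTE B20).
have [a [c [a0 hE]]] := nonvanishing_exptype (hol_subr hG hA) (exptype_sub eG (exptype_monomial T e)) nz.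
have fE : (fun z => G z - T * z ^+ e) = fun z => a * cexp (c * z) by apply/funext.
have h z : a * c ^+ k * cexp (c * z) = B2 - dern k (fun z => T * z ^+ e) 0.
  by rewrite -(hB2 z) -(dA z); have := congr1 (fun f => dern k f z) fE; rewrite dern_sub // dern_aexp => ->.
have c0 : c = 0.
  apply/eqP; apply/negPn/negP => cn0; move: (cn0).
  by rewrite (aexp_const (mulf_neq0 a0 (expf_neq0 k cn0)) h) eqxx.
have GE z : G z = T * z ^+ e + a by have := hE z; rewrite c0 mul0r cexp0 mulr1 => <-; rewrite subrKC.
case: ek => ek; first by apply: nc; exists (T + a) => z; rewrite GE ek expr0 mulr1.
have := F1 z1 Gz1 1%N k1.
have -> : dern 1 G = fun z => T * e%:R * z ^+ e.-1.
  apply: der_fun => z; have -> : G = fun z => T * z ^+ e + a by apply/funext.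
  by rewrite -[X in cder _ _ X]addr0; apply: cder_add; [exact: cder_mono|exact: cder_cst].
move=> /eqP; rewrite !mulf_eq0 expf_eq0 => /orP[/orP[/eqP T0|]|/andP[_ /eqP z10]].
- by apply: nc; exists a => z; rewrite GE T0 mul0r add0r.
- by rewrite ek (negbTE (nat_neq0 R k0)).
- by move: Gz1; rewrite GE z10 ek expr0n eqn0Ngt k0 mulr0 add0r => /eqP; rewrite (negbTE a0).
Qed.

(** The unique zero x is exactly double, so G = (z - x)^2 a2 exp(c2 z). If c2 <> 0, the second
    derivative of this form has a zero, while a c^2 exp(c z) has none; if c2 = 0 it would be
    constant. *)
Lemma classify_case1_quadratic (G : C -> C) (T a c x : C) : entire G -> exptype G -> a != 0 -> c != 0 ->
  (forall z, G z = T * z + a * cexp (c * z)) -> G x = 0 -> der G x = 0 ->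
  (forall z, G z = 0 -> z = x) -> False.
Proof.
move=> hG eG a0 c0 GE Gx dGx uniq.
have GF : G = fun z => T * z ^+ 1 + a * cexp (c * z) by apply/funext => z; rewrite GE.
have d2 : dern 2 G = fun z => a * c ^+ 2 * cexp (c * z).
  rewrite {1}GF dern_add; [|exact: entire_mono|exact: entire_aexp].
  by rewrite dern_mono_lt // dern_aexp; apply/funext => z; rewrite add0r.
pose q := quot (quot G x) x.
have entq f : entire f -> entire (quot f x).
  move=> hf z _; apply: (@quot_hol _ f x (nrm (z - x) + 1)); first exact: hol_plane.
  by rewrite /disc ltrDl.
have hq : entire q by exact: (entq _ (entq _ hG)).
have eq : exptype q by apply: exptype_quot; [exact: (entq _ hG)|exact: exptype_quot].
have Gq z : G z = (z - x) ^+ 2 * q z.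
  rewrite (quotE G x z) Gx add0r (quotE (quot G x) x z) quotpp dGx add0r -/q.
  by move: (q z) => y; ring.
have q0 z : q z != 0.
  have [->|zx] := eqVneq z x; last first.
    apply/eqP => h; move/eqP: zx; apply; apply: uniq; by rewrite Gq h mulr0.
  have := @dern_iterq _ G x 1 2 ltr01 (hol_plane hG); rewrite d2 => h.
  apply/eqP => qx; move: h; rewrite /iterq /= -/q qx mulr0 => /eqP.
  by rewrite mulf_eq0 (negbTE (cexp_neq0 _)) orbF mulf_eq0 expf_eq0 (negbTE a0) (negbTE c0).
have [a2 [c2 [a20 qE]]] := nonvanishing_exptype hq eq q0.
have dlin z : cder (fun z : C => z - x) z 1.
  by rewrite -[X in cder _ _ X]subr0; apply: cder_sub; [exact: cder_id|exact: cder_cst].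
have d1' : der G = fun z => a2 * cexp (c2 * z) * (c2 * (z - x) ^+ 2 + 2 * (z - x)).
  apply: der_fun => z.
  apply: (@cder_ext _ (fun z => (z - x) ^+ 2 * (a2 * cexp (c2 * z)))).
    by move=> w; rewrite -qE -Gq.
  have := cder_mul (cder_exp 1 (dlin z)) (cder_aexp a2 c2 z).
  by congr cder; rewrite expr1; ring.
have d2' : dern 2 G = fun z => a2 * cexp (c2 * z) * (c2 ^+ 2 * (z - x) ^+ 2 + 4 * c2 * (z - x) + 2).
  rewrite dernS [dern 1 G]d1'; apply: der_fun => z.
  have := cder_mul (cder_aexp a2 c2 z) (cder_add (cder_mul (cder_cst c2 z) (cder_exp 1 (dlin z)))
     (cder_mul (cder_cst 2 z) (dlin z))).
  by congr cder; rewrite expr1; ring.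
have E z : a * c ^+ 2 * cexp (c * z) = a2 * cexp (c2 * z) * (c2 ^+ 2 * (z - x) ^+ 2 + 4 * c2 * (z - x) + 2).
  by have := congr1 (fun f => f z) d2'; rewrite d2.
have ac2 : a * c ^+ 2 != 0 by rewrite mulf_neq0 // expf_neq0.
have [c20|c20] := eqVneq c2 0.
  suff H : forall z, a * c ^+ 2 * cexp (c * z) = a2 * 2.
    by move: c0; rewrite (aexp_const ac2 H) eqxx.
  by move=> z; rewrite E c20 mul0r cexp0; ring.
(* A root of s^2 + 4 s + 2, the polynomial factor of G'' after the substitution z = x + s / c2. *)
pose s : C := toC (- 2 + Num.sqrt 2).
have s0 : s ^+ 2 + 4 * s + 2 = 0.
  have : (Num.sqrt 2 : R) ^+ 2 = 2 by rewrite sqr_sqrtr.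
  move=> h; apply: ceqP; rewrite expr2 /s -!toC_nat !cpxE; last by ring.
  have -> : (- 2 + Num.sqrt 2 : R) * (- 2 + Num.sqrt 2) - 0 * 0 + (4%:R * (- 2 + Num.sqrt 2) - 0 * 0) + 2%:R =
     Num.sqrt 2 ^+ 2 - 2 by ring.
  by rewrite h subrr.
have := E (x + s / c2).
have -> : c2 ^+ 2 * (x + s / c2 - x) ^+ 2 + 4 * c2 * (x + s / c2 - x) + 2 = s ^+ 2 + 4 * s + 2 by field.
rewrite s0 mulr0 => /eqP; rewrite mulf_eq0 (negbTE ac2) (negbTE (cexp_neq0 _)).
by [].
Qed.

(** G^(k) has no zero, hence G never meets T z^m and G = T z^m + a exp(c z). If G has no zero it is
    a pure exponential, and comparing k-th derivatives gives T = 0. A zero has multiplicity k: for k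
    >= 3 the first two derivatives already conflict, which leaves k = 2, m = 1. *)
Lemma classify_case1 k G T m : (1 < k)%N -> (m < k)%N -> T != 0 -> entire G -> exptype G ->
  ~ (exists c, forall z, G z = c) ->
  (forall z, G z = 0 -> forall j, (j < k)%N -> dern j G z = 0) ->
  ((exists z, G z != T * z ^+ m) -> forall z, G z = T * z ^+ m -> dern k G z = 0) ->
  ((exists z, dern k G z != 0) -> forall z, dern k G z != 0) -> False.
Proof.
move=> k1 mk T0 hG eG nc F1 F2 F4; have k0 := ltnW k1; have hA := entire_mono T m.
have dk z : dern k G z != 0.
  apply: F4; apply: contrapT => H; apply: (dern_neq0 k0 hG eG F1 nc) => v.
  by apply/eqP/negPn/negP => h; apply: H; exists v.
have nz z : G z - T * z ^+ m != 0.
  rewrite subr_eq0; apply/eqP => h; move/eqP: (dk z); apply; apply: F2 => //.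
  apply: contrapT => H; have GE : G = fun z => T * z ^+ m.
    by apply/funext => v; apply/eqP/negPn/negP => h'; apply: H; exists v.
  by move: (dk 0); rewrite GE dern_mono_lt // eqxx.
have [a [c [a0 hE]]] := nonvanishing_exptype (hol_subr hG hA) (exptype_sub eG (exptype_monomial T m)) nz.
have GE z : G z = T * z ^+ m + a * cexp (c * z) by rewrite -hE subrKC.
have GF : G = fun z => T * z ^+ m + a * cexp (c * z) by apply/funext.
have hX := entire_aexp a c.
have dnG n : dern n G = fun z => dern n (fun z => T * z ^+ m) z + a * c ^+ n * cexp (c * z).
  by rewrite {1}GF dern_add // dern_aexp.
have c0 : c != 0.
  apply/eqP => c0; move: (dk 0); rewrite dnG dern_mono_lt // c0 expr0n eqn0Ngt k0 /=.
  by rewrite mulr0 mul0r addr0 eqxx.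
have [[x Gx]|nzG] := pselect (exists z, G z = 0); last first.
  have [|a2 [c2 [a20 hE2]]] := nonvanishing_exptype hG eG.
    by move=> z; apply/eqP => h; apply: nzG; exists z.
  have GF2 : G = fun z => a2 * cexp (c2 * z) by apply/funext.
  have H z : a2 * c2 ^+ k * cexp (c2 * z) = a * c ^+ k * cexp (c * z).
    have := congr1 (fun f => f z) (dnG k); rewrite {1}GF2 dern_aexp dern_mono_lt //.
    by rewrite add0r.
  have ack : a * c ^+ k != 0 by rewrite mulf_neq0 // expf_neq0.
  have ack2 : a2 * c2 ^+ k != 0.
    apply/eqP => h; have := H 0; rewrite h mul0r mulr0 cexp0 mulr1 => /esym/eqP.
    by rewrite (negbTE ack).
  have H2 z : a2 * c2 ^+ k * cexp ((c2 - c) * z) = a * c ^+ k.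
    have -> : (c2 - c) * z = c2 * z + - (c * z) by ring.
    by rewrite cexpD mulrA H cexpN mulfK // cexp_neq0.
  have cc := aexp_const ack2 H2; have cc2 : c2 = c by apply/eqP; rewrite -subr_eq0 cc.
  have aa : a2 = a.
    have := H2 0; rewrite cc mul0r cexp0 mulr1 cc2; apply: mulIf; exact: expf_neq0.
  have := GE 1; rewrite hE2 aa cc2 expr1n -[LHS]add0r => /addIr/esym/eqP.
  by rewrite mulr1 (negbTE T0).
(* Eliminating the exponential between G = 0 and G' = 0 gives c z = m. *)
have key z : G z = 0 -> [/\ (0 < m)%N, z != 0 & c * z = m%:R].
  move=> Gz; have := F1 z Gz 1%N k1; rewrite dnG [dern 1 _](der_fun (cder_mono T m)).
  have E : a * cexp (c * z) = - (T * z ^+ m) by apply/eqP; rewrite -addr_eq0 addrC -GE Gz.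
  rewrite expr1 (mulrAC a) E => e.
  have E0 : T * z ^+ m != 0 by rewrite -oppr_eq0 -E mulf_neq0 // cexp_neq0.
  have [m0|m0] := posnP m.
    move: e; rewrite m0 !expr0 mulr0 mul0r add0r mulr1 => /eqP.
    by rewrite mulf_eq0 (negbTE c0) oppr_eq0 (negbTE T0).
  have z0 : z != 0.
    by apply: contraNneq E0 => ->; rewrite expr0n eqn0Ngt m0 mulr0.
  split=> //; apply/eqP; rewrite -subr_eq0.
  have : T * z ^+ m.-1 * (c * z - m%:R) = 0.
    have zE : z ^+ m = z ^+ m.-1 * z by rewrite -exprSr prednK.
    by apply: oppr_inj; rewrite oppr0 -[RHS]e zE; ring.
  move/eqP; rewrite mulf_eq0 => /orP[|//].
  by rewrite (negbTE (mulf_neq0 T0 (expf_neq0 _ z0))).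
have [m0 x0 cx] := key x Gx.
have [k2|k2] := leqP k 2.
  have kE : k = 2%N by apply/eqP; rewrite eqn_leq k2.
  have mE : m = 1%N by apply/eqP; rewrite eqn_leq m0 andbT -ltnS -kE.
  apply: (@classify_case1_quadratic G T a c x) => //.
  - by move=> z; rewrite GE mE.
  - exact: (F1 x Gx 1%N k1).
  - move=> z /key[_ _ cz]; apply: (mulfI c0); by rewrite cz cx.
have := F1 x Gx 2%N k2; rewrite dnG.
have E : a * cexp (c * x) = - (T * x ^+ m) by apply/eqP; rewrite -addr_eq0 addrC -GE Gx.
have -> : dern 2 (fun z => T * z ^+ m) = fun z => T * m%:R * m.-1%:R * z ^+ m.-2.
  by rewrite dernS [dern 1 _](der_fun (cder_mono T m)) (der_fun (cder_mono (T * m%:R) m.-1)).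
rewrite (mulrAC a) E.
have [m1|m1] := leqP m 1.
  have mE : m = 1%N by apply/eqP; rewrite eqn_leq m0 andbT.
  rewrite mE mulr0 mul0r add0r => /eqP; rewrite mulf_eq0 oppr_eq0 (negbTE (expf_neq0 _ c0)) orbF.
  by rewrite (negbTE (mulf_neq0 T0 (expf_neq0 _ x0))).
have -> : x ^+ m = x ^+ 2 * x ^+ m.-2 by rewrite -exprD; congr (_ ^+ _); lia.
have -> : T * m%:R * m.-1%:R * x ^+ m.-2 + - (T * (x ^+ 2 * x ^+ m.-2)) * c ^+ 2 =
   T * x ^+ m.-2 * (m%:R * m.-1%:R - (c * x) ^+ 2) by ring.
rewrite cx => /eqP; rewrite mulf_eq0 (negbTE (mulf_neq0 T0 (expf_neq0 _ x0))) /=.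
have -> : m%:R * m.-1%:R - m%:R ^+ 2 = - m%:R :> C.
  by rewrite -{1 3 4}(prednK m0) -natr1; ring.
by rewrite oppr_eq0 (negbTE (nat_neq0 R m0)).
Qed.

End Classification.

(** * Marty's criterion and gluing *)

Section Normality.
Variable R : realType.
Local Notation C := (Cplx R).
Local Notation disc := (@disc R).
Local Notation hol := (@hol R).
Local Notation der := (@der R).

Lemma real_induction (Q : R -> Prop) : Q 0 ->
  (forall t, 0 <= t < 1 -> (forall s, 0 <= s <= t -> Q s) ->
     exists2 d, 0 < d & forall s, t <= s < t + d -> s <= 1 -> Q s) ->
  (forall t, 0 < t <= 1 -> (forall s, 0 <= s < t -> Q s) -> Q t) ->
  forall t, 0 <= t <= 1 -> Q t.
Proof.
move=> Q0 up lim; pose S := [set t : R | 0 <= t <= 1 /\ forall s, 0 <= s <= t -> Q s].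
have S0 : S 0 by split=> [|s /le_anti <- //]; rewrite lexx ler01.
have hS : has_sup S by split; [exists 0|exists 1 => t [/andP[]]].
have s0 : 0 <= sup S by apply: ub_le_sup => //; exact: hS.2.
have s1 : sup S <= 1 by apply: ge_sup => [|t [/andP[]]//]; exists 0.
have below s : 0 <= s < sup S -> Q s.
  move=> /andP[sge slt]; have e0 : 0 < sup S - s by lra.
  have [t [_ ht] st] := sup_adherent e0 hS.
  by apply: ht; rewrite sge /=; lra.
have Qs : Q (sup S).
  have [e|n] := eqVneq (sup S) 0; first by rewrite e.
  by apply: lim => //; rewrite lt_def n s0.
have upto s : 0 <= s <= sup S -> Q s.
  move=> /andP[sge]; rewrite le_eqVlt => /orP[/eqP -> //|sl]; apply: below; by rewrite sge.
have [e|s1'] := eqVneq (sup S) 1; first by rewrite -e.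
have slt1 : sup S < 1 by rewrite lt_def eq_sym s1'.
have [|d d0 hd] := up (sup S) _ upto; first by rewrite s0.
pose t := Num.min 1 (sup S + d / 2).
have tS : S t.
  have tle : t <= sup S + d / 2 by rewrite ge_min lexx orbT.
  have t1 : t <= 1 by rewrite ge_min lexx.
  have t0 : 0 <= t by rewrite le_min ler01; lra.
  split; first by rewrite t0.
  move=> s /andP[sge st]; have [h|h] := leP s (sup S); first by apply: upto; rewrite sge.
  by apply: hd; [apply/andP; split; lra|lra].
have : t <= sup S by apply: ub_le_sup tS; exact: hS.2.
have : sup S < t by rewrite lt_min slt1; lra.
lra.
Qed.

(** While |F| <= 2a the speed is at most c (1 + 4a^2) < a, so the path cannot reach modulus 2a
    within unit time; [real_induction] makes this continuation argument precise. *)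
Lemma path_growth (F dF : R -> C) a c : 0 < a -> 0 <= c -> c * (1 + (2 * a) ^+ 2) < a ->
  (forall t, 0 <= t <= 1 -> rder F t (dF t)) ->
  (forall t, 0 <= t <= 1 -> nrm (dF t) <= c * (1 + nrm (F t) ^+ 2)) ->
  nrm (F 0) <= a -> nrm (F 1) <= 2 * a.
Proof.
move=> a0 c0 ca hF hd F0.
have ub t : 0 <= t <= 1 -> (forall s, 0 <= s < t -> nrm (F s) <= 2 * a) -> nrm (F t) < 2 * a.
  move=> /andP[t0 t1] h.
  have step s : 0 <= s < t -> nrm (F s - F 0) <= c * (1 + (2 * a) ^+ 2).
    move=> /andP[s0 st].
    apply: le_trans (@mean_value_ineq _ F dF 0 s (c * (1 + (2 * a) ^+ 2)) s0 _ _) _.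
    - by move=> u /andP[u0 us]; apply: hF; rewrite u0; lra.
    - move=> u /andP[u0 us]; apply: le_trans (hd u _) _; first by rewrite u0; lra.
      rewrite ler_wpM2l // lerD2l lerXn2r ?nnegrE ?nrm_ge0 //; first lra.
      by apply: h; rewrite u0; lra.
    - have : 0 <= c * (1 + (2 * a) ^+ 2) by rewrite mulr_ge0 // addr_ge0 // sqr_ge0.
      by rewrite subr0; nra.
  have lim : nrm (F t - F 0) <= c * (1 + (2 * a) ^+ 2).
    have [->|tn] := eqVneq t 0.
      by rewrite subrr nrm0 mulr_ge0 // addr_ge0 // sqr_ge0.
    have tp : 0 < t by rewrite lt_def tn.
    apply/ler_addgt0Pr => e e0.
    have [d d0 h2] := rder_cont (hF t (introT andP (conj t0 t1))) e0.
    pose s := Num.max 0 (t - d / 2).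
    have s0 : 0 <= s by rewrite le_max lexx.
    have st : s < t by rewrite gt_max tp; lra.
    have sd : t - d / 2 <= s by rewrite le_max lexx orbT.
    have := h2 s ltac:(rewrite ler0_norm; lra); have := step s ltac:(by rewrite s0).
    by have := nrm_distD (F s) (F t) (F 0); rewrite (nrmC (F t) (F s)); lra.
  by have := nrm_lerB (F t) (F 0); lra.
apply: (@real_induction (fun t => nrm (F t) <= 2 * a)) => //; last by rewrite ler01 lexx.
- lra.
- move=> t /andP[t0 t1] h; have h1 := ub t ltac:(by rewrite t0 ltW) (fun s hs => h s ltac:(by move/andP: hs => [-> /ltW->])).
  have e0 : 0 < 2 * a - nrm (F t) by lra.
  have [d d0 hd'] := rder_cont (hF t ltac:(by rewrite t0 ltW)) e0.
  exists d => // s /andP[ts sd] _; have := hd' s ltac:(rewrite ger0_norm; lra).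
  by have := nrm_lerB (F s) (F t); lra.
- by move=> t /andP[t0 t1] h; apply: ltW; apply: ub => //; rewrite t1 ltW.
Qed.

Lemma segment_growth f p r K z w a : 0 < a -> 0 <= K -> hol (disc p r) f ->
  (forall v, disc p r v -> nrm (der f v) <= K * (1 + nrm (f v) ^+ 2)) ->
  disc p r z -> disc p r w -> nrm (w - z) * K * (1 + (2 * a) ^+ 2) < a ->
  nrm (f z) <= a -> nrm (f w) <= 2 * a.
Proof.
move=> a0 K0 hf hK zr wr small fz.
pose g (t : R) := z + toC t * (w - z).
have gr t : 0 <= t <= 1 -> disc p r (g t).
  move=> /andP[t0 t1]; rewrite /disc /g.
  have -> : z + toC t * (w - z) - p = toC (1 - t) * (z - p) + toC t * (w - p) by rewrite toCB toC1; ring.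
  apply: le_lt_trans (nrmD _ _) _; rewrite !nrmM !nrm_toC !ger0_norm //; last lra.
  move: zr wr; rewrite /disc; have := nrm_ge0 (z - p); have := nrm_ge0 (w - p).
  move: (nrm (z - p)) (nrm (w - p)) => x y y0 x0 xr yr.
  have [h|h] := leP t (1 / 2); nra.
have D t : rder g t (w - z).
  have := rder_add (rder_cst z t) (rder_mul (rder_toC t) (rder_cst (w - z) t)).
  by congr rder; ring.
have := @path_growth (fun t => f (g t)) (fun t => der f (g t) * (w - z)) a (nrm (w - z) * K) a0 _ small.
have g0 : g 0 = z by rewrite /g toC0 mul0r addr0.
have g1 : g 1 = w by rewrite /g toC1 mul1r subrKC.
rewrite g0 g1; apply=> //; first by rewrite mulr_ge0 // nrm_ge0.
  by move=> t ht; apply: (@rder_comp _ f g t _ _ _ (D t)); apply: hol_der hf _; exact: gr.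
move=> t ht; rewrite nrmM mulrC -mulrA ler_wpM2l ?nrm_ge0 //; apply: hK; exact: gr.
Qed.

Definition conv_or_inf (U : C -> Prop) (f : nat -> C -> C) :=
  (exists g, ucvg U f g) \/
  (forall M, exists N, forall n, (N <= n)%N -> forall z, U z -> M < nrm (f n z)).

Lemma conv_or_inf_sub (U V : C -> Prop) f : (forall z, V z -> U z) -> conv_or_inf U f -> conv_or_inf V f.
Proof.
move=> VU [[g hg]|h]; [left; exists g; exact: ucvg_sub hg|right=> M].
by have [N hN] := h M; exists N => n /hN H z /VU; exact: H.
Qed.
Lemma conv_or_inf_esub U f phi chi : conv_or_inf U (fun n => f (phi n)) -> esub chi phi ->
  conv_or_inf U (fun n => f (chi n)).
Proof.
move=> [[g hg]|h] hs; [left; exists g; exact: ucvg_esub hg hs|right=> M].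
have [N hN] := h M; have [N0 h0] := hs; exists (maxn N0 N) => n; rewrite geq_max => /andP[n0 n1].
by have [m nm ->] := h0 n n0; apply: hN; apply: leq_trans nm.
Qed.

Lemma infinitely_often (P : nat -> Prop) :
  (exists2 phi, sinc phi & forall n, P (phi n)) \/ (exists N, forall n, (N <= n)%N -> ~ P n).
Proof.
have [h|h] := pselect (exists N, forall n, (N <= n)%N -> ~ P n); [by right|left].
have [|next hnext] := @choice nat nat (fun n m => (n <= m)%N /\ P m).
  move=> n; apply: contrapT => H; apply: h; exists n => m nm Pm; apply: H.
  by exists m.
pose phi := fix phi n := if n is m.+1 then next (phi m).+1 else next 0%N.
exists phi => [n|[|n]] /=; [exact: (hnext _).1|exact: (hnext _).2|exact: (hnext _).2].
Qed.

(** If |f n p| <= 2 infinitely often, those functions are bounded near p and Montel applies.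
    Otherwise |f n| > 1 near p, and Harnack for ln |f n| bounds values near p by squares of values
    at p and conversely, so boundedness or divergence at p spreads. *)
Lemma marty p r K : 0 < r -> 0 <= K -> exists2 d, 0 < d & forall f : nat -> C -> C,
  (forall n, hol (disc p r) (f n)) ->
  (forall n z, disc p r z -> nrm (der (f n) z) <= K * (1 + nrm (f n z) ^+ 2)) ->
  exists2 psi, sinc psi & conv_or_inf (disc p d) (fun n => f (psi n)).
Proof.
(* [segment_growth] needs |w - z| K (1 + 4a^2) < a; with d K <= 1/10 it holds for a = 2 (17/10 < 2)
   and for a = 1 (5/10 < 1). *)
move=> r0 K0; pose d := Num.min r (1 / (10 * (K + 1))).
have d0 : 0 < d by rewrite lt_min r0 divr_gt0 // mulr_gt0 //; lra.
have dr : d <= r by rewrite ge_min lexx.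
have dK : d * K <= 1 / 10.
  apply: (@le_trans _ _ (1 / (10 * (K + 1)) * K)); first by rewrite ler_wpM2r // ge_min lexx orbT.
  by rewrite mulrAC ler_pdivrMr ?mulr_gt0 //; lra.
(* [montel] on the radius d/4 loses a factor 16. *)
exists (d / 64); first by rewrite divr_gt0.
move=> f hf hK.
have pr : disc p r p := disc_center p r0.
have sub z : disc p d z -> disc p r z by exact: disc_le.
have small z : disc p d z -> nrm (f 0%N z) = nrm (f 0%N z) -> nrm (z - p) * K <= 1 / 10.
  by move=> zd _; apply: le_trans dK; rewrite ler_wpM2r // ltW.
have c1 n : nrm (f n p) <= 2 -> forall z, disc p d z -> nrm (f n z) <= 4.
  move=> h z zd; have sm := small z zd erefl.
  have -> : (4 : R) = 2 * 2 by ring.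
  apply: (@segment_growth (f n) p r K p z 2) => //; [exact: hK|exact: sub|].
  have := mulr_ge0 (nrm_ge0 (z - p)) K0; lra.
have c2 n : 2 < nrm (f n p) -> forall z, disc p d z -> 1 < nrm (f n z).
  move=> h z zd; rewrite ltNge; apply/negP => hz; have sm := small z zd erefl.
  suff : nrm (f n p) <= 2 * 1 by lra.
  apply: (@segment_growth (f n) p r K z p 1) => //; [exact: hK|exact: sub|].
  by rewrite nrmC; have := mulr_ge0 (nrm_ge0 (z - p)) K0; lra.
have fin (phi : nat -> nat) M : sinc phi -> (forall n z, disc p (d / 4) z -> nrm (f (phi n) z) <= M) ->
   exists2 psi, sinc psi & conv_or_inf (disc p (d / 64)) (fun n => f (psi n)).
  move=> sp hM; have [|n|psi s2 [g hg]] := @montel _ (fun n => f (phi n)) p (d / 4) M _ _ hM.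
  - by rewrite divr_gt0.
  - by apply: hol_sub (hf (phi n)) => z zd; apply: sub; apply: disc_le zd; lra.
  exists (phi \o psi); first exact: sinc_comp.
  by left; exists g; apply: ucvg_sub hg => z; apply: disc_le; lra.
have [[phi sp hphi]|[N hN]] := infinitely_often (fun n => nrm (f n p) <= 2).
  by apply: (fin phi 4 sp) => n z zd; apply: c1 => //; apply: disc_le zd; lra.
have big n : (N <= n)%N -> 2 < nrm (f n p) by move=> /hN h; rewrite ltNge; exact/negP.
have [[M hM]|unb] := pselect (exists M, exists2 phi, sinc phi & forall n, (N <= phi n)%N /\ nrm (f (phi n) p) <= M).
  have [phi sp hphi] := hM.
  apply: (fin phi (M ^+ 2) sp) => n w wd.
  have [Np pM] := hphi n; have bp := big _ Np.
  have f1 := c2 _ bp; have wd' : disc p d w by apply: disc_le wd; lra.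
  have sw z : disc w (3 / 4 * d) z -> disc p d z.
    by apply: disc_sub; move: wd; rewrite /disc; lra.
  have hw : hol (disc w (3 / 4 * d)) (f (phi n)) by apply: hol_sub (hf (phi n)) => z /sw; exact: sub.
  have pw : disc w (3 / 4 * d) p by move: wd; rewrite /disc nrmC; lra.
  have := harnack hw (fun z zd => f1 z (sw z zd)) pw.
  have t0 := nrm_ge0 (p - w); have td : nrm (p - w) < d / 4 by rewrite nrmC.
  have u0 : 0 < ln (nrm (f (phi n) p)) by apply: ln_gt0; lra.
  have v0 : 0 < ln (nrm (f (phi n) w)) by apply: ln_gt0; exact: f1.
  (* Centre w, radius 3d/4 and |p - w| < d/4 give the Harnack ratio at most (3/4 + 1/4) / (3/4 -
     1/4) = 2. *)
  move=> H; have : ln (nrm (f (phi n) w)) <= 2 * ln (nrm (f (phi n) p)).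
    by move: H u0 v0; set u := ln _; set v := ln _; nra.
  rewrite -[2 * ln _]/(2%:R * ln _) mulr_natl -lnXn; last lra.
  rewrite ler_ln ?posrE ?exprn_gt0 //; [|by have := f1 w wd'; lra|lra].
  by move/le_trans; apply; rewrite lerXn2r ?nnegrE ?nrm_ge0 //; lra.
exists (fun n => n + N)%N; first exact: sinc_shift.
right=> M.
(* The square anticipates Harnack, which gives |f p| <= |f z|^2. *)
have [N1 hN1] : exists N1, forall n, (N1 <= n)%N -> (Num.max 1 M) ^+ 2 < nrm (f (n + N)%N p).
  have [[phi sp hphi]|[N1 h1]] := infinitely_often (fun n => nrm (f (n + N)%N p) <= (Num.max 1 M) ^+ 2).
    exfalso; apply: unb; exists (Num.max 1 M ^+ 2), (fun n => phi n + N)%N.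
      by move=> n; rewrite ltn_add2r.
    by move=> n; rewrite leq_addl.
  by exists N1 => n /h1 h; rewrite ltNge; exact/negP.
exists N1 => n n1 z zd.
have bp := big (n + N)%N (leq_addl _ _); have f1 := c2 _ bp.
have zd' : disc p d z by apply: disc_le zd; lra.
have hw : hol (disc p d) (f (n + N)%N) by apply: hol_sub (hf _) => v; exact: sub.
have := harnack hw f1 zd'; have := hN1 n n1.
have t0 := nrm_ge0 (z - p); have td : nrm (z - p) < d / 64 by exact: zd.
have u0 : 0 < ln (nrm (f (n + N)%N p)) by apply: ln_gt0; lra.
have v0 : 0 < ln (nrm (f (n + N)%N z)) by apply: ln_gt0; exact: f1.
move=> HM H; have : ln (nrm (f (n + N)%N p)) <= 2 * ln (nrm (f (n + N)%N z)).
  by move: H u0 v0; set u := ln _; set v := ln _; nra.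
have fz := f1 z zd'.
rewrite -[2 * ln _]/(2%:R * ln _) mulr_natl -lnXn; last lra.
rewrite ler_ln ?posrE ?exprn_gt0 //; [|lra|lra].
move=> H3; have m1 : 1 <= Num.max 1 M by rewrite le_max lexx.
have : Num.max 1 M ^+ 2 < nrm (f (n + N)%N z) ^+ 2 by exact: lt_le_trans HM H3.
rewrite ltr_pXn2r ?nnegrE ?nrm_ge0 //; last lra.
by apply: le_lt_trans; rewrite le_max lexx orbT.
Qed.

Definition linf (U : C -> Prop) (f : nat -> C -> C) := forall z, U z -> exists2 r, 0 < r &
  forall M, exists N, forall n, (N <= n)%N -> forall w, disc z r w -> M < nrm (f n w).

(** Connectedness in the form used for gluing; it covers the domain D and the plane of the rescaled
    variable alike. *)
Definition locally_const_const (U : C -> Prop) := forall P : C -> Prop,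
  (forall z, U z -> exists2 r, 0 < r & forall w, U w -> disc z r w -> (P w <-> P z)) ->
  (forall z, U z -> P z) \/ (forall z, U z -> ~ P z).

Lemma plane_connected : locally_const_const (fun=> True).
Proof.
move=> P h.
have key z w : P z <-> P w.
  pose g (t : R) := z + toC t * (w - z).
  have cg t : cont_at (@Num.norm R R) g t.
    apply: cont_add; first exact: cont_cst.
    by apply: cont_mul; [exact: rcont_toC|exact: cont_cst].
  have near t : exists2 d, 0 < d & forall s, `|s - t| < d -> (P (g s) <-> P (g t)).
    have [r r0 hr] := h (g t) I; have [d d0 hd] := cg t r r0; exists d => // s /hd sd.
    exact: hr.
  have g0 : g 0 = z by rewrite /g toC0 mul0r addr0.
  have g1 : g 1 = w by rewrite /g toC1 mul1r subrKC.
  rewrite -g1; apply: (@real_induction (fun t => P z <-> P (g t))); last by rewrite ler01 lexx.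
  - by rewrite g0.
  - move=> t /andP[t0 _] ht; have [d d0 hd] := near t; exists d => // s /andP[ts sd] _.
    have e1 := ht t ltac:(by rewrite t0 lexx).
    have e2 := hd s ltac:(rewrite ger0_norm; lra).
    by tauto.
  - move=> t /andP[t0 _] ht; have [d d0 hd] := near t.
    pose s := Num.max 0 (t - d / 2).
    have s0 : 0 <= s by rewrite le_max lexx.
    have st : s < t by rewrite gt_max t0; lra.
    have sd : t - d / 2 <= s by rewrite le_max lexx orbT.
    have e1 := ht s ltac:(by rewrite s0).
    have e2 := hd s ltac:(rewrite ler0_norm; lra).
    by tauto.
have [P0|P0] := pselect (P 0); [left|right] => z _; [exact/(key 0 z)|by move/(key z 0)].
Qed.

Lemma domain_connected (D : set C) : domain D -> locally_const_const D.
Proof.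
move=> [oD cD _] P h.
(* P is constrained on D only, so sets open in C with the right trace on D have to be built from
   discs. *)
pose O (Q : C -> Prop) : set C := fun w => exists z r, [/\ 0 < r, D z, Q z, disc z r w &
   forall v, D v -> disc z r v -> Q v].
have openO Q : open (O Q).
  rewrite openE => w [z [r [r0 Dz Qz zr hv]]].
  have [s s0 hs] := disc_open zr.
  exists (toC s); first by rewrite /= -toC0 toC_lt.
  move=> v /=; rewrite normE toC_lt => vs; exists z, r; split=> //.
  by apply: hs; rewrite /disc nrmC.
have OP Q : (forall z, D z -> exists2 r, 0 < r & forall w, D w -> disc z r w -> (Q w <-> Q z)) ->
    forall z, D z -> Q z -> O Q z.
  move=> hQ z Dz Qz; have [r r0 hr] := hQ z Dz; exists z, r; split=> //.
    exact: disc_center.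
  by move=> v Dv vr; apply/(hr v).
have hN z : D z -> exists2 r, 0 < r & forall w, D w -> disc z r w -> (~ P w <-> ~ P z).
  by move=> /h[r r0 hr]; exists r => // w Dw wr; have := hr w Dw wr; tauto.
have [[z0 [Dz0 Pz0]]|none] := pselect (exists z, D z /\ P z); last first.
  by right=> z Dz Pz; apply: none; exists z.
left; have E : [set z | D z /\ P z] = D.
  apply: cD; first by exists z0.
  - exists (O P); first exact: openO.
    apply/seteqP; split=> [z [Dz Pz]|z [Dz [w [r [r0 Dw Pw wr hv]]]]]; split=> //.
      exact: OP.
    exact: hv.
  - exists (~` O (fun z => ~ P z)); first exact: open_closedC.
    apply/seteqP; split=> [z [Dz Pz]|z [Dz nO]]; split=> //.
      by move=> [w [r [r0 Dw Pw wr hv]]]; exact: (hv z Dz wr).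
    by apply: contrapT => nP; apply: nO; exact: OP.
by move=> z Dz; have [] : [set z | D z /\ P z] z by rewrite E.
Qed.

(** Countably many discs form a base, so the local extractions can be diagonalised. *)
Lemma rat_disc z r : 0 < r -> exists (q : rat * rat) (n : nat),
  let c := mkc (ratr q.1) (ratr q.2) : C in
  disc c n.+1%:R^-1 z /\ forall w, disc c n.+1%:R^-1 w -> disc z r w.
Proof.
move=> r0; have [n hn] := inv_nat_small (e := r / 2) ltac:(lra).
have := hn n (leqnn _); have p0 : 0 < n.+1%:R^-1 :> R by rewrite invr_gt0.
move: p0; set p := _^-1 => p0 pr.
have [a ha] := @rat_in_itvoo R (re z) (re z + p / 2) ltac:(lra).
have [b hb] := @rat_in_itvoo R (im z) (im z + p / 2) ltac:(lra).
exists (a, b), n; rewrite /= -/p; clearbody p.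
have zc : disc (mkc (ratr a) (ratr b)) p z.
  apply: le_lt_trans (nrm_le_reim _) _; rewrite !cpxE.
  move: ha hb; rewrite !in_itv /= => /andP[a1 a2] /andP[b1 b2].
  by rewrite !ler0_norm; lra.
split=> // w; apply: disc_sub; rewrite nrmC; move: zc; rewrite /disc; lra.
Qed.

(** A diagonal subsequence settles every rational disc on which extraction is possible. Near each
    point the outcome is then convergence or divergence to infinity; these exclude each other and
    are locally constant, so one of them holds throughout U. *)
Lemma normal_glue (U : C -> Prop) (f : nat -> C -> C) : locally_const_const U ->
  (forall z, U z -> exists2 r, 0 < r & forall phi, sinc phi -> exists2 psi, sinc psi &
     conv_or_inf (disc z r) (fun n => f (phi (psi n)))) ->
  exists2 chi, sinc chi & (exists g, lucvg U (fun n => f (chi n)) g) \/ linf U (fun n => f (chi n)).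
Proof.
move=> cU hloc.
pose LN B := forall phi, sinc phi -> exists2 psi, sinc psi & conv_or_inf B (fun n => f (phi (psi n))).
pose B i : C -> Prop := if (unpickle i : option (rat * rat * nat)) is Some q
   then disc (mkc (ratr q.1.1) (ratr q.1.2)) q.2.+1%:R^-1 else fun=> False.
have [||chi sc hchi] := @diag_subseq (fun i phi => LN (B i) -> conv_or_inf (B i) (fun n => f (phi n))).
- move=> i phi sp; have [h|h] := pselect (LN (B i)); last by exists id.
  by have [psi s2 hpsi] := h phi sp; exists psi.
- move=> i phi chi hp _ hs /hp h; exact: conv_or_inf_esub h hs.
exists chi => //.
have loc z : U z -> exists2 r, 0 < r & conv_or_inf (disc z r) (fun n => f (chi n)).
  move=> Uz; have [r r0 hr] := hloc z Uz; have [q [n /= [zc sub]]] := rat_disc z r0.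
  have BE : B (pickle (q, n)) = disc (mkc (ratr q.1) (ratr q.2)) n.+1%:R^-1 by rewrite /B pickleK.
  have := hchi (pickle (q, n)); rewrite BE => H.
  have [s s0 hs] := disc_open zc; exists s => //; apply: conv_or_inf_sub hs _; apply: H.
  by move=> phi /hr[psi s2 h]; exists psi => //; exact: conv_or_inf_sub h.
pose P z := exists2 r, 0 < r & exists g, ucvg (disc z r) (fun n => f (chi n)) g.
have notboth z r : 0 < r -> (forall M, exists N, forall n, (N <= n)%N -> forall w, disc z r w -> M < nrm (f (chi n) w)) -> ~ P z.
  move=> r0 hi [s s0 [g hg]].
  have [M hM] := tends_bounded (ucvg_tends hg (disc_center z s0)).
  have [N hN] := hi M; have := hN N (leqnn _) z (disc_center z r0); have := hM N; lra.
have [|all|none] := cU P.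
- move=> z Uz; have [r r0 [[g hg]|hi]] := loc z Uz; exists r => // w Uw wr;
    have [s s0 hs] := disc_open wr.
    split=> _; first by exists r => //; exists g.
    by exists s => //; exists g; exact: ucvg_sub hg.
  split=> h; exfalso; last exact: (notboth z r r0 hi).
  apply: (notboth w s s0 _ h) => M; have [N hN] := hi M; exists N => n /hN H v /hs; exact: H.
- left.
  have [|g hg] := @choice C C (fun z l => U z -> tends (fun n => f (chi n) z) l).
    move=> z; have [Uz|nU] := pselect (U z); last by exists 0.
    have [r r0 [g hg]] := all z Uz; exists (g z) => _; apply: ucvg_tends hg _; exact: disc_center.
  (* A disc around a point of U may leave U, and uniform convergence is claimed on all of it; off U
     the limit is therefore chosen wherever it exists. *)
  exists (fun z => if pselect (U z) then g z else
     get [set l | tends (fun n => f (chi n) z) l]).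
  move=> z Uz; have [r r0 [g' hg']] := all z Uz; exists r => // e e0.
  have [N hN] := hg' e e0; exists N => n /hN H w wr.
  have tw := ucvg_tends hg' wr.
  case: pselect => [Uw|nU]; first by rewrite (tends_uniq (hg w Uw) tw); exact: H.
  have : [set l | tends (fun n => f (chi n) w) l] (get [set l | tends (fun n => f (chi n) w) l]).
    by apply: (@getI _ [set l | tends (fun n => f (chi n) w) l] (g' w)).
  by move=> /= t2; rewrite (tends_uniq t2 tw); exact: H.
- right=> z Uz; have [r r0 [[g hg]|hi]] := loc z Uz; last by exists r.
  by exfalso; apply: (none z Uz); exists r => //; exists g.
Qed.

End Normality.

(** * Zalcman rescaling *)

Section Rescaling.
Variable R : realType.
Local Notation C := (Cplx R).
Local Notation disc := (@disc R).
Local Notation hol := (@hol R).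
Local Notation der := (@der R).

(* The amplitude by which the functions are divided at the point z and the
   scale s: th is 1 and p is the possible zero, of order m, of a, unless k = 1
   or a vanishes near p, when th is 0. *)
Definition ampl (th : R) (m k : nat) (p z : C) (s : R) : R := th * (nrm (z - p) + s) ^+ m + s ^+ k.

(* Spherical derivative at the origin of h (z + s _) / (ampl z s). *)
Definition sder th m k p (h : C -> C) z s : R :=
  s * nrm (der h z) * ampl th m k p z s / (ampl th m k p z s ^+ 2 + nrm (h z) ^+ 2).

Lemma ampl_gt0 th m k p z s : 0 <= th -> 0 < s -> 0 < ampl th m k p z s.
Proof.
move=> t0 s0; rewrite ltr_wpDl ?exprn_gt0 // mulr_ge0 // exprn_ge0 //.
by rewrite addr_ge0 ?nrm_ge0 // ltW.
Qed.
Lemma ampl_ge th m k p z s : 0 <= th -> 0 < s -> s ^+ k <= ampl th m k p z s.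
Proof.
move=> t0 s0; rewrite lerDr mulr_ge0 // exprn_ge0 //.
by rewrite addr_ge0 ?nrm_ge0 // ltW.
Qed.

Lemma frac_le1 (x M y : R) : 0 <= x -> 0 < M -> x * M / (M ^+ 2 + y ^+ 2) <= x / M.
Proof.
move=> x0 M0; have y0 := sqr_ge0 y.
rewrite ler_pdivrMr; last by rewrite ltr_wpDr // exprn_gt0.
rewrite -[leLHS]mulr1 mulrDr -[leLHS]addr0 mulr1; apply: lerD.
  by rewrite expr2 !mulrA divfK // gt_eqF.
by rewrite mulr_ge0 // divr_ge0 // ltW.
Qed.
Lemma frac_le2 (x M y : R) : 0 <= x -> 0 < M -> 0 < y -> x * M / (M ^+ 2 + y ^+ 2) <= x / y.
Proof.
move=> x0 M0 y0; rewrite ler_pdivrMr; last by rewrite addr_gt0 // exprn_gt0.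
rewrite mulrAC ler_pdivlMr //.
rewrite -!mulrA; apply: ler_wpM2l => //; nra.
Qed.
Lemma frac_le3 (x M y : R) : 0 <= x -> 0 < M -> 0 < y -> x * M / (M ^+ 2 + y ^+ 2) <= x * M / y ^+ 2.
Proof.
move=> x0 M0 y0; apply: ler_wpM2l; first by rewrite mulr_ge0 // ltW.
by rewrite lef_pV2 ?posrE ?addr_gt0 ?exprn_gt0 // lerDr exprn_ge0 // ltW.
Qed.

Lemma ler_mulr_shrink (x t y v : R) : 0 <= x -> 0 <= t -> t <= 1 -> 0 <= y -> y <= v -> t * x * y <= v * x.
Proof.
move=> x0 t0 t1 y0 yv; rewrite mulrAC ler_wpM2r //; apply: le_trans yv.
by rewrite -[leRHS]mul1r ler_wpM2r.
Qed.

Section Local.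
Variables (th : R) (m k : nat) (p : C) (K : R) (h : C -> C) (zs : C) (r0 : R).
Hypotheses (th0 : 0 <= th) (K0 : 0 < K) (r00 : 0 < r0) (hh : hol (disc zs r0) h).
Local Notation sd := (sder th m k p h).

(** For one fixed h this keeps the points with spherical derivative at least K away from scale 0, so
    that a nearly minimal scale exists in [zalcman_points]. *)
Definition sder_small := exists2 d, 0 < d & forall z s, disc zs d z -> 0 < s < d -> sd z s < K.

Lemma der_near : exists D d, [/\ 0 < D, 0 < d & forall z, disc zs d z -> nrm (der h z) <= D].
Proof.
have [d d0 hd] := cont_bounded (hol_cont (der_hol_disc hh) (disc_center zs r00)).
exists (nrm (der h zs) + 1), d; split=> //; first by rewrite ltr_wpDl // nrm_ge0.
by move=> z /hd /ltW.
Qed.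

Lemma sder_small_nonzero : h zs != 0 -> sder_small.
Proof.
move=> h0; have [D [d [D0 d0 hD]]] := der_near.
have c0 : 0 < nrm (h zs) by rewrite nrm_gt0.
have [d2 d20 hd2] := hol_cont hh (disc_center zs r00) (divr_gt0 c0 (ltr0Sn _ 1)).
pose B := th * (nrm (zs - p) + 2) ^+ m + 1; have B0 : 0 < B.
  by rewrite ltr_wpDl // mulr_ge0 // exprn_ge0 // addr_ge0 // nrm_ge0.
pose c := nrm (h zs) / 2; have cp : 0 < c by rewrite divr_gt0.
pose d3 := K / (D * B / c ^+ 2 + 1).
have E0 : 0 < D * B / c ^+ 2 by apply: divr_gt0; [exact: mulr_gt0|exact: exprn_gt0].
have d30 : 0 < d3 by rewrite divr_gt0 //; lra.
exists (Num.min (Num.min d d2) (Num.min 1 d3)); first by rewrite !lt_min d0 d20 ltr01.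
move=> z s; rewrite /disc !lt_min => /andP[/andP[zd zd2] /andP[z1 _]] /andP[s0 /andP[_ /andP[s1 s3]]].
have hz : c <= nrm (h z).
  have := hd2 z zd2; have := nrm_lerB (h zs) (h z); rewrite nrmC /c; lra.
have MB : ampl th m k p z s <= B.
  apply: lerD; last by apply: exprn_ile1; lra.
  apply: ler_wpM2l => //; rewrite lerXn2r ?nnegrE ?addr_ge0 ?nrm_ge0 //; try lra.
  by have := nrm_distD zs z p; lra.
have M0 := ampl_gt0 m k p z th0 s0.
have hz0 : 0 < nrm (h z) by lra.
have dz := hD z zd; have d00 := nrm_ge0 (der h z).
have x0 : 0 <= s * nrm (der h z) by rewrite mulr_ge0 // ltW.
apply: le_lt_trans (frac_le3 x0 M0 hz0) _.
apply: (@le_lt_trans _ _ (s * (D * B / c ^+ 2))).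
  rewrite -!mulrA ler_wpM2l ?(ltW s0) //; apply: ler_pM => //.
    by rewrite divr_ge0 ?exprn_ge0 // ltW.
  apply: ler_pM => //; rewrite ?invr_ge0 ?exprn_ge0 ?(ltW M0) ?(ltW hz0) //.
  by rewrite lef_pV2 ?posrE ?exprn_gt0 // lerXn2r ?nnegrE ?(ltW cp) // ltW.
move: s3; rewrite /d3 ltr_pdivlMr; last lra.
have := ltW s0; nra.
Qed.

Lemma sder_small_ampl c : 0 < c -> (exists2 d, 0 < d & forall z s, disc zs d z -> 0 < s -> c <= ampl th m k p z s) ->
  sder_small.
Proof.
move=> c0 [d1 d10 hM]; have [D [d [D0 d0 hD]]] := der_near.
pose d3 := K * c / D; have d30 : 0 < d3 by rewrite divr_gt0 ?mulr_gt0.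
exists (Num.min (Num.min d d1) d3); first by rewrite !lt_min d0 d10.
move=> z s; rewrite /disc !lt_min => /andP[/andP[zd zd1] _] /andP[s0 /andP[_ s3]].
have M0 := ampl_gt0 m k p z th0 s0.
have x0 : 0 <= s * nrm (der h z) by rewrite mulr_ge0 ?nrm_ge0 // ltW.
apply: le_lt_trans (frac_le1 _ x0 M0) _.
rewrite ltr_pdivrMr //; apply: (@lt_le_trans _ _ (K * c)); last by rewrite ler_pM2l // hM.
move: s3; rewrite /d3 ltr_pdivlMr // => s3.
by apply: le_lt_trans s3; rewrite ler_wpM2l ?(ltW s0) // hD.
Qed.

(** For k = 1 the amplitude is at least s, so the spherical derivative is at most |h'|. Zeros of h
    may be simple, and K has to exceed the derivative there. *)
Lemma sder_small_first : k = 1%N -> nrm (der h zs) < K -> sder_small.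
Proof.
move=> k1 hK; have e0 : 0 < K - nrm (der h zs) by lra.
have [d d0 hd] := hol_cont (der_hol_disc hh) (disc_center zs r00) e0.
exists d => // z s zd /andP[s0 _].
have M0 := ampl_gt0 m k p z th0 s0.
have x0 : 0 <= s * nrm (der h z) by rewrite mulr_ge0 ?nrm_ge0 // ltW.
apply: le_lt_trans (frac_le1 _ x0 M0) _.
rewrite ltr_pdivrMr //; apply: (@lt_le_trans _ _ (K * s)).
  rewrite [s * _]mulrC (ltr_pM2r s0).
  by move: (le_lt_trans (nrm_lerB _ _) (hd z zd)); rewrite ltrD2r.
have E : s ^+ k = s by rewrite k1 expr1.
by rewrite ler_pM2l //; apply: (@le_trans _ _ (s ^+ k)); [rewrite E|exact: ampl_ge].
Qed.

Lemma sder_small_zero : (exists2 d, 0 < d & forall z, disc zs d z -> h z = 0) -> sder_small.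
Proof.
move=> [d d0 hd]; exists d => // z s zd _.
have [t t0 ht] := disc_open zd.
have E : der h z = 0.
  apply: derE; apply: (@cder_local _ (fun=> 0) h z 0 t) => //; last exact: cder_cst.
  by move=> w /ht /hd.
by rewrite /sder E nrm0 mulr0 !mul0r.
Qed.

(** At distance t >= N s from the zero, bound by s |h'| / |h|, which is of order s / t; closer in,
    h' is of order s^(j-1) and division by s^k leaves a factor s^(j-k), which is small as j > k. *)
Lemma sder_small_order j q : (k < j)%N -> hol (disc zs r0) q -> q zs != 0 ->
  (forall z, h z = (z - zs) ^+ j * q z) -> sder_small.
Proof.
move=> kj hq q0 hE.
have j0 : (0 < j)%N by apply: leq_ltn_trans kj.
have c0 : 0 < nrm (q zs) by rewrite nrm_gt0.
pose c := nrm (q zs) / 2; have cp : 0 < c by rewrite divr_gt0.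
have dp := disc_center zs r00.
have [d1 d10 hd1] := hol_cont hq dp cp.
have [d2 d20 hd2] := cont_bounded (hol_cont hq dp).
have [d3 d30 hd3] := cont_bounded (hol_cont (der_hol_disc hq) dp).
pose D := j%:R * (nrm (q zs) + 1) + (nrm (der q zs) + 1).
have D0 : 0 < D.
  by rewrite ltr_wpDl // ?mulr_ge0 // ?addr_ge0 ?nrm_ge0 // ltr_wpDl // nrm_ge0.
(* D bounds |h'| / t^(j-1) and c bounds |q| from below; D / (c N) < K settles the far region. *)
pose N := D / c / K + 1.
have N0 : 0 < N by have : 0 < D / c / K by [rewrite !divr_gt0]; rewrite /N; lra.
pose d4 := K / (D * N ^+ j.-1 + 1).
have E0 : 0 < D * N ^+ j.-1 by rewrite mulr_gt0 // exprn_gt0.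
have d40 : 0 < d4 by rewrite divr_gt0 //; lra.
pose d := Num.min (Num.min d1 d2) (Num.min (Num.min d3 r0) (Num.min 1 d4)).
exists d; first by rewrite !lt_min d10 d20 d30 r00 ltr01.
move=> z s; rewrite /disc !lt_min => /andP[/andP[z1 z2] /andP[/andP[z3 z4] /andP[z5 _]]].
move=> /andP[s0 /andP[_ /andP[_ /andP[s1 s4]]]].
have M0 := ampl_gt0 m k p z th0 s0.
set t := nrm (z - zs) in z1 z2 z3 z4 z5; have t0 : 0 <= t := nrm_ge0 _.
have dh : nrm (der h z) <= D * t ^+ j.-1.
  have dlin : cder (fun z : C => z - zs) z 1.
    by rewrite -[X in cder _ _ X]subr0; apply: cder_sub; [exact: cder_id|exact: cder_cst].
  have X := cder_exp j.-1 dlin; rewrite prednK // in X.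
  have := cder_mul X (hol_der hq z4).
  have -> : (fun w : C => (w - zs) ^+ j * q w) = h by apply/funext => w; rewrite hE.
  move=> /derE ->; apply: le_trans (nrmD _ _) _; rewrite !nrmM nrm1 mulr1 !nrmX -/t.
  rewrite -toC_nat nrm_toC ger0_norm // -{3}(prednK j0) exprS.
  have a1 : nrm (q z) <= nrm (q zs) + 1 by apply: ltW; exact: hd2.
  have a2 : nrm (der q z) <= nrm (der q zs) + 1 by apply: ltW; exact: hd3.
  have T0 : 0 <= t ^+ j.-1 by rewrite exprn_ge0.
  rewrite /D mulrDl; apply: lerD.
    by rewrite mulrAC ler_wpM2r // ler_wpM2l.
  exact: (ler_mulr_shrink T0 t0 (ltW z5) (nrm_ge0 _) a2).
have x0 : 0 <= s * nrm (der h z) by rewrite mulr_ge0 ?nrm_ge0 // ltW.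
have [tN|tN] := leP (N * s) t.
  have tp : 0 < t by apply: lt_le_trans tN; rewrite mulr_gt0.
  have hz : c * t ^+ j <= nrm (h z).
    rewrite hE nrmM nrmX -/t mulrC ler_wpM2l ?exprn_ge0 //.
    by have := hd1 z z1; have := nrm_lerB (q zs) (q z); rewrite nrmC /c; lra.
  have hz0 : 0 < nrm (h z) by apply: lt_le_trans hz; rewrite mulr_gt0 // exprn_gt0.
  apply: le_lt_trans (frac_le2 x0 M0 hz0) _; rewrite ltr_pdivrMr //.
  apply: (@lt_le_trans _ _ (K * (c * t ^+ j))); last by rewrite ler_pM2l.
  apply: (@le_lt_trans _ _ (s * (D * t ^+ j.-1))); first by rewrite ler_wpM2l // ltW.
  rewrite -(prednK j0) exprS /=.
  have T0 : 0 < t ^+ j.-1 by rewrite exprn_gt0.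
  have -> : s * (D * t ^+ j.-1) = (s * D) * t ^+ j.-1 by ring.
  have -> : K * (c * (t * t ^+ j.-1)) = (K * c * t) * t ^+ j.-1 by ring.
  rewrite ltr_pM2r //.
  have Kc : 0 < K * c by rewrite mulr_gt0.
  apply: (@lt_le_trans _ _ (K * c * (N * s))); last by rewrite ler_pM2l.
  have -> : K * c * (N * s) = D * s + K * c * s by rewrite /N; field; rewrite !gt_eqF.
  by have : 0 < K * c * s by [rewrite mulr_gt0]; lra.
apply: le_lt_trans (frac_le1 _ x0 M0) _; rewrite ltr_pdivrMr //.
apply: (@lt_le_trans _ _ (K * s ^+ k)); last by rewrite ler_pM2l // ampl_ge.
have tj : t ^+ j.-1 <= (N * s) ^+ j.-1 by rewrite lerXn2r ?nnegrE ?mulr_ge0 ?(ltW tN) // ltW.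
apply: (@le_lt_trans _ _ (s * (D * (N * s) ^+ j.-1))).
  by rewrite ler_wpM2l ?(ltW s0) //; apply: le_trans dh _; rewrite ler_wpM2l // ltW.
have -> : s * (D * (N * s) ^+ j.-1) = D * N ^+ j.-1 * s ^+ j.
  have -> : s ^+ j = s * s ^+ j.-1 by rewrite -exprS prednK.
  by rewrite exprMn; ring.
have -> : s ^+ j = s ^+ (j - k) * s ^+ k by rewrite -exprD subnK // ltnW.
rewrite mulrA ltr_pM2r ?exprn_gt0 //.
have sj : s ^+ (j - k) <= s.
  rewrite -[leRHS]expr1; apply: ler_wiXn2l; [exact: ltW|exact: ltW|by rewrite subn_gt0].
apply: (@le_lt_trans _ _ (D * N ^+ j.-1 * s)); first by rewrite ler_wpM2l // ltW.
move: s4; rewrite /d4 ltr_pdivlMr; last lra.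
by have := ltW s0; nra.
Qed.
End Local.

Lemma sder_small_unif th m k p K h (c0 : C) r :
  (forall zs, nrm (zs - c0) <= r -> sder_small th m k p K h zs) ->
  exists2 d, 0 < d & forall z s, disc c0 r z -> 0 < s < d -> sder th m k p h z s < K.
Proof.
move=> loc; apply: contrapT => H.
have [|u hu] := @choice nat (C * R) (fun n q => [/\ disc c0 r q.1, 0 < q.2 < n.+1%:R^-1 &
    K <= sder th m k p h q.1 q.2]).
  move=> n; apply: contrapT => H2; apply: H; exists n.+1%:R^-1; first by rewrite invr_gt0.
  move=> z s zr hs; rewrite ltNge; apply/negP => hK; apply: H2; exists (z, s); split=> //.
have [phi sp [l hl]] := @bounded_sub _ (fun n => (u n).1) (r + nrm c0)
  (fun n => ltac:(have [zr _ _] := hu n; move: zr; rewrite /disc; have := nrm_lerB (u n).1 c0; lra)).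
have lr : nrm (l - c0) <= r.
  by apply: tends_le hl _; exists 0%N => n _; have [zr _ _] := hu (phi n); exact: ltW.
have [d d0 hd] := loc l lr.
have [N1 h1] := hl d d0; have [N2 h2] := inv_nat_small d0.
pose n := maxn N1 N2; have [zr /andP[s0 s1] hK] := hu (phi n).
have := hd (u (phi n)).1 (u (phi n)).2 (h1 n (leq_maxl _ _)).
rewrite s0 (lt_trans s1) /=; first by move=> /(_ isT); rewrite ltNge hK.
by apply: h2; apply: leq_trans (leq_maxr _ _) (sinc_ge _ sp).
Qed.

(** Among the points with spherical derivative at least K, minimise s / (r - |z - c0|) up to a
    factor 2. The weight keeps the rescaled discs inside: [bad] makes the minimal ratio tend to 0,
    and points of less than half the ratio are good. *)
Lemma zalcman_points th m k p K (h : nat -> C -> C) (c0 : C) r : 0 < r ->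
  (forall n, exists2 d, 0 < d & forall z s, disc c0 r z -> 0 < s < d -> sder th m k p (h n) z s < K) ->
  (forall l, 0 < l -> exists N, forall n, (N <= n)%N -> exists z s,
     [/\ disc c0 r z, 0 < s <= l * (r - nrm (z - c0)) & K <= sder th m k p (h n) z s]) ->
  exists z s N0, [/\
    forall n, (N0 <= n)%N -> [/\ disc c0 r (z n), 0 < s n & K <= sder th m k p (h n) (z n) (s n)],
    forall e, 0 < e -> exists N, forall n, (N <= n)%N -> s n <= e * (r - nrm (z n - c0)) &
    forall n, (N0 <= n)%N -> forall w t, disc c0 r w -> 0 < t ->
      2 * t * (r - nrm (z n - c0)) < s n * (r - nrm (w - c0)) -> sder th m k p (h n) w t < K].
Proof.
move=> r0 loc bad.
pose P n (q : C * R) := [/\ disc c0 r q.1, 0 < q.2 & K <= sder th m k p (h n) q.1 q.2].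
pose x (q : C * R) := q.2 / (r - nrm (q.1 - c0)).
have gap q n : P n q -> 0 < r - nrm (q.1 - c0) by case=> + _ _; rewrite /disc; lra.
have [|u hu] := @choice nat (C * R) (fun n q => (exists q', P n q') -> P n q /\
   forall q', P n q' -> x q <= 2 * x q').
  move=> n; have [[q1 Pq1]|nP] := pselect (exists q', P n q'); last by exists (0, 0).
  pose S := [set y : R | exists2 q, P n q & y = x q].
  have [d d0 hd] := loc n.
  have lowx q : P n q -> d / r <= x q.
    move=> Pq; have g0 := gap q n Pq; case: (Pq) => zr s0 hK.
    have sd : d <= q.2 by rewrite leNgt; apply/negP => h2; have := hd q.1 q.2 zr; rewrite s0 h2 ltNge hK => /(_ isT).
    rewrite /x ler_pdivlMr // mulrAC ler_pdivrMr //.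
    by have := nrm_ge0 (q.1 - c0); nra.
  have Sn : S !=set0 by exists (x q1); exists q1.
  have Slb : has_lbound S by exists (d / r) => _ [q Pq ->]; exact: lowx.
  have i0 : 0 < inf S.
    by apply: lt_le_trans (_ : d / r <= _); [rewrite divr_gt0|apply: lb_le_inf => // _ [q Pq ->]; exact: lowx].
  have [|y [q Pq ->] hq] := @inf_adherent _ S _ i0; first by split.
  exists q => _; split=> // q' Pq'.
  have : inf S <= x q' by apply: ge_inf => //; exists q'.
  by move: hq; lra.
have [N0 hN0] := bad 1 ltr01.
have ex n : (N0 <= n)%N -> exists q, P n q.
  by move=> /hN0 [z [s [zr /andP[s0 _] hK]]]; exists (z, s).
exists (fun n => (u n).1), (fun n => (u n).2), N0; split.
- by move=> n /ex /hu[].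
- move=> e e0; have [N hN] := bad (e / 2) ltac:(lra); exists (maxn N0 N) => n.
  rewrite geq_max => /andP[n0 n1]; have [Pu hx] := hu n (ex n n0).
  have [z [s [zr /andP[s0 s1] hK]]] := hN n n1.
  have Pz : P n (z, s) by [].
  have := hx (z, s) Pz; have g1 := gap _ _ Pu; have g2 := gap _ _ Pz.
  rewrite {1}/x ler_pdivrMr // => H; apply: le_trans H _; rewrite ler_wpM2r //; first exact: ltW.
  have : x (z, s) <= e / 2 by rewrite /x ler_pdivrMr.
  lra.
- move=> n n0 w t wr t0 H; have [Pu hx] := hu n (ex n n0).
  rewrite ltNge; apply/negP => hK; have Pw : P n (w, t) by [].
  have := hx (w, t) Pw; have g1 := gap _ _ Pu; have g2 := gap _ _ Pw.
  rewrite /x ler_pdivrMr //= => H2.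
  have : (u n).2 * (r - nrm (w - c0)) <= 2 * t * (r - nrm ((u n).1 - c0)).
    apply: le_trans (ler_wpM2r (ltW g2) H2) _.
    have -> : 2 * (t / (r - nrm (w - c0))) * (r - nrm ((u n).1 - c0)) * (r - nrm (w - c0)) =
      2 * t * (r - nrm ((u n).1 - c0)) by field; rewrite gt_eqF.
    by [].
  by rewrite leNgt H.
Qed.

Lemma dern_affine h q r (c z : C) (rho : C) k z1 s1 : 0 < s1 -> hol (disc q r) h ->
  (forall w, disc z1 s1 w -> disc q r (z + rho * w)) ->
  forall w, disc z1 s1 w -> dern k (fun w => c * h (z + rho * w)) w = c * rho ^+ k * dern k h (z + rho * w).
Proof.
move=> s0 hh sub; elim: k => [|k IH] w wd; first by rewrite expr0 mulr1.
have [t t0 ht] := disc_open wd; rewrite dernS.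
apply: (@der_loc _ (fun w => c * rho ^+ k * dern k h (z + rho * w)) _ _ _ t) => //.
  by move=> v /ht vd; rewrite IH.
have A : cder (fun v => z + rho * v) w rho.
  have := cder_add (cder_cst z w) (cder_mul (cder_cst rho w) (cder_id w)).
  by rewrite mul0r mulr1 !add0r.
have X := @cder_comp _ (dern k h) (fun v => z + rho * v) w _ _ (hol_der (dern_hol_disc k hh) (sub w wd)) A.
have := cder_mul (cder_cst (c * rho ^+ k) w) X; rewrite -dernS.
move: (dern k.+1 h _) (dern k h _) => x y.
by congr cder; rewrite exprS; ring.
Qed.

End Rescaling.

(** * Extraction of a nonconstant blow-up limit *)

Section BlowUp.
Variable R : realType.
Local Notation C := (Cplx R).
Local Notation disc := (@disc R).
Local Notation hol := (@hol R).
Local Notation der := (@der R).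
Local Notation dern := (@dern R).
Local Notation plane := (fun _ : C => True).

Lemma rtends_toC (u : nat -> R) l : rtends u l <-> tends (fun n => toC (u n)) (toC l).
Proof.
have E n : nrm (toC (u n) - toC l) = `|u n - l| by rewrite -toCB nrm_toC.
by split=> h e /h[N hN]; exists N => n /hN; rewrite E.
Qed.
Lemma rtends_cst (c : R) : rtends (fun=> c) c.
Proof. by apply/rtends_toC; exact: tends_cst. Qed.
Lemma rtends_add (u v : nat -> R) a b : rtends u a -> rtends v b -> rtends (fun n => u n + v n) (a + b).
Proof.
move=> /rtends_toC hu /rtends_toC hv; apply/rtends_toC; rewrite toCD.
by apply: tends_ext (tends_add hu hv) => n; rewrite toCD.
Qed.
Lemma rtends_mul (u v : nat -> R) a b : rtends u a -> rtends v b -> rtends (fun n => u n * v n) (a * b).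
Proof.
move=> /rtends_toC hu /rtends_toC hv; apply/rtends_toC; rewrite toCM.
by apply: tends_ext (tends_mul hu hv) => n; rewrite toCM.
Qed.
Lemma rtends_ext (u v : nat -> R) l : (forall n, u n = v n) -> rtends u l -> rtends v l.
Proof. by move=> /funext ->. Qed.
Lemma rtends_exp (u : nat -> R) a k : rtends u a -> rtends (fun n => u n ^+ k) (a ^+ k).
Proof.
move=> hu; elim: k => [|k IH]; first exact: rtends_cst.
by rewrite exprS; apply: rtends_ext (rtends_mul hu IH) => n; rewrite exprS.
Qed.
Lemma rtends_nrm (u : nat -> C) l : tends u l -> rtends (fun n => nrm (u n)) (nrm l).
Proof.
move=> hu e /hu[N hN]; exists N => n /hN; apply: le_lt_trans.
by rewrite ler_norml; have := nrm_lerB (u n) l; have := nrm_lerB l (u n); rewrite nrmC; lra.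
Qed.
Lemma rtends_le (u v : nat -> R) a b : rtends u a -> rtends v b ->
  (exists N, forall n, (N <= n)%N -> u n <= v n) -> a <= b.
Proof.
move=> hu hv [N hN]; rewrite leNgt; apply/negP => ab.
have [N1 h1] := hu ((a - b) / 2) ltac:(lra); have [N2 h2] := hv ((a - b) / 2) ltac:(lra).
pose n := maxn N (maxn N1 N2).
have n0 : (N <= n)%N by rewrite leq_maxl.
have n1 : (N1 <= n)%N by rewrite !leq_max leqnn orbT.
have n2 : (N2 <= n)%N by rewrite !leq_max leqnn !orbT.
move: (hN n n0) (h1 n n1) (h2 n n2); rewrite !ltr_norml => ? /andP[? ?] /andP[? ?]; lra.
Qed.
Lemma rtends_uniq (u : nat -> R) a b : rtends u a -> rtends u b -> a = b.
Proof. by move=> /rtends_toC ha /rtends_toC hb; have [] := tends_uniq ha hb. Qed.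

Lemma lucvg_ext (U : C -> Prop) f f' g : (forall n z, f n z = f' n z) -> lucvg U f g -> lucvg U f' g.
Proof. by move=> E h z /h[r r0 hr]; exists r => // e /hr[N hN]; exists N => n Nn w wr; rewrite -E; exact: hN. Qed.
Lemma lucvg_sub (U : C -> Prop) f g phi : sinc phi -> lucvg U f g -> lucvg U (fun n => f (phi n)) g.
Proof.
move=> sp h z /h[r r0 hr]; exists r => // e /hr[N hN]; exists N => n Nn; apply: hN.
exact: leq_trans Nn (sinc_ge n sp).
Qed.
Lemma lhol_sub (U : C -> Prop) f phi : sinc phi -> lhol U f -> lhol U (fun n => f (phi n)).
Proof.
move=> sp h z /h[r r0 [N hN]]; exists r => //; exists N => n Nn; apply: hN.
exact: leq_trans Nn (sinc_ge n sp).
Qed.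
Lemma lucvg_add (U : C -> Prop) f F g G : lucvg U f F -> lucvg U g G ->
  lucvg U (fun n z => f n z + g n z) (fun z => F z + G z).
Proof.
move=> hf hg z Uz; have [r r0 hr] := hf z Uz; have [s s0 hs] := hg z Uz.
exists (Num.min r s); first by rewrite lt_min r0.
move=> e e0; have [N hN] := hr (e / 2) ltac:(lra); have [M hM] := hs (e / 2) ltac:(lra).
exists (maxn N M) => n; rewrite geq_max => /andP[/hN n1 /hM n2] w.
rewrite /disc lt_min => /andP[/n1 w1 /n2 w2].
by rewrite opprD addrACA; have := nrmD (f n w - F w) (g n w - G w); lra.
Qed.
Lemma lucvg_opp (U : C -> Prop) f F : lucvg U f F -> lucvg U (fun n z => - f n z) (fun z => - F z).
Proof.
move=> hf z /hf[r r0 hr]; exists r => // e /hr[N hN]; exists N => n Nn w wr.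
by rewrite -opprD nrmN; exact: hN.
Qed.
Lemma lucvg_mul (U : C -> Prop) f F g G : (forall z, U z -> ccont F z) -> (forall z, U z -> ccont G z) ->
  lucvg U f F -> lucvg U g G -> lucvg U (fun n z => f n z * g n z) (fun z => F z * G z).
Proof.
move=> cF cG hf hg z Uz; have [r r0 hr] := hf z Uz; have [s s0 hs] := hg z Uz.
have [d1 d10 hd1] := cont_bounded (cF z Uz); have [d2 d20 hd2] := cont_bounded (cG z Uz).
exists (Num.min (Num.min r s) (Num.min d1 d2)); first by rewrite !lt_min r0 s0 d10 d20.
pose B := nrm (F z) + nrm (G z) + 2.
have B0 : 0 < B by have := nrm_ge0 (F z); have := nrm_ge0 (G z); rewrite /B; lra.
move=> e e0; pose e' := Num.min 1 (e / (2 * B)).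
have e'0 : 0 < e' by rewrite lt_min ltr01 divr_gt0 // mulr_gt0.
have e1 : e' <= 1 by rewrite ge_min lexx.
have eB : e' * (2 * B) <= e by rewrite -ler_pdivlMr ?mulr_gt0 // ge_min lexx orbT.
clearbody e'.
have [N hN] := hr e' e'0; have [M hM] := hs e' e'0.
exists (maxn N M) => n; rewrite geq_max => /andP[/hN n1 /hM n2] w.
rewrite /disc !lt_min => /andP[/andP[/n1 w1 /n2 w2] /andP[/hd1 w3 /hd2 w4]].
have -> : f n w * g n w - F w * G w = (f n w - F w) * (g n w - G w) + (f n w - F w) * G w + F w * (g n w - G w) by ring.
apply: le_lt_trans (nrmD _ _) _; apply: le_lt_trans (lerD (nrmD _ _) (lexx _)) _; rewrite !nrmM.
move: (nrm_ge0 (f n w - F w)) (nrm_ge0 (g n w - G w)) (nrm_ge0 (G w)) (nrm_ge0 (F w)) (nrm_ge0 (F z)) (nrm_ge0 (G z)) w1 w2 w3 w4 eB.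
rewrite /B; move: (nrm (f n w - F w)) (nrm (g n w - G w)) (nrm (G w)) (nrm (F w)) (nrm (F z)) (nrm (G z)).
move=> x y gw fw fz gz x0 y0 gw0 fw0 fz0 gz0 w1 w2 w3 w4 eB.
have a1 : x * y <= e' * 1 by apply: ler_pM => //; lra.
have a2 : x * gw <= e' * (gz + 1) by apply: ler_pM => //; lra.
have a3 : fw * y <= (fz + 1) * e' by apply: ler_pM => //; lra.
have := mulr_ge0 (ltW e'0) fz0; have := mulr_ge0 (ltW e'0) gz0; lra.
Qed.
Lemma lucvg_cst (U : C -> Prop) (u : nat -> C) l : tends u l -> lucvg U (fun n _ => u n) (fun=> l).
Proof. by move=> h z _; exists 1 => // e /h[N hN]; exists N => n /hN. Qed.
Lemma lhol_all (U : C -> Prop) f : (forall n, hol (fun=> True) (f n)) -> lhol U f.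
Proof. by move=> h z _; exists 1 => //; exists 0%N => n _; exact: hol_plane. Qed.
Lemma lhol_op2 (op : C -> C -> C) (U : C -> Prop) f g :
  (forall V F G, hol V F -> hol V G -> hol V (fun z => op (F z) (G z))) ->
  lhol U f -> lhol U g -> lhol U (fun n z => op (f n z) (g n z)).
Proof.
move=> hop hf hg z Uz; have [r r0 [N hN]] := hf z Uz; have [s s0 [M hM]] := hg z Uz.
exists (Num.min r s); first by rewrite lt_min r0.
exists (maxn N M) => n; rewrite geq_max => /andP[/hN n1 /hM n2]; apply: hop.
  by apply: hol_sub n1 => w; apply: disc_le; rewrite ge_min lexx.
by apply: hol_sub n2 => w; apply: disc_le; rewrite ge_min lexx orbT.
Qed.

Section Zoom.
Variables (z : nat -> C) (s : nat -> R) (zs : C).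
Hypotheses (hz : tends z zs) (hs : rtends s 0).

Lemma zoom_near q r d : 0 < d -> exists N, forall n, (N <= n)%N -> forall w, disc q r w -> nrm (z n + toC (s n) * w - zs) < d.
Proof.
move=> d0; have [N hN] := hz (e := d / 2) ltac:(lra).
pose c := nrm q + `|r| + 1; have c0 : 0 < c by rewrite ltr_wpDl // addr_ge0 ?nrm_ge0.
have [M hM] := hs (e := d / 2 / c) ltac:(by rewrite divr_gt0 // divr_gt0).
exists (maxn N M) => n; rewrite geq_max => /andP[/hN n1 /hM]; rewrite subr0 ltr_pdivlMr // => n2 w wq.
have wc : nrm w <= c.
  by move: wq; rewrite /disc /c; have := nrm_lerB w q; have := ler_norm r; lra.
rewrite addrAC; apply: le_lt_trans (nrmD _ _) _; rewrite nrmM nrm_toC.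
by have := ler_wpM2l (normr_ge0 (s n)) wc; lra.
Qed.

Lemma zoom_lucvg g : ccont g zs -> lucvg plane (fun n w => g (z n + toC (s n) * w)) (fun=> g zs).
Proof.
move=> cg q _; exists 1 => // e /cg[d d0 hd]; have [N hN] := zoom_near q 1 d0.
by exists N => n /hN h w /h; exact: hd.
Qed.
Lemma zoom_tends g u w : ccont g zs -> tends u w -> tends (fun n => g (z n + toC (s n) * u n)) (g zs).
Proof.
move=> cg hu e /cg[d d0 hd]; have [N hN] := zoom_near w 1 d0; have [M hM] := hu 1 ltr01.
by exists (maxn N M) => n; rewrite geq_max => /andP[/hN h /hM /h]; exact: hd.
Qed.

Lemma hol_affine g c0 r (a b : C) q t : hol (disc c0 r) g -> (forall w, disc q t w -> disc c0 r (a + b * w)) ->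
  hol (disc q t) (fun w => g (a + b * w)).
Proof.
move=> hg sub w wq; have [d hd] := hg _ (sub w wq); exists (d * b).
apply: (@cder_comp _ g (fun w => a + b * w) w _ _ hd).
by have := cder_add (cder_cst a w) (cder_mul (cder_cst b w) (cder_id w)); rewrite mul0r mulr1 !add0r.
Qed.

Lemma zoom_lhol (g : nat -> C -> C) c0 r : (forall n, hol (disc c0 r) (g n)) -> disc c0 r zs ->
  lhol plane (fun n w => g n (z n + toC (s n) * w)).
Proof.
move=> hg dz q _; have [t t0 ht] := disc_open dz; exists 1 => //.
have [N hN] := zoom_near q 1 t0; exists N => n /hN h.
by apply: (hol_affine (hg n)) => w /h /ht.
Qed.
End Zoom.

Definition resc th m k p (h : nat -> C -> C) (z : nat -> C) (s : nat -> R) (n : nat) (w : C) : C :=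
  toC (ampl th m k p (z n) (s n))^-1 * h n (z n + toC (s n) * w).

(* In [bu_growth] the scale is s n / 3 because (z n, s n) is extremal only up to
   a factor 2. *)
Record blowup th m k p K (h : nat -> C -> C) z s zs G : Prop := BlowUp {
  bu_pos : forall n, 0 < s n;
  bu_s : rtends s 0;
  bu_z : tends z zs;
  bu_hol : lhol plane (resc th m k p h z s);
  bu_cvg : lucvg plane (resc th m k p h z s) G;
  bu_big : K * (1 + nrm (G 0) ^+ 2) <= nrm (der G 0);
  bu_growth : forall w, exists N, forall n, (N <= n)%N ->
    let mu := ampl th m k p (z n + toC (s n) * w) (s n / 3) / ampl th m k p (z n) (s n) in
    nrm (der (resc th m k p h z s n) w) * mu <= 3 * K * (mu ^+ 2 + nrm (resc th m k p h z s n w) ^+ 2) }.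

Lemma blowup_sub th m k p K h z s zs G phi : sinc phi -> blowup th m k p K h z s zs G ->
  blowup th m k p K (fun n => h (phi n)) (fun n => z (phi n)) (fun n => s (phi n)) zs G.
Proof.
move=> sp [b1 b2 b3 b4 b5 b6 b7]; split=> //.
- exact: rtends_sub b2 sp.
- exact: tends_sub b3 sp.
- exact: lhol_sub sp b4.
- exact: lucvg_sub sp b5.
- by move=> w; have [N hN] := b7 w; exists N => n Nn; apply: hN; exact: leq_trans Nn (sinc_ge n sp).
Qed.

Section Bounds.
Variables (th : R) (m k : nat) (p : C) (K : R) (th0 : 0 <= th) (K0 : 0 < K).
Local Notation amp := (ampl th m k p).

(** The amplitude is polynomial in the distance to p and in s, hence changes by a bounded factor
    over a bounded rescaled region. *)
Lemma ampl_ratio (z w : C) s B : 0 < s -> 0 <= B -> nrm (w - z) <= s * B ->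
  amp w (s / 3) <= (3 * (B + 1)) ^+ (m + k) * amp z s /\ amp z s <= (3 * (B + 1)) ^+ (m + k) * amp w (s / 3).
Proof.
move=> s0 B0 wz; set b := 3 * (B + 1); have b1 : 1 <= b by rewrite /b; lra.
have le1 := nrm_distD z w p; have le2 := nrm_distD w z p; rewrite (nrmC z w) in le2.
have z0 := nrm_ge0 (z - p); have w0 := nrm_ge0 (w - p).
have key x y t u : 0 <= x -> 0 <= t -> 0 <= y -> 0 <= u -> x <= b * y -> t <= b * u -> 
   th * x ^+ m + t ^+ k <= b ^+ (m + k) * (th * y ^+ m + u ^+ k).
  move=> x0 t0 y0 u0 xy tu; rewrite mulrDr; apply: lerD.
    rewrite mulrCA; apply: ler_wpM2l => //; apply: (@le_trans _ _ ((b * y) ^+ m)).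
      by rewrite lerXn2r ?nnegrE ?mulr_ge0 //; lra.
    by rewrite exprMn ler_wpM2r ?exprn_ge0 // ler_weXn2l // leq_addr.
  apply: (@le_trans _ _ ((b * u) ^+ k)).
    by rewrite lerXn2r ?nnegrE ?mulr_ge0 //; lra.
  by rewrite exprMn ler_wpM2r ?exprn_ge0 // ler_weXn2l // leq_addl.
have sB : 0 <= s * B by rewrite mulr_ge0 // ltW.
split; apply: key; rewrite ?addr_ge0 //; rewrite /b; try lra.
- have : 0 <= B * nrm (z - p) by rewrite mulr_ge0. nra.
- nra.
Qed.

Variables (h : nat -> C -> C) (c0 : C) (r : R) (z : nat -> C) (s : nat -> R).
Hypotheses (r0 : 0 < r) (hh : forall n, hol (disc c0 r) (h n)).
Hypothesis hz : forall n, [/\ disc c0 r (z n), 0 < s n & K <= sder th m k p (h n) (z n) (s n)].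
Hypothesis hsm : forall e, 0 < e -> exists N, forall n, (N <= n)%N -> s n <= e * (r - nrm (z n - c0)).
Hypothesis hmax : forall n w t, disc c0 r w -> 0 < t ->
      2 * t * (r - nrm (z n - c0)) < s n * (r - nrm (w - c0)) -> sder th m k p (h n) w t < K.
Local Notation g := (resc th m k p h z s).
Local Notation M n := (amp (z n) (s n)).

(** Since s n is small against the distance of z n to the boundary, that distance shrinks at most to
    3/4 of itself; this exceeds 2/3, so the scale s n / 3 lies below the extremal ratio despite the
    factor 2. *)
Lemma zoom_in B : 0 <= B -> exists N, forall n, (N <= n)%N -> forall w, nrm w <= B ->
  disc c0 r (z n + toC (s n) * w) /\
  2 * (s n / 3) * (r - nrm (z n - c0)) < s n * (r - nrm (z n + toC (s n) * w - c0)).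
Proof.
move=> B0; have [N hN] := hsm (e := (4 * (B + 1))^-1) ltac:(by rewrite invr_gt0; lra).
exists N => n /hN + w wB; have [zr s0 _] := hz n; move: zr; rewrite /disc.
set gap := r - _ => zr; have gap0 : 0 < gap by rewrite /gap; lra.
rewrite mulrC ler_pdivlMr; last lra.
have : nrm (z n + toC (s n) * w - c0) <= nrm (z n - c0) + s n * B.
  rewrite addrAC; apply: le_trans (nrmD _ _) _; rewrite nrmM nrm_toC ger0_norm; last exact: ltW.
  by rewrite lerD2l ler_wpM2l // ltW.
have : 0 <= s n * B by rewrite mulr_ge0 // ltW.
rewrite /gap in gap0 *; move: (nrm _) (nrm _) gap0 => x y gap0 sB yx h4; split; first nra.
have : r - y <= 3/2 * (r - x) - 0 by nra.
nra.
Qed.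

Lemma resc_hol B : 0 <= B -> exists N, forall n, (N <= n)%N -> hol (disc 0 B) (g n).
Proof.
move=> B0; have [N hN] := zoom_in B0; exists N => n /hN H.
have hG : hol (disc 0 B) (fun w => h n (z n + toC (s n) * w)).
  apply: (@hol_affine _ c0 r _ _ 0 B (@hh n)) => w; rewrite /disc subr0 => /ltW /H[].
  by [].
exact: hol_mul (hol_cst _) hG.
Qed.
Lemma resc_der B : 0 <= B -> exists N, forall n, (N <= n)%N -> forall w, disc 0 B w ->
  der (g n) w = toC (M n)^-1 * toC (s n) * der (h n) (z n + toC (s n) * w).
Proof.
move=> B0; have [N hN] := zoom_in B0; exists N => n /hN H w wB; have b0 := le_lt_trans (nrm_ge0 _) wB.
have := @dern_affine _ (h n) c0 r (toC (M n)^-1) (z n) (toC (s n)) 1 0 B b0 (@hh n).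
by rewrite expr1; apply=> // v; rewrite /disc subr0 => /ltW /H[].
Qed.
Lemma resc_growth B : 0 <= B -> exists N, forall n, (N <= n)%N -> forall w, disc 0 B w ->
  let mu := amp (z n + toC (s n) * w) (s n / 3) / M n in
  nrm (der (g n) w) * mu <= 3 * K * (mu ^+ 2 + nrm (g n w) ^+ 2).
Proof.
move=> B0; have [N1 h1] := zoom_in B0; have [N2 h2] := resc_der B0.
exists (maxn N1 N2) => n; rewrite geq_max => /andP[/h1 H1 /h2 H2] w wB; rewrite (H2 w wB).
have {}wB : nrm w <= B by move: wB; rewrite /disc subr0 => /ltW.
have [dw gw] := H1 w wB; have [_ s0 _] := hz n.
have s3 : 0 < s n / 3 by lra.
have := hmax dw s3 gw; have M0 := ampl_gt0 m k p (z n) th0 s0.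
rewrite /resc /sder; have := ampl_gt0 m k p (z n + toC (s n) * w) th0 s3.
rewrite !nrmM !nrm_toC (ger0_norm (ltW s0)) ger0_norm; last by rewrite invr_ge0 ltW.
move: M0 => /=; move: (nrm (der _ _)) (nrm (h n _)) => d y.
move: (s n) (M n) (amp (z n + toC (s n) * w) (s n / 3)) => t M M' M0 M'0.
rewrite ltr_pdivrMr; last by rewrite ltr_wpDr ?sqr_ge0 // exprn_gt0.
move=> H; have M20 : 0 < M ^+ 2. exact: exprn_gt0.
rewrite -(ler_pM2r M20).
have -> : M^-1 * t * d * (M' / M) * M ^+ 2 = 3 * (t / 3 * d * M') by field; rewrite gt_eqF.
have -> : 3 * K * ((M' / M) ^+ 2 + (M^-1 * y) ^+ 2) * M ^+ 2 = 3 * (K * (M' ^+ 2 + y ^+ 2)) by field; rewrite gt_eqF.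
by rewrite ler_pM2l // ltW.
Qed.
Lemma resc_big : exists N, forall n, (N <= n)%N -> K * (1 + nrm (g n 0) ^+ 2) <= nrm (der (g n) 0).
Proof.
have [N hN] := resc_der (B := 1) ler01; exists N => n /hN /(_ 0 (disc_center 0 ltr01)) ->.
have [_ s0] := hz n; have M0 := ampl_gt0 m k p (z n) th0 s0.
rewrite /resc /sder mulr0 addr0 !nrmM !nrm_toC (ger0_norm (ltW s0)) ger0_norm; last by rewrite invr_ge0 ltW.
move: (nrm _) (nrm _) M0 => y d; move: (s n) (M n) => t M M0.
rewrite ler_pdivlMr; last by rewrite ltr_wpDr ?sqr_ge0 // exprn_gt0.
have M20 : 0 < M ^+ 2. exact: exprn_gt0.
move=> H; rewrite -(ler_pM2r M20).
have -> : K * (1 + (M^-1 * y) ^+ 2) * M ^+ 2 = K * (M ^+ 2 + y ^+ 2) by field; rewrite gt_eqF.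
by have -> : M^-1 * t * d * M ^+ 2 = t * d * M by field; rewrite gt_eqF.
Qed.
Lemma resc_marty B : 0 <= B -> exists2 K', 0 <= K' & exists N, forall n, (N <= n)%N -> forall w, disc 0 B w ->
  nrm (der (g n) w) <= K' * (1 + nrm (g n w) ^+ 2).
Proof.
move=> B0; have [N hN] := resc_growth B0; set b := (3 * (B + 1)) ^+ (m + k).
have b0 : 0 < b by rewrite exprn_gt0 //; lra.
exists (3 * K * b); first by rewrite !mulr_ge0 ?(ltW K0) ?(ltW b0).
exists N => n /hN H w wB; have [_ s0 _] := hz n.
have s3 : 0 < s n / 3 by lra.
have wz : nrm (z n + toC (s n) * w - z n) <= s n * B.
  rewrite addrAC subrr add0r nrmM nrm_toC (ger0_norm (ltW s0)) ler_wpM2l ?(ltW s0) //.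
  by move: wB; rewrite /disc subr0 => /ltW.
have [a1 a2] := ampl_ratio s0 B0 wz; have /= := H w wB.
have := ampl_gt0 m k p (z n) th0 s0; have := ampl_gt0 m k p (z n + toC (s n) * w) th0 s3.
move: a1 a2; rewrite -/b; move: (nrm (der _ _)) (nrm (g n w)) (nrm_ge0 (der (g n) w)) => d y d0.
move: (amp (z n + _) _) (M n) => M' M a1 a2 M'0 M0.
have mu1 : M' / M <= b by rewrite ler_pdivrMr.
have mu0 : 0 < M' / M by rewrite divr_gt0.
have mu2 : 1 <= b * (M' / M) by rewrite mulrA ler_pdivlMr // mul1r.
move: (M' / M) mu0 mu1 mu2 => mu mu0 mu1 mu2 H2.
have b1 : b * (3 * K * y ^+ 2) <= b * (3 * K * y ^+ 2) by [].
have y2 := sqr_ge0 y.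
rewrite -(ler_pM2r mu0); apply: le_trans H2 _.
have e1 : 3 * K * mu ^+ 2 <= 3 * K * b * mu.
  by rewrite expr2 mulrA ler_pM2r // ler_wpM2l // ltW // mulr_gt0.
have e2 : 3 * K * y ^+ 2 <= 3 * K * b * y ^+ 2 * mu.
  have -> : 3 * K * b * y ^+ 2 * mu = 3 * K * y ^+ 2 * (b * mu) by ring.
  by rewrite ler_peMr // mulr_ge0 // mulr_ge0 // ltW.
have -> : 3 * K * b * (1 + y ^+ 2) * mu = 3 * K * b * mu + 3 * K * b * y ^+ 2 * mu by ring.
by rewrite mulrDr; apply: lerD.
Qed.

Lemma resc_local q : exists2 t, 0 < t & forall phi, sinc phi -> exists2 psi, sinc psi &
   conv_or_inf (disc q t) (fun n => g (phi (psi n))).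
Proof.
have B0 : 0 <= nrm q + 1 by rewrite addr_ge0 ?nrm_ge0.
have sub w : disc q 1 w -> disc 0 (nrm q + 1) w by apply: disc_sub; rewrite subr0.
have [K' K'0 [N1 h1]] := resc_marty B0; have [N2 h2] := resc_hol B0; pose N := maxn N1 N2.
have [t t0 ht] := marty q ltr01 K'0; exists t => // phi sp.
have ge n : (N1 <= phi (n + N))%N /\ (N2 <= phi (n + N))%N.
  have : (N <= phi (n + N))%N by apply: leq_trans (sinc_ge _ sp); rewrite leq_addl.
  by rewrite geq_max => /andP[].
have [||psi s1 hpsi] := ht (fun n => g (phi (n + N)%N)).
- by move=> n; apply: hol_sub sub _; apply: h2; exact: (ge n).2.
- by move=> n w wq; apply: h1; [exact: (ge n).1|exact: sub].
by exists (fun n => psi n + N)%N => // n; rewrite ltn_add2r.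
Qed.

(** If g tended to infinity near 0, then 1/g and by Cauchy its derivative would tend to 0; but |g'|
    / |g|^2 >= K at 0. The threshold 8 / u / K is what the Cauchy estimate on radius u asks for. *)
Lemma resc_not_inf phi : sinc phi -> ~ linf plane (fun n => g (phi n)).
Proof.
move=> sp /(_ 0 I)[t t0 ht]; pose u := Num.min t 1; have u0 : 0 < u by rewrite lt_min t0 ltr01.
have [N1 h1] := resc_hol (B := 1) ler01; have [N2 h2] := resc_big.
have X0 : 0 < 8 / u / K by rewrite !divr_gt0.
have [N3 h3] := ht (8 / u / K + 1); pose n := maxn N3 (maxn N1 N2).
have n1 : (N1 <= phi n)%N by apply: leq_trans (sinc_ge _ sp); rewrite !leq_max leqnn orbT.
have n2 : (N2 <= phi n)%N by apply: leq_trans (sinc_ge _ sp); rewrite !leq_max leqnn !orbT.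
have n3 : (N3 <= n)%N by rewrite leq_max leqnn.
move: {h1 h2 h3}(h1 _ n1) (h2 _ n2) (h3 _ n3); move: (g (phi n)) => G hG big far.
have hG' : hol (disc 0 u) G by apply: hol_sub hG => w; apply: disc_le; rewrite ge_min lexx orbT.
have far' w : disc 0 u w -> 8 / u / K + 1 < nrm (G w) by move=> wu; apply: far; apply: disc_le wu; rewrite ge_min lexx.
have nz w : disc 0 u w -> G w != 0 by move=> /far' H; rewrite -nrm_gt0; lra.
have d0 := disc_center 0 u0; have d02 : disc 0 (u / 2) 0 by apply: disc_center; rewrite divr_gt0.
pose e := (8 / u / K + 1)^-1; have e0 : 0 < e by rewrite invr_gt0; lra.
have := der_bound (m := e) u0 (hol_inv hG' nz) _ d02.
have bd v : disc 0 u v -> nrm (G v)^-1 <= e.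
  move=> vu; rewrite nrmV /e lef_pV2 ?posrE; [exact: (ltW (far' _ vu))| |lra].
  by apply: lt_trans (far' _ vu); lra.
move=> /(_ bd); have -> : der (fun w => (G w)^-1) 0 = - der G 0 / G 0 ^+ 2.
  by apply: derE; apply: cder_inv; [exact: nz|exact: hol_der hG' d0].
rewrite nrmM nrmN nrmV nrmX.
have g0 : 0 < nrm (G 0) by rewrite nrm_gt0 nz.
have g2 : 0 < nrm (G 0) ^+ 2 by rewrite exprn_gt0.
move=> H; have : K <= 8 * e / u.
  apply: le_trans H; rewrite ler_pdivlMr //; apply: le_trans big; rewrite ler_wpM2l ?(ltW K0) //; lra.
have -> : 8 * e / u = (8 / u / K) * K * e by field; rewrite !gt_eqF.
rewrite /e ler_pdivlMr; last lra.
move: (8 / u / K) => x; by rewrite mulrDr mulr1 [x * K]mulrC gerDl leNgt K0.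
Qed.

Lemma blowup_exists : exists phi zs G, [/\ sinc phi, nrm (zs - c0) <= r &
  blowup th m k p K (fun n => h (phi n)) (fun n => z (phi n)) (fun n => s (phi n)) zs G].
Proof.
have [phi sp [zs hzs]] := @bounded_sub _ z (r + nrm c0)
  (fun n => ltac:(have [zr _ _] := hz n; move: zr; rewrite /disc; have := nrm_lerB (z n) c0; lra)).
have loc q : plane q -> exists2 t, 0 < t & forall f, sinc f -> exists2 psi, sinc psi &
    conv_or_inf (disc q t) (fun n => g (phi (f (psi n)))).
  move=> _; have [t t0 ht] := resc_local q; exists t => // f sf.
  by have [psi s1 h1] := ht (phi \o f) (sinc_comp sp sf); exists psi.
have [chi sc [[G hG]|]] := normal_glue (f := fun n => g (phi n)) (@plane_connected R) loc; last first.
  by move=> H; case: (@resc_not_inf (phi \o chi) (sinc_comp sp sc)).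
have spc := sinc_comp sp sc.
have lh : lhol plane (fun n => g (phi (chi n))).
  apply: (lhol_sub (phi := phi \o chi)) => // q _; exists 1 => //.
  have [N hN] := resc_hol (B := nrm q + 1) (addr_ge0 (nrm_ge0 _) ler01).
  by exists N => n /hN; apply: hol_sub => w; apply: disc_sub; rewrite subr0.
exists (phi \o chi), zs, G; split=> //.
  apply: tends_le hzs _; exists 0%N => n _; have [zr _ _] := hz (phi n); exact: ltW.
split=> //.
- by move=> n; have [] := hz (phi (chi n)).
- apply: (rtends_sub (phi := phi \o chi)) => // e e0; have [N hN] := hsm (e := e / (2 * r)) ltac:(by rewrite divr_gt0 // mulr_gt0).
  exists N => n /hN; have [_ s0 _] := hz n; rewrite subr0 (ger0_norm (ltW s0)) => H; apply: le_lt_trans H _.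
  rewrite mulrAC ltr_pdivrMr ?mulr_gt0 // ltr_pM2l //.
  by apply: (@le_lt_trans _ _ r); [rewrite gerBl nrm_ge0|rewrite ltr_pMl ?ltr1n].
- exact: (tends_sub hzs sc).
- have t1 : tends (fun n => g (phi (chi n)) 0) (G 0) by apply: (lucvg_point (u := fun=> 0) I lh hG); exact: tends_cst.
  have t2 : tends (fun n => der (g (phi (chi n))) 0) (der G 0).
    by apply: (lucvg_point (u := fun=> 0) I (lhol_der lh) (lucvg_der lh hG)); exact: tends_cst.
  apply: (rtends_le _ (rtends_nrm t2)).
    by apply: rtends_mul; [exact: rtends_cst|apply: rtends_add; [exact: rtends_cst|apply: rtends_exp; exact: rtends_nrm t1]].
  have [N hN] := resc_big; exists N => n Nn; apply: hN; exact: leq_trans Nn (sinc_ge n spc).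
- move=> w; have [N hN] := resc_growth (B := nrm w + 1) (addr_ge0 (nrm_ge0 _) ler01).
  exists N => n Nn; apply: hN; first exact: leq_trans Nn (sinc_ge n spc).
  rewrite /disc subr0; lra.
Qed.
End Bounds.
End BlowUp.

(** * Value sharing in the limit *)

Section LimitFacts.
Variable R : realType.
Local Notation C := (Cplx R).
Local Notation disc := (@disc R).
Local Notation hol := (@hol R).
Local Notation der := (@der R).
Local Notation dern := (@dern R).
Local Notation plane := (fun _ : C => True).
Variables (th : R) (m k : nat) (p : C) (K : R) (h : nat -> C -> C) (z : nat -> C) (s : nat -> R) (zs : C) (G : C -> C).
Hypotheses (th0 : 0 <= th) (K0 : 0 < K) (k0 : (0 < k)%N) (bu : blowup th m k p K h z s zs G).
Local Notation amp n := (ampl th m k p (z n) (s n)).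
Local Notation g := (resc th m k p h z s).
Local Notation W n w := (z n + toC (s n) * w).
Local Notation tau n := (s n ^+ k / amp n).

Lemma amp_gt0 n : 0 < amp n.
Proof. exact: ampl_gt0 (bu_pos bu n). Qed.

Lemma limit_entire : hol plane G.
Proof. exact: lucvg_hol (bu_hol bu) (bu_cvg bu). Qed.
Lemma limit_der0 : K <= nrm (der G 0).
Proof.
apply: le_trans (bu_big bu); rewrite ler_peMr ?(ltW K0) // lerDl; exact: sqr_ge0.
Qed.
Lemma limit_nonconst : ~ (exists c, forall w, G w = c).
Proof.
move=> [c hc]; have := limit_der0; have -> : G = fun=> c by apply/funext.
by rewrite (derE (cder_cst c 0)) nrm0 leNgt K0.
Qed.

Lemma limit_growth w mu : rtends (fun n => ampl th m k p (W n w) (s n / 3) / amp n) mu ->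
  nrm (der G w) * mu <= 3 * K * (mu ^+ 2 + nrm (G w) ^+ 2).
Proof.
move=> hmu; have lh := bu_hol bu; have hG := bu_cvg bu.
have t1 : tends (fun n => g n w) (G w) by apply: (lucvg_point (u := fun=> w) I lh hG); exact: tends_cst.
have t2 : tends (fun n => der (g n) w) (der G w).
  by apply: (lucvg_point (u := fun=> w) I (lhol_der lh) (lucvg_der lh hG)); exact: tends_cst.
apply: (rtends_le (rtends_mul (rtends_nrm t2) hmu) _ (bu_growth bu w)).
apply: rtends_mul; first exact: rtends_cst.
by apply: rtends_add; apply: rtends_exp => //; exact: rtends_nrm t1.
Qed.

(** For k > 1 these become u = a, v = b and, after division by alpha0, gam, ba, bb from alpha1, a,
    b. For k = 1, h = f - a gives u = 0, v = b - a, and ba, bb collect the terms coming from a. *)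
Variables (c0 : C) (r1 : R) (u v gam ba bb A : C -> C) (t Minf : R).
Hypotheses (hh : forall n, hol (disc c0 r1) (h n)) (hu : hol (disc c0 r1) u) (hv : hol (disc c0 r1) v)
  (hgam : hol (disc c0 r1) gam) (hba : hol (disc c0 r1) ba) (hbb : hol (disc c0 r1) bb)
  (hzs : disc c0 r1 zs).
Local Notation Lop n x := (dern k (h n) x + gam x * h n x).
Hypotheses (share : forall n x, disc c0 r1 x -> (h n x = u x <-> Lop n x = ba x))
  (partial : forall n x, disc c0 r1 x -> Lop n x = bb x -> h n x = v x)
  (uv : u zs != v zs)
  (hA : lucvg plane (fun n w => toC (amp n)^-1 * u (W n w)) A)
  (htau : rtends (fun n => tau n) t) (hM : rtends (fun n => amp n) Minf).
Local Notation E := (fun n w => dern k (g n) w + toC (s n ^+ k) * gam (W n w) * g n w).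

Lemma resc_near q : exists N, forall n, (N <= n)%N -> forall w, disc q 1 w -> disc c0 r1 (W n w).
Proof.
have [d d0 hd] := disc_open hzs; have [N hN] := zoom_near (bu_z bu) (bu_s bu) q 1 d0.
by exists N => n /hN H w /H; exact: hd.
Qed.
Lemma resc_dern j q : exists N, forall n, (N <= n)%N -> forall w, disc q 1 w ->
  dern j (g n) w = toC (amp n)^-1 * toC (s n) ^+ j * dern j (h n) (W n w).
Proof.
have [N hN] := resc_near q; exists N => n /hN H w wq.
exact: (dern_affine (toC (amp n)^-1) j ltr01 (@hh n) H wq).
Qed.
Lemma resc_op q : exists N, forall n, (N <= n)%N -> forall w, disc q 1 w ->
  E n w = toC (tau n) * Lop n (W n w).
Proof.
have [N hN] := resc_dern k q; exists N => n /hN H w wq; rewrite (H w wq) /resc.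
have -> : toC (s n ^+ k / amp n) = toC (amp n)^-1 * toC (s n) ^+ k by rewrite toCM rmorphXn mulrC.
rewrite rmorphXn; move: (dern _ _ _) => x; move: (toC (amp n)^-1) (toC _ ^+ k) (gam _) (h n _) => a e g' y /=; ring.
Qed.
Lemma point_in a w : tends a w -> exists N, forall n, (N <= n)%N -> disc w 1 (a n).
Proof. by move=> /(_ 1 ltr01). Qed.
Lemma cts f : hol (disc c0 r1) f -> ccont f zs.
Proof. by move=> hf; exact: hol_cont hf hzs. Qed.
Lemma point_tends f a w : hol (disc c0 r1) f -> tends a w -> tends (fun n => f (W n (a n))) (f zs).
Proof. by move=> hf; apply: (zoom_tends (bu_z bu) (bu_s bu)); exact: cts. Qed.
Lemma tau_tends : tends (fun n => toC (tau n)) (toC t).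
Proof. exact/rtends_toC. Qed.

(** The lower-order term of the operator carries the factor s n ^ k and disappears in the limit. *)
Lemma op_lucvg : lucvg plane E (dern k G).
Proof.
have hG := limit_entire; have cG w : plane w -> ccont G w by move=> _; exact: hol_cont hG I.
have sk : tends (fun n => toC (s n ^+ k)) 0.
  have := rtends_exp k (bu_s bu); rewrite expr0n gtn_eqF // => /rtends_toC; by rewrite toC0.
have H1 : lucvg plane (fun n w => toC (s n ^+ k) * gam (W n w)) (fun=> 0 * gam zs).
  apply: lucvg_mul; [by move=> *; exact: cont_cst|by move=> *; exact: cont_cst| |].
    exact: lucvg_cst sk.
  exact: (zoom_lucvg (g := gam) (bu_z bu) (bu_s bu) (cts hgam)).
have cgam w : plane w -> ccont (fun _ : C => 0 * gam zs) w by move=> _; exact: cont_cst.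
have H2 := lucvg_mul cgam cG H1 (bu_cvg bu).
have := lucvg_add (lucvg_dern k (bu_hol bu) (bu_cvg bu)) H2.
by congr lucvg; apply/funext => w; rewrite !mul0r addr0.
Qed.
Lemma op_lhol : lhol plane E.
Proof.
have lW f : hol (disc c0 r1) f -> lhol plane (fun n w => f (W n w)).
  by move=> hf; exact: (zoom_lhol (bu_z bu) (bu_s bu) (fun=> hf) hzs).
have l1 : lhol plane (fun n w => toC (s n ^+ k) * gam (W n w)).
  apply: (lhol_op2 (op := *%R) (f := fun n (w : C) => toC (s n ^+ k))) (lW _ hgam) => [V F H|]; first exact: hol_mul.
  by apply: lhol_all => n; exact: hol_cst.
have l2 : lhol plane (fun n w => toC (s n ^+ k) * gam (W n w) * g n w).
  by apply: (lhol_op2 (op := *%R)) l1 (bu_hol bu) => V F H; exact: hol_mul.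
by apply: (lhol_op2 (op := +%R)) (lhol_dern k (bu_hol bu)) l2 => V F H; exact: hol_add.
Qed.
Lemma tau_lucvg f : hol (disc c0 r1) f ->
  lucvg plane (fun n w => toC (tau n) * f (W n w)) (fun=> toC t * f zs).
Proof.
move=> hf; apply: lucvg_mul; [by move=> *; exact: cont_cst|by move=> *; exact: cont_cst| |].
  exact: lucvg_cst tau_tends.
exact: (zoom_lucvg (g := f) (bu_z bu) (bu_s bu) (cts hf)).
Qed.
Lemma scal_lhol (c : nat -> C) f : hol (disc c0 r1) f -> lhol plane (fun n w => c n * f (W n w)).
Proof.
move=> hf; apply: (lhol_op2 (op := *%R) (f := fun n (w : C) => c n)) (zoom_lhol (bu_z bu) (bu_s bu) (fun=> hf) hzs).
  by move=> V F H; exact: hol_mul.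
by apply: lhol_all => n; exact: hol_cst.
Qed.
Lemma hurwitz_diff f F f' F' w : lhol plane f -> lucvg plane f F -> lhol plane f' -> lucvg plane f' F' ->
  (exists w, F w != F' w) -> F w = F' w ->
  exists2 a, tends a w & exists N, forall n, (N <= n)%N -> f n (a n) = f' n (a n).
Proof.
move=> lf cf lf' cf' [w0 hw0] hw.
have ld : lhol plane (fun n w => f n w - f' n w).
  by apply: (lhol_op2 (op := fun x y => x - y)) => // V F1 F2; exact: hol_subr.
have cd : lucvg plane (fun n w => f n w - f' n w) (fun w => F w - F' w).
  by apply: lucvg_add => //; exact: lucvg_opp.
have [|[d d0 hd]|a ha [N hN]] := hurwitz (p := w) I ld cd.
- by rewrite hw subrr.
- have := entire_eq0 (lucvg_hol ld cd) d0 hd w0 => /eqP; rewrite subr_eq0; exact/negP.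
by exists a => //; exists N => n /hN /eqP; rewrite subr_eq0 => /eqP.
Qed.

Lemma tau_neq0 n : toC (tau n) != 0.
Proof. by rewrite toC_eq0 gt_eqF // divr_gt0 ?amp_gt0 // exprn_gt0 // (bu_pos bu). Qed.
Lemma scal_inj n x y : toC (amp n)^-1 * x = toC (amp n)^-1 * y -> x = y.
Proof. by apply: mulfI; rewrite toC_eq0 invr_eq0 gt_eqF // amp_gt0. Qed.

Lemma limit_share1 w : (exists w, G w != A w) -> G w = A w -> dern k G w = toC t * ba zs.
Proof.
move=> ex hw; have [a ha [N hN]] := hurwitz_diff (bu_hol bu) (bu_cvg bu) (scal_lhol _ hu) hA ex hw.
have [N1 h1] := point_in ha; have [N2 h2] := resc_near w; have [N3 h3] := resc_op w.
apply: (@tends_uniq _ (fun n => E n (a n))); first exact: (lucvg_point I op_lhol op_lucvg ha).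
apply: (tends_eventually _ (tends_mul tau_tends (point_tends hba ha))).
exists (maxn (maxn N N1) (maxn N2 N3)) => n.
rewrite !geq_max => /andP[/andP[/hN n0 /h1 n1] /andP[/h2 n2 /h3 n3]].
by rewrite n3 //; congr (_ * _); apply/esym/share; [exact: n2|exact: scal_inj n0].
Qed.
Lemma limit_share_pt f w : hol (disc c0 r1) f ->
  (exists w, dern k G w != toC t * f zs) -> dern k G w = toC t * f zs ->
  exists2 a, tends a w & exists N, forall n, (N <= n)%N -> disc c0 r1 (W n (a n)) /\ Lop n (W n (a n)) = f (W n (a n)).
Proof.
move=> hf ex hw; have [a ha [N hN]] := hurwitz_diff op_lhol op_lucvg (scal_lhol _ hf) (tau_lucvg hf) ex hw.
have [N1 h1] := point_in ha; have [N2 h2] := resc_near w; have [N3 h3] := resc_op w.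
exists a => //; exists (maxn (maxn N N1) (maxn N2 N3)) => n.
rewrite !geq_max => /andP[/andP[/hN n0 /h1 n1] /andP[/h2 n2 /h3 n3]].
split; first exact: n2.
by apply: (mulfI (tau_neq0 n)); rewrite -n3.
Qed.
Lemma limit_share2 w : (exists w, dern k G w != toC t * ba zs) -> dern k G w = toC t * ba zs -> G w = A w.
Proof.
move=> ex hw; have [a ha [N hN]] := limit_share_pt hba ex hw.
apply: (@tends_uniq _ (fun n => g n (a n))); first exact: (lucvg_point I (bu_hol bu) (bu_cvg bu) ha).
apply: (tends_eventually _ (lucvg_point I (scal_lhol _ hu) hA ha)).
by exists N => n /hN[n1 n2]; rewrite /resc; congr (_ * _); apply/esym/share.
Qed.
Lemma limit_value f a w : hol (disc c0 r1) f -> tends a w ->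
  (exists N, forall n, (N <= n)%N -> h n (W n (a n)) = f (W n (a n))) -> f zs = toC Minf * G w.
Proof.
move=> hf ha [N hN]; apply: tends_uniq (point_tends hf ha) _.
have mM : tends (fun n => toC (amp n)) (toC Minf) by exact/rtends_toC.
apply: (tends_eventually _ (tends_mul mM (lucvg_point I (bu_hol bu) (bu_cvg bu) ha))).
exists N => n /hN <-; rewrite /resc mulrA -toCM mulfV ?gt_eqF ?amp_gt0 //.
by rewrite toC1 mul1r.
Qed.
(** Points with operator value bb accumulate, in the rescaled variable, at a bad w, so v = Minf G(w)
    at zs. This is absurd if Minf = 0 and v <> 0; and if the limits of the multiples of bb and ba
    coincide, points with operator value ba accumulate at w too, so u = Minf G(w) = v. *)
Lemma limit_partial w : (Minf = 0 /\ v zs != 0) \/ toC t * bb zs = toC t * ba zs ->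
  (exists w, dern k G w != toC t * bb zs) -> dern k G w != toC t * bb zs.
Proof.
move=> alt ex; apply/negP => /eqP hw.
have [a ha [N hN]] := limit_share_pt hbb ex hw.
have ev : v zs = toC Minf * G w.
  by apply: limit_value hv ha _; exists N => n /hN[n1 n2]; exact: partial.
case: alt => [[M0 v0]|E0]; first by move: v0; rewrite ev M0 toC0 mul0r eqxx.
rewrite E0 in ex hw; have [a' ha' [N' hN']] := limit_share_pt hba ex hw.
have eu : u zs = toC Minf * G w.
  by apply: limit_value hu ha' _; exists N' => n /hN'[n1 n2]; apply/share.
by move: uv; rewrite eu ev eqxx.
Qed.
Lemma limit_mult w j : (forall n x, disc c0 r1 x -> h n x = 0 -> forall j, (j < k)%N -> dern j (h n) x = 0) ->
  G w = 0 -> (j < k)%N -> dern j G w = 0.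
Proof.
move=> mult hw jk; have ex : exists w, G w != 0.
  apply: contrapT => H; apply: limit_nonconst; exists 0 => x; apply/eqP/negPn/negP => hx.
  by apply: H; exists x.
have l0 : lhol plane (fun (_ : nat) (_ : C) => 0 : C) by apply: lhol_all => n; exact: hol_cst.
have [a ha [N hN]] := hurwitz_diff (bu_hol bu) (bu_cvg bu) l0 (lucvg_cst (U := plane) (tends_cst 0)) ex hw.
have [N1 h1] := point_in ha; have [N2 h2] := resc_near w; have [N3 h3] := resc_dern j w.
apply: (@tends_uniq _ (fun n => dern j (g n) (a n))).
  exact: (lucvg_point I (lhol_dern j (bu_hol bu)) (lucvg_dern j (bu_hol bu) (bu_cvg bu)) ha).
apply: (tends_eventually _ (tends_cst 0)).
exists (maxn (maxn N N1) (maxn N2 N3)) => n.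
rewrite !geq_max => /andP[/andP[/hN n0 /h1 n1] /andP[/h2 n2 /h3 n3]].
rewrite n3 // mult ?mulr0 //; first exact: n2.
by apply: (@scal_inj n); rewrite mulr0.
Qed.
End LimitFacts.

(** * Exclusion of every blow-up limit *)

Section NoBlowUp.
Variable R : realType.
Local Notation C := (Cplx R).
Local Notation disc := (@disc R).
Local Notation hol := (@hol R).
Local Notation der := (@der R).
Local Notation dern := (@dern R).
Local Notation plane := (fun _ : C => True).

Lemma growth_bounds (G : C -> C) m c B K : 0 <= K -> 0 < c -> hol plane G ->
  (forall w, 1 <= nrm w -> exists2 mu, c * nrm w ^+ m <= mu <= B * nrm w ^+ m &
     nrm (der G w) * mu <= K * (mu ^+ 2 + nrm (G w) ^+ 2)) -> exptype G.
Proof.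
move=> K0 c0 hG h; pose L := K * (B ^+ 2 + 1) / c.
have L0 : 0 <= L by rewrite divr_ge0 ?(ltW c0) // mulr_ge0 // addr_ge0 // sqr_ge0.
apply: (@growth_exptype _ G m L L0 hG) => w w1; have [mu /andP[m1 m2]] := h w w1.
have x0 : 0 < nrm w ^+ m by rewrite exprn_gt0 //; lra.
move: (nrm w ^+ m) (nrm (der G w)) (nrm (G w)) (nrm_ge0 (der G w)) x0 m1 m2 => x d y d0 x0 m1 m2 H.
rewrite /L mulrAC ler_pdivlMr //; apply: (@le_trans _ _ (d * mu)).
  by rewrite -mulrA ler_wpM2l // mulrC.
apply: le_trans H _; rewrite -mulrA ler_wpM2l //.
have mu0 : 0 <= mu by apply: le_trans m1; rewrite mulr_ge0 // ltW.
have : mu ^+ 2 <= (B * x) ^+ 2 by rewrite lerXn2r ?nnegrE // (le_trans mu0).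
rewrite exprMn; have := sqr_ge0 y; have := sqr_ge0 x; have := sqr_ge0 B.
move: (x ^+ 2) (y ^+ 2) (B ^+ 2) (mu ^+ 2) => X Y B2 M ? ? ? ?; nra.
Qed.

(** Hurwitz transfers an equation only if its two sides are not identically equal; the existence
    premises record that. *)
Definition limit_facts k (G A : C -> C) (B1 B : C) := [/\
  (exists w, G w != A w) -> forall w, G w = A w -> dern k G w = B1,
  (exists w, dern k G w != B1) -> forall w, dern k G w = B1 -> G w = A w &
  (exists w, dern k G w != B) -> forall w, dern k G w != B].

Section Data.
Variables (k : nat) (K : R) (h : nat -> C -> C) (c0 : C) (r1 : R) (u v gam ba bb : C -> C).
Hypotheses (K0 : 0 < K) (k0 : (0 < k)%N).
Hypotheses (hh : forall n, hol (disc c0 r1) (h n)) (hu : hol (disc c0 r1) u) (hv : hol (disc c0 r1) v)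
  (hgam : hol (disc c0 r1) gam) (hba : hol (disc c0 r1) ba) (hbb : hol (disc c0 r1) bb).
Local Notation Lop n x := (dern k (h n) x + gam x * h n x).
Hypotheses (share : forall n x, disc c0 r1 x -> (h n x = u x <-> Lop n x = ba x))
  (partial : forall n x, disc c0 r1 x -> Lop n x = bb x -> h n x = v x).

Section Pure.
Variables (p : C) (z : nat -> C) (s : nat -> R) (zs : C) (G : C -> C).
Hypotheses (bu : blowup 0 0 k p K h z s zs G) (hzs : disc c0 r1 zs) (u0 : forall x, u x = 0)
  (v0 : v zs != 0).

Lemma pure_ampl x t : ampl 0 0 k p x t = t ^+ k.
Proof. by rewrite /ampl mul0r add0r. Qed.
Lemma pure_facts : limit_facts k G (fun=> 0) (ba zs) (bb zs).
Proof.
have s0 n := bu_pos bu n.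
have hA : lucvg plane (fun n w => toC (ampl 0 0 k p (z n) (s n))^-1 * u (z n + toC (s n) * w)) (fun=> 0).
  apply: (lucvg_ext (f := fun _ _ => 0)); last exact: lucvg_cst (tends_cst 0).
  by move=> n w; rewrite u0 mulr0.
have ht : rtends (fun n => s n ^+ k / ampl 0 0 k p (z n) (s n)) 1.
  apply: rtends_ext (rtends_cst 1) => n; rewrite pure_ampl divff // gt_eqF // exprn_gt0 //; exact: s0.
have hM : rtends (fun n => ampl 0 0 k p (z n) (s n)) 0.
  have := rtends_exp k (bu_s bu); rewrite expr0n gtn_eqF //.
  by apply: rtends_ext => n; rewrite pure_ampl.
have uv : u zs != v zs by rewrite u0 eq_sym.
have E c : toC 1 * c = c :> C by rewrite toC1 mul1r.
split=> [ex w|ex w|ex w].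
- by move=> hw; rewrite (limit_share1 (lexx 0) k0 bu hh hu hgam hba hzs share hA ht ex hw) E.
- by move=> hw; apply: (limit_share2 (lexx 0) k0 bu hh hu hgam hba hzs share hA ht); rewrite E.
have := @limit_partial _ _ _ _ _ _ _ _ _ _ _ (lexx 0) k0 bu _ _ _ _ _ _ _ _ _ hh hu hv hgam hba hbb hzs share partial uv ht hM w.
by rewrite E; apply=> //; left.
Qed.
Lemma pure_exptype : exptype G.
Proof.
have s0 n := bu_pos bu n.
apply: (@growth_bounds G 0 ((1 / 3) ^+ k) ((1 / 3) ^+ k) (3 * K)) => //.
- by rewrite mulr_ge0 // ltW.
- by apply: exprn_gt0; lra.
- exact: limit_entire bu.
move=> w _; exists ((1 / 3) ^+ k); first by rewrite expr0 mulr1 lexx.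
apply: (limit_growth bu); apply: rtends_ext (rtends_cst _) => n.
by rewrite !pure_ampl -expr_div_n; congr (_ ^+ _); field; rewrite gt_eqF // s0.
Qed.
End Pure.

Lemma no_blowup_first p z s zs G : k = 1%N -> (forall x, u x = 0) -> disc c0 r1 zs -> v zs != 0 ->
  bb zs != ba zs -> bb zs != 0 -> nrm (ba zs) < K -> ~ blowup 0 0 k p K h z s zs G.
Proof.
move=> k1 u0 hzs v0 bab b0 hK bu; have [F2 F3 F4] := pure_facts bu hzs u0 v0.
have nc := limit_nonconst K0 bu.
rewrite k1 in F2 F3 F4.
have := @classify_first _ G (bb zs) (ba zs) (limit_entire bu) (pure_exptype bu) bab b0.
apply=> //.
- apply: F2; apply: contrapT => H; apply: nc; exists 0 => w; apply/eqP/negPn/negP => hw.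
  by apply: H; exists w.
- by exists 0; apply: lt_le_trans hK (limit_der0 K0 bu).
Qed.

Hypothesis mult : forall n x, disc c0 r1 x -> h n x = 0 -> forall j, (j < k)%N -> dern j (h n) x = 0.

Lemma no_blowup_zero p z s zs G : (1 < k)%N -> (forall x, u x = 0) -> disc c0 r1 zs -> v zs != 0 ->
  ba zs = 0 -> bb zs != 0 -> ~ blowup 0 0 k p K h z s zs G.
Proof.
move=> k1 u0 hzs v0 ba0 b0 bu; have [F2 F3 F4] := pure_facts bu hzs u0 v0.
have nc := limit_nonconst K0 bu; rewrite ba0 in F2 F3.
have E : (fun w : C => 0 * w ^+ 0) = fun=> 0 by apply/funext => w; rewrite mul0r.
have ex : exists w, G w != 0.
  apply: contrapT => H; apply: nc; exists 0 => w; apply/eqP/negPn/negP => hw.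
  by apply: H; exists w.
have := @classify_case2 _ k G 0 0 (bb zs) k1 (or_introl (erefl _)) (limit_entire bu) (pure_exptype bu) nc.
apply=> //.
- by move=> H; apply: nc; exists 0 => w; rewrite H mul0r.
- by rewrite E; case: (k) k0 => // j _; rewrite dern_cst.
- by move=> w hw j; exact: (limit_mult (lexx 0) K0 bu hh hzs mult).
- by move=> w; rewrite mul0r; exact: F2.
- by move=> H w; rewrite mul0r; exact: F3.
Qed.

(* The limits are taken along q n, which is z n - p if |z n - p| / s n -> oo
   (then d0 = 1 and e0 = 0) and s n if this ratio is bounded (then e0 = 1). *)
Section Mixed.
Variables (m : nat) (p : C) (a1 : C -> C) (z : nat -> C) (s : nat -> R) (zs : C) (G : C -> C) (q d e : nat -> C) (d0 e0 : C).
Hypotheses (bu : blowup 1 m k p K h z s zs G) (hzs : disc c0 r1 zs).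
Hypotheses (ua : forall x, u x = (x - p) ^+ m * a1 x) (ha1 : hol (disc c0 r1) a1).
Hypotheses (zq : forall n, z n - p = q n * d n) (sq : forall n, toC (s n) = q n * e n)
  (hd : tends d d0) (he : tends e e0).
Variables (c : C) (t : R).
Local Notation amp n := (ampl 1 m k p (z n) (s n)).
Hypotheses (hc : tends (fun n => q n ^+ m * toC (amp n)^-1) c) (ht : rtends (fun n => s n ^+ k / amp n) t).
Hypotheses (uv : u zs != v zs) (v0 : v zs != 0) (bau : u zs = 0 -> ba zs = 0).

Lemma mixed_pos n : 0 < amp n.
Proof. exact: ampl_gt0 ler01 (bu_pos bu n). Qed.
Lemma mixed_s n : s n = nrm (q n) * nrm (e n).
Proof. by rewrite -nrmM -sq nrm_toC gtr0_norm // (bu_pos bu). Qed.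
Lemma mixed_c : rtends (fun n => nrm (q n) ^+ m / amp n) (nrm c).
Proof.
apply: rtends_ext (rtends_nrm hc) => n; rewrite nrmM nrmX nrm_toC gtr0_norm // invr_gt0.
exact: mixed_pos.
Qed.
Lemma mixed_t0 : 0 <= t.
Proof.
apply: (rtends_le (rtends_cst 0) ht); exists 0%N => n _.
by rewrite divr_ge0 ?(ltW (mixed_pos n)) // exprn_ge0 // ltW // (bu_pos bu).
Qed.
Lemma mixed_mu w : rtends (fun n => ampl 1 m k p (z n + toC (s n) * w) (s n / 3) / amp n)
  (nrm c * (nrm (d0 + e0 * w) + nrm e0 / 3) ^+ m + t * 3^-1 ^+ k).
Proof.
have hx : rtends (fun n => nrm (d n + e n * w) + nrm (e n) / 3) (nrm (d0 + e0 * w) + nrm e0 / 3).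
  apply: rtends_add; first by apply: rtends_nrm; apply: tends_add => //; apply: tends_mul => //; exact: tends_cst.
  by apply: rtends_mul; [exact: rtends_nrm he|exact: rtends_cst].
have H := rtends_add (rtends_mul mixed_c (rtends_exp m hx)) (rtends_mul ht (rtends_cst (3^-1 ^+ k))).
apply: rtends_ext H => n; rewrite [ampl _ _ _ _ (z n + _) _]/ampl mul1r.
have -> : nrm (z n + toC (s n) * w - p) + s n / 3 = nrm (q n) * (nrm (d n + e n * w) + nrm (e n) / 3).
  have -> : z n + toC (s n) * w - p = q n * (d n + e n * w) by rewrite addrAC zq sq; ring.
  by rewrite nrmM {1}mixed_s; ring.
rewrite exprMn [RHS]mulrDl; congr (_ + _); first by rewrite mulrAC.
by rewrite exprMn mulrAC.
Qed.
(** Dividing the two summands of the amplitude by the amplitude and passing to the limit; in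
    particular c and t are not both 0. *)
Lemma mixed_one : 1 = nrm c * (nrm d0 + nrm e0) ^+ m + t.
Proof.
have H : rtends (fun n => nrm (q n) ^+ m / amp n * (nrm (d n) + nrm (e n)) ^+ m + s n ^+ k / amp n)
  (nrm c * (nrm d0 + nrm e0) ^+ m + t).
  apply: rtends_add => //; apply: rtends_mul; first exact: mixed_c.
  by apply: rtends_exp; apply: rtends_add; exact: rtends_nrm.
apply: rtends_uniq H; apply: rtends_ext (rtends_cst 1) => n.
have -> : nrm (q n) ^+ m / amp n * (nrm (d n) + nrm (e n)) ^+ m + s n ^+ k / amp n =
  ((nrm (q n) * (nrm (d n) + nrm (e n))) ^+ m + s n ^+ k) / amp n.
  by rewrite exprMn [RHS]mulrDl; congr (_ + _); rewrite mulrAC.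
have -> : nrm (q n) * (nrm (d n) + nrm (e n)) = nrm (z n - p) + s n by rewrite zq nrmM mixed_s; ring.
have <- : amp n = (nrm (z n - p) + s n) ^+ m + s n ^+ k by rewrite /ampl mul1r.
by rewrite divff // gt_eqF // mixed_pos.
Qed.
Lemma mixed_M : rtends (fun n => amp n) (nrm (zs - p) ^+ m).
Proof.
have H : rtends (fun n => (nrm (z n - p) + s n) ^+ m + s n ^+ k) ((nrm (zs - p) + 0) ^+ m + 0 ^+ k).
  apply: rtends_add; apply: rtends_exp; last exact: bu_s bu.
  apply: rtends_add; last exact: bu_s bu.
  by apply: rtends_nrm; apply: tends_subr; [exact: bu_z bu|exact: tends_cst].
move: H; rewrite addr0 expr0n gtn_eqF // addr0.
by apply: rtends_ext => n; rewrite /ampl mul1r.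
Qed.
(** The term |z n - p|^m is bounded by the amplitude, so the product is at most s n ^ k. Hence
    either t = 0 or the amplitudes tend to 0, the two alternatives of [limit_partial]. *)
Lemma mixed_tM : t * nrm (zs - p) ^+ m = 0.
Proof.
apply/eqP; rewrite eq_le mulr_ge0 ?mixed_t0 ?exprn_ge0 ?nrm_ge0 // andbT.
have H1 : rtends (fun n => s n ^+ k / amp n * nrm (z n - p) ^+ m) (t * nrm (zs - p) ^+ m).
  apply: rtends_mul => //; apply: rtends_exp; apply: rtends_nrm.
  by apply: tends_subr; [exact: bu_z bu|exact: tends_cst].
have := rtends_exp k (bu_s bu); rewrite expr0n gtn_eqF // => H2.
apply: (rtends_le H1 H2); exists 0%N => n _; have s0 := bu_pos bu n; have M0 := mixed_pos n.
rewrite mulrAC ler_pdivrMr //; apply: ler_wpM2l; first by rewrite exprn_ge0 // ltW.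
rewrite /ampl mul1r; apply: (@le_trans _ _ ((nrm (z n - p) + s n) ^+ m)).
  by rewrite lerXn2r ?nnegrE ?addr_ge0 ?nrm_ge0 ?(ltW s0) // lerDl ltW.
by rewrite lerDl exprn_ge0 // ltW.
Qed.
Lemma mixed_ba : toC t * ba zs = 0.
Proof.
have /eqP := mixed_tM; rewrite mulf_eq0 => /orP[/eqP->|]; first by rewrite toC0 mul0r.
rewrite -nrmX nrm_eq0 => /eqP E; by rewrite bau ?mulr0 // ua E mul0r.
Qed.
Lemma lucvg_pow (f : nat -> C -> C) F : (forall w, plane w -> ccont F w) -> lucvg plane f F ->
  lucvg plane (fun n w => f n w ^+ m) (fun w => F w ^+ m).
Proof.
move=> cF hf; elim: (m) => [|j IH].
  by apply: (lucvg_cst (u := fun=> 1)); exact: tends_cst.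
have H := lucvg_mul cF (fun w pw => cont_exp j (cF w pw)) hf IH.
have -> : (fun w => F w ^+ j.+1) = (fun w => F w * F w ^+ j) by apply/funext => w; rewrite exprS.
by apply: lucvg_ext H => n w; rewrite exprS.
Qed.
Lemma mixed_A : lucvg plane (fun n w => toC (amp n)^-1 * u (z n + toC (s n) * w))
  (fun w => c * a1 zs * (d0 + e0 * w) ^+ m).
Proof.
have cc x w : plane w -> ccont (fun _ : C => x) w by move=> _; exact: cont_cst.
have cl w : plane w -> ccont (fun w => d0 + e0 * w) w.
  move=> _; apply: cont_add; first exact: cont_cst.
  by apply: cont_mul; [exact: cont_cst|exact: ccont_id].
have H1 : lucvg plane (fun n w => d n + e n * w) (fun w => d0 + e0 * w).
  apply: lucvg_add; first exact: lucvg_cst.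
  apply: (lucvg_mul (F := fun=> e0) (G := id)); [exact: cc|by move=> w _; exact: ccont_id|exact: lucvg_cst|].
  by move=> w _; exists 1 => // e' e'0; exists 0%N => n _ x _; rewrite subrr nrm0.
have H2 := lucvg_pow cl H1.
have H3 : lucvg plane (fun n w => a1 (z n + toC (s n) * w)) (fun=> a1 zs).
  apply: (zoom_lucvg (g := a1) (bu_z bu) (bu_s bu)); exact: hol_cont ha1 hzs.
have H4 := lucvg_mul (cc c) (cc (a1 zs)) (lucvg_cst (U := plane) hc) H3.
have H5 := lucvg_mul (cc (c * a1 zs)) (fun w pw => cont_exp m (cl w pw)) H4 H2.
apply: lucvg_ext H5 => n w; rewrite ua.
have -> : z n + toC (s n) * w - p = q n * (d n + e n * w) by rewrite addrAC zq sq; ring.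
by rewrite exprMn; move: (a1 _) (_ ^+ m) (q n ^+ m) (toC _^-1) => *; ring.
Qed.

Lemma mixed_facts : limit_facts k G (fun w => c * a1 zs * (d0 + e0 * w) ^+ m) 0 (toC t * bb zs).
Proof.
have hA := mixed_A; have ba0 := mixed_ba.
split=> [ex w|ex w|ex w].
- by move=> hw; rewrite (limit_share1 ler01 k0 bu hh hu hgam hba hzs share hA ht ex hw) ba0.
- by move=> hw; apply: (limit_share2 ler01 k0 bu hh hu hgam hba hzs share hA ht); rewrite ba0.
have := @limit_partial _ _ _ _ _ _ _ _ _ _ _ ler01 k0 bu _ _ _ _ _ _ _ _ _ hh hu hv hgam hba hbb hzs share partial uv ht mixed_M w.
apply=> //; have /eqP := mixed_tM; rewrite mulf_eq0 => /orP[/eqP t0|/eqP M0]; [right|by left].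
by rewrite t0 toC0 !mul0r.
Qed.
Lemma mixed_mult w : G w = 0 -> forall j, (j < k)%N -> dern j G w = 0.
Proof. by move=> hw j; exact: (limit_mult ler01 K0 bu hh hzs mult). Qed.
Hypotheses (k1 : (1 < k)%N) (a10 : a1 zs != 0) (b0 : bb zs != 0).
Local Notation T := (c * a1 zs).

Lemma third_pow : 0 < (3^-1 : R) ^+ k <= 1.
Proof. by apply/andP; split; [apply: exprn_gt0|apply: exprn_ile1]; lra. Qed.

(** Far from p on the scale s n the rescaled a is the constant T. If t = 0 then T <> 0 and
    [classify_case1] applies with exponent 0; otherwise B <> 0 and [classify_case2] applies. *)
Lemma mixed_const : d0 = 1 -> e0 = 0 -> False.
Proof.
move=> d1 e1; have hG := limit_entire bu; have nc := limit_nonconst K0 bu.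
have t0 := mixed_t0; have one := mixed_one; rewrite d1 e1 nrm0 nrm1 addr0 expr1n mulr1 in one.
have /andP[y0 y1] := third_pow.
have cc0 := nrm_ge0 c.
(* The factor mu is |c| + t / 3^k, which lies between 1 / 3^k and 1 because |c| + t = 1. *)
have eG : exptype G.
  apply: (@growth_bounds G 0 (3^-1 ^+ k) 1 (3 * K)) => //; first by rewrite mulr_ge0 // ltW.
  move=> w _; exists (nrm c + t * 3^-1 ^+ k).
    by move: (3^-1 ^+ k) y0 y1 => y y0 y1; rewrite expr0 !mulr1; apply/andP; split; nra.
  apply: (limit_growth bu); have := mixed_mu w.
  by rewrite d1 e1 mul0r addr0 nrm1 nrm0 mul0r addr0 expr1n mulr1.
have [F2 F3 F4] := mixed_facts; rewrite d1 e1 in F2 F3.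
have E w : T * (1 + 0 * w) ^+ m = T * w ^+ 0 by rewrite mul0r addr0 expr1n.
have ex : exists w, G w != T * (1 + 0 * w) ^+ m.
  apply: contrapT => H; apply: nc; exists T => w; apply/eqP/negPn/negP => hw.
  by apply: H; exists w; rewrite E mulr1.
have F2' w : G w = T * w ^+ 0 -> dern k G w = 0 by rewrite -E; exact: F2.
have [tz|tn] := eqVneq t 0.
  have c1 : c != 0 by rewrite -nrm_eq0; apply/eqP => n0; move: one; rewrite n0 tz; lra.
  apply: (@classify_case1 _ k G T 0 k1 k0 (mulf_neq0 c1 a10) hG eG nc mixed_mult) => [_|]; first exact: F2'.
  by rewrite tz toC0 mul0r in F4.
have B0 : toC t * bb zs != 0 by rewrite mulf_neq0 // toC_eq0.
have := @classify_case2 _ k G T 0 (toC t * bb zs) k1 (or_introl (erefl _)) hG eG nc.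
apply=> //; first by move=> H; apply: nc; exists T => w; rewrite H mulr1.
- by have -> : (fun z => T * z ^+ 0) = (fun=> T) by [apply/funext => w; rewrite mulr1]; case: (k) k0 => // j _; rewrite dern_cst.
- exact: mixed_mult.
- by move=> H w hw; rewrite -E; exact: F3.
Qed.

Lemma limit_facts_shift A B1 B x : hol plane G -> limit_facts k G A B1 B ->
  limit_facts k (fun w => G (w - x)) (fun w => A (w - x)) B1 B.
Proof.
move=> hG [F2 F3 F4]; split; rewrite ?(dern_shift (- x) k hG).
- by move=> [w hw] w' hw'; apply: F2 => //; exists (w - x).
- by move=> [w hw] w' hw'; apply: F3 => //; exists (w - x).
- by move=> [w hw] w'; apply: F4; exists (w - x).
Qed.

Hypothesis qs : forall n, q n = toC (s n).
Lemma mixed_qs n : nrm (q n) = s n.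
Proof. by rewrite qs nrm_toC gtr0_norm // (bu_pos bu). Qed.
Lemma small_pow j : (0 < j)%N -> rtends (fun n => s n ^+ j) 0.
Proof. by move=> j0; have := rtends_exp j (bu_s bu); rewrite expr0n gtn_eqF. Qed.
Lemma mixed_lt : (m < k)%N -> t = 0.
Proof.
move=> mk; have := rtends_mul (small_pow (j := k - m) ltac:(by rewrite subn_gt0)) mixed_c.
rewrite mul0r; apply: rtends_uniq; apply: rtends_ext ht => n.
by rewrite mixed_qs mulrA -exprD subnK // ltnW.
Qed.
Lemma mixed_gt : (k < m)%N -> c = 0.
Proof.
move=> km; apply/eqP; rewrite -nrm_eq0; apply/eqP.
have := rtends_mul (small_pow (j := m - k) ltac:(by rewrite subn_gt0)) ht.
rewrite mul0r; apply: rtends_uniq; apply: rtends_ext mixed_c => n.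
by rewrite mixed_qs mulrA -exprD subnK // ltnW.
Qed.
Lemma mixed_eq : m = k -> c = toC t.
Proof.
move=> mk; apply: tends_uniq hc _; move/rtends_toC: ht; apply: tends_ext => n.
by rewrite toCM rmorphXn qs mk.
Qed.

(** For m < k the power s^m outweighs s^k, so t = 0 and the polynomial survives; for m > k, c = 0
    and A = 0; for m = k the two limits agree and zs = p. *)
Lemma mixed_near : e0 = 1 -> (m = k -> zs = p -> k%:R * nrm (a1 zs) < K /\ bb zs != a1 zs * k`!%:R) -> False.
Proof.
move=> e1 hmk; have hG := limit_entire bu; have nc := limit_nonconst K0 bu.
have t0 := mixed_t0; have one := mixed_one; rewrite e1 nrm1 in one.
have /andP[y0 y1] := third_pow; have cc0 := nrm_ge0 c.
(* The translation turns A into the monomial T w^m. *)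
pose H w := G (w - d0).
have hH : hol plane H.
  have H1 := cder_sub (cder_id _) (cder_cst d0 _).
  move=> w _; have [g hg] := hG (w - d0) I; exists (g * (1 - 0)).
  exact: (@cder_comp _ G (fun w => w - d0) w _ _ hg (H1 w)).
have dH j w : dern j H w = dern j G (w - d0) by rewrite /H (dern_shift (- d0) j hG).
have dH1 w : der H w = der G (w - d0) := dH 1%N w.
have nH : ~ (exists c, forall w, H w = c).
  by move=> [x hx]; apply: nc; exists x => w; have := hx (w + d0); rewrite /H addrK.
have mH w : H w = 0 -> forall j, (j < k)%N -> dern j H w = 0.
  by move=> hw j jk; rewrite dH; exact: mixed_mult.
have muH w : nrm (der H w) * (nrm c * (nrm w + 3^-1) ^+ m + t * 3^-1 ^+ k) <=
     3 * K * ((nrm c * (nrm w + 3^-1) ^+ m + t * 3^-1 ^+ k) ^+ 2 + nrm (H w) ^+ 2).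
  have := mixed_mu (w - d0); rewrite e1 nrm1 mul1r div1r addrCA subrr addr0 => X.
  by rewrite dH1; exact: (limit_growth bu X).
have c1 : nrm c * (nrm d0 + 1) ^+ m <= 1 by lra.
have eH : c != 0 -> (t <= 1) -> exptype H.
  move=> c0' t1; apply: (@growth_bounds H m (nrm c) (nrm c * 2 ^+ m + 1) (3 * K)) => //.
  - by rewrite mulr_ge0 // ltW.
  - by rewrite nrm_gt0.
  move=> w w1; exists (nrm c * (nrm w + 3^-1) ^+ m + t * 3^-1 ^+ k); last exact: muH.
  have wm : 1 <= nrm w ^+ m by rewrite exprn_ege1.
  have b1 : nrm w ^+ m <= (nrm w + 3^-1) ^+ m by rewrite lerXn2r ?nnegrE ?addr_ge0 ?nrm_ge0 //; lra.
  have b2 : (nrm w + 3^-1) ^+ m <= 2 ^+ m * nrm w ^+ m.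
    by rewrite -exprMn lerXn2r ?nnegrE ?mulr_ge0 ?addr_ge0 ?nrm_ge0 //; lra.
  have ty : 0 <= t * 3^-1 ^+ k <= 1 by apply/andP; split; [rewrite mulr_ge0 // ltW|apply: mulr_ile1 => //; exact: ltW].
  have /andP[ty0 ty1] := ty.
  move: (nrm w ^+ m) ((nrm w + 3^-1) ^+ m) (t * 3^-1 ^+ k) (2 ^+ m) wm b1 b2 ty0 ty1 => x x' ty' tw *.
  by apply/andP; split; nra.
have F := @limit_facts_shift _ _ _ d0 hG mixed_facts; rewrite e1 in F.
have EA w : T * (d0 + 1 * (w - d0)) ^+ m = T * w ^+ m by rewrite mul1r addrCA subrr addr0.
have [F2 F3 F4] := F; rewrite -/H in F2 F3 F4.
have F2' : (exists w, H w != T * w ^+ m) -> forall w, H w = T * w ^+ m -> dern k H w = 0.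
  by move=> [w hw] w' hw'; apply: F2; [exists w; rewrite EA|rewrite EA].
have F3' : (exists w, dern k H w != 0) -> forall w, dern k H w = 0 -> H w = T * w ^+ m.
  by move=> ex w hw; rewrite -EA; exact: F3.
have cpow : 0 <= nrm c * (nrm d0 + 1) ^+ m by rewrite mulr_ge0 // exprn_ge0 // addr_ge0 ?nrm_ge0.
have [mk|km|mk] := ltngtP m k.
- have tz := mixed_lt mk; have cn : c != 0.
    by rewrite -nrm_eq0; apply/eqP => n0; move: one; rewrite n0 tz mul0r; lra.
  have eX := eH cn ltac:(by rewrite tz ler01).
  apply: (@classify_case1 _ k H T m k1 mk (mulf_neq0 cn a10) hH eX nH mH F2').
  by rewrite tz toC0 mul0r in F4.
- have cz := mixed_gt km; rewrite cz nrm0 mul0r add0r in one; rewrite -one toC1 mul1r in F4.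
  have z0 w : T * w ^+ m = 0 by rewrite cz !mul0r.
  have zz w : T * w ^+ m = 0 * w ^+ 0 by rewrite z0 mul0r.
  have eX : exptype H.
    apply: (@growth_bounds H 0 (3^-1 ^+ k) (3^-1 ^+ k) (3 * K)) => //.
    - by rewrite mulr_ge0 // ltW.
    move=> w _; exists (3^-1 ^+ k); first by rewrite expr0 mulr1 lexx.
    by have := muH w; rewrite cz nrm0 mul0r add0r -one mul1r.
  have := @classify_case2 _ k H 0 0 (bb zs) k1 (or_introl (erefl _)) hH eX nH.
  apply=> //.
  + by move=> X; apply: nH; exists 0 => w; rewrite X mul0r.
  + have -> : (fun w : C => 0 * w ^+ 0) = fun=> 0 by apply/funext => w; rewrite mul0r.
    by case: (k) k0 => // j _; rewrite dern_cst.
  + move=> w hw; apply: F2'; last by rewrite zz.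
    apply: contrapT => X; apply: nH; exists 0 => w'; apply/eqP/negPn/negP => hw'.
    by apply: X; exists w'; rewrite z0.
  + by move=> ex w hw; rewrite -zz; exact: F3'.
have cE := mixed_eq mk; have tE : nrm c = t by rewrite cE nrm_toC ger0_norm.
have tn : t != 0 by apply/eqP => n0; move: one; rewrite tE n0 mul0r; lra.
have zp : zs = p.
  have /eqP := mixed_tM; rewrite mulf_eq0 (negbTE tn) /= expf_eq0 => /andP[_].
  by rewrite nrm_eq0 subr_eq0 => /eqP.
have [hK hB] := hmk mk zp.
have cn : c != 0 by rewrite cE toC_eq0.
have t1 : t <= 1 by lra.
have eX := eH cn t1; rewrite mk in F2' F3'.
have dT : dern k (fun w => T * w ^+ k) 0 = T * k`!%:R by rewrite dern_mono_eq.
(* Here the size of K matters: G = A would satisfy the sharing conditions, but its derivative at 0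
   has modulus at most k |a1(zs)| < K. *)
have nA : ~ (forall w, H w = T * w ^+ k).
  move=> X; have := limit_der0 K0 bu; have -> : der G 0 = der H d0 by rewrite dH1 subrr.
  have -> : H = fun w => T * w ^+ k by apply/funext.
  rewrite (derE (cder_mono T k d0)) !nrmM nrmX tE -toC_nat nrm_toC ger0_norm //; apply/negP; rewrite -ltNge.
  apply: le_lt_trans hK.
  have : t * nrm d0 ^+ k.-1 <= 1.
    apply: le_trans c1; rewrite tE mk; apply: ler_wpM2l => //.
    apply: (@le_trans _ _ ((nrm d0 + 1) ^+ k.-1)).
      by rewrite lerXn2r ?nnegrE ?addr_ge0 ?nrm_ge0 // lerDl.
    by apply: ler_weXn2l; [rewrite lerDr nrm_ge0|exact: leq_pred].
  have : 0 <= k%:R * nrm (a1 zs) by rewrite mulr_ge0 ?nrm_ge0.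
  move: (nrm d0 ^+ k.-1) (nrm (a1 zs)) (k%:R : R) => X1 X2 X3 P Q.
  have -> : t * X2 * X3 * X1 = X3 * X2 * (t * X1) by ring.
  by rewrite -[leRHS]mulr1 ler_wpM2l.
have := @classify_case2 _ k H T k (toC t * bb zs) k1 (or_intror (erefl _)) hH eX nH nA.
apply=> //.
- by rewrite mulf_neq0 // toC_eq0.
- by rewrite dT cE -mulrA; apply: contra hB => /eqP/mulfI ->; rewrite // toC_eq0.
move=> w; apply: F2'; apply: contrapT => X; apply: nA => w'; apply/eqP/negPn/negP => hw'.
by apply: X; exists w'.
Qed.
End Mixed.
End Data.
End NoBlowUp.

(** * Local normality *)

Section LocalNormality.
Variable R : realType.
Local Notation C := (Cplx R).
Local Notation disc := (@disc R).
Local Notation hol := (@hol R).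
Local Notation der := (@der R).
Local Notation dern := (@dern R).

Lemma no_blowup_mixed k K h c0 r1 (u v gam ba bb : C -> C) m p a1 z s zs G :
  0 < K -> (1 < k)%N ->
  (forall n, hol (disc c0 r1) (h n)) -> hol (disc c0 r1) u -> hol (disc c0 r1) v ->
  hol (disc c0 r1) gam -> hol (disc c0 r1) ba -> hol (disc c0 r1) bb ->
  (forall n x, disc c0 r1 x -> (h n x = u x <-> dern k (h n) x + gam x * h n x = ba x)) ->
  (forall n x, disc c0 r1 x -> dern k (h n) x + gam x * h n x = bb x -> h n x = v x) ->
  (forall n x, disc c0 r1 x -> h n x = 0 -> forall j, (j < k)%N -> dern j (h n) x = 0) ->
  disc c0 r1 zs -> (forall x, u x = (x - p) ^+ m * a1 x) -> hol (disc c0 r1) a1 ->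
  u zs != v zs -> v zs != 0 -> (u zs = 0 -> ba zs = 0) -> a1 zs != 0 -> bb zs != 0 ->
  (m = k -> zs = p -> k%:R * nrm (a1 zs) < K /\ bb zs != a1 zs * k`!%:R) ->
  ~ blowup 1 m k p K h z s zs G.
Proof.
move=> K0 k1 hh hu hv hgam hba hbb share partial mult hzs ua ha1 uv v0 bau a10 b0 hmk bu.
have k0 := ltnW k1.
pose amp n := ampl 1 m k p (z n) (s n).
have reduce (phi : nat -> nat) (q d e : nat -> C) d0 e0 : sinc phi ->
  (forall n, nrm (q n) <= nrm (z (phi n) - p) + s (phi n)) ->
  (forall n, z (phi n) - p = q n * d n) -> (forall n, toC (s (phi n)) = q n * e n) ->
  tends d d0 -> tends e e0 -> (d0 = 1 /\ e0 = 0) \/ (e0 = 1 /\ forall n, q n = toC (s (phi n))) -> False.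
  move=> sp qb zq sq hd he alt.
  have M0 n : 0 < amp n := ampl_gt0 m k p (z n) ler01 (bu_pos bu n).
  (* The bound on |q n| makes |q n|^m at most the amplitude; both quotients lie in the unit disc,
     and subsequences give c and t. *)
  have [|f1 sf1 [c hc]] := @bounded_sub _ (fun n => q n ^+ m * toC (amp (phi n))^-1) 1.
    move=> n; rewrite nrmM nrmX nrm_toC gtr0_norm ?invr_gt0 // ler_pdivrMr // mul1r.
    have s0 := bu_pos bu (phi n); rewrite /amp /ampl mul1r.
    apply: (@le_trans _ _ ((nrm (z (phi n) - p) + s (phi n)) ^+ m)).
      by rewrite lerXn2r ?nnegrE ?addr_ge0 ?nrm_ge0 // ltW.
    by rewrite lerDl exprn_ge0 // ltW.
  have [|f2 sf2 [t ht]] := @rbounded_sub _ (fun n => s (phi (f1 n)) ^+ k / amp (phi (f1 n))) 1.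
    move=> n; have s0 := bu_pos bu (phi (f1 n)).
    rewrite ger0_norm; last by rewrite divr_ge0 ?exprn_ge0 // ltW.
    by rewrite ler_pdivrMr // mul1r; exact: ampl_ge ler01 s0.
  have sf := sinc_comp sf1 sf2; pose f n := f1 (f2 n).
  have bf := blowup_sub (sinc_comp sp sf) bu.
  case: alt => [[d1 e1]|[e1 qs]].
    exact: (mixed_const K0 k0 (fun n => hh (phi (f n))) hu hv hgam hba hbb (fun n => share (phi (f n)))
      (fun n => partial (phi (f n))) (fun n => mult (phi (f n))) bf hzs ua ha1
      (fun n => zq (f n)) (fun n => sq (f n)) (tends_sub hd sf) (tends_sub he sf) (tends_sub hc sf2) ht uv v0 bau k1 a10 b0 d1 e1).
  exact: (mixed_near K0 k0 (fun n => hh (phi (f n))) hu hv hgam hba hbb (fun n => share (phi (f n)))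
      (fun n => partial (phi (f n))) (fun n => mult (phi (f n))) bf hzs ua ha1
      (fun n => zq (f n)) (fun n => sq (f n)) (tends_sub hd sf) (tends_sub he sf) (tends_sub hc sf2) ht uv v0 bau k1 a10 b0
      (fun n => qs (f n)) e1 hmk).
have [[B hB]|far] := pselect (exists B, forall N, exists2 n, (N <= n)%N & nrm (z n - p) <= B * s n).
  have [[phi sp hphi]|[N hN]] := infinitely_often (fun n => nrm (z n - p) <= B * s n); last first.
    by have [n /hN] := hB N.
  have s0 n : 0 < s (phi n) := bu_pos bu _.
  have sn n : toC (s (phi n)) != 0 by rewrite toC_eq0 gt_eqF.
  have [|f sf [w hw]] := @bounded_sub _ (fun n => (z (phi n) - p) / toC (s (phi n))) B.
    by move=> n; rewrite nrmM nrmV nrm_toC gtr0_norm // ler_pdivrMr.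
  apply: (reduce (phi \o f) (fun n => toC (s (phi (f n)))) (fun n => (z (phi (f n)) - p) / toC (s (phi (f n)))) (fun=> 1) w 1) => //.
  - exact: sinc_comp.
  - by move=> n; rewrite nrm_toC gtr0_norm //= lerDr nrm_ge0.
  - by move=> n; rewrite mulrC divfK.
  - by move=> n; rewrite mulr1.
  - exact: tends_cst.
  - by right.
have {}far B : exists N, forall n, (N <= n)%N -> B * s n < nrm (z n - p).
  apply: contrapT => H; apply: far; exists B => N; apply: contrapT => H2; apply: H; exists N => n Nn.
  by rewrite ltNge; apply/negP => X; apply: H2; exists n.
have [N hN] := far 0; pose phi n := (n + N)%N.
have zp n : 0 < nrm (z (phi n) - p) by have := hN (phi n) (leq_addl _ _); rewrite mul0r.
have zn n : z (phi n) - p != 0 by rewrite -nrm_gt0.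
apply: (reduce phi (fun n => z (phi n) - p) (fun=> 1) (fun n => toC (s (phi n)) / (z (phi n) - p)) 1 0) => //.
- by move=> n; rewrite lerDl ltW // (bu_pos bu).
- by move=> n; rewrite mulr1.
- by move=> n; rewrite mulrC divfK.
- exact: tends_cst.
- move=> e e0; have [N1 h1] := far e^-1; exists N1 => n Nn.
  have s0 := bu_pos bu (phi n).
  rewrite subr0 nrmM nrmV nrm_toC gtr0_norm // ltr_pdivrMr // mulrC -ltr_pdivrMr // mulrC.
  by apply: h1; apply: leq_trans Nn (leq_addr _ _).
- by left.
Qed.

Section Zalcman.
Variables (th : R) (m k : nat) (p : C) (K : R) (c0 : C) (r : R) (H : (C -> C) -> Prop).
Hypotheses (th0 : 0 <= th) (K0 : 0 < K) (r0 : 0 < r) (hH : forall h, H h -> hol (disc c0 r) h)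
  (small : forall h zs, H h -> nrm (zs - c0) <= r -> sder_small th m k p K h zs)
  (noblow : forall h z s zs G, (forall n, H (h n)) -> nrm (zs - c0) <= r -> ~ blowup th m k p K h z s zs G).

(** Were there no common l, functions violating the choices 1/(n+1) would feed [zalcman_points] and
    produce a blow-up limit. *)
Lemma zalcman_family : exists2 l, 0 < l & forall h z s, H h -> disc c0 r z -> 0 < s <= l * (r - nrm (z - c0)) ->
  sder th m k p h z s < K.
Proof.
apply: contrapT => X.
have [|h hh] := @choice nat (C -> C) (fun n h => H h /\ exists z s,
     [/\ disc c0 r z, 0 < s <= n.+1%:R^-1 * (r - nrm (z - c0)) & K <= sder th m k p h z s]).
  move=> n; apply: contrapT => Y; apply: X; exists n.+1%:R^-1; first by rewrite invr_gt0.
  move=> h z s Hh zr hs; rewrite ltNge; apply/negP => hK; apply: Y; exists h; split=> //.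
  by exists z, s.
have loc n := sder_small_unif (fun zs hzs => small (hh n).1 hzs).
have [|z [s [N0 [h1 h2 h3]]]] := zalcman_points r0 loc.
  move=> l l0; have [N hN] := inv_nat_small l0; exists N => n Nn.
  have [_ [z [s [zr /andP[s0 s1] hK]]]] := hh n; exists z, s; split=> //; rewrite s0 /=.
  apply: le_trans s1 _; apply: ler_wpM2r; first by move: zr; rewrite /disc; lra.
  by apply: ltW; exact: hN.
pose sh n := (n + N0)%N; have ge n : (N0 <= sh n)%N by rewrite leq_addl.
have [|||||phi [zs [G [sp zsr bu]]]] := @blowup_exists _ th m k p K th0 K0 (fun n => h (sh n)) c0 r (fun n => z (sh n)) (fun n => s (sh n)) => //.
- by move=> n; apply: hH; exact: (hh (sh n)).1.
- by move=> n; apply: h1.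
- by move=> e /h2[N hN]; exists N => n Nn; apply: hN; apply: leq_trans Nn (leq_addr _ _).
- by move=> n; apply: h3.
by apply: (noblow _ zsr bu) => n; exact: (hh _).1.
Qed.

(** On the half disc the scale s = l r / 2 is admissible at every point. At one fixed scale the
    amplitude lies between positive constants, so the weighted bound becomes an ordinary spherical
    derivative bound. *)
Lemma zalcman_normal : exists2 d, 0 < d & forall h : nat -> C -> C, (forall n, H (h n)) ->
  exists2 psi, sinc psi & conv_or_inf (disc c0 d) (fun n => h (psi n)).
Proof.
have [l l0 hl] := zalcman_family; have r2 : 0 < r / 2 by rewrite divr_gt0.
pose s := l * (r / 2); have s0 : 0 < s by rewrite mulr_gt0.
pose Mx := th * (nrm (c0 - p) + r + s) ^+ m + s ^+ k.
have sk : 0 < s ^+ k by rewrite exprn_gt0.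
(* Mx bounds the amplitude from above and s^k bounds it from below; they serve the terms 1 and |h|^2
   respectively. *)
pose K' := K / s * (Mx + (s ^+ k)^-1).
have nn x : 0 <= nrm (x - p) by exact: nrm_ge0.
have Mx0 : 0 < Mx by rewrite ltr_wpDl // mulr_ge0 // exprn_ge0 // !addr_ge0 // ltW.
have Ks : 0 < K / s by rewrite divr_gt0.
have K'0 : 0 <= K'.
  by apply: mulr_ge0; [exact: ltW|apply: addr_ge0; [exact: ltW|rewrite invr_ge0 ltW]].
have bd h z : H h -> disc c0 (r / 2) z -> nrm (der h z) <= K' * (1 + nrm (h z) ^+ 2).
  move=> Hh zr; have zr' : disc c0 r z by apply: disc_le zr; lra.
  have := hl h z s Hh zr'; rewrite s0 /= /s ler_pM2l //.
  have -> : r / 2 <= r - nrm (z - c0) by move: zr; rewrite /disc; lra.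
  move=> /(_ isT); rewrite -/s /sder.
  have M0 := ampl_gt0 m k p z th0 s0; have Mk := ampl_ge m k p z th0 s0.
  have Mx1 : ampl th m k p z s <= Mx.
    rewrite lerD2r ler_wpM2l // lerXn2r ?nnegrE ?addr_ge0 // ?(ltW s0) ?(ltW r0) //.
    by rewrite lerD2r; have := nrm_distD c0 z p; move: zr; rewrite /disc; lra.
  move: (ampl _ _ _ _ _ _) M0 Mk Mx1 => M M0 Mk Mx1.
  rewrite ltr_pdivrMr; last by rewrite ltr_wpDr ?sqr_ge0 // exprn_gt0.
  move: (nrm (der h z)) (nrm (h z)) => d y /ltW X.
  have sM : 0 < s * M by rewrite mulr_gt0.
  rewrite -(ler_pM2r sM); have -> : d * (s * M) = s * d * M by ring.
  apply: le_trans X _.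
  have -> : K' * (1 + y ^+ 2) * (s * M) = K * ((Mx + (s ^+ k)^-1) * (1 + y ^+ 2) * M).
    by rewrite /K'; field; rewrite !gt_eqF.
  rewrite ler_pM2l //.
  have y2 := sqr_ge0 y; have e1 : 1 <= (s ^+ k)^-1 * M by rewrite mulrC ler_pdivlMr ?mul1r.
  have -> : (Mx + (s ^+ k)^-1) * (1 + y ^+ 2) * M = Mx * M + Mx * M * y ^+ 2 + (s ^+ k)^-1 * M + (s ^+ k)^-1 * M * y ^+ 2 by ring.
  have e2 : M ^+ 2 <= Mx * M by rewrite expr2 ler_pM2r.
  have e3 : y ^+ 2 <= (s ^+ k)^-1 * M * y ^+ 2 by rewrite ler_peMl.
  have e4 : 0 <= Mx * M * y ^+ 2 by rewrite mulr_ge0 // mulr_ge0 // ltW.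
  move: (Mx * M * y ^+ 2) (Mx * M) ((s ^+ k)^-1 * M * y ^+ 2) ((s ^+ k)^-1 * M) (y ^+ 2) (M ^+ 2) e1 e2 e3 e4.
  by move=> x1 x2 x3 x4 x5 x6; lra.
have [d d0 hd] := marty c0 r2 K'0; exists d => // h hh; apply: hd => [n|n z zr].
  by apply: hol_sub (hH (hh n)) => z; apply: disc_le; lra.
exact: bd.
Qed.
End Zalcman.

Lemma op_scale (A0 A1 x f c : C) : A0 != 0 -> (A0 * x + A1 * f = c <-> x + A1 / A0 * f = c / A0).
Proof.
move=> n0; have -> : x + A1 / A0 * f = (A0 * x + A1 * f) / A0 by field.
by split=> [->//|]; apply: mulIf; rewrite invr_eq0.
Qed.

Section Family.
Variables (D : C -> Prop) (k : nat) (F : (C -> C) -> Prop) (a b al0 al1 : C -> C).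
Hypotheses (oD : forall z, D z -> exists2 r, 0 < r & forall w, disc z r w -> D w) (k0 : (0 < k)%N)
  (hF : forall f, F f -> hol D f)
  (mult : forall f, F f -> forall z, D z -> f z = 0 -> forall j, (j < k)%N -> dern j f z = 0)
  (ha : hol D a) (hb : hol D b) (hal0 : hol D al0) (hal1 : hol D al1)
  (nz0 : forall z, D z -> al0 z != 0) (nzb : forall z, D z -> b z != 0)
  (hab : forall z, D z -> a z != b z /\ b z - al1 z * a z - al0 z * dern k a z != 0)
  (share : forall f, F f -> forall z, D z -> (f z = a z <-> al0 z * dern k f z + al1 z * f z = a z))
  (partial : forall f, F f -> forall z, D z -> al0 z * dern k f z + al1 z * f z = b z -> f z = b z).

Definition normal_at p := exists2 d, 0 < d & forall f : nat -> C -> C, (forall n, F (f n)) ->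
  exists2 psi, sinc psi & conv_or_inf (disc p d) (fun n => f (psi n)).

Lemma share_quotient f z : F f -> D z -> (f z = a z <-> dern k f z + al1 z / al0 z * f z = a z / al0 z).
Proof. by move=> Ff Dz; rewrite -op_scale ?nz0 //; exact: share. Qed.
Lemma partial_quotient f z : F f -> D z -> dern k f z + al1 z / al0 z * f z = b z / al0 z -> f z = b z.
Proof. by move=> Ff Dz; rewrite -op_scale ?nz0 //; exact: partial. Qed.
Lemma hol_quotient U f g : (forall z, U z -> D z) -> (forall z, D z -> g z != 0) ->
  hol D f -> hol D g -> hol U (fun z => f z / g z).
Proof.
move=> UD g0 hf hg; apply: hol_mul; first exact: hol_sub hf.
by apply: hol_inv => [|z /UD /g0 //]; exact: hol_sub hg.
Qed.

(* A common zero of f and a is a zero of f of order greater than k. *)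
Lemma sder_small_family th m p K f zs : 0 <= th -> 0 < K -> F f -> D zs -> (f zs = 0 -> a zs = 0) ->
  sder_small th m k p K f zs.
Proof.
move=> th0 K0 Ff Dz fa; have [r r0 hr] := oD Dz; have hf : hol (disc zs r) f := hol_sub hr (hF Ff).
have [fz|fz] := eqVneq (f zs) 0; last exact: sder_small_nonzero th0 K0 r0 hf fz.
have dk : dern k f zs = 0.
  have : f zs = a zs by rewrite fz fa.
  by move=> /(share_quotient Ff Dz); rewrite fz fa // mulr0 addr0 mul0r.
have [h|[n [_ qn fE]]] := hol_factor r0 hf; first exact: sder_small_zero.
apply: (sder_small_order m p th0 K0 r0 _ (iterq_hol n hf) qn fE).
rewrite ltnNge; apply/negP => nk; have dn : dern n f zs = 0.
  by move: nk; rewrite leq_eqVlt => /orP[/eqP->//|]; exact: mult.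
by move: dn => /(dern_eq0_iterq n r0 hf) E; rewrite E eqxx in qn.
Qed.

Lemma normal_at_first p : k = 1%N -> D p -> normal_at p.
Proof.
move=> k1 Dp; have [r1 r10 hr] := oD Dp; pose r := r1 / 2.
have r0 : 0 < r by rewrite /r; lra.
have rr1 : r < r1 by rewrite /r; lra.
have inr zs : nrm (zs - p) <= r -> disc p r1 zs by rewrite /disc; lra.
have hda : hol D (der a) := der_hol oD ha.
pose gam z := al1 z / al0 z.
(* Rewriting the operator for h = f - a moves alpha1 a + alpha0 a' to the right-hand side; for k = 1
   hypothesis (2) says that [bb] has no zero. *)
pose ba z := (a z - al1 z * a z - al0 z * der a z) / al0 z.
pose bb z := (b z - al1 z * a z - al0 z * der a z) / al0 z.
have hnum c : hol D c -> hol D (fun z => c z - al1 z * a z - al0 z * der a z).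
  by move=> hc; apply: hol_subr; [apply: hol_subr => //; exact: hol_mul|exact: hol_mul].
have hgam : hol (disc p r1) gam by exact: hol_quotient.
have hba : hol (disc p r1) ba by apply: hol_quotient => //; exact: hnum.
have hbb : hol (disc p r1) bb by apply: hol_quotient => //; exact: hnum.
have [B hB] := hol_bounded rr1 hba.
have B0 : 0 <= B by apply: le_trans (hB p _); rewrite ?nrm_ge0 // subrr nrm0 ltW.
(* At a zero of h the shared value gives h' = ba, so K exceeds |h'| at every zero in the closed
   disc. *)
pose K := B + 1; have K0 : 0 < K by rewrite /K; lra.
pose H (h : C -> C) := exists2 f, F f & h = fun z => f z - a z.
have hH h : H h -> hol (disc p r1) h.
  by move=> [f Ff ->]; apply: hol_sub hr _; apply: hol_subr => //; exact: hF.
have dH f z : F f -> D z -> der (fun z => f z - a z) z = der f z - der a z.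
  by move=> Ff Dz; apply: derE; apply: cder_sub; apply: hol_der Dz => //; exact: hF.
have opH f z c : F f -> D z -> (der (fun z => f z - a z) z + gam z * (f z - a z) =
     (c z - al1 z * a z - al0 z * der a z) / al0 z <-> al0 z * der f z + al1 z * f z = c z).
  move=> Ff Dz; rewrite dH // /gam -op_scale ?nz0 //.
  move: (der f z) (der a z) => x y; have -> : al0 z * (x - y) + al1 z * (f z - a z) =
     al0 z * x + al1 z * f z - al1 z * a z - al0 z * y by ring.
  by split=> [/addIr/addIr //|->].
have shareH h z : H h -> disc p r1 z -> (h z = 0 <-> der h z + gam z * h z = ba z).
  move=> [f Ff ->] /hr Dz; rewrite (opH f z a Ff Dz); have := share Ff Dz; rewrite k1 => <-.
  by split=> [/eqP|->]; rewrite ?subrr // subr_eq0 => /eqP.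
have partialH h z : H h -> disc p r1 z -> der h z + gam z * h z = bb z -> h z = b z - a z.
  move=> [f Ff ->] /hr Dz; rewrite (opH f z b Ff Dz) => X.
  by rewrite (partial Ff Dz) // k1.
have [d d0 hd] : exists2 d, 0 < d & forall h : nat -> C -> C, (forall n, H (h n)) ->
  exists2 psi, sinc psi & conv_or_inf (disc p d) (fun n => h (psi n)).
  apply: (@zalcman_normal 0 0 k p K p r H) => //.
  - by move=> h /hH; apply: hol_sub => z; apply: disc_le; exact: ltW.
  - move=> h zs Hh zsr; have dz := inr zs zsr; have [s s0 hs] := disc_open dz.
    have hz : hol (disc zs s) h := hol_sub hs (hH h Hh).
    have [h0|h0] := eqVneq (h zs) 0; last exact: sder_small_nonzero s0 hz h0.
    apply: (sder_small_first _ _ _ _ s0 hz k1) => //.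
    have /(shareH h zs Hh dz) := h0; rewrite h0 mulr0 addr0 => ->.
    by have := hB zs zsr; rewrite /K; lra.
  move=> h z s zs G Hh zsr; have dz := inr zs zsr; have Dz := hr zs dz.
  have [ab bn] := hab Dz; rewrite k1 in bn.
  have n0 := nz0 Dz.
  apply: (@no_blowup_first _ k K h p r1 (fun=> 0) (fun z => b z - a z) gam ba bb K0 k0 _ _ _ hgam hba hbb) => //.
  - by move=> n; exact: hH.
  - exact: hol_cst.
  - by apply: hol_sub hr _; exact: hol_subr.
  - by move=> n x xr; rewrite k1; exact: shareH.
  - by move=> n x xr; rewrite k1; exact: partialH.
  - by rewrite subr_eq0 eq_sym.
  - rewrite /ba /bb; apply: contra ab => /eqP/mulIf; rewrite invr_eq0 => /(_ n0)/addIr/addIr ->.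
    by [].
  - by rewrite mulf_neq0 // invr_eq0.
  - by have := hB zs zsr; rewrite /K; lra.
(* Boundedness of a near p carries both convergence and divergence to infinity from f - a back to
   f. *)
have [t t0 ht] := cont_bounded (hol_cont ha Dp).
exists (Num.min d t); first by rewrite lt_min d0.
move=> f hf; have [|psi sp [[g hg]|hi]] := hd (fun n z => f n z - a z).
- by move=> n; exists (f n).
- exists psi => //; left; exists (fun z => g z + a z) => e /hg[N hN]; exists N => n Nn z.
  rewrite /disc lt_min => /andP[zd _].
  have -> : f (psi n) z - (g z + a z) = f (psi n) z - a z - g z by ring.
  exact: hN.
exists psi => //; right=> M; have [N hN] := hi (M + (nrm (a p) + 1)); exists N => n Nn z.
rewrite /disc lt_min => /andP[zd /ht za]; have := hN n Nn z zd.
by have := nrmB (f (psi n) z) (a z); lra.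
Qed.

Lemma normal_at_zero p s : (1 < k)%N -> D p -> 0 < s -> (forall z, disc p s z -> a z = 0) -> normal_at p.
Proof.
move=> k1 Dp s0 az; have [r2 r20 hr2] := oD Dp; pose r1 := Num.min r2 s; pose r := r1 / 2.
have r10 : 0 < r1 by rewrite lt_min r20.
have r0 : 0 < r by rewrite /r; lra.
have rr1 : r < r1 by rewrite /r; lra.
have inr zs : nrm (zs - p) <= r -> disc p r1 zs by rewrite /disc; lra.
have hr z : disc p r1 z -> D z by move=> zr; apply: hr2; apply: disc_le zr; rewrite ge_min lexx.
have a0 z : disc p r1 z -> a z = 0 by move=> zr; apply: az; apply: disc_le zr; rewrite ge_min lexx orbT.
have hH f : F f -> hol (disc p r1) f by move=> Ff; apply: hol_sub hr _; exact: hF.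
apply: (@zalcman_normal 0 0 k p 1 p r F) => //.
- by move=> h /hH; apply: hol_sub => z; apply: disc_le; exact: ltW.
- by move=> f zs Ff zsr; apply: sder_small_family => //; [exact: hr (inr _ zsr)|move=> _; exact: a0 (inr _ zsr)].
move=> h z t zs G Hh zsr; have dz := inr zs zsr; have Dz := hr zs dz.
apply: (@no_blowup_zero _ k 1 h p r1 (fun=> 0) b (fun z => al1 z / al0 z) (fun=> 0) (fun z => b z / al0 z) ltr01 k0) => //.
- by move=> n; exact: hH.
- exact: hol_cst.
- exact: hol_sub hr hb.
- exact: hol_quotient.
- exact: hol_cst.
- exact: hol_quotient.
- by move=> n x xr; have := share_quotient (Hh n) (hr x xr); rewrite (a0 x xr) mul0r.
- by move=> n x xr; exact: partial_quotient (hr x xr).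
- by move=> n x xr; exact: mult (hr x xr).
- exact: nzb.
- by rewrite mulf_neq0 ?invr_eq0 ?nz0 ?nzb.
Qed.

Lemma normal_at_order p s m a1 : (1 < k)%N -> D p -> 0 < s -> hol (disc p s) a1 -> a1 p != 0 ->
  (forall z, a z = (z - p) ^+ m * a1 z) -> (m = k -> dern k a p = k`!%:R * a1 p) -> normal_at p.
Proof.
move=> k1 Dp s0 ha1 a10 aE dka; have [r2 r20 hr2] := oD Dp.
have e0 : 0 < nrm (a1 p) by rewrite nrm_gt0.
have [t t0 ht] := hol_cont ha1 (disc_center p s0) e0.
pose r1 := Num.min (Num.min r2 s) t; pose r := r1 / 2.
have r10 : 0 < r1 by rewrite !lt_min r20 s0.
have r0 : 0 < r by rewrite /r; lra.
have rr1 : r < r1 by rewrite /r; lra.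
have inr zs : nrm (zs - p) <= r -> disc p r1 zs by rewrite /disc; lra.
have rle : [/\ r1 <= r2, r1 <= s & r1 <= t] by rewrite !ge_min !lexx ?orbT.
have [r1r2 r1s r1t] := rle.
have hr z : disc p r1 z -> D z by move=> zr; apply: hr2; exact: disc_le zr.
have a1n z : disc p r1 z -> a1 z != 0.
  move=> zr; apply/eqP => E; have := ht z (disc_le r1t zr).
  by rewrite E sub0r nrmN ltxx.
have hH f : F f -> hol (disc p r1) f by move=> Ff; apply: hol_sub hr _; exact: hF.
(* Chosen for the case m = k of [mixed_near], where G = A has to be discarded. *)
pose K := k%:R * nrm (a1 p) + 1.
have K0 : 0 < K by rewrite ltr_wpDl // mulr_ge0 // ltW.
apply: (@zalcman_normal 1 m k p K p r F) => //.
- by move=> h /hH; apply: hol_sub => z; apply: disc_le; exact: ltW.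
- move=> f zs Ff zsr; have dz := inr zs zsr; have Dz := hr zs dz.
  (* At a zero of a, a zero of f has order above k; elsewhere the amplitude is bounded below near
     zs, whatever the scale. *)
  have [z0|z0] := eqVneq (a zs) 0; first exact: sder_small_family.
  have [u u0 hu] := disc_open dz; have hf : hol (disc zs u) f := hol_sub hu (hH f Ff).
  have pn : 0 < nrm (zs - p) ^+ m.
    by rewrite -nrmX nrm_gt0; apply: contra z0 => /eqP E; rewrite aE E mul0r.
  have [m0|m0] := posnP m.
    apply: (sder_small_ampl ler01 K0 u0 hf ltr01); exists 1 => // w x _ x0.
    by rewrite /ampl m0 expr0 mulr1 lerDl exprn_ge0 // ltW.
  have n0 : 0 < nrm (zs - p).
    by rewrite lt_neqAle nrm_ge0 andbT; apply/eqP => E; move: pn; rewrite -E expr0n gtn_eqF // ltxx.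
  have n2 : 0 < nrm (zs - p) / 2 by lra.
  apply: (sder_small_ampl ler01 K0 u0 hf (exprn_gt0 m n2)); exists (nrm (zs - p) / 2) => // w x wz x0.
  rewrite /ampl mul1r; apply: (@le_trans _ _ ((nrm (w - p) + x) ^+ m)).
    rewrite lerXn2r ?nnegrE ?addr_ge0 ?nrm_ge0 ?(ltW x0) ?(ltW n2) //.
    apply: (@le_trans _ _ (nrm (w - p))); last by rewrite lerDl ltW.
    move: wz (nrm_distD w zs p); rewrite /disc (nrmC w zs).
    by move: (nrm (zs - w)) (nrm (zs - p)) (nrm (w - p)) => *; lra.
  by rewrite lerDl exprn_ge0 // ltW.
move=> h z x zs G Hh zsr; have dz := inr zs zsr; have Dz := hr zs dz; have [ab bn] := hab Dz.
apply: (@no_blowup_mixed k K h p r1 a b (fun z => al1 z / al0 z) (fun z => a z / al0 z) (fun z => b z / al0 z) m p a1) => //.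
- by move=> n; exact: hH.
- exact: hol_sub hr ha.
- exact: hol_sub hr hb.
- exact: hol_quotient.
- exact: hol_quotient.
- exact: hol_quotient.
- by move=> n y yr; exact: share_quotient (hr y yr).
- by move=> n y yr; exact: partial_quotient (hr y yr).
- by move=> n y yr; exact: mult (hr y yr).
- by apply: hol_sub ha1 => y; exact: disc_le.
- exact: nzb.
- by move=> ->; rewrite mul0r.
- exact: a1n.
- by rewrite mulf_neq0 ?invr_eq0 ?nz0 ?nzb.
move=> mk zp; rewrite zp; split; first by rewrite /K ltrDl.
have ap : a p = 0 by rewrite aE subrr expr0n mk gtn_eqF // mul0r.
move: bn; rewrite zp ap mulr0 subr0 (dka mk) => bn; apply: contra bn => /eqP E.
have n0 := nz0 Dp; have -> : b p = al0 p * (b p / al0 p) by rewrite mulrC divfK.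
by rewrite E [_ * a1 p]mulrC subrr.
Qed.

Lemma normal_at_all p : D p -> normal_at p.
Proof.
move=> Dp; have [k1|k1] := eqVneq k 1%N; first exact: normal_at_first.
have {}k1 : (1 < k)%N by rewrite ltn_neqAle eq_sym k1.
have [r r0 hr] := oD Dp; have har : hol (disc p r) a := hol_sub hr ha.
have [[s s0 hs]|[m [_ qm aE]]] := hol_factor r0 har; first exact: normal_at_zero s0 hs.
apply: (normal_at_order k1 Dp r0 (iterq_hol m har) qm aE) => mk.
by rewrite -mk (dern_iterq m r0 har).
Qed.
End Family.
End LocalNormality.

(** * From local uniform convergence to compact sets *)

Section Main.
Variable R : realType.
Local Notation C := (Cplx R).
Local Notation disc := (@disc R).
Local Notation hol := (@hol R).

Lemma near_disc (z : C) r : 0 < r -> nbhs z (disc z r).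
Proof.
move=> r0; exists (toC r); first by rewrite /= -toC0 toC_lt.
by move=> w /=; rewrite normE toC_lt /disc nrmC.
Qed.
Lemma open_disc (D : set C) z : open D -> D z -> exists2 r, 0 < r & forall w, disc z r w -> D w.
Proof.
rewrite openE => oD /oD[e /= e0 he]; have eE : e = toC (nrm e) by rewrite -normE gtr0_norm.
exists (nrm e); first by rewrite -toC_lt toC0 -eE.
by move=> w; rewrite /disc nrmC => we; apply: he => /=; rewrite normE eE toC_lt.
Qed.
Lemma compact_uniform (K : set C) (Q : nat -> C -> Prop) : compact K ->
  (forall x, K x -> exists2 r, 0 < r & exists N, forall n, (N <= n)%N -> forall w, disc x r w -> Q n w) ->
  exists N, forall n, (N <= n)%N -> forall w, K w -> Q n w.
Proof.
move=> /compact_near_coveringP cK h.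
have [|N _ hN] := cK nat \oo Q _; last by exists N => n /hN.
move=> x /h[r r0 [N hN]]; exists (disc x r, [set n | (N <= n)%N]).
  by split; [exact: near_disc|exists N].
by move=> [w n] [/= wr Nn]; exact: hN.
Qed.

Lemma lucvg_loc_unif (D : set C) f g : lucvg D f g -> cvg_loc_unif D f g.
Proof.
move=> cv K cK KD P /uniform_nbhs [E [entE EP]].
have [e /= e0 he] : exists2 e : C, 0 < e & forall x y : C, ball x e y -> E (x, y).
  by move: entE; rewrite -entourage_ballE => -[e e0 he]; exists e => // x y xy; exact: (he (x, y)).
have eE : e = toC (nrm e) by rewrite -normE gtr0_norm.
have en : 0 < nrm e by rewrite -toC_lt toC0 -eE.
have [|N hN] := @compact_uniform K (fun n w => nrm (f n w - g w) < nrm e) cK.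
  move=> x /KD /cv[r r0 hr]; exists r => //; exact: hr en.
exists N => // n /= Nn; apply: EP => w Kw; apply: he.
by rewrite -ball_normE /ball_ /= normE eE toC_lt nrmC; exact: hN.
Qed.
Lemma linf_loc_unif (D : set C) f : linf D f -> cvg_loc_unif_infty D f.
Proof.
move=> h K cK KD M; have [|N hN] := @compact_uniform K (fun n w => M < nrm (f n w)) cK.
  by move=> x /KD /h[r r0 hr]; exists r.
by exists N => // n /= Nn w Kw; rewrite normE toC_lt; exact: hN.
Qed.
End Main.

Unset Implicit Arguments.

Theorem theorem2p2 (R : realType) (D : set (Cplx R)) (k : nat)
    (F : set (Cplx R -> Cplx R)) (a b alpha0 alpha1 : Cplx R -> Cplx R)
    (hD : domain D) (hk : (0 < k)%N)
    (hF : forall f, F f -> holomorphic_on D f)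
    (hmult : forall f, F f -> forall z, D z -> f z = 0 -> multiplicity_ge k f z)
    (ha : holomorphic_on D a) (hb : holomorphic_on D b)
    (halpha0 : holomorphic_on D alpha0) (halpha1 : holomorphic_on D alpha1)
    (halpha0_neq0 : forall z, D z -> alpha0 z <> 0)
    (hb_neq0 : forall z, D z -> b z <> 0)
    (hab : forall z, D z ->
       a z <> b z /\ b z - alpha1 z * a z - alpha0 z * derive1n k a z <> 0)
    (hshare : forall f, F f -> forall z, D z ->
       (f z = a z <-> alpha0 z * derive1n k f z + alpha1 z * f z = a z))
    (hpartial : forall f, F f -> forall z, D z ->
       alpha0 z * derive1n k f z + alpha1 z * f z = b z -> f z = b z) :
  normal_family D F.
Proof.
have [oD _ _] := hD.
have H f : holomorphic_on D f -> hol D f.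
  by move=> hf z Dz; exists (derive1 f z); apply/cder_derivable; split; [exact: hf|].
have loc z : D z -> normal_at F z.
  apply: (@normal_at_all R D k F a b alpha0 alpha1) => //; try exact: H.
  - by move=> w; exact: open_disc.
  - by move=> f Ff; exact: H (hF f Ff).
  - by move=> w /halpha0_neq0/eqP.
  - by move=> w /hb_neq0/eqP.
  - by move=> w /hab[/eqP ? /eqP].
move=> f hf; have [|chi sc h] := @normal_glue R D f (domain_connected hD).
  (* Local normality concerns arbitrary sequences of the family, so the radius is common to all
     subsequences, as gluing requires. *)
  move=> z /loc[d d0 hd]; exists d => // phi _; exact: (hd (fun n => f (phi n))).
exists chi; first exact: sincP.
case: h => [[g hg]|hi]; [left; exists g; exact: lucvg_loc_unif|right; exact: linf_loc_unif].
Qed.
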